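(* Let $f:\overline{\Omega}\times\mathbb{R}^{m\times n}\to\mathbb{R}_{\ge 0}$ be Borel measurable, convex in the second variable, and assume there are constants $c_0,C_0>0$ with $c_0|Ay|\le f(x,y)\le C_0(1+|Ay|)$ for all $(x,y)\in\overline\Omega\times\mathbb{R}^{m\times n}$. Then $$F_{relaxed}(u)=F_{dual}(u)\qquad\text{for all }u\in L^2(\Omega,\mathbb{R}^m).$$ Additionally, for every $u\in \mathrm{BV}^{\mathbb{A}}(\Omega)\cap L^2(\Omega,\mathbb{R}^m)$, a sequence $(u_l)_{l\in\mathbb{N}}$ attaining the infimum in the definition of $F_{relaxed}(u)$ (i.e. $u_l\to u$ in $L^2$ and $\liminf_{l\to\infty}\int_\Omega f(x,\mathbb{A}u_l)\,dx=F_{relaxed}(u)$) can be taken with $u_l\in W^{\mathbb{A},1+\frac1l}(\Omega)\cap L^2(\Omega,\mathbb{R}^m)$ for every $l$.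
   Context: Setting: $\Omega\subset\mathbb{R}^n$ is a bounded open set with Lipschitz boundary. $A:\mathbb{R}^{m\times n}\to\mathbb{R}^{m\times n}$ is a fixed linear map, symmetric with respect to the Frobenius product $y:y'=\sum_{i,j}y_{ij}y'_{ij}$, with $A^2=A$. For $u:\Omega\to\mathbb{R}^m$ set $\mathbb{A}u:=A\,\mathrm{D}u$ (distributional). $\mathrm{BV}^{\mathbb{A}}(\Omega)$ is the space of $u\in L^1(\Omega,\mathbb{R}^m)$ for which $\mathbb{A}u$ is a bounded $\mathbb{R}^{m\times n}$-valued Radon measure on $\Omega$; $W^{\mathbb{A},p}(\Omega):=\{u\in\mathrm{BV}^{\mathbb{A}}(\Omega):\mathbb{A}u\in L^p(\Omega,\mathbb{R}^{m\times n})\}$ (absolutely continuous measures are identified with their densities). The divergence of matrix fields is taken row-wise, $(\operatorname{div}z)_i=\sum_j\partial_jz_{ij}$, in the distributional sense. $X_2(\Omega):=\{z\in L^\infty(\Omega,\mathbb{R}^{m\times n}): Az=z,\ \operatorname{div}z\in L^2(\Omega,\mathbb{R}^m)\}$. For $u\in\mathrm{BV}^{\mathbb{A}}(\Omega)\cap L^2(\Omega,\mathbb{R}^m)$ and $z\in X_2(\Omega)$ the pairing $(z,\mathbb{A}u)$ is the distribution $\langle (z,\mathbb{A}u),\phi\rangle:=-\int_\Omega\sum_{i,j}(\phi\,\partial_jz_{ij}u_i+\partial_j\phi\, z_{ij}u_i)\,dx$, $\phi\in C_c^\infty(\Omega)$, which is a bounded Radon measure on $\Omega$. $f^*(x,\cdot)$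 is the Legendre transform of $f(x,\cdot)$: $f^*(x,z)=\sup_{y}(z:y-f(x,y))$. Set $\mathcal{Z}:=\{z\in X_2(\Omega): f^*(x,z(x))\in L^1(\Omega)\}$. For $u\in L^2(\Omega,\mathbb{R}^m)$: $$F_{dual}(u):=\begin{cases}\sup_{z\in\mathcal{Z}}\Big(\int_\Omega -f^*(x,z(x))\,dx+\int_\Omega (z,\mathbb{A}u)\Big)&u\in\mathrm{BV}^{\mathbb{A}}(\Omega),\\+\infty&\text{else,}\end{cases}$$ $$F_{relaxed}(u):=\inf\Big\{\liminf_{l\to\infty}\int_\Omega f(x,\mathbb{A}u_l(x))\,dx\ :\ u_l\in W^{\mathbb{A},1}(\Omega),\ u_l\to u\text{ in }L^2(\Omega,\mathbb{R}^m)\Big\}.$$ *)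

(* Defs.v *)
From HB Require Import structures.
From mathcomp Require Import all_boot all_order all_algebra.
From mathcomp Require Import all_classical all_reals all_analysis.
From mathcomp Require Import measurable_realfun.
Set Implicit Arguments. Unset Strict Implicit. Unset Printing Implicit Defensive.
Import Order.TTheory GRing.Theory Num.Theory.
Import numFieldNormedType.Exports.
Local Open Scope classical_set_scope.
Local Open Scope ring_scope.

Section BorelMatrix.
Context {R : realType} {m n : nat}.

(* Borel sigma-algebra, for the topology MathComp-Analysis puts on matrices. *)
HB.instance Definition _ := @isMeasurable.Build
  (sigma_display (@open 'M[R]_(m, n))) 'M[R]_(m, n)
  <<s @open 'M[R]_(m, n) >>
  (@sigma_algebra0 _ _ _) (@sigma_algebraC _ _) (@sigma_algebra_bigcup _ _ _).

Lemma open_measurable_mx (U : set 'M[R]_(m, n)) : open U -> measurable U.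
Proof. exact: sub_sigma_algebra. Qed.

Lemma open_mx_rat (U : set 'M[R]_(m, n)) : open U ->
  U = \bigcup_(q in [set q : 'M[rat]_(m, n) * nat |
                      ball (map_mx ratr q.1 : 'M[R]_(m, n)) (q.2.+1%:R^-1 : R) `<=` U])
        ball (map_mx ratr q.1 : 'M[R]_(m, n)) (q.2.+1%:R^-1 : R).
Proof.
move=> oU; apply/seteqP; split=> [x Ux|x [q qU]]; last exact: qU.
have /nbhs_ballP[e /= e0 eU] : nbhs x U by rewrite nbhsE; exists U.
have [k _ /(_ k (leqnn k))/= ke] := near_infty_natSinv_lt (PosNum (divr_gt0 e0 (ltr0n R 2))).
have /choice[q qP] : forall ij : 'I_m * 'I_n, exists q : rat,
    ball (x ij.1 ij.2) (k.+1%:R^-1 : R) (ratr q).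
  move=> ij; have : x ij.1 ij.2 - k.+1%:R^-1 < x ij.1 ij.2 + k.+1%:R^-1.
    by rewrite ltrBlDr -addrA ltrDl addr_gt0// invr_gt0.
  move=> /rat_in_itvoo[q]; rewrite in_itv/= => /andP[q1 q2]; exists q.
  by rewrite /ball/= distrC ltr_distl q1.
have bxq : ball x (k.+1%:R^-1 : R) (map_mx ratr (\matrix_(i, j) q (i, j))).
  split; first by rewrite invr_gt0.
  by move=> i j; rewrite !mxE; exact: (qP (i, j)).
exists (\matrix_(i, j) q (i, j), k) => /=; last exact: ball_sym.
move=> y qy; apply: eU.
apply: (@le_ball _ _ _ (k.+1%:R^-1 + k.+1%:R^-1)).
  by rewrite (splitr e) lerD// ltW.
exact: ball_triangle qy.
Qed.

Lemma measurable_coord (i : 'I_m) (j : 'I_n) :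
  measurable_fun [set: 'M[R]_(m, n)] (fun x : 'M[R]_(m, n) => x i j).
Proof.
apply: (@measurability _ _ _ _ _ _ (@RGenOInfty.G R)).
  exact: RGenOInfty.measurableE.
move=> _ [_ [a ->] <-]; rewrite setTI set_itvE; apply: open_measurable_mx.
by apply: open_comp => [? _|]; [exact: coord_continuous|exact: open_gt].
Qed.

End BorelMatrix.

Section LebesgueMeasure.
Context {R : realType}.

Definition cons_rV {n : nat} (p : 'rV[R]_n * R) : 'rV[R]_n.+1 :=
  row_mx (p.2)%:M p.1.

Lemma ball_cons_rV n (c : 'rV[R]_n.+1) (e : R) :
  cons_rV @^-1` ball c e =
  ball (rsubmx (c : 'rV[R]_(1 + n))) e `*` ball (c 0 0) e.
Proof.
have c0 : c 0 0 = lsubmx (c : 'rV[R]_(1 + n)) 0 0.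
  by rewrite mxE; congr (c _ _); exact/val_inj.
have rE (p : 'rV[R]_n * R) j : cons_rV p 0 (rshift 1 j) = p.1 0 j.
  exact: row_mxEr.
have lE (p : 'rV[R]_n * R) : cons_rV p 0 (lshift n (0 : 'I_1)) = p.2.
  by apply: etrans (@row_mxEl R 1 1 n _ _ _ _) _; rewrite mxE.
apply/seteqP; split=> [p [e0 /= cp]|p [[e0 /= c1] /= c2]].
  split=> /=.
    by split=> // i j; rewrite ord1 mxE -rE; exact: cp.
  by rewrite c0 mxE -lE; exact: cp.
split=> // i j; rewrite ord1.
case: (@split_ordP 1 n j) => k ->; last first.
  by rewrite rE; have := c1 0 k; rewrite mxE.
by rewrite ord1 lE; move: c2; rewrite c0 mxE.
Qed.

Lemma measurable_cons_rV n :
  measurable_fun [set: 'rV[R]_n * R] (@cons_rV n).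
Proof.
apply: (@measurability _ _ _ _ _ _ (@open 'rV[R]_n.+1)) => //.
move=> _ [U oU <-]; rewrite setTI (open_mx_rat oU) preimage_bigcup.
rewrite bigcup_mkcond; apply: countable_bigcupT_measurable.
  exact: countableP.
move=> q; case: ifPn => // _; rewrite ball_cons_rV.
by apply: measurableX; [apply: open_measurable_mx; exact: ball_open|exact: measurable_ball].
Qed.

Section LebesgueStep.
Variables (n : nat) (mu : {measure set 'rV[R]_n -> \bar R}).

Definition lebesgue_step : set 'rV[R]_n.+1 -> \bar R :=
  pushforward (mu \x @lebesgue_measure R)%E (@cons_rV n).

Let lebesgue_step0 : lebesgue_step set0 = 0%E.
Proof. by rewrite /lebesgue_step /pushforward preimage_set0 measure0. Qed.

Let lebesgue_step_ge0 A : (0 <= lebesgue_step A)%E.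
Proof. by rewrite /lebesgue_step /pushforward measure_ge0. Qed.

Let lebesgue_step_sigma_additive : semi_sigma_additive lebesgue_step.
Proof.
move=> F mF tF mUF; rewrite /lebesgue_step /pushforward preimage_bigcup.
apply: measure_semi_sigma_additive.
- by move=> k; rewrite -[_ @^-1` _]setTI; exact: measurable_cons_rV.
- apply/trivIsetP => i j _ _ ij; rewrite -preimage_setI.
  by move/trivIsetP : tF => ->//; rewrite preimage_set0.
- by rewrite -preimage_bigcup; rewrite -[_ @^-1` _]setTI; exact: measurable_cons_rV.
Qed.

HB.instance Definition _ := isMeasure.Build _ _ _ lebesgue_step
  lebesgue_step0 lebesgue_step_ge0 lebesgue_step_sigma_additive.

End LebesgueStep.

Fixpoint lebesgue_rV (n : nat) : {measure set 'rV[R]_n -> \bar R} :=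
  if n is n'.+1 then lebesgue_step (lebesgue_rV n') else dirac (0 : 'rV[R]_0).

Lemma lebesgue_rV_box n (A : 'I_n -> set R) : (forall i, measurable (A i)) ->
  lebesgue_rV n [set v | forall i, A i (v 0 i)] =
  (\prod_(i < n) lebesgue_measure (A i))%E.
Proof.
elim: n A => [|n IHn] A mA.
  by rewrite big_ord0 /= diracE mem_set// => -[].
rewrite big_ord_recl /= /lebesgue_step /pushforward.
have -> : cons_rV @^-1` [set v : 'rV[R]_n.+1 | forall i, A i (v 0 i)] =
    [set v : 'rV[R]_n | forall i, A (lift ord0 i) (v 0 i)] `*` A ord0.
  have lE (p : 'rV[R]_n * R) j : cons_rV p 0 (lift ord0 j) = p.1 0 j.
    by rewrite -rshift1; exact: row_mxEr.
  have oE (p : 'rV[R]_n * R) : cons_rV p 0 ord0 = p.2.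
    have -> : ord0 = lshift n (0 : 'I_1) by exact/val_inj.
    by apply: etrans (@row_mxEl R 1 1 n _ _ _ _) _; rewrite mxE.
  apply/seteqP; split=> [p /= Ap|p [/= A1 A2] i].
    by split=> [i|]; [rewrite -lE|rewrite -oE]; exact: Ap.
  by have [j ->|->] := unliftP ord0 i; rewrite ?lE ?oE.
have mB : measurable [set v : 'rV[R]_n | forall i, A (lift ord0 i) (v 0 i)].
  rewrite [X in measurable X](_ : _ = \bigcap_(i in [set: 'I_n])
      ((fun v : 'rV[R]_n => v 0 i) @^-1` A (lift ord0 i))); last first.
    by apply/seteqP; split=> [v Av i _|v Av i]; exact: Av.
  apply: fin_bigcap_measurable => // i _.
  by rewrite -[_ @^-1` _]setTI; exact: measurable_coord.
rewrite product_measure1E//; last exact: mA.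
rewrite [RHS]muleC; congr (_ * _)%E.
exact: (IHn (fun i => A (lift ord0 i))).
Qed.

End LebesgueMeasure.

Section Setting.
Context {R : realType}.

Definition frob {m n : nat} (y y' : 'M[R]_(m, n)) : R :=
  \sum_i \sum_j y i j * y' i j.

Definition frob_norm {m n : nat} (y : 'M[R]_(m, n)) : R := Num.sqrt (frob y y).

(* Near each of its boundary points, Omega is, up to an orthogonal change of
   coordinates, the strict epigraph of a Lipschitz function of the coordinates
   other than the k-th one. *)
Definition lipschitz_boundary {n : nat} (Omega : set 'rV[R]_n) : Prop :=
  forall x0, (closure Omega `\` Omega°) x0 ->
  exists (Q : 'M[R]_n) (k : 'I_n) (g : 'rV[R]_n.-1 -> R),
    [/\ Q *m Q^T = 1%:M,
        [lipschitz g y | y in setT] &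
        \forall x \near x0,
          Omega x <-> g (col' k (x *m Q)) < (x *m Q) 0 k].

Definition partial {n : nat} (j : 'I_n) (phi : 'rV[R]_n -> R) :
  'rV[R]_n -> R := 'D_(delta_mx 0 j) phi.

Definition smooth {n : nat} (phi : 'rV[R]_n -> R) : Prop :=
  forall s : seq 'I_n, let psi := foldr partial phi s in
    continuous psi /\ forall j x, derivable psi x (delta_mx 0 j).

Section Domain.
Context {m n : nat}.
Variable Omega : set 'rV[R]_n.

Local Notation lambda := (@lebesgue_rV R n).

Definition test_function (phi : 'rV[R]_n -> R) : Prop :=
  [/\ smooth phi,
      compact (closure [set x | phi x != 0]) &
      closure [set x | phi x != 0] `<=` Omega].

(* Functions are total; only their values on Omega matter, and \_ extends a
   function on Omega by zero. *)
Definition LpNorm {a b : nat} (p : \bar R) (g : 'rV[R]_n -> 'M[R]_(a, b)) :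
    \bar R :=
  Lnorm lambda p (EFin \o ((fun x => frob_norm (g x)) \_ Omega)).

Definition Lp {a b : nat} (p : \bar R) (g : 'rV[R]_n -> 'M[R]_(a, b)) : Prop :=
  measurable_fun Omega g /\ (LpNorm p g < +oo)%E.

Definition L2_cvg {a b : nat} (u_ : nat -> 'rV[R]_n -> 'M[R]_(a, b))
    (u : 'rV[R]_n -> 'M[R]_(a, b)) : Prop :=
  (forall l, Lp 2%:E (u_ l)) /\
  LpNorm 2%:E (fun x => u_ l x - u x) @[l --> \oo] --> 0%E.

(* Bounded R-valued Radon measures are charges; the integral against a charge
   is taken through its Jordan decomposition. *)
Definition charge_integral (nu : {charge set 'rV[R]_n -> \bar R})
    (phi : 'rV[R]_n -> R) : R :=
  let h := projT2 (cid (projT2 (cid (Hahn_decomposition nu)))) in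
  \int[jordan_pos h]_(x in Omega) phi x - \int[jordan_neg h]_(x in Omega) phi x.

Definition dist_gradient (u : 'rV[R]_n -> 'cV[R]_m) (phi : 'rV[R]_n -> R) :
    'M[R]_(m, n) :=
  \matrix_(i, j) - \int[lambda]_(x in Omega) (u x i 0 * partial j phi x).

Definition is_density (T : ('rV[R]_n -> R) -> 'M[R]_(m, n))
    (g : 'rV[R]_n -> 'M[R]_(m, n)) : Prop :=
  forall phi, test_function phi -> forall i j,
    T phi i j = \int[lambda]_(x in Omega) (g x i j * phi x).

Definition is_measure (T : ('rV[R]_n -> R) -> 'M[R]_(m, n))
    (nu : 'I_m -> 'I_n -> {charge set 'rV[R]_n -> \bar R}) : Prop :=
  forall phi, test_function phi -> forall i j,
    T phi i j = charge_integral (nu i j) phi.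

(* Row-wise: div z belongs to 'cV_m. *)
Definition is_div (z : 'rV[R]_n -> 'M[R]_(m, n)) (d : 'rV[R]_n -> 'cV[R]_m) :
    Prop :=
  forall phi, test_function phi -> forall i,
    \int[lambda]_(x in Omega) (d x i 0 * phi x) =
    - \int[lambda]_(x in Omega) (\sum_j z x i j * partial j phi x).

(* The square-integrable divergence, unique almost everywhere when it exists. *)
Definition div (z : 'rV[R]_n -> 'M[R]_(m, n)) : 'rV[R]_n -> 'cV[R]_m :=
  xget (fun=> 0) [set d | Lp 2%:E d /\ is_div z d].

(* <(z, Au), phi>; the terms phi * d_j z_ij * u_i are summed over j into
   phi * (div z)_i * u_i. *)
Definition pairing (z : 'rV[R]_n -> 'M[R]_(m, n)) (u : 'rV[R]_n -> 'cV[R]_m)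
    (phi : 'rV[R]_n -> R) : R :=
  - \int[lambda]_(x in Omega)
      \sum_i (phi x * div z x i 0 * u x i 0 +
              \sum_j partial j phi x * z x i j * u x i 0).

(* The integral over Omega of the bounded Radon measure (z, Au). *)
Definition pairing_mass (z : 'rV[R]_n -> 'M[R]_(m, n))
    (u : 'rV[R]_n -> 'cV[R]_m) : \bar R :=
  xget 0%E [set e | exists nu : {charge set 'rV[R]_n -> \bar R},
    (forall phi, test_function phi -> pairing z u phi = charge_integral nu phi)
    /\ e = nu Omega].

Section Operator.
Variable A : {linear 'M[R]_(m, n) -> 'M[R]_(m, n)}.

Definition dist_A (u : 'rV[R]_n -> 'cV[R]_m) (phi : 'rV[R]_n -> R) :
  'M[R]_(m, n) := A (dist_gradient u phi).

Definition BV (u : 'rV[R]_n -> 'cV[R]_m) : Prop :=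
  Lp 1%:E u /\ exists nu, is_measure (dist_A u) nu.

Definition W (p : \bar R) (u : 'rV[R]_n -> 'cV[R]_m) : Prop :=
  BV u /\ exists2 g, Lp p g & is_density (dist_A u) g.

(* The density of Au, unique almost everywhere when u belongs to W 1. *)
Definition density_A (u : 'rV[R]_n -> 'cV[R]_m) : 'rV[R]_n -> 'M[R]_(m, n) :=
  xget (fun=> 0) [set g | Lp 1%:E g /\ is_density (dist_A u) g].

Definition X2 (z : 'rV[R]_n -> 'M[R]_(m, n)) : Prop :=
  [/\ Lp +oo%E z,
      \forall x \ae lambda, Omega x -> A (z x) = z x &
      exists2 d, Lp 2%:E d & is_div z d].

Section Functionals.
Variable f : 'rV[R]_n -> 'M[R]_(m, n) -> R.

Definition legendre (x : 'rV[R]_n) (z : 'M[R]_(m, n)) : \bar R :=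
  ereal_sup [set (frob z y - f x y)%:E | y in [set: 'M[R]_(m, n)]].

Definition calZ (z : 'rV[R]_n -> 'M[R]_(m, n)) : Prop :=
  X2 z /\ lambda.-integrable Omega (fun x => legendre x (z x)).

Definition F_dual (u : 'rV[R]_n -> 'cV[R]_m) : \bar R :=
  if `[< BV u >] then
    ereal_sup [set (\int[lambda]_(x in Omega) (- legendre x (z x))
                    + pairing_mass z u)%E | z in calZ]
  else +oo%E.

Definition energy (u : 'rV[R]_n -> 'cV[R]_m) : \bar R :=
  (\int[lambda]_(x in Omega) (f x (density_A u x))%:E)%E.

Definition F_relaxed (u : 'rV[R]_n -> 'cV[R]_m) : \bar R :=
  ereal_inf [set limn_einf (fun l => energy (u_ l)) |
    u_ in [set u_ | (forall l, W 1%:E (u_ l)) /\ L2_cvg u_ u]].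

End Functionals.
End Operator.
End Domain.
End Setting.

(* Main.v *)
Require Import Defs.
From HB Require Import structures.
From mathcomp Require Import all_boot all_order all_algebra.
From mathcomp Require Import all_classical all_reals all_analysis.
From mathcomp Require Import measurable_realfun.
From mathcomp Require Import finmap ring lra.
Set Implicit Arguments.
Unset Strict Implicit.
Unset Printing Implicit Defensive.
Import Order.TTheory GRing.Theory Num.Theory.
Import numFieldNormedType.Exports.
Local Open Scope classical_set_scope.
Local Open Scope ring_scope.

(* Lower bound: for z in the domain of f* and u_l -> u in L^2, test the
   inequality f(x, Au_l) >= z : Au_l - f*(x, z) against cutoffs and pass to the
   limit; when u is not in BV^A, Riesz representation shows that no sequence has
   bounded energy.

   Upper bound: restrict to functions v smooth on the whole space and add the
   penalty K ||v - u||^2. Let m_K be the infimum. Perturbing both arguments,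
     h(q, s) = inf_v int f(x, A Dv + q) + K int |v - u + s|^2
   is convex and continuous on pairs of bounded functions, so Hahn-Banach gives
   a subgradient at 0, and Radon-Nikodym represents it by a bounded matrix field
   z and a square-integrable w. Stationarity in v says that w is the divergence
   of z up to the boundary, i.e. the normal trace of z vanishes, and the
   subgradient inequality becomes
     m_K + int z : y + int w . u <= int f(x, y)   for bounded y.
   Choosing y among rational matrices nearly optimal for f* gives
   m_K <= - int f*(x, z) - int w . u. Because the normal trace is zero, shifting
   z into Omega near the Lipschitz boundary before mollifying shows that
   - int w . u is the total mass of (z, Au); hence m_K <= F_dual(u). The same
   boundary estimate bounds m_K uniformly in K, so near-minimisers for K = l + 1
   converge to u in L^2: they form the recovery sequence, and being smooth up to
   the boundary they lie in every W^{A,p}. *)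

(** * Hahn-Banach theorem with a convex majorant *)

(** The integrand grows linearly, so bounded energies are compact only as measures. The upper bound
    therefore extracts no limit: it compares infima, and the penalty alone yields the L^2
    convergence. Perturbations are bounded functions because a linear functional there is determined
    by its values on indicators as soon as it respects bounded pointwise limits; one device,
    extension followed by a charge, then gives both the Radon measures and the dual field. The two
    perturbations need different bounds. Convexity and growth in [A y] alone make [f x] Lipschitz,
    with change at most [C0] times the size of [A q]; hence z is bounded independently of K, which
    makes the estimate of m_K uniform. The penalty is quadratic and its bound not homogeneous; a
    free parameter in Young's inequality recovers the square integrability of w. The measure (z, Au)
    is defined through test functions with compact support in Omega, whereas stationarity allows
    test functions up to the boundary. The obstacle is a possible loss of mass between the two,
    excluded because the variation of Au near the boundary tends to 0. *)

Section HahnBanach.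
Context {R : realType} {V : lmodType R}.
Implicit Types (D F : set V) (p l : V -> R).

(** Domains are sets, so that the bounded measurable functions can serve as a domain inside the
    module of all functions. *)
Definition subspace D := D 0 /\ forall a x y, D x -> D y -> D (a *: x + y).

Definition linear_on D l :=
  forall a x y, D x -> D y -> l (a *: x + y) = a * l x + l y.

Definition convex_on D p := forall t x y, 0 < t < 1 -> D x -> D y ->
  p (t *: x + (1 - t) *: y) <= t * p x + (1 - t) * p y.

Lemma subspaceD D x y : subspace D -> D x -> D y -> D (x + y).
Proof. by move=> [_ DD] Dx Dy; have := DD 1 x y Dx Dy; rewrite scale1r. Qed.

Lemma subspaceZ D a x : subspace D -> D x -> D (a *: x).
Proof. by move=> [D0 DD] Dx; have := DD a x 0 Dx D0; rewrite addr0. Qed.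

Lemma subspaceB D x y : subspace D -> D x -> D y -> D (x - y).
Proof.
by move=> [D0 DD] Dx Dy; have := DD (-1) y x Dy Dx; rewrite scaleN1r addrC.
Qed.

Lemma linear_on0 D l : subspace D -> linear_on D l -> l 0 = 0.
Proof.
move=> [D0 _] /(_ (-1) 0 0 D0 D0); rewrite scaleN1r oppr0 addr0 mulN1r.
by rewrite addNr.
Qed.

Lemma linear_onD D l x y : subspace D -> linear_on D l -> D x -> D y ->
  l (x + y) = l x + l y.
Proof. by move=> _ lD Dx Dy; have := lD 1 x y Dx Dy; rewrite scale1r mul1r. Qed.

Lemma linear_onZ D l a x : subspace D -> linear_on D l -> D x ->
  l (a *: x) = a * l x.
Proof.
move=> sD lD Dx; have := lD a x 0 Dx sD.1.
by rewrite (linear_on0 sD lD) !addr0.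
Qed.

Lemma linear_onB D l x y : subspace D -> linear_on D l -> D x -> D y ->
  l (x - y) = l x - l y.
Proof.
move=> _ lD Dx Dy; have := lD (-1) y x Dy Dx.
by rewrite scaleN1r mulN1r addrC => ->; rewrite addrC.
Qed.

(* A partial linear functional dominated by p, represented by its graph. *)
Let dominated D p (G : set (V * R)) :=
  [/\ forall x r, G (x, r) -> D x /\ r <= p x,
      forall a x y r s, G (x, r) -> G (y, s) -> G (a *: x + y, a * r + s) &
      forall r, G (0, r) -> r = 0].

Let dominated_fun D p G x r s : dominated D p G -> G (x, r) -> G (x, s) -> r = s.
Proof.
move=> [_ GD G0] Gr Gs; have := GD (-1) _ _ _ _ Gr Gs.
rewrite scaleN1r addNr => /G0; rewrite mulN1r addrC => /eqP.
by rewrite subr_eq0 => /eqP.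
Qed.

(** The value at [x0] must lie between all left slopes and all right slopes of p. For a convex p
    without homogeneity, the two are compared through the convex combination of [y - t *: x0] and
    [x + t' *: x0] in which [x0] cancels. *)
Let extend_step D p (G : set (V * R)) x0 : subspace D -> convex_on D p ->
  dominated D p G -> G (0, 0) -> D x0 ->
  exists c, forall x r t, G (x, r) -> 0 < t ->
    r + t * c <= p (x + t *: x0) /\ r - t * c <= p (x - t *: x0).
Proof.
move=> sD cp dG G00 Dx0; have [GD GL G0] := dG.
pose S := [set c | exists x r t, [/\ G (x, r), 0 < t &
   c = (r - p (x - t *: x0)) / t]].
have key x r t y s t' : G (x, r) -> G (y, s) -> 0 < t -> 0 < t' ->
    (s - p (y - t *: x0)) / t <= (p (x + t' *: x0) - r) / t'.
  move=> Gx Gy t0 t'0; have tt0 : 0 < t + t' by rewrite addr_gt0.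
  have [Dx _] := GD _ _ Gx; have [Dy _] := GD _ _ Gy.
  pose a := t' / (t + t').
  have ha : 1 - a = t / (t + t') by rewrite /a; field; rewrite gt_eqF.
  have a01 : 0 < a < 1.
    by rewrite /a divr_gt0//= ltr_pdivrMr// mul1r ltrDr.
  have Dym : D (y - t *: x0) by apply: subspaceB => //; exact: subspaceZ.
  have Dxp : D (x + t' *: x0) by apply: subspaceD => //; exact: subspaceZ.
  have := cp _ _ _ a01 Dym Dxp.
  have -> : a *: (y - t *: x0) + (1 - a) *: (x + t' *: x0) =
     a *: y + (1 - a) *: x.
    rewrite !scalerDr addrACA scalerN !scalerA ha /a.
    have -> : t' / (t + t') * t = t / (t + t') * t' by ring.
    by rewrite addNr addr0.
  have G1 : G (a *: y + (1 - a) *: x, a * s + (1 - a) * r).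
    apply: (GL) => //; have := GL (1 - a) _ _ _ _ Gx G00.
    by rewrite !addr0.
  have [_ h1] := GD _ _ G1.
  move=> h2; have h3 := le_trans h1 h2; rewrite ha /a in h3.
  rewrite ler_pdivrMr// [leRHS]mulrAC ler_pdivlMr//.
  suff : t' * s + t * r <= t' * p (y - t *: x0) + t * p (x + t' *: x0).
    by lra.
  rewrite -(@ler_pM2r _ (t + t')^-1) ?invr_gt0//.
  by move: h3; rewrite !mulrDl !(mulrAC _ ((t + t')^-1)).
exists (sup S) => x r t Gx t0; split.
  have : sup S <= (p (x + t *: x0) - r) / t.
    apply: ge_sup.
      by exists ((0 - p (0 - 1 *: x0)) / 1), 0, 0, 1.
    by move=> _ [y [s [t' [Gy t'0 ->]]]]; exact: key.
  by rewrite ler_pdivlMr// mulrC => h; lra.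
have : (r - p (x - t *: x0)) / t <= sup S.
  apply: ub_le_sup; last by exists x, r, t.
  exists ((p (0 + 1 *: x0) - 0) / 1) => _ [y [s [t' [Gy t'0 ->]]]].
  exact: key.
by rewrite ler_pdivrMr// mulrC => h; lra.
Qed.

(** Zorn's lemma is applied to graphs of dominated partial functionals extending l; [extend_step]
    shows that a maximal graph has domain D. *)
Lemma hahn_banach D F l p : subspace D -> subspace F -> F `<=` D ->
  linear_on F l -> convex_on D p -> (forall x, F x -> l x <= p x) ->
  exists L, [/\ linear_on D L, forall x, D x -> L x <= p x &
                forall x, F x -> L x = l x].
Proof.
move=> sD sF FD lF cp lp.
pose G0 : set (V * R) := [set xr | F xr.1 /\ xr.2 = l xr.1].
(* The first alternative admits the union of the empty chain, which does not contain [G0]; a maximal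
   set satisfies the second one in any case. *)
pose P := fun G : set (V * R) => G `<=` G0 \/ (dominated D p G /\ G0 `<=` G).
have dG0 : dominated D p G0.
  split=> [x r [/= Fx ->]|a x y r s [/= Fx ->] [/= Fy ->]|r [/= _ ->]].
  - by split; [exact: FD|exact: lp].
  - by split => /=; [exact: sF.2|rewrite lF].
  - exact: linear_on0 lF.
have [G [PG Gmax]] : exists A, P A /\ forall B, A `<` B -> ~ P B.
  apply: Zorn_bigcup => K KP tK.
  have [[G1 [KG1 [dG1 G01]]]|noG] :=
    pselect (exists G, K G /\ (dominated D p G /\ G0 `<=` G)); last first.
    left => xr [G KG Gxr]; have [h|h] := KP _ KG; first exact: h.
    by exfalso; apply: noG; exists G.
  right; split; last by move=> x G0x; exists G1 => //; exact: G01.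
  have tot G G' : K G -> K G' -> G `<=` G' \/ G' `<=` G.
    by move=> KG KG'; exact: tK.
  have dom G : K G -> dominated D p (G `|` G1).
    move=> KG; have [GG1|G1G] := tot _ _ KG KG1.
      by rewrite (setUidr GG1).
    rewrite (setUidl G1G); have [GG0|[]//] := KP _ KG.
    suff -> : G = G1 by [].
    apply/seteqP; split => // x Gx; exact/G01/GG0.
  split.
  - by move=> x r [G KG Gx]; have [+ _ _] := dom _ KG; apply; left.
  - move=> a x y r s [G KG Gx] [G' KG' Gy].
    have [GG'|G'G] := tot _ _ KG KG'.
      have [_ + _] := dom _ KG' => /(_ a x y r s (or_introl (GG' _ Gx)) (or_introl Gy)).
      by case=> h; [exists G'|exists G1].
    have [_ + _] := dom _ KG => /(_ a x y r s (or_introl Gx) (or_introl (G'G _ Gy))).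
    by case=> h; [exists G|exists G1].
  - by move=> r [G KG Gx]; have [_ _ +] := dom _ KG; apply; left.
have {PG}[dG G0G] : dominated D p G /\ G0 `<=` G.
  have [GG0|//] := PG; split.
    suff -> : G = G0 by [].
    apply/seteqP; split => //; apply: contrapT => nG0G.
    by apply: (Gmax G0); [split|left].
  apply: contrapT => nG0G.
  by apply: (Gmax G0); [split|left].
have G00 : G (0, 0).
  by apply: G0G; split => /=; [exact: sF.1|rewrite (linear_on0 sF lF)].
have [GD GL G0'] := dG.
have full x0 : D x0 -> exists r, G (x0, r).
  move=> Dx0; apply: contrapT => nx0.
  have [c cP] := extend_step sD cp dG G00 Dx0.
  (* If [x0] were missing from the domain, adjoining it with value c would give a strictly larger
     graph. *)
  pose G' : set (V * R) := [set yr | exists x r t,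
    G (x, r) /\ yr = (x + t *: x0, r + t * c)].
  have GG' : G `<=` G'.
    by move=> [x r] Gx; exists x, r, 0; rewrite scale0r mul0r !addr0.
  apply: (Gmax G').
    split => // /(_ (x0, c)) h; apply: nx0; exists c; apply: h.
    by exists 0, 0, 1; rewrite scale1r mul1r !add0r.
  right; split; last exact: (subset_trans G0G GG').
  split.
  - move=> _ _ [x [r [t [Gx [-> ->]]]]]; have [Dx rp] := GD _ _ Gx.
    split; first by apply: subspaceD => //; exact: subspaceZ.
    have [t0|t0|->] := ltgtP t 0; last by rewrite scale0r mul0r !addr0.
      have := cP _ _ (- t) Gx; rewrite oppr_gt0 => /(_ t0)[_].
      by rewrite scaleNr mulNr !opprK.
    by have [] := cP _ _ t Gx t0.
  - move=> a _ _ _ _ [x [r [t [Gx [-> ->]]]]] [y [s [t' [Gy [-> ->]]]]].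
    exists (a *: x + y), (a * r + s), (a * t + t'); split; first exact: GL.
    congr (_, _); last by ring.
    by rewrite scalerDr scalerDl scalerA addrACA.
  - move=> _ [x [r [t [Gx [h ->]]]]].
    have [t0|t0] := eqVneq t 0.
      move: h; rewrite t0 scale0r addr0 mul0r addr0 => h.
      by apply: G0'; rewrite h.
    (* A nonzero t would make [x0] a multiple of x, hence put it in the domain of G. *)
    exfalso; apply: nx0; exists (- t^-1 * r).
    have := GL (- t^-1) _ _ _ _ Gx G00; rewrite !addr0.
    suff -> : - t^-1 *: x = x0 by [].
    have -> : x = - (t *: x0) by apply/eqP; rewrite -addr_eq0 -h.
    by rewrite scalerN scaleNr opprK scalerA mulVf// scale1r.
have /choice[L LP] : forall x, exists r, D x -> G (x, r).
  move=> x; have [Dx|nDx] := pselect (D x); last by exists 0.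
  by have [r] := full _ Dx; exists r.
exists L; split.
- move=> a x y Dx Dy; apply: (dominated_fun dG (LP _ _)); first exact: sD.2.
  by apply: GL; exact: LP.
- by move=> x Dx; have [_] := GD _ _ (LP _ Dx).
- move=> x Fx; apply: (dominated_fun dG (LP _ _)); first exact: FD.
  exact: G0G.
Qed.

End HahnBanach.

(** * Smooth functions *)

Section SmoothFunctions.
Context {R : realType} {n : nat}.
Local Notation T := 'rV[R]_n.
Implicit Types (f g phi : T -> R) (G : set (T -> R)).

(** The algebra generated by G. If the generators are continuous and derivable with partials in it,
    then so are all its elements, which gives smoothness without iterated Leibniz formulas. *)
Inductive gen_alg G : (T -> R) -> Prop :=
| gen_alg_gen f : G f -> gen_alg G f
| gen_alg_cst c : gen_alg G (fun=> c)
| gen_alg_add f g : gen_alg G f -> gen_alg G g -> gen_alg G (fun x => f x + g x)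
| gen_alg_mul f g : gen_alg G f -> gen_alg G g -> gen_alg G (fun x => f x * g x).

Let pderivable f := forall (j : 'I_n) x, derivable f x (delta_mx 0 j).

Lemma partialD j f g : pderivable f -> pderivable g ->
  partial j (fun x => f x + g x) = fun x => partial j f x + partial j g x.
Proof. by move=> df dg; apply/funext => x; apply: deriveD. Qed.

Lemma partialM j f g : pderivable f -> pderivable g ->
  partial j (fun x => f x * g x) =
  fun x => f x * partial j g x + g x * partial j f x.
Proof. by move=> df dg; apply/funext => x; apply: deriveM. Qed.

Lemma partial_cst j (c : R) : partial j (fun _ : T => c) = fun _ => 0.
Proof. by apply/funext => x; apply: derive_cst. Qed.

Lemma smooth_gen_alg G :
  (forall g, G g -> [/\ continuous g, forall j x, derivable g x (delta_mx 0 j) &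
                        forall j, gen_alg G (partial j g)]) ->
  forall f, gen_alg G f -> smooth f.
Proof.
move=> GP.
have key f : gen_alg G f -> [/\ continuous f, pderivable f &
    forall j, gen_alg G (partial j f)].
  elim=> {f} [f|c|f g _ [cf df af] _ [cg dg ag]|f g af' [cf df af] ag' [cg dg ag]].
  - exact: GP.
  - split=> [|j x|j]; first exact: cst_continuous.
      exact: derivable_cst.
    by rewrite partial_cst; exact: gen_alg_cst.
  - split=> [x|j x|j]; first exact: (continuousD (cf x) (cg x)).
      exact: derivableD.
    by rewrite partialD//; exact: gen_alg_add.
  - split=> [x|j x|j]; first exact: (continuousM (cf x) (cg x)).
      exact: derivableM.
    by rewrite partialM//; apply: gen_alg_add; exact: gen_alg_mul.
move=> f fG s.
have : gen_alg G (foldr partial f s).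
  by elim: s => //= j s IHs; have [_ _] := key _ IHs; exact.
by move=> /key[].
Qed.

Lemma smooth_continuous f : smooth f -> continuous f.
Proof. by move=> /(_ [::])[]. Qed.

Lemma smooth_derivable f j x : smooth f -> derivable f x (delta_mx 0 j).
Proof. by move=> /(_ [::])[_]; exact. Qed.

Lemma smooth_partial f j : smooth f -> smooth (partial j f).
Proof.
move=> sf s; have := sf (rcons s j); rewrite -cats1 foldr_cat /=; exact.
Qed.

(** Generators for which stability under differentiation holds by construction. *)
Let derivs f : set (T -> R) := [set g | exists s, g = foldr partial f s].

Let derivs_self f : derivs f f. Proof. by exists [::]. Qed.

Let derivsP f G : smooth f -> derivs f `<=` gen_alg G -> forall g, derivs f g ->
  [/\ continuous g, forall j x, derivable g x (delta_mx 0 j) &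
                        forall j, gen_alg G (partial j g)].
Proof.
move=> sf fG g [s ->]; have [cs ds] := sf s; split => // j.
by apply: fG; exists (j :: s).
Qed.

Let smooth_binary f g h : smooth f -> smooth g ->
  gen_alg (derivs f `|` derivs g) h -> smooth h.
Proof.
move=> sf sg; apply: smooth_gen_alg => k [fk|gk].
  by apply: (derivsP sf) => // k' ?; apply: gen_alg_gen; left.
by apply: (derivsP sg) => // k' ?; apply: gen_alg_gen; right.
Qed.

Lemma smoothD f g : smooth f -> smooth g -> smooth (fun x => f x + g x).
Proof.
move=> sf sg; apply: (smooth_binary sf sg).
by apply: gen_alg_add; apply: gen_alg_gen; [left|right].
Qed.

Lemma smoothM f g : smooth f -> smooth g -> smooth (fun x => f x * g x).
Proof.
move=> sf sg; apply: (smooth_binary sf sg).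
by apply: gen_alg_mul; apply: gen_alg_gen; [left|right].
Qed.

Lemma smooth_cst (c : R) : smooth (fun _ : T => c).
Proof. by apply: (@smooth_gen_alg set0) => //; exact: gen_alg_cst. Qed.

Lemma smoothZ (c : R) f : smooth f -> smooth (fun x => c * f x).
Proof. by apply: smoothM; exact: smooth_cst. Qed.

Lemma smoothN f : smooth f -> smooth (fun x => - f x).
Proof.
by move=> /(smoothZ (-1)); congr smooth; apply/funext => x; rewrite mulN1r.
Qed.

Lemma smoothB f g : smooth f -> smooth g -> smooth (fun x => f x - g x).
Proof. by move=> sf /smoothN; exact: smoothD. Qed.

Lemma smooth_sum (I : Type) (r : seq I) (P : pred I) (F : I -> T -> R) :
  (forall i, smooth (F i)) -> smooth (fun x => \sum_(i <- r | P i) F i x).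
Proof.
move=> sF; elim: r => [|i r IHr].
  rewrite [X in smooth X](_ : _ = fun=> 0); first exact: smooth_cst.
  by apply/funext => x; rewrite big_nil.
have [Pi|Pi] := boolP (P i).
  rewrite [X in smooth X](_ : _ = fun x => F i x + \sum_(i <- r | P i) F i x).
    exact: (smoothD (sF i) IHr).
  by apply/funext => x; rewrite big_cons Pi.
rewrite [X in smooth X](_ : _ = fun x => \sum_(i <- r | P i) F i x) //.
by apply/funext => x; rewrite big_cons (negbTE Pi).
Qed.

Lemma smooth_prod (I : Type) (r : seq I) (P : pred I) (F : I -> T -> R) :
  (forall i, smooth (F i)) -> smooth (fun x => \prod_(i <- r | P i) F i x).
Proof.
move=> sF; elim: r => [|i r IHr].
  rewrite [X in smooth X](_ : _ = fun=> 1); first exact: smooth_cst.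
  by apply/funext => x; rewrite big_nil.
have [Pi|Pi] := boolP (P i).
  rewrite [X in smooth X](_ : _ = fun x => F i x * \prod_(i <- r | P i) F i x).
    exact: (smoothM (sF i) IHr).
  by apply/funext => x; rewrite big_cons Pi.
rewrite [X in smooth X](_ : _ = fun x => \prod_(i <- r | P i) F i x) //.
by apply/funext => x; rewrite big_cons (negbTE Pi).
Qed.

(** The reciprocal g is adjoined as one more generator: its partials are [- g * g] times those of f,
    so the generated algebra is stable. *)
Lemma smoothV f : smooth f -> (forall x, f x != 0) -> smooth (fun x => (f x)^-1).
Proof.
move=> sf f0; pose g := fun x => (f x)^-1.
apply: (@smooth_gen_alg (derivs f `|` [set g])); last by apply: gen_alg_gen; right.
move=> k [fk|->{k}].
  by apply: (derivsP sf) => // k' ?; apply: gen_alg_gen; left.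
split=> [x|j x|j].
- by apply: continuousV => //; exact: (smooth_continuous sf).
- by apply: derivableV => //; exact: smooth_derivable.
- have -> : partial j g = fun x => -1 * (g x * g x) * partial j f x.
    apply/funext => x; rewrite /partial deriveV//; last exact: smooth_derivable.
    by rewrite -invfM -expr2 mulN1r.
  apply: gen_alg_mul; last by apply: gen_alg_gen; left; exists [:: j].
  apply: gen_alg_mul; first exact: gen_alg_cst.
  by apply: gen_alg_mul; apply: gen_alg_gen; right.
Qed.

Lemma partial_shift j f c : partial j (fun x => f (x + c)) =
  fun x => partial j f (x + c).
Proof.
apply/funext => x; rewrite /partial /derive.
have -> // : (fun h : R => h^-1 *:
     (((fun x0 : T => f (x0 + c)) \o shift x) (h *: delta_mx 0 j) - f (x + c))) =
     (fun h => h^-1 *: ((f \o shift (x + c)) (h *: delta_mx 0 j) - f (x + c))).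
by apply/funext => h /=; rewrite addrA.
Qed.

Lemma foldr_partial_shift s f c : foldr partial (fun x => f (x + c)) s =
  fun x => foldr partial f s (x + c).
Proof. by elim: s => //= j s ->; rewrite partial_shift. Qed.

Lemma smooth_shift f c : smooth f -> smooth (fun x => f (x + c)).
Proof.
move=> sf s; rewrite foldr_partial_shift /=; have [cs ds] := sf s; split.
  move=> x; apply: (@continuous_comp _ _ _ (fun x : T => x + c) (foldr partial f s)).
    by apply: continuousD; [exact: cvg_id|exact: cst_continuous].
  exact: cs.
move=> j x; have := ds j (x + c); rewrite /derivable.
suff -> : (fun h : R => h^-1 *: ((foldr partial f s \o shift (x + c)) (h *: delta_mx 0 j)
    - foldr partial f s (x + c))) = (fun h : R => h^-1 *: (((fun x0 => foldr partial f s (x0 + c)) \o shift x) (h *: delta_mx 0 j)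
    - foldr partial f s (x + c))) by [].
by apply/funext => h /=; rewrite addrA.
Qed.

Lemma smooth_sub f : smooth f ->
  forall c, smooth (fun x => f (x - c)).
Proof. by move=> sf c; exact: smooth_shift. Qed.

End SmoothFunctions.

(** * The flat exponential and its derivatives *)

Section FlatFunction.
Context {R : realType}.
Implicit Types (p : {poly R}) (t : R).

(* The family t |-> p(1/t) exp(-1/t) on t > 0, extended by 0, is closed under
   differentiation. *)
Definition flat p t : R := if 0 < t then p.[t^-1] * expR (- t^-1) else 0.

(** Since e^s >= s^(i+1) / (i+1)!, each monomial s^i e^(-s) with s = 1/t is at most (i+1)! t. A
    bound linear in t is what the difference quotient at 0 requires. *)
Lemma flat_bound p : exists C, forall t, 0 < t -> t <= 1 -> `|flat p t| <= C * t.
Proof.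
exists (\sum_(i < size p) `|p`_i| * i.+1`!%:R) => t t0 t1.
rewrite /flat t0 horner_coef mulr_suml mulr_suml.
apply: (le_trans (ler_norm_sum _ _ _)); apply: ler_sum => i _.
rewrite -mulrA normrM -mulrA; apply: ler_wpM2l => //.
have s0 : 0 < t^-1 by rewrite invr_gt0.
rewrite ger0_norm; last by rewrite mulr_ge0// ?expR_ge0// exprn_ge0// ltW.
rewrite expRN ler_pdivrMr ?expR_gt0//.
have := @expR_ge1Dxn R t^-1 i (ltW s0).
set E := expR _; set s := t^-1 => h.
have {}h : s ^+ i.+1 <= E * i.+1`!%:R.
  rewrite -ler_pdivrMr ?ltr0n ?fact_gt0//; apply: le_trans h.
  by rewrite lerDr.
have -> : i.+1`!%:R * t * E = t * (E * i.+1`!%:R) by ring.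
have -> : s ^+ i = t * s ^+ i.+1 by rewrite exprS mulrA divff ?gt_eqF// mul1r.
by rewrite ler_pM2l.
Qed.

(** For t > 0 the chain rule produces p(1/t) - p'(1/t) multiplied by 1/t^2, hence the polynomial X^2
    (p - p'); at 0 the decay given by [flat_bound] takes over. *)
Lemma is_derive_flat p t :
  is_derive t 1 (flat p) (flat ('X^2 * (p - p^`())) t).
Proof.
have [t0|t0|->] := ltgtP t 0.
- have -> : flat ('X^2 * (p - p^`())) t = 0 by rewrite /flat ltNge ltW.
  apply: (@near_eq_is_derive _ _ _ (fun=> 0)).
  + near=> s; rewrite /flat ifF//; apply/negbTE; rewrite -leNgt ltW//.
    by near: s; exact: lt_nbhsl.
- pose g := fun s : R => p.[s^-1] * expR (- s^-1).
  apply: (@near_eq_is_derive _ _ _ g).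
  + near=> s; rewrite /flat ifT//.
    by near: s; exact: lt_nbhsr.
  have tn0 : t != 0 by rewrite gt_eqF.
  have dV : is_derive t 1 (fun s : R => s^-1) (- t ^- 2 *: 1).
    exact: (is_deriveV tn0 (is_derive_id _ _)).
  have dp : is_derive t 1 (fun s : R => p.[s^-1]) (p^`().[t^-1] * (- t ^- 2 *: 1)).
    exact: (@is_derive1_comp _ (horner p) (fun s => s^-1)).
  have de : is_derive t 1 (fun s : R => expR (- s^-1))
      (expR (- t^-1) * (- (- t ^- 2 *: 1))).
    exact: (@is_derive1_comp _ expR (fun s => - s^-1)).
  have [h1 h2] := is_deriveM dp de.
  apply: DeriveDef; first exact: h1.
  apply: (etrans h2); rewrite /flat t0 /= !hornerE/= /GRing.scale/= -exprVn; ring.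
- rewrite [X in is_derive _ _ _ X](_ : _ = 0); last by rewrite /flat ltxx.
  (* Dividing [flat p h] by h multiplies p by X, so the bound for X p controls the difference
     quotient. *)
  have [C CP] := flat_bound ('X * p).
  have lim0 : h^-1 *: ((flat p \o shift 0) (h *: 1) - flat p 0) @[h --> 0^'] --> 0.
    apply/cvgrPdist_le => e e0; rewrite near_withinE; near=> h => h0.
    rewrite sub0r normrN /= addr0 /GRing.scale/= mulr1 {2}/flat ltxx subr0.
    have [h_gt0|h_le0] := ltP 0 h; last first.
      by rewrite /flat ltNge h_le0/= mulr0 normr0 ltW.
    have -> : h^-1 * flat p h = flat ('X * p) h.
      by rewrite /flat h_gt0 hornerM hornerX mulrA.
    have h1 : h < 1 by near: h; exact: lt_nbhsl.
    apply: (le_trans (CP _ h_gt0 (ltW h1))).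
    apply: (@le_trans _ _ ((`|C| + 1) * h)).
      by rewrite ler_pM2r// (le_trans (ler_norm _))// lerDl.
    rewrite -ler_pdivlMl; last by rewrite ltr_wpDl.
    apply: ltW; near: h; apply: lt_nbhsl.
    by rewrite mulr_gt0// invr_gt0 ltr_wpDl.
  by apply: DeriveDef; [apply/cvg_ex; exists 0|exact/cvg_lim].
Unshelve. all: by end_near.
Qed.

End FlatFunction.

(** * Smooth steps and bumps *)

Section Bumps.
Context {R : realType} {n : nat}.
Local Notation T := 'rV[R]_n.

Lemma is_derive_flat_coord p (a b : R) (i j : 'I_n) (x : T) :
  is_derive x (delta_mx 0 j) (fun x : T => flat p (a * x 0 i + b))
    (a * (i == j)%:R * flat ('X^2 * (p - p^`())) (a * x 0 i + b)).
Proof.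
pose g h : R := (a * (i == j)%:R) * h + (a * x 0 i + b).
have dg : is_derive (0 : R) 1 g (a * (i == j)%:R).
  have -> : g = (a * (i == j)%:R) \*: id + cst (a * x 0 i + b) by [].
  by apply: is_derive_eq; rewrite /GRing.scale/= mulr1 addr0.
have g0 : g 0 = a * x 0 i + b by rewrite /g mulr0 add0r.
have := @is_derive1_comp _ (flat p) g 0 _ _ (is_derive_flat p (g 0)) dg.
have lineE (h : R) : flat p (a * (h *: delta_mx 0 j + x) 0 i + b) = (flat p \o g) h.
  rewrite /= /g !mxE eqxx eq_sym /=; congr (flat p _); rewrite eq_sym; ring.
rewrite g0 mulrC => -[h1 h2].
have E : (fun h : R => h^-1 *: (((fun x : T => flat p (a * x 0 i + b)) \o shift x) (h *: delta_mx 0 j) - flat p (a * x 0 i + b))) = (fun h : R => h^-1 *: (((flat p \o g) \o shift 0) (h *: 1) - (flat p \o g) 0)).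
  apply/funext => h; rewrite /= -g0; congr (_ *: (_ - _)).
  by rewrite addr0 [h *: 1]mulr1; exact: lineE.
by apply: DeriveDef; [rewrite /derivable E|rewrite /derive E].
Qed.

Let flat_coords (i : 'I_n) : set (T -> R) :=
  [set f | exists p (a b : R), f = fun x : T => flat p (a * x 0 i + b)].

Lemma flat_continuous (p : {poly R}) : continuous (flat p).
Proof.
move=> t; apply/differentiable_continuous/derivable1_diffP.
by have [] := is_derive_flat p t.
Qed.

Lemma smooth_flat_coord p (a b : R) (i : 'I_n) :
  smooth (fun x : T => flat p (a * x 0 i + b)).
Proof.
apply: (@smooth_gen_alg _ _ (flat_coords i)); last first.
  by apply: gen_alg_gen; exists p, a, b.
move=> _ [{}p [{}a [{}b ->]]]; split.
- move=> x; apply: (@continuous_comp _ _ _ (fun x : T => a * x 0 i + b) (flat p)).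
    apply: continuousD; last exact: cst_continuous.
    by apply: continuousM; [exact: cst_continuous|exact: coord_continuous].
  exact: flat_continuous.
- by move=> j x; have [] := is_derive_flat_coord p a b i j x.
- move=> j; have -> : partial j (fun x : T => flat p (a * x 0 i + b)) =
    fun x => a * (i == j)%:R * flat ('X^2 * (p - p^`())) (a * x 0 i + b).
    by apply/funext => x; have [_] := is_derive_flat_coord p a b i j x.
  apply: gen_alg_mul; first exact: gen_alg_cst.
  by apply: gen_alg_gen; exists ('X^2 * (p - p^`())), a, b.
Qed.

(** The usual smooth transition, 0 for t <= 0 and 1 for t >= 1; the two flat functions in the
    denominator never vanish together. *)
Definition step (t : R) : R := flat 1 t / (flat 1 t + flat 1 (1 - t)).

Lemma flat1_ge0 (t : R) : 0 <= flat 1 t.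
Proof. by rewrite /flat; case: ifP => // _; rewrite hornerE mul1r expR_ge0. Qed.

Lemma flat1_gt0 (t : R) : 0 < t -> 0 < flat 1 t.
Proof. by rewrite /flat => ->; rewrite hornerE mul1r expR_gt0. Qed.

Lemma flat1_eq0 (t : R) : t <= 0 -> flat 1 t = 0.
Proof. by rewrite /flat ltNge => ->. Qed.

Lemma step_den_gt0 (t : R) : 0 < flat 1 t + flat 1 (1 - t).
Proof.
have [t0|t0] := ltP 0 t; first by rewrite ltr_wpDr ?flat1_ge0// flat1_gt0.
by rewrite ltr_wpDl ?flat1_ge0// flat1_gt0// subr_gt0 (le_lt_trans t0).
Qed.

Lemma step01 (t : R) : 0 <= step t <= 1.
Proof.
rewrite /step divr_ge0 ?flat1_ge0 ?(ltW (step_den_gt0 t))//=.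
by rewrite ler_pdivrMr ?step_den_gt0// mul1r lerDl flat1_ge0.
Qed.

Lemma step_eq1 (t : R) : 1 <= t -> step t = 1.
Proof.
move=> t1; rewrite /step (@flat1_eq0 (1 - t)) ?subr_le0// addr0 divff//.
by rewrite gt_eqF// flat1_gt0// (lt_le_trans _ t1).
Qed.

Lemma step_eq0 (t : R) : t <= 0 -> step t = 0.
Proof. by move=> t0; rewrite /step flat1_eq0// mul0r. Qed.

Lemma smooth_step_coord (a b : R) (i : 'I_n) :
  smooth (fun x : T => step (a * x 0 i + b)).
Proof.
have E (x : T) : 1 - (a * x 0 i + b) = (- a) * x 0 i + (1 - b) :> R by ring.
rewrite /step; apply: smoothM; first exact: smooth_flat_coord.
apply: smoothV; last by move=> x; rewrite gt_eqF// step_den_gt0.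
apply: smoothD; first exact: smooth_flat_coord.
rewrite [X in smooth X](_ : _ = fun x : T => flat 1 (- a * x 0 i + (1 - b))).
  exact: smooth_flat_coord.
by apply/funext => x; rewrite E.
Qed.

Lemma smooth_bump (c : T) (r : R) : 0 < r -> exists b : T -> R,
  [/\ smooth b, forall x, 0 <= b x <= 1,
      forall x : T, (forall i, `|x 0 i - c 0 i| <= r) -> b x = 1 &
      forall (x : T) i, b x != 0 -> `|x 0 i - c 0 i| < 2 * r].
Proof.
(* In each coordinate one step rises and one falls. Their arguments are (x_i - c_i + 2r)/r and (2r -
   (x_i - c_i))/r: both are at least 1 when |x_i - c_i| <= r, and one is nonpositive when |x_i -
   c_i| >= 2r. *)
move=> r0; exists (fun x : T => \prod_(i < n)
  (step (r^-1 * x 0 i + (2 - c 0 i / r)) *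
   step ((- r^-1) * x 0 i + (2 + c 0 i / r)))).
have E1 (x : T) i : r^-1 * x 0 i + (2 - c 0 i / r) = (x 0 i - c 0 i + 2 * r) / r.
  by field; rewrite gt_eqF.
have E2 (x : T) i : - r^-1 * x 0 i + (2 + c 0 i / r) = (2 * r - (x 0 i - c 0 i)) / r.
  by field; rewrite gt_eqF.
split.
- by apply: smooth_prod => i; apply: smoothM; exact: smooth_step_coord.
- move=> x; apply/andP; split.
    have s0 t : 0 <= step t by have /andP[] := step01 t.
    by apply: prodr_ge0 => i _; apply: mulr_ge0.
  apply: prodr_ile1 => i _; have /andP[a0 a1] := step01 (r^-1 * x 0 i + (2 - c 0 i / r)).
  have /andP[b0 b1] := step01 (- r^-1 * x 0 i + (2 + c 0 i / r)).
  by rewrite mulr_ge0//= mulr_ile1.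
- move=> x xc; apply: big1 => i _; have := xc i; rewrite ler_norml => /andP[x1 x2].
  by rewrite E1 E2 !step_eq1 ?mulr1// ler_pdivlMr//; lra.
- move=> x i bx; rewrite ltr_norml; apply/andP; split;
    rewrite ltNge; apply: contra bx => h; rewrite prodf_seq_eq0;
    apply/hasP; exists i; rewrite ?mem_index_enum//=.
    by rewrite E1 step_eq0 ?mul0r// pmulr_lle0 ?invr_gt0//; lra.
  by rewrite E2 (@step_eq0 (_ / r)) ?mulr0// pmulr_lle0 ?invr_gt0//; lra.
Qed.

End Bumps.

(** * Integrals of real-valued functions *)

Section RealIntegrals.
Context d (T : measurableType d) (R : realType).
Variable mu : {measure set T -> \bar R}.
Implicit Types (D : set T) (f g h : T -> R).

Lemma rintgD D f g : measurable D ->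
  mu.-integrable D (EFin \o f) -> mu.-integrable D (EFin \o g) ->
  mu.-integrable D (EFin \o (fun x => f x + g x)).
Proof. move=> mD fi gi; apply: (@eq_integrable _ _ _ _ _ mD _ _ _ (integrableD mD fi gi)) => x _.
by []. Qed.

Lemma rintgZ D r f : measurable D -> mu.-integrable D (EFin \o f) ->
  mu.-integrable D (EFin \o (fun x => r * f x)).
Proof. by move=> mD fi; apply: (@eq_integrable _ _ _ _ _ mD _ _ _ (integrableZl mD r fi)) => x _. Qed.

Lemma rintgN D f : measurable D -> mu.-integrable D (EFin \o f) ->
  mu.-integrable D (EFin \o (fun x => - f x)).
Proof. by move=> mD fi; apply: (@eq_integrable _ _ _ _ _ mD _ _ _ (integrableN fi)) => x _. Qed.

Lemma rintgB D f g : measurable D ->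
  mu.-integrable D (EFin \o f) -> mu.-integrable D (EFin \o g) ->
  mu.-integrable D (EFin \o (fun x => f x - g x)).
Proof. by move=> mD fi gi; apply: rintgD => //; exact: rintgN. Qed.

Lemma rintg0 D : mu.-integrable D (EFin \o (fun=> 0)).
Proof. exact: integrable0. Qed.

Lemma rintg_sum D (I : Type) (s : seq I) (F : I -> T -> R) : measurable D ->
  (forall i, mu.-integrable D (EFin \o F i)) ->
  mu.-integrable D (EFin \o (fun x => \sum_(i <- s) F i x)).
Proof.
move=> mD Fi; elim: s => [|i s IHs].
  rewrite (_ : (fun x => \sum_(i <- [::]) F i x) = fun=> 0); first exact: rintg0.
  by apply/funext => x; rewrite big_nil.
rewrite (_ : (fun x => \sum_(j <- i :: s) F j x) =
  fun x => F i x + \sum_(j <- s) F j x); first exact: rintgD.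
by apply/funext => x; rewrite big_cons.
Qed.

Lemma Rintegral_sum D (I : Type) (s : seq I) (F : I -> T -> R) : measurable D ->
  (forall i, mu.-integrable D (EFin \o F i)) ->
  \int[mu]_(x in D) (\sum_(i <- s) F i x) = \sum_(i <- s) \int[mu]_(x in D) F i x.
Proof.
move=> mD Fi; elim: s => [|i s IHs].
  rewrite big_nil (_ : (fun x => \sum_(i <- [::]) F i x) = fun=> 0).
    by rewrite Rintegral_cst// mul0r.
  by apply/funext => x; rewrite big_nil.
rewrite big_cons -IHs -RintegralD//; last exact: rintg_sum.
by congr Rintegral; apply/funext => x; rewrite big_cons.
Qed.

Lemma rintg_measurable D f : mu.-integrable D (EFin \o f) -> measurable_fun D f.
Proof. by move=> /measurable_int/measurable_EFinP. Qed.

Lemma rintg_le D f g : measurable D -> measurable_fun D f ->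
  (forall x, D x -> `|f x| <= g x) ->
  mu.-integrable D (EFin \o g) -> mu.-integrable D (EFin \o f).
Proof.
move=> mD mf fg gi; apply: (le_integrable mD _ _ gi).
  exact/measurable_EFinP.
by move=> x Dx /=; rewrite lee_fin (le_trans (fg _ Dx) (ler_norm _)).
Qed.

Lemma rintg_norm D f : measurable D -> mu.-integrable D (EFin \o f) ->
  mu.-integrable D (EFin \o (fun x => `|f x|)).
Proof. by move=> mD fi; apply: (@eq_integrable _ _ _ _ _ mD _ _ _ (integrable_abse fi)) => x _. Qed.

Lemma rintg_bounded D f M : measurable D -> (mu D < +oo)%E ->
  measurable_fun D f -> (forall x, D x -> `|f x| <= M) ->
  mu.-integrable D (EFin \o f).
Proof.
move=> mD Doo mf fM; apply: (@rintg_le _ _ (fun=> M)) => //.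
apply/integrableP; split; first exact: measurable_cst.
rewrite (_ : (fun x => `|(EFin \o (fun=> M)) x|%E) = cst `|M|%:E)//.
by rewrite integral_cst//; apply: lte_mul_pinfty.
Qed.

Lemma rintgM_bounded D f g M : measurable D ->
  mu.-integrable D (EFin \o f) -> measurable_fun D g ->
  (forall x, D x -> `|g x| <= M) ->
  mu.-integrable D (EFin \o (fun x => f x * g x)).
Proof.
move=> mD fi mg gM; apply: (@rintg_le _ _ (fun x => M * `|f x|)) => //.
- by apply: measurable_funM => //; exact: rintg_measurable fi.
- by move=> x Dx; rewrite normrM mulrC ler_wpM2r ?gM.
- by apply: rintgZ => //; exact: rintg_norm.
Qed.

Lemma EFin_Rintegral D f : measurable D -> mu.-integrable D (EFin \o f) ->
  (\int[mu]_(x in D) f x)%:E = (\int[mu]_(x in D) (f x)%:E)%E.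
Proof. by move=> mD fi; rewrite fineK//; exact: integrable_fin_num. Qed.

Lemma Rintegral_le_bound D f g : measurable D ->
  mu.-integrable D (EFin \o f) -> mu.-integrable D (EFin \o g) ->
  (forall x, D x -> `|f x| <= g x) ->
  `|\int[mu]_(x in D) f x| <= \int[mu]_(x in D) g x.
Proof.
move=> mD fi gi fg; apply: (le_trans (le_normr_Rintegral mD fi)).
by apply: le_Rintegral => //; exact: rintg_norm.
Qed.

Lemma Rintegral_dct D (f_ : nat -> T -> R) f g : measurable D ->
  (forall k, measurable_fun D (f_ k)) -> mu.-integrable D (EFin \o g) ->
  (forall k x, D x -> `|f_ k x| <= g x) ->
  (forall x, D x -> f_ k x @[k --> \oo] --> f x) ->
  mu.-integrable D (EFin \o f) /\
  \int[mu]_(x in D) f_ k x @[k --> \oo] --> \int[mu]_(x in D) f x.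
Proof.
move=> mD mf_ gi f_g f_f.
have mf : measurable_fun D (EFin \o f).
  apply: (emeasurable_fun_cvg (fun k => EFin \o f_ k)) => [k|x Dx].
    exact/measurable_EFinP.
  by apply: cvg_EFin; [near=> k|exact: f_f].
have := @dominated_convergence _ _ _ mu D mD
  (fun k => EFin \o f_ k) (EFin \o f) (EFin \o g).
case.
- by move=> k; exact/measurable_EFinP.
- exact: mf.
- by apply: aeW => x Dx; apply: cvg_EFin; [near=> k|exact: f_f].
- exact: gi.
- by apply: aeW => x k Dx; rewrite lee_fin; exact: f_g.
move=> fi _ fc.
split => //.
by apply: fine_cvg; rewrite fineK//; exact: integrable_fin_num.
Unshelve. all: by end_near.
Qed.

Lemma Rintegral_ae_eq D f g : measurable D ->
  mu.-integrable D (EFin \o f) -> measurable_fun D g ->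
  (\forall x \ae mu, D x -> f x = g x) ->
  mu.-integrable D (EFin \o g) /\
  \int[mu]_(x in D) f x = \int[mu]_(x in D) g x.
Proof.
move=> mD fi mg fg.
have E : ae_eq mu D (EFin \o f) (EFin \o g).
  by apply: filterS fg => x fg Dx /=; rewrite fg.
have mf : measurable_fun D (EFin \o f) by case/integrableP : fi.
have mg' : measurable_fun D (EFin \o g) by exact/measurable_EFinP.
split; last first.
  by rewrite /Rintegral; congr fine; exact: ae_eq_integral.
apply/integrableP; split => //.
have [_] := integrableP _ _ _ fi; congr (_ < _)%E.
apply: ae_eq_integral => //; try exact: measurableT_comp.
by apply: filterS fg => x fgx Dx /=; rewrite fgx.
Qed.

Lemma rintg_indic A : measurable A -> (mu A < +oo)%E ->
  mu.-integrable setT (EFin \o (\1_A : T -> R)).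
Proof.
move=> mA Aoo; apply/integrableP; split; first exact/measurable_EFinP.
rewrite (_ : (fun x => _) = fun x => (\1_A x)%:E); last first.
  by apply/funext => x /=; rewrite ger0_norm.
by rewrite integral_indic// setIT.
Qed.

Lemma le_measure_set (A B : set T) : measurable A -> measurable B -> A `<=` B ->
  (mu A <= mu B)%E.
Proof. move=> mA mB AB; exact: (le_measure mu (mem_set mA) (mem_set mB) AB). Qed.

Lemma indic_in (A : set T) x : A x -> \1_A x = 1 :> R.
Proof. by move=> Ax; rewrite indicE mem_set. Qed.

Lemma indic_out (A : set T) x : ~ A x -> \1_A x = 0 :> R.
Proof. by move=> Ax; rewrite indicE memNset. Qed.

(** The sets may overlap: this is enough to evaluate a linear functional through indicators. *)
Definition simple_fun (f : T -> R) := exists N (c : 'I_N -> R) (A : 'I_N -> set T),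
  (forall i, measurable (A i)) /\ f = fun x => \sum_(i < N) c i * \1_(A i) x.

Lemma simple_funB f g : simple_fun f -> simple_fun g ->
  simple_fun (fun x => f x - g x).
Proof.
move=> [N [c [A [mA ->]]]] [N' [c' [A' [mA' ->]]]].
exists (N + N')%N, (fun i => match fintype.split i with inl j => c j | inr j => - c' j end),
  (fun i => match fintype.split i with inl j => A j | inr j => A' j end).
split; first by move=> i; case: (fintype.split i).
apply/funext => x; rewrite big_split_ord/=; congr (_ + _).
  by apply: eq_bigr => i _; rewrite (unsplitK (inl i)).
rewrite -sumrN; apply: eq_bigr => i _.
by rewrite (unsplitK (inr i)) mulNr.
Qed.

Lemma simple_fun_measurable f : simple_fun f -> measurable_fun setT f.
Proof.
move=> [N [c [A [mA ->]]]]; apply: measurable_sum => i.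
by apply: measurable_funM => //; exact: measurable_indic.
Qed.

Import HBNNSimple.

Lemma simple_fun_nnsfun (f : {nnsfun T >-> R}) : simple_fun f.
Proof.
pose s : seq R := fset_set (range f).
exists (size s), (fun i => s`_i), (fun i => f @^-1` [set s`_i]); split=> //.
apply/funext => x; rewrite fimfunE fsbig_finite//=.
by rewrite -/s (big_nth 0) big_mkord.
Qed.

Lemma simple_approx_ge0 g : measurable_fun setT g -> (forall x, 0 <= g x) ->
  exists f_ : nat -> T -> R, [/\ forall k, simple_fun (f_ k),
    forall k x, 0 <= f_ k x <= g x & forall x, f_ k x @[k --> \oo] --> g x].
Proof.
move=> mg' g0; have mg : measurable_fun setT (EFin \o g) by exact/measurable_EFinP.
pose f_ k := nnsfun_approx measurableT mg k.
have fg x : f_ k x @[k --> \oo] --> g x.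
  exact: (fine_cvg (cvg_nnsfun_approx measurableT mg (fun x _ => g0 x) (I : setT x))).
exists (fun k => f_ k); split => // [k|k x]; first exact: simple_fun_nnsfun.
apply/andP; split; first exact: fun_ge0.
have nd : nondecreasing_seq (f_ ^~ x).
  by move=> i j ij; exact/lefP/nd_nnsfun_approx.
rewrite -(cvg_lim _ (fg x))//; apply: nondecreasing_cvgn_le => //.
by apply/cvg_ex; exists (g x); exact: fg.
Qed.

(** Positive and negative parts are approximated from below; at each point one of the two
    approximations is 0, so their difference stays below |g| in absolute value. *)
Lemma simple_approx g : measurable_fun setT g ->
  exists f_ : nat -> T -> R, [/\ forall k, simple_fun (f_ k),
    forall k x, `|f_ k x| <= `|g x| & forall x, f_ k x @[k --> \oo] --> g x].
Proof.
move=> mg.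
have [|x|a [sa ag ca]] := @simple_approx_ge0 (fun x => Num.max (g x) 0).
- exact: measurable_maxr.
- by rewrite le_max lexx orbT.
have [|x|b [sb bg cb]] := @simple_approx_ge0 (fun x => Num.max (- g x) 0).
- by apply: measurable_maxr => //; exact: measurableT_comp.
- by rewrite le_max lexx orbT.
exists (fun k x => a k x - b k x); split => [k|k x|x]; first exact: simple_funB.
  have /andP[a0 a1] := ag k x; have /andP[b0 b1] := bg k x.
  have [gx|gx] := leP 0 (g x).
    have bk : b k x = 0.
      by apply/eqP; rewrite eq_le b0 (le_trans b1)// max_r ?oppr_le0.
    by rewrite bk subr0 !ger0_norm// (le_trans a1)// max_l.
  have ak : a k x = 0.
    by apply/eqP; rewrite eq_le a0 (le_trans a1)// max_r ?(ltW gx).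
  rewrite ak sub0r normrN (ltr0_norm gx) (ger0_norm b0) (le_trans b1)// max_l//.
  by rewrite oppr_ge0 (ltW gx).
have -> : g x = Num.max (g x) 0 - Num.max (- g x) 0.
  have [gx|gx] := leP 0 (g x); first by rewrite max_r ?oppr_le0// subr0.
  by rewrite max_l ?oppr_ge0 ?(ltW gx)// sub0r opprK.
by apply: cvgB; [exact: ca|exact: cb].
Qed.

End RealIntegrals.

(** * Lebesgue measure on row vectors *)

Section MatrixMeasurability.
Context {R : realType}.

(** An open set is a countable union of balls with rational centres, and a ball of the matrix norm
    is a finite intersection of conditions on single entries. *)
Lemma measurable_fun_mx d (X : measurableType d) (m n : nat) (D : set X)
    (g : X -> 'M[R]_(m, n)) : measurable D ->
  (forall i j, measurable_fun D (fun x => g x i j)) -> measurable_fun D g.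
Proof.
move=> mD mg; apply: (@measurability _ _ _ _ _ _ (@open 'M[R]_(m, n))) => //.
move=> _ [U oU <-]; rewrite (open_mx_rat oU) preimage_bigcup setI_bigcupr.
rewrite bigcup_mkcond; apply: countable_bigcupT_measurable.
  exact: countableP.
move=> q; case: ifPn => // _.
rewrite [X in measurable X](_ : _ = D `&` \bigcap_(i in [set: 'I_m])
    \bigcap_(j in [set: 'I_n]) (D `&` (fun x => g x i j) @^-1`
      ball (ratr (q.1 i j) : R) (q.2.+1%:R^-1 : R))).
  apply: measurableI => //.
  apply: fin_bigcap_measurable => // i _.
  apply: fin_bigcap_measurable => // j _.
  by apply: mg => //; exact: measurable_ball.
apply/seteqP; split=> [x [Dx [_ qx]]|x [Dx qx]].
  split=> // i _ j _; split => //=.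
  by have := qx i j; rewrite mxE.
split=> //; split; first by rewrite invr_gt0.
by move=> i j; rewrite mxE; have [] := qx i I j I.
Qed.

Lemma measurable_fun_coord d (X : measurableType d) (m n : nat) (D : set X)
    (g : X -> 'M[R]_(m, n)) i j : measurable D ->
  measurable_fun D g -> measurable_fun D (fun x => g x i j).
Proof.
move=> mD mg; apply: (measurable_comp _ _ (measurable_coord i j) mg) => //.
Qed.

Lemma continuous_measurable_mx m n (f : 'M[R]_(m, n) -> R) :
  continuous f -> measurable_fun setT f.
Proof.
move=> cf; apply: (@measurability _ _ _ _ _ _ (@RGenOInfty.G R)).
  exact: RGenOInfty.measurableE.
move=> _ [_ [a ->] <-]; rewrite setTI set_itvE; apply: open_measurable_mx.
by apply: open_comp => [? _|]; [exact: cf|exact: open_gt].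
Qed.

End MatrixMeasurability.

(** * Boxes and translation invariance *)

Section LebesgueRV.
Context {R : realType}.

(** Lebesgue measure on the line is characterised by its values on half-open intervals, and shifts
    preserve their lengths. *)
Lemma lebesgue_measure_shift (c : R) (E : set R) : measurable E ->
  lebesgue_measure ((fun x => x + c) @^-1` E) = lebesgue_measure E.
Proof.
move=> mE.
have mf : measurable_fun [set: R] (fun x : R => x + c).
  by apply: measurable_funD => //; exact: measurable_id.
pose mu0 := (pushforward (@lebesgue_measure R)
  (fun x : measurableTypeR R => ((x : R) + c : measurableTypeR R)) :
  {measure set (measurableTypeR R) -> \bar R}).
pose mu := mu0 mf.
rewrite -[LHS]/(mu E); apply/esym.
apply: (@lebesgue_measure_unique R mu) => // _ [[a b] _ <-] /=.
rewrite /mu /mu0 /= /pushforward.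
have -> : (fun x : R => x + c) @^-1` `]a, b] = `]a - c, b - c]%classic.
  by apply/seteqP; split=> x /=; rewrite !in_itv/= ltrBlDr lerBrDr.
rewrite !lebesgue_measure_itv/= !lte_fin ltrD2r; case: ifP => // _.
by rewrite -!EFinB opprB addrA subrK.
Qed.

Section Dim.
Variable n : nat.
Local Notation T := 'rV[R]_n.
Local Notation lam := (@lebesgue_rV R n).

Definition box (A : 'I_n -> set R) : set T := [set v | forall i, A i (v 0 i)].

Lemma measurable_box A : (forall i, measurable (A i)) -> measurable (box A).
Proof.
move=> mA; rewrite [X in measurable X](_ : _ = \bigcap_(i in [set: 'I_n])
      ((fun v : T => v 0 i) @^-1` A i)); last first.
  by apply/seteqP; split=> [v Av i _|v Av i]; exact: Av.
apply: fin_bigcap_measurable => // i _.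
by rewrite -[_ @^-1` _]setTI; exact: measurable_coord.
Qed.

Lemma lebesgue_box (A : 'I_n -> set R) : (forall i, measurable (A i)) ->
  lam (box A) = (\prod_(i < n) lebesgue_measure (A i))%E.
Proof. exact: lebesgue_rV_box. Qed.

Let boxes : set (set T) := [set E | exists2 A, (forall i, measurable (A i)) & E = box A].

Definition cube (k : nat) : set T := box (fun=> `[- k%:R, k%:R]%classic).

Lemma cube_lty k : (lam (cube k) < +oo)%E.
Proof.
rewrite /cube lebesgue_rV_box//.
pose I : set R := `[- k%:R, k%:R]%classic.
suff : exists r : R, (\prod_(i < n) lebesgue_measure I)%E = r%:E.
  by move=> [r ->]; exact: ltry.
elim/big_ind : _ => [|x y [r ->] [s ->]|i _].
- by exists 1.
- by exists (r * s).
- rewrite /I lebesgue_measure_itv/=; case: ifPn => _; last by exists 0.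
  by eexists; rewrite -EFinB.
Qed.

Lemma cube_cover : \bigcup_k cube k = setT.
Proof.
apply/seteqP; split => // x _.
exists (Num.truncn (\sum_i `|x 0 i|)).+1 => //= i.
rewrite /= in_itv/= -ler_norml; apply: (@le_trans _ _ (\sum_i `|x 0 i|)).
  by rewrite (bigD1 i)//= lerDl sumr_ge0.
by rewrite ltW// truncnS_gt.
Qed.

Lemma bounded_sub_cube (D : set T) : bounded_set D -> exists k, D `<=` cube k.
Proof.
move=> [M [_ DM]]; exists (Num.truncn (`|M| + 1)).+1 => x Dx i.
rewrite /= in_itv/= -ler_norml.
have Mx : `|x| <= `|M| + 1.
  by apply: DM => //; rewrite (le_lt_trans (ler_norm _))// ltrDl.
apply: (@le_trans _ _ `|x|).
  by rewrite [leRHS]/Num.Def.normr/= mx_normrE; apply: (le_bigmax _ _ (ord0, i)).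
by rewrite (le_trans Mx)// ltW// truncnS_gt.
Qed.

Lemma lebesgue_rV_lty (D : set T) : measurable D -> bounded_set D ->
  (lam D < +oo)%E.
Proof.
move=> mD /bounded_sub_cube[k Dk]; apply: le_lt_trans (cube_lty k).
by apply: le_measure_set => //; exact: measurable_box.
Qed.

Lemma lebesgue_rV_sigma_finite : sigma_finite setT lam.
Proof.
exists cube; first by rewrite cube_cover.
by move=> k; split; [exact: measurable_box|exact: cube_lty].
Qed.

Lemma measurable_boxesE : (@measurable _ T) = <<s boxes >>.
Proof.
apply/seteqP; split; last first.
  apply: smallest_sub; first exact: sigma_algebra_measurable.
  by move=> _ [A mA ->]; exact: measurable_box.
apply: smallest_sub; first exact: smallest_sigma_algebra.
move=> U oU; rewrite (open_mx_rat oU) bigcup_mkcond.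
apply: (@countable_bigcupT_measurable _ (g_sigma_algebraType boxes)).
  exact: countableP.
move=> q; case: ifPn => // _; apply: sub_sigma_algebra.
exists (fun i => ball (ratr (q.1 0 i) : R) (q.2.+1%:R^-1 : R)).
  by move=> i; exact: measurable_ball.
apply/seteqP; split=> [x [_ qx] i|x qx].
  by have := qx 0 i; rewrite mxE.
split; first by rewrite invr_gt0.
by move=> i j; rewrite mxE ord1; exact: qx.
Qed.

Lemma measurable_shift (c : T) : measurable_fun setT (fun x : T => x + c).
Proof.
apply: measurable_fun_mx => // i j.
rewrite (_ : (fun x : T => (x + c) i j) = fun x : T => x i j + c i j).
  by apply: measurable_funD => //; exact: measurable_coord.
by apply/funext => x; rewrite mxE.
Qed.

(** The shifted measure agrees with the original on products of measurable sets, which are stable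
    under intersection, generate the Borel sets and contain the exhausting cubes of finite
    measure. *)
Lemma lebesgue_rV_shift (c : T) (E : set T) : measurable E ->
  lam ((fun x => x + c) @^-1` E) = lam E.
Proof.
move=> mE.
pose mu0 := (pushforward lam (fun x : T => x + c) : {measure set T -> \bar R}).
pose mu := mu0 (measurable_shift c).
rewrite -[LHS]/(mu E); apply/esym.
apply: (@measure_unique _ _ _ boxes cube) => //.
- exact: measurable_boxesE.
- move=> _ _ [A mA ->] [B mB ->]; exists (fun i => A i `&` B i).
    by move=> i; exact: measurableI.
  apply/seteqP; split=> x /=; first by move=> [Ax Bx] i; split; [exact: Ax|exact: Bx].
  by move=> ABx; split => i; have [] := ABx i.
- by move=> k; exists (fun=> `[- k%:R, k%:R]%classic).
- exact: cube_cover.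
- move=> _ [A mA ->]; rewrite /mu /mu0 /= /pushforward.
  have -> : (fun x : T => x + c) @^-1` box A = box (fun i => (fun t => t + c 0 i) @^-1` A i).
    by apply/seteqP; split=> x /= Ax i; have := Ax i; rewrite mxE.
  rewrite lebesgue_box// lebesgue_box//.
    by apply: eq_bigr => i _; rewrite lebesgue_measure_shift.
  move=> i; rewrite -[X in measurable X]setTI.
  by apply: (measurable_funD (@measurable_id _ _ _) (@measurable_cst _ _ _ _ _ _)).
- exact: cube_lty.
Qed.

Lemma integral_shift (c : T) (f : T -> \bar R) : measurable_fun setT f ->
  (forall x, (0 <= f x)%E) ->
  (\int[lam]_x f (x + c)%R = \int[lam]_x f x)%E.
Proof.
move=> mf f0.
rewrite -(@ge0_integral_pushforward _ _ _ _ _ _ (measurable_shift c) lam setT f)//.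
apply: (@eq_measure_integral _ _ _ setT lam) => [|mf1 A mA _].
  exact: measurable_shift.
exact: (lebesgue_rV_shift c mA).
Qed.

Lemma rintg_shift (c : T) (f : T -> R) :
  lam.-integrable setT (EFin \o f) ->
  lam.-integrable setT (EFin \o (fun x => f (x + c))).
Proof.
move=> fi; have /integrableP[mf foo] := fi; apply/integrableP; split.
  exact: (measurableT_comp mf (measurable_shift c)).
rewrite (@integral_shift c (fun x => `|(f x)%:E|%E))//.
exact: measurableT_comp.
Qed.

Lemma Rintegral_shift (c : T) (f : T -> R) :
  lam.-integrable setT (EFin \o f) ->
  \int[lam]_x f (x + c) = \int[lam]_x f x.
Proof.
move=> fi; have /integrableP[mf _] := fi; congr fine.
have := integral_pushforward (measurable_shift c) mf (rintg_shift c fi) measurableT.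
rewrite preimage_setT => <-.
apply: (@eq_measure_integral _ _ _ setT lam) => [|mf1 A mA _].
  exact: measurable_shift.
exact: (lebesgue_rV_shift c mA).
Qed.

End Dim.
End LebesgueRV.

(** * Continuity of translations in L^1 *)

Section TranslationContinuity.
Context {R : realType} {n : nat}.
Local Notation T := 'rV[R]_n.
Local Notation lam := (@lebesgue_rV R n).
Implicit Types (g : T -> R).

Definition L1_cont g := lam.-integrable setT (EFin \o g) /\
  forall e, 0 < e -> exists2 r, 0 < r & forall c : T, `|c| < r ->
    \int[lam]_x `|g (x + c) - g x| <= e.

Let intd g c : lam.-integrable setT (EFin \o g) ->
  lam.-integrable setT (EFin \o (fun x => `|g (x + c) - g x|)).
Proof.
by move=> gi; apply: rintg_norm => //; apply: rintgB => //; exact: rintg_shift.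
Qed.

(** Shifting preserves the L^1 distance between g and g', so the increment of g splits into three
    terms of size at most e / 3. *)
Lemma L1_cont_approx g : lam.-integrable setT (EFin \o g) ->
  (forall e, 0 < e -> exists2 g', L1_cont g' & \int[lam]_x `|g x - g' x| <= e) ->
  L1_cont g.
Proof.
move=> gi gg; split => // e e0; have e3 : 0 < e / 3 by rewrite divr_gt0.
have [g' [g'i g'c] gg'] := gg _ e3.
have [r r0 rP] := g'c _ e3; exists r => // c cr.
pose d x := `|g x - g' x|.
have di : lam.-integrable setT (EFin \o d).
  by apply: rintg_norm => //; exact: rintgB.
have dci := rintg_shift c di.
apply: (@le_trans _ _ (\int[lam]_x ((d (x + c) + `|g' (x + c) - g' x|) + d x))).
  apply: le_Rintegral => //; first exact: intd.
    by apply: rintgD => //; apply: rintgD => //; exact: intd.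
  move=> x _; rewrite /d.
  have -> : g (x + c) - g x = (g (x + c) - g' (x + c)) +
    (g' (x + c) - g' x) - (g x - g' x) by ring.
  by apply: (le_trans (ler_normB _ _)); rewrite lerD2r ler_normD.
rewrite RintegralD//; last by apply: rintgD => //; exact: intd.
rewrite RintegralD//; last exact: intd.
rewrite Rintegral_shift//.
have := rP _ cr; have := gg'; rewrite -/(d _) => h1 h2.
by rewrite /d; lra.
Qed.

Lemma L1_contD g h : L1_cont g -> L1_cont h -> L1_cont (fun x => g x + h x).
Proof.
move=> [gi gc] [hi hc]; split; first exact: rintgD.
move=> e e0; have e2 : 0 < e / 2 by rewrite divr_gt0.
have [r r0 rP] := gc _ e2; have [s s0 sP] := hc _ e2.
exists (Num.min r s); first by rewrite lt_min r0.
move=> c; rewrite lt_min => /andP[cr cs].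
apply: (@le_trans _ _ (\int[lam]_x (`|g (x + c) - g x| + `|h (x + c) - h x|))).
  apply: le_Rintegral => //.
  - by apply: (@intd (fun x => g x + h x)); exact: rintgD.
  - by apply: rintgD => //; exact: intd.
  - by move=> x _; rewrite opprD addrACA ler_normD.
rewrite RintegralD//; [|exact: intd..].
by have := rP _ cr; have := sP _ cs; lra.
Qed.

Lemma L1_contZ a g : L1_cont g -> L1_cont (fun x => a * g x).
Proof.
move=> [gi gc]; split; first exact: rintgZ.
move=> e e0; have a1 : 0 < `|a| + 1 by rewrite ltr_wpDl.
have [r r0 rP] := gc _ (divr_gt0 e0 a1); exists r => // c cr.
have -> : (fun x : T => `|a * g (x + c) - a * g x|) = fun x => `|a| * `|g (x + c) - g x|.
  by apply/funext => x; rewrite -mulrBr normrM.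
rewrite RintegralZl//; last exact: intd.
apply: (@le_trans _ _ ((`|a| + 1) * (\int[lam]_x `|g (x + c) - g x|))).
  by rewrite ler_wpM2r ?lerDl// Rintegral_ge0.
by rewrite mulrC -ler_pdivlMr//; exact: rP.
Qed.

Lemma L1_cont0 : L1_cont (fun=> 0).
Proof.
split; first exact: rintg0.
move=> e e0; exists 1 => // c _.
by under eq_fun do rewrite subrr normr0; rewrite Rintegral_cst// mul0r ltW.
Qed.

Lemma L1_cont_sum (I : Type) (s : seq I) (F : I -> T -> R) :
  (forall i, L1_cont (F i)) -> L1_cont (fun x => \sum_(i <- s) F i x).
Proof.
move=> Fi; elim: s => [|i s IHs].
  rewrite (_ : (fun x => \sum_(i <- [::]) F i x) = fun=> 0); first exact: L1_cont0.
  by apply/funext => x; rewrite big_nil.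
rewrite (_ : (fun x => \sum_(j <- i :: s) F j x) =
  fun x => F i x + \sum_(j <- s) F j x); first exact: L1_contD.
by apply/funext => x; rewrite big_cons.
Qed.

Lemma L1_cont_limit (f_ : nat -> T -> R) g h : (forall k, L1_cont (f_ k)) ->
  lam.-integrable setT (EFin \o g) ->
  (forall k x, `|f_ k x| <= g x) -> (forall x, f_ k x @[k --> \oo] --> h x) ->
  L1_cont h.
Proof.
move=> fc gi fg fh.
have mf k : measurable_fun setT (f_ k) by have [/rintg_measurable] := fc k.
have [hi _] := @Rintegral_dct _ _ _ lam setT f_ h g measurableT mf gi
  (fun k x _ => fg k x) (fun x _ => fh x).
have hg x : `|h x| <= g x.
  by apply: (ler_cvg_to (cvg_norm (fh x)) (cvg_cst (g x))); apply: nearW => k.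
apply: L1_cont_approx => // e e0.
have d0 : \int[lam]_x `|h x - f_ k x| @[k --> \oo] --> (0 : R).
  have -> : (0 : R) = \int[lam]_(x in setT) (cst 0 x) by rewrite Rintegral_cst// mul0r.
  apply: (proj2 (@Rintegral_dct _ _ _ lam setT (fun k x => `|h x - f_ k x|) (fun=> 0)
    (fun x => 2 * g x) measurableT _ _ _ _)).
  - move=> k; apply: measurableT_comp => //; apply: measurable_funB => //.
    exact: rintg_measurable hi.
  - exact: rintgZ.
  - move=> k x _; rewrite normr_id mulr_natl mulr2n.
    by rewrite (le_trans (ler_normB _ _))// lerD.
  - move=> x _; have -> : (0 : R) = `|h x - h x| by rewrite subrr normr0.
    by apply: cvg_norm; apply: cvgB; [exact: cvg_cst|exact: fh].
have : \forall k \near \oo, \int[lam]_x `|h x - f_ k x| < e.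
  exact: (cvgr_lt _ d0).
by move=> [k _ /(_ k (leqnn k)) ke]; exists (f_ k) => //; exact: ltW.
Qed.

Lemma L1_cont_continuous g M k : continuous g -> (forall x, `|g x| <= M) ->
  (forall x, g x != 0 -> cube k x) -> L1_cont g.
Proof.
move=> cg gM gk; have mg : measurable_fun setT g by exact: continuous_measurable_mx.
have M0 : 0 <= M by exact: le_trans (gM 0).
have gindic (N : nat) (f : T -> R) : measurable_fun setT f -> (forall x, `|f x| <= 2 * M) ->
    (forall x, f x != 0 -> cube N x) ->
    lam.-integrable setT (EFin \o (fun x => 2 * M * \1_(cube N) x)) /\
    forall x, `|f x| <= 2 * M * \1_(cube N) x.
  move=> mf fM fN; split.
    apply: rintgZ => //; apply: rintg_indic; first exact: measurable_box.
    exact: cube_lty.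
  move=> x; have [/eqP ->|fx] := boolP (f x == 0).
    by rewrite normr0 mulr_ge0// mulr_ge0.
  by rewrite indicE mem_set ?mulr1//; exact: fN.
have gi : lam.-integrable setT (EFin \o g).
  have [|||i1 i2] := gindic k g => //.
    by move=> x; rewrite (le_trans (gM x))// mulr_natl mulr2n lerDl.
  exact: (rintg_le _ _ _ i1).
split => // e e0; apply: contrapT => nr.
(* Dominated convergence is sequential, so a failure of continuity is first turned into shifts [h k]
   tending to 0. *)
have /choice[h hP] : forall k : nat, exists h : T, `|h| < k.+1%:R^-1 /\
    e < \int[lam]_x `|g (x + h) - g x|.
  move=> j; apply: contrapT => nh; apply: nr; exists j.+1%:R^-1 => // c cj.
  by rewrite leNgt; apply/negP => ec; apply: nh; exists c.
have h1 j : `|h j| <= 1.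
  by have [hj _] := hP j; rewrite (le_trans (ltW hj))// invf_le1// ler1n.
have h0 : h j @[j --> \oo] --> (0 : T).
  apply/cvgrPdist_lt => r r0; near=> j; rewrite sub0r normrN.
  have [hj _] := hP j; apply: lt_trans hj _.
  by near: j; exact: near_infty_natSinv_lt (PosNum r0).
pose f j (x : T) := `|g (x + h j) - g x|.
have mgs j : measurable_fun setT (fun x : T => g (x + h j)).
  exact: (measurableT_comp mg (measurable_shift (h j))).
have mf j : measurable_fun setT (f j).
  by apply: measurableT_comp => //; apply: measurable_funB.
have fM j x : `|f j x| <= 2 * M.
  rewrite /f normr_id mulr_natl mulr2n (le_trans (ler_normB _ _))//.
  by rewrite lerD.
have fk j x : f j x != 0 -> cube k.+1 x.
  rewrite /f normr_eq0 => fx.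
  have : cube k (x + h j) \/ cube k x.
    have [g0|/gk] := eqVneq (g x) 0; last by right.
    by left; apply: gk; move: fx; rewrite g0 subr0.
  move=> [] ck i; have := ck i; rewrite /= !in_itv/= -!ler_norml; last first.
    by move=> /le_trans; apply; rewrite ler_nat.
  rewrite mxE => hxj; have -> : x 0 i = (x 0 i + h j 0 i) - h j 0 i by rewrite addrK.
  apply: (le_trans (ler_normB _ _)); rewrite -natr1 lerD//.
  apply: le_trans (h1 j).
  by rewrite [leRHS]/Num.Def.normr/= mx_normrE; apply: (le_bigmax _ _ (ord0, i)).
have fi := fun j => gindic k.+1 (f j) (mf j) (fM j) (fk j).
have f0 (x : T) : setT x -> f j x @[j --> \oo] --> (0 : R).
  move=> _; have -> : (0 : R) = `|g x - g x| by rewrite subrr normr0.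
  apply: cvg_norm; apply: cvgB; last exact: cvg_cst.
  have hx : (x : T) + h j @[j --> \oo] --> (x : T).
    rewrite -[X in _ --> X](addr0 x).
    by apply: (@cvgD _ _ _ _ _ (fun=> x) h); [exact: cvg_cst|exact: h0].
  exact: (cvg_comp _ _ hx (cg x)).
have [_] := @Rintegral_dct _ _ _ lam setT f (fun=> 0) _ measurableT mf (fi 0%N).1
  (fun j x _ => (fi j).2 x) f0.
rewrite Rintegral_cst// mul0r => /cvgr_lt /(_ _ e0) [j _ /(_ j (leqnn j))].
by have [_ ej] := hP j; rewrite ltNge (ltW ej).
Unshelve. all: by end_near. Qed.

Definition obox (a b : T) : set T := box (fun i => `]a 0 i, b 0 i[%classic).

Lemma obox_sub_cube a b : exists k, obox a b `<=` cube k.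
Proof.
exists (Num.truncn (\sum_i (`|a 0 i| + `|b 0 i|))).+1 => x ax i.
have := ax i; rewrite /= !in_itv/= => /andP[ai bi].
have : `|x 0 i| <= \sum_i (`|a 0 i| + `|b 0 i|).
  rewrite (bigD1 i)//= (@le_trans _ _ (`|a 0 i| + `|b 0 i|))//; last first.
    by rewrite lerDl sumr_ge0// => j _; rewrite addr_ge0.
  rewrite ler_norml; have := ler_norm (b 0 i); 
  have := normr_ge0 (b 0 i); have := normr_ge0 (a 0 i).
  have := ler_norm (- a 0 i); rewrite normrN.
  by move=> *; apply/andP; split; lra.
by rewrite -ler_norml => /le_trans; apply; rewrite ltW// truncnS_gt.
Qed.

Lemma measurable_obox a b : measurable (obox a b).
Proof. exact: measurable_box. Qed.

Lemma L1_cont_obox a b : L1_cont \1_(obox a b).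
Proof.
have [N abN] := obox_sub_cube a b.
(* The arguments of the two steps have slope k at opposite faces: [f k] vanishes off the open box
   and equals 1 at a point as soon as k times its distance to every face reaches 1. *)
pose f (k : nat) (x : T) : R := \prod_(i < n)
  (step (k%:R * x 0 i + (- k%:R * a 0 i)) * step ((- k%:R) * x 0 i + k%:R * b 0 i)).
have s01 t : 0 <= step t :> R by have /andP[] := step01 t.
have s1 t : step t <= 1 :> R by have /andP[] := step01 t.
have f01 k x : `|f k x| <= 1.
  rewrite ger0_norm; last by apply: prodr_ge0 => i _; exact: mulr_ge0.
  by apply: prodr_ile1 => i _; rewrite mulr_ge0//= mulr_ile1.
have fbox k x : f k x != 0 -> obox a b x.
  rewrite /f prodf_seq_neq0 => /allP fx i; have := fx i (mem_index_enum _) => /=.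
  rewrite mulf_eq0 negb_or => /andP[s1x s2x]; rewrite in_itv/=; apply/andP; split.
    rewrite ltNge; apply: contra s1x => xa; rewrite step_eq0//.
    by rewrite mulNr -mulrBr mulr_ge0_le0// subr_le0.
  rewrite ltNge; apply: contra s2x => xa; rewrite step_eq0//.
  by rewrite mulNr addrC -mulrBr mulr_ge0_le0// subr_le0.
have fc k : continuous (f k).
  apply: smooth_continuous; apply: smooth_prod => i.
  by apply: smoothM; exact: smooth_step_coord.
apply: (@L1_cont_limit f (\1_(obox a b)) _).
- move=> k; apply: (@L1_cont_continuous _ 1 N) => //.
  by move=> x /fbox; exact: abN.
- apply: rintg_indic; first exact: measurable_obox.
  apply: le_lt_trans (@cube_lty R n N).
  by apply: le_measure_set => //; [exact: measurable_obox|exact: measurable_box].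
- move=> k x; have [/eqP ->|fx] := boolP (f k x == 0); first by rewrite normr0.
  by rewrite indicE mem_set//; exact: fbox fx.
- move=> x; have [xab|xab] := pselect (obox a b x); last first.
    rewrite indicE memNset//; apply: cvg_near_cst; apply: nearW => k.
    by apply/eqP/negPn/negP => /fbox.
  rewrite indicE mem_set//; apply: cvg_near_cst.
  have key (c : R) : 0 < c -> \forall k \near \oo, 1 <= k%:R * c.
    move=> c0; near=> k; rewrite -ler_pdivrMr// mul1r.
    by near: k; exact: nbhs_infty_ger.
  have : \forall k \near \oo, forall i, 1 <= k%:R * (x 0 i - a 0 i) /\ 1 <= k%:R * (b 0 i - x 0 i).
    apply: filter_forall => i; have := xab i; rewrite /= in_itv/= => /andP[ai bi].
    by apply: filterS2 (key (x 0 i - a 0 i) _) (key (b 0 i - x 0 i) _);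
      rewrite ?subr_gt0//.
  apply: filterS => k kP; apply: big1 => i _; have [k1 k2] := kP i.
  by rewrite !step_eq1 ?mulr1//; [rewrite mulNr addrC -mulrBr|rewrite mulNr -mulrBr].
Unshelve. all: by end_near. Qed.

(** A Dynkin system. Intersecting with bounded boxes keeps the indicators integrable although E may
    have infinite measure. *)
Let H : set (set T) :=
  [set E | measurable E /\ forall N : nat,
    L1_cont \1_(E `&` obox (const_mx (- N%:R)) (const_mx N%:R))].

Let sigmaE : (@measurable _ T) = <<s [set E | exists a b, E = obox a b] >>.
Proof.
apply/seteqP; split; last first.
  apply: smallest_sub; first exact: sigma_algebra_measurable.
  by move=> _ [a [b ->]]; exact: measurable_obox.
apply: smallest_sub; first exact: smallest_sigma_algebra.
move=> U oU; rewrite (open_mx_rat oU) bigcup_mkcond.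
apply: (@countable_bigcupT_measurable _ (g_sigma_algebraType [set E | exists a b, E = obox a b])).
  exact: countableP.
move=> q; case: ifPn => // _; apply: sub_sigma_algebra.
exists (map_mx ratr q.1 - const_mx q.2.+1%:R^-1), (map_mx ratr q.1 + const_mx q.2.+1%:R^-1).
apply/seteqP; split=> [x [_ qx] i|x qx].
  have := qx 0 i; rewrite /= in_itv/= !mxE /ball/= ltr_distlC.
  by move=> /andP[-> ->].
split; first by rewrite invr_gt0.
move=> i j; rewrite ord1; have := qx j; rewrite /= in_itv/= !mxE /ball/= ltr_distlC.
by [].
Qed.

Let oboxI a b c d : exists e f, obox a b `&` obox c d = obox e f.
Proof.
exists (\row_i Num.max (a 0 i) (c 0 i)), (\row_i Num.min (b 0 i) (d 0 i)).
apply/seteqP; split=> [x [xab xcd] i|x xef].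
  have := xab i; have := xcd i; rewrite /= !in_itv/= !mxE gt_max lt_min.
  by move=> /andP[-> ->] /andP[-> ->].
by split=> i; have := xef i; rewrite /= !in_itv/= !mxE gt_max lt_min;
  move=> /andP[/andP[? ?] /andP[? ?]]; apply/andP.
Qed.

Let indic_obox_i a b E : measurable E ->
  lam.-integrable setT (EFin \o (\1_(E `&` obox a b) : T -> R)).
Proof.
move=> mE; have mEo : measurable (E `&` obox a b).
  by apply: measurableI => //; exact: measurable_obox.
apply: rintg_indic; first exact: mEo.
have [k abk] := obox_sub_cube a b; apply: le_lt_trans (@cube_lty R n k).
apply: le_measure_set => //; first exact: measurable_box.
by move=> x [_ /abk].
Qed.

Lemma L1_cont_indic E N : measurable E ->
  L1_cont \1_(E `&` obox (const_mx (- N%:R)) (const_mx N%:R)).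
Proof.
rewrite sigmaE => mE.
suff : H E by move=> [_]; exact.
move: E mE; apply: (@lambda_system_subset _ _ _ setT H) => //.
- by move=> _ _ [a [b ->]] [c [d ->]]; have [e [f ->]] := oboxI a b c d; exists e, f.
- split => //.
  + split => // k; rewrite setTI; exact: L1_cont_obox.
  + move=> A B BA [mA cA] [mB cB]; split; first exact: measurableD.
    move=> k; set D := obox _ _.
    have -> : \1_((A `\` B) `&` D) = fun x => \1_(A `&` D) x + -1 * \1_(B `&` D) x :> R.
      apply/funext => x.
      have [Dx|nDx] := pselect (D x); last first.
        by rewrite !indic_out ?mulr0 ?addr0// => -[_].
      have [Bx|nBx] := pselect (B x).
        rewrite indic_out; last by move=> [[_]].
        by rewrite !indic_in ?mulr1 ?subrr//; split => //; exact: BA.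
      rewrite [X in _ * X]indic_out ?mulr0 ?addr0; last by move=> [].
      have [Ax|nAx] := pselect (A x); first by rewrite !indic_in.
      by rewrite !indic_out//; [move=> []|move=> [[]]].
    by apply: L1_contD; [exact: cA|apply: L1_contZ; exact: cB].
  + move=> F ndF FH; split; first by apply: bigcupT_measurable => i; have [] := FH i.
    move=> k; set D := obox _ _.
    apply: (@L1_cont_limit (fun i => \1_(F i `&` D)) (\1_(setT `&` D))).
    * by move=> i; have [_] := FH i; apply.
    * exact: indic_obox_i.
    * move=> i x; rewrite ger0_norm ?indic_ge0// setTI !indicE ler_nat.
      have [/set_mem[_ Dx]|//] := boolP (x \in F i `&` D).
      by rewrite mem_set.
    * move=> x; apply: cvg_near_cst.
      have [[j _ Fjx]|nFx] := pselect ((\bigcup_i F i) x); last first.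
        apply: nearW => i; rewrite !indic_out//; first by move=> [/nFx].
        by move=> [Fix _]; apply: nFx; exists i.
      have [Dx|nDx] := pselect (D x); last first.
        by apply: nearW => i; rewrite !indic_out//; move=> [_].
      near=> i; rewrite !indic_in//; first by split => //; exists j.
      split => //; have /ndF/subsetPset : (j <= i)%N by near: i; exact: nbhs_infty_ge.
      exact.
- by move=> _ [a [b ->]]; split => [|k]; [exact: measurable_obox|
    have [e [f ->]] := oboxI a b (const_mx (- k%:R)) (const_mx k%:R); exact: L1_cont_obox].
Unshelve. all: by end_near. Qed.

Let D N : set T := obox (const_mx (- N%:R)) (const_mx N%:R).

(** Simple approximations of g are cut to growing boxes. They become combinations of the indicators
    treated before, and dominated convergence carries L^1 continuity over to g. *)
Lemma L1_cont_integrable g : lam.-integrable setT (EFin \o g) -> L1_cont g.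
Proof.
move=> gi; have mg : measurable_fun setT g by exact: rintg_measurable gi.
have [f_ [sf fg cf]] := simple_approx mg.
apply: (@L1_cont_limit (fun k x => f_ k x * \1_(D k) x) (fun x => `|g x|)).
- move=> k; have [N [c [A [mA ->]]]] := sf k.
  rewrite (_ : (fun x => _) = fun x => \sum_(i < N) c i * \1_(A i `&` D k) x).
    by apply: L1_cont_sum => i; apply: L1_contZ; exact: L1_cont_indic.
  apply/funext => x; rewrite mulr_suml.
  by apply: eq_bigr => i _; rewrite -mulrA indicI.
- exact: rintg_norm.
- move=> k x; rewrite normrM -[leRHS]mulr1 ler_pM//.
  by rewrite ger0_norm ?indic_ge0// indicE lern1 leq_b1.
move=> x; rewrite -[X in _ --> X]mulr1; apply: cvgM; first exact: cf.
apply: cvg_near_cst.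
have : \forall k \near \oo, forall i, `|x 0 i| < k%:R.
  by apply: filter_forall => i; exact: nbhs_infty_gtr.
by apply: filterS => k xk; rewrite indic_in// => i; rewrite /= in_itv/= !mxE -ltr_norml.
Qed.

End TranslationContinuity.

(** * Mollification *)

Section SequentialLimits.
Context {R : realType}.

(** Lets dominated convergence, a statement about sequences, prove limits along a neighbourhood
    filter. *)
Lemma cvg_nbhs_seq (V : normedModType R) (f : V -> R) (x : V) (l : R) :
  (forall u : nat -> V, u k @[k --> \oo] --> x -> f (u k) @[k --> \oo] --> l) ->
  f y @[y --> x] --> l.
Proof.
move=> fu; apply/cvgrPdist_lt => e e0; apply: contrapT => nf.
have /choice[u uP] : forall k : nat, exists y : V,
    ball x (k.+1%:R^-1 : R) y /\ e <= `|l - f y|.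
  move=> k; apply: contrapT => ny; apply: nf.
  apply/nbhs_ballP; exists k.+1%:R^-1 => /=; first by rewrite invr_gt0.
  by move=> y xy; rewrite /= ltNge; apply/negP => h; apply: ny; exists y.
have ux : u k @[k --> \oo] --> x.
  apply/cvgrPdist_lt => r r0; near=> k.
  have [+ _] := uP k; rewrite -ball_normE /= => /lt_trans; apply.
  by near: k; exact: near_infty_natSinv_lt (PosNum r0).
have /cvgrPdist_lt/(_ _ e0)[k _ /(_ k (leqnn k))] := fu _ ux.
by rewrite ltNge; have [_ ->] := uP k.
Unshelve. all: by end_near. Qed.

Lemma cvg_dnbhs0_seq (f : R -> R) (l : R) :
  (forall u : nat -> R, (forall k, u k != 0 /\ `|u k| <= 1) ->
     u k @[k --> \oo] --> 0 -> f (u k) @[k --> \oo] --> l) ->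
  f y @[y --> 0^'] --> l.
Proof.
move=> fu; apply/cvgrPdist_lt => e e0; apply: contrapT => nf.
have /choice[u uP] : forall k : nat, exists y : R,
    [/\ y != 0, `|y| < k.+1%:R^-1 & e <= `|l - f y|].
  move=> k; apply: contrapT => ny; apply: nf; rewrite near_withinE.
  apply/nbhs_ballP; exists k.+1%:R^-1 => /=; first by rewrite invr_gt0.
  move=> y; rewrite /ball/= sub0r normrN => xy y0.
  by rewrite /= ltNge; apply/negP => h; apply: ny; exists y.
have ux : u k @[k --> \oo] --> 0.
  apply/cvgrPdist_lt => r r0; near=> k.
  rewrite sub0r normrN; have [_ + _] := uP k; move=> /lt_trans; apply.
  by near: k; exact: near_infty_natSinv_lt (PosNum r0).
have u1 k : u k != 0 /\ `|u k| <= 1.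
  have [u0 uk _] := uP k; split => //.
  by rewrite (le_trans (ltW uk))// invf_le1// ler1n.
have /cvgrPdist_lt/(_ _ e0)[k _ /(_ k (leqnn k))] := fu _ u1 ux.
by rewrite ltNge; have [_ _ ->] := uP k.
Unshelve. all: by end_near. Qed.

End SequentialLimits.

(** * Bounded supports, increments and difference quotients *)

Section SupportBounds.
Context {R : realType} {n : nat}.
Local Notation T := 'rV[R]_n.
Local Notation lam := (@lebesgue_rV R n).
Implicit Types (f g : T -> R).

Definition bounded_support f := exists k, forall x : T, f x != 0 -> cube k x.

Lemma coord_norm_le (x : T) i : `|x 0 i| <= `|x|.
Proof.
by rewrite [leRHS]/Num.Def.normr/= mx_normrE; apply: (le_bigmax _ _ (ord0, i)).
Qed.

Lemma cube_compact k : compact (@cube R n k).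
Proof.
have := @rV_compact R n (fun=> `[- k%:R, k%:R]%classic).
by apply => i; exact: segment_compact.
Qed.

Lemma cube_closed k : closed (@cube R n k).
Proof. by apply: compact_closed; [exact: norm_hausdorff|exact: cube_compact]. Qed.

Lemma continuous_bounded_compact f (K : set T) : compact K -> continuous f ->
  exists M, forall x, K x -> `|f x| <= M.
Proof.
move=> cK cf; have : compact (f @` K).
  by apply: continuous_compact => //; exact: continuous_subspaceT.
move=> /compact_bounded[M [_ MP]]; exists (`|M| + 1) => x Kx.
by apply: MP; [rewrite (le_lt_trans (ler_norm _))// ltrDl|exists x].
Qed.

Lemma bounded_support_bounded f : continuous f -> bounded_support f ->
  exists M, forall x, `|f x| <= M.
Proof.
move=> cf [k fk]; have [M MP] := continuous_bounded_compact (@cube_compact k) cf.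
exists `|M| => x; have [->|/fk/MP] := eqVneq (f x) 0; first by rewrite normr0.
by move=> /le_trans; apply; exact: ler_norm.
Qed.

Lemma partial_support f j x : partial j f x != 0 -> closure [set x | f x != 0] x.
Proof.
apply: contraNP => nx; have oc : open (~` closure [set x | f x != 0]).
  by apply: closed_openC; exact: closed_closure.
have : \forall y \near x, 0 = f y.
  have : nbhs x (~` closure [set x | f x != 0]) by exact: open_nbhs_nbhs.
  apply: filterS => y ny; apply/eqP; rewrite eq_sym; apply/negPn/negP => fy.
  by apply: ny; exact: subset_closure.
move=> h; have [_ d0] := @near_eq_is_derive _ _ _ (fun=> 0) f x (delta_mx 0 j) 0 h
  (is_derive_cst _ _ _).
by rewrite /partial d0.
Qed.

Lemma bounded_support_partial f j : bounded_support f -> bounded_support (partial j f).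
Proof.
move=> [k fk]; exists k => x /partial_support.
have [/(_ (@cube_closed k)) + _] := closure_id (@cube R n k) => ->.
by apply: closure_subset => y; exact: fk.
Qed.

Lemma bounded_support_integrable f : continuous f -> bounded_support f ->
  lam.-integrable setT (EFin \o f).
Proof.
move=> cf fs; have [M fM] := bounded_support_bounded cf fs; have [k fk] := fs.
have mf : measurable_fun setT f by exact: continuous_measurable_mx.
apply: (@rintg_le _ _ _ _ _ _ (fun x => M * \1_(cube k) x)) => //.
  move=> x _; have [->|/fk kx] := eqVneq (f x) 0.
    by rewrite normr0 mulr_ge0// (le_trans _ (fM 0)).
  by rewrite indic_in// mulr1.
apply: rintgZ => //; apply: rintg_indic; last exact: cube_lty.
exact: measurable_box.
Qed.

Lemma derive_line f (v x : T) (s : R) : derivable f (s *: v + x) v ->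
  is_derive s 1 (fun s : R => f (s *: v + x)) ('D_v f (s *: v + x)).
Proof.
move=> df.
have E : (fun h : R => h^-1 *: (((fun s : R => f (s *: v + x)) \o shift s) (h *: (1 : R))
    - f (s *: v + x))) =
  (fun h => h^-1 *: ((f \o shift (s *: v + x)) (h *: v) - f (s *: v + x))).
  apply/funext => h /=; congr (_ *: (f _ - _)).
  by rewrite [h *: 1]mulr1 scalerDl addrA.
by apply: DeriveDef; [rewrite /derivable E|rewrite /derive E].
Qed.

Lemma smooth_increment f j M : smooth f -> (forall x, `|partial j f x| <= M) ->
  forall (x : T) (t : R), `|f (x + t *: delta_mx 0 j) - f x| <= M * `|t|.
Proof.
move=> sf fM.
have pos (x : T) (t : R) : 0 <= t -> `|f (x + t *: delta_mx 0 j) - f x| <= M * t.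
  move=> t0; pose g (s : R) := f (s *: delta_mx 0 j + x).
  have dg s : is_derive s (1 : R) g (partial j f (s *: delta_mx 0 j + x)).
    by apply: derive_line; exact: smooth_derivable.
  have cg : {within `[0, t], continuous g}.
    apply: continuous_subspaceT => s.
    by apply/differentiable_continuous/derivable1_diffP; have [] := dg s.
  have [c _] := MVT_segment t0 (fun s _ => dg s) cg.
  rewrite /g scale0r add0r addrC subr0 (addrC x) (addrC (- _)) => ->.
  by rewrite normrM (ger0_norm t0) ler_wpM2r.
move=> x t; have [t0|t0] := leP 0 t; first by rewrite (ger0_norm t0); exact: pos.
rewrite (ltr0_norm t0) distrC.
have := pos (x + t *: delta_mx 0 j) (- t); rewrite scaleNr addrK; apply.
by rewrite oppr_ge0 ltW.
Qed.

Lemma smooth_quotient f j (x : T) (u : nat -> R) : smooth f ->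
  (forall k, u k != 0) -> u k @[k --> \oo] --> 0 ->
  (u k)^-1 * (f (x + u k *: delta_mx 0 j) - f x) @[k --> \oo] --> partial j f x.
Proof.
move=> sf u0 uc; have := @smooth_derivable _ _ f j x sf.
rewrite /derivable => df; have : (fun h : R => h^-1 *: ((f \o shift x) (h *: delta_mx 0 j) - f x)) h @[h --> 0^'] --> partial j f x by exact: df.
move=> fc; have uc' : u k @[k --> \oo] --> (0 : R)^'.
  move=> A A0; apply: (@filterS _ \oo _ (fun k => u k != 0 -> A (u k))) (uc _ A0).
  by move=> k; apply; exact: u0.
have := cvg_comp _ _ uc' fc; apply: cvg_trans; apply: near_eq_cvg.
by apply: nearW => k /=; rewrite (addrC x).
Qed.

(** Difference quotients have integral 0 by translation invariance, and they converge to the partial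
    derivative under a bound supported in a single cube. *)
Lemma Rintegral_partial f j : smooth f -> bounded_support f ->
  \int[lam]_x partial j f x = 0.
Proof.
move=> sf fs; pose u (k : nat) : R := k.+1%:R^-1.
have u0 k : u k != 0 by rewrite invr_eq0.
have u01 k : 0 <= u k <= 1 by rewrite /u invr_ge0 ler0n/= invf_le1// ler1n.
have uc : u k @[k --> \oo] --> 0.
  apply/cvgrPdist_lt => r r0; near=> k.
  have /andP[uk0 _] := u01 k; rewrite sub0r normrN ger0_norm//.
  by near: k; exact: near_infty_natSinv_lt (PosNum r0).
have [M fM] := bounded_support_bounded (smooth_continuous (smooth_partial j sf))
  (bounded_support_partial j fs).
have fi := bounded_support_integrable (smooth_continuous sf) fs.
have M0 : 0 <= M by exact: le_trans (fM 0).
pose q k (x : T) := (u k)^-1 * (f (x + u k *: delta_mx 0 j) - f x).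
have fsi k : lam.-integrable setT (EFin \o (fun x : T => f (x + u k *: delta_mx 0 j))).
  exact: rintg_shift.
have qi k : lam.-integrable setT (EFin \o q k).
  by apply: rintgZ => //; exact: rintgB.
have [N fN] := fs.
(* The increments [u k] are at most 1, so all quotients vanish outside a cube larger by 1. *)
have qN k x : q k x != 0 -> cube N.+1 x.
  have [xN|xN] := pselect (cube N.+1 x) => //.
  rewrite /q mulf_eq0 negb_or => /andP[_].
  have -> : f x = 0.
    apply/eqP/negPn/negP => /fN xN'; apply: xN => i; have := xN' i.
    rewrite /= !in_itv/= -!ler_norml => /le_trans; apply.
    by rewrite ler_nat.
  rewrite subr0 => /fN xN'; exfalso; apply: xN => i; have := xN' i.
  rewrite /= !in_itv/= -!ler_norml !mxE => h.
  have -> : x 0 i = (x 0 i + u k * (true && (i == j))%:R) - u k * (true && (i == j))%:R.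
    by rewrite addrK.
  apply: (le_trans (ler_normB _ _)); rewrite -natr1 lerD//.
  have /andP[uk0 uk1] := u01 k.
  rewrite normrM (ger0_norm uk0) -[leRHS]mulr1 ler_pM//.
  by rewrite normr_nat lern1 leq_b1.
have q0 k : \int[lam]_x q k x = 0.
  rewrite RintegralZl//; last exact: rintgB.
  by rewrite RintegralB// Rintegral_shift// subrr mulr0.
have qM k x : setT x -> `|q k x| <= M * \1_(cube N.+1) x.
  move=> _; have [->|/qN qx] := eqVneq (q k x) 0; first by rewrite normr0 mulr_ge0.
  rewrite indic_in// mulr1 /q normrM normfV mulrC ler_pdivrMr ?normr_gt0//.
  exact: smooth_increment.
have iM : lam.-integrable setT (EFin \o (fun x => M * \1_(cube N.+1) x)).
  by apply: rintgZ => //; apply: rintg_indic; [exact: measurable_box|exact: cube_lty].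
have [_] := Rintegral_dct measurableT (fun k => rintg_measurable (qi k)) iM qM
  (fun x _ => @smooth_quotient f j x u sf u0 uc).
under eq_fun do rewrite q0.
by move=> /cvg_lim <-//; rewrite lim_cst.
Unshelve. all: by end_near. Qed.

End SupportBounds.

Section Tonelli.
Context {R : realType} {n : nat}.
Local Notation T := 'rV[R]_n.
Local Notation lam := (@lebesgue_rV R n).

(** A named copy of the measure, carrying the sigma-finite structure required by Tonelli and
    Radon-Nikodym. *)
Definition lebesgue_sf : set T -> \bar R := lebesgue_rV n.

HB.instance Definition _ := Measure.copy lebesgue_sf (lebesgue_rV n : set T -> \bar R).
HB.instance Definition _ := @Measure_isSigmaFinite.Build _ T R lebesgue_sf
  (@lebesgue_rV_sigma_finite R n).

Lemma lebesgue_rV_tonelli (G : T * T -> \bar R) : measurable_fun setT G ->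
  (forall p, (0 <= G p)%E) ->
  (\int[lam]_x \int[lam]_y G (x, y) = \int[lam]_y \int[lam]_x G (x, y))%E.
Proof.
move=> mG G0; have := @fubini_tonelli _ _ T T R lebesgue_sf lebesgue_sf G mG G0.
exact.
Qed.

Lemma measurable_add : measurable_fun setT (fun p : T * T => p.2 + p.1).
Proof.
apply: measurable_fun_mx => // i j.
rewrite (_ : (fun p : T * T => (p.2 + p.1) i j) = fun p => p.2 i j + p.1 i j).
  apply: measurable_funD.
    by apply: (measurableT_comp (measurable_coord i j)); exact: measurable_snd.
  by apply: (measurableT_comp (measurable_coord i j)); exact: measurable_fst.
by apply/funext => p; rewrite mxE.
Qed.

End Tonelli.

(** * Mollification by a smooth kernel *)

Section Convolution.
Context {R : realType} {n : nat}.
Local Notation T := 'rV[R]_n.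
Local Notation lam := (@lebesgue_rV R n).
Implicit Types (z w u k : T -> R).

(* Correlation rather than convolution: the kernel is evaluated at y - x. *)
Definition conv z k (x : T) : R := \int[lam]_y (z y * k ((y : T) - x)).

(** The support lies within distance e of 0 but need not be centred there; this freedom allows
    inward shifts at the boundary. *)
Definition kernel (e : R) k := [/\ smooth k, forall x, 0 <= k x,
  \int[lam]_x k x = 1 & forall x : T, k x != 0 -> `|x| < e].

Lemma small_bounded_support k e : (forall x : T, k x != 0 -> `|x| < e) ->
  bounded_support k.
Proof.
move=> ke; exists (Num.truncn `|e|).+1 => x /ke xe i.
rewrite /= in_itv/= -ler_norml; apply: (le_trans (coord_norm_le x i)).
by rewrite (le_trans (ltW xe))// (le_trans (ler_norm _))// ltW// truncnS_gt.
Qed.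

Let shift_measurable k (x : T) : continuous k ->
  measurable_fun setT (fun y : T => k (y - x)).
Proof.
move=> ck; apply: (measurableT_comp (continuous_measurable_mx ck)).
exact: measurable_shift.
Qed.

Lemma conv_integrand z k (x : T) : lam.-integrable setT (EFin \o z) ->
  continuous k -> bounded_support k ->
  lam.-integrable setT (EFin \o (fun y : T => z y * k (y - x))).
Proof.
move=> zi ck sk; have [M kM] := bounded_support_bounded ck sk.
by apply: (@rintgM_bounded _ _ _ _ _ _ _ M) => //; exact: shift_measurable.
Qed.

Lemma conv_shiftE z k (x : T) : lam.-integrable setT (EFin \o z) ->
  continuous k -> bounded_support k ->
  conv z k x = \int[lam]_s (z ((s : T) + x) * k s).
Proof.
move=> zi ck sk; rewrite /conv -(Rintegral_shift x (conv_integrand x zi ck sk)).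
by congr Rintegral; apply/funext => s; rewrite addrK.
Qed.

Lemma conv_continuous z k : lam.-integrable setT (EFin \o z) ->
  continuous k -> bounded_support k -> continuous (conv z k).
Proof.
move=> zi ck sk x; apply: cvg_nbhs_seq => u ux.
have [M kM] := bounded_support_bounded ck sk.
apply: (proj2 (@Rintegral_dct _ _ _ lam setT (fun j (y : T) => z y * k (y - u j))
  (fun y : T => z y * k (y - x)) (fun y => M * `|z y|) measurableT _ _ _ _)).
- by move=> j; exact: rintg_measurable (conv_integrand _ zi ck sk).
- by apply: rintgZ => //; exact: rintg_norm.
- by move=> j y _; rewrite normrM mulrC ler_wpM2r.
- move=> y _; apply: cvgM; first exact: cvg_cst.
  have yx : (y : T) - u j @[j --> \oo] --> (y : T) - x.
    by apply: (@cvgB _ _ _ _ _ (fun=> y) u); [exact: cvg_cst|exact: ux].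
  exact: (cvg_comp _ _ yx (ck _)).
Qed.

(** The kernel is evaluated at y - x, so differentiating in x costs a sign; the mean value bound on
    k dominates the quotients by a multiple of |z|. *)
Lemma conv_derive z k j (x : T) : lam.-integrable setT (EFin \o z) ->
  smooth k -> bounded_support k ->
  is_derive x (delta_mx 0 j) (conv z k) (- conv z (partial j k) x).
Proof.
move=> zi sk bk; have ck := smooth_continuous sk.
have cdk := smooth_continuous (smooth_partial j sk).
have bdk := bounded_support_partial j bk.
have [M kM] := bounded_support_bounded cdk bdk.
pose q (h : R) (y : T) := z y * (h^-1 * (k (y - (h *: delta_mx 0 j + x)) - k (y - x))).
have qE (h : R) : h^-1 *: ((conv z k \o shift x) (h *: delta_mx 0 j) - conv z k x) =
    \int[lam]_y q h y.
  rewrite /= /conv -RintegralB//; [|exact: conv_integrand..].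
  rewrite /GRing.scale/= -RintegralZl//; last first.
    by apply: rintgB => //; exact: conv_integrand.
  by congr Rintegral; apply/funext => y; rewrite /q; ring.
have lim0 : h^-1 *: ((conv z k \o shift x) (h *: delta_mx 0 j) - conv z k x)
    @[h --> 0^'] --> - conv z (partial j k) x.
  under eq_fun do rewrite qE.
  apply: cvg_dnbhs0_seq => u u01 u0.
  have -> : - conv z (partial j k) x = \int[lam]_y (z y * (- partial j k ((y : T) - x))).
    rewrite /conv -mulN1r -RintegralZl//; last exact: conv_integrand.
    by congr Rintegral; apply/funext => y; ring.
  apply: (proj2 (@Rintegral_dct _ _ _ lam setT (fun i => q (u i))
    (fun y : T => z y * (- partial j k (y - x))) (fun y => M * `|z y|) measurableT _ _ _ _)).
  - move=> i; apply: measurable_funM; first exact: rintg_measurable zi.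
    apply: measurable_funM => //.
    by apply: measurable_funB; exact: shift_measurable.
  - by apply: rintgZ => //; exact: rintg_norm.
  - move=> i y _; rewrite /q normrM mulrC ler_wpM2r// normrM normfV.
    have [ui _] := u01 i; rewrite mulrC ler_pdivrMr ?normr_gt0//.
    have -> : (y : T) - (u i *: delta_mx 0 j + x) = (y - x) + (- u i) *: delta_mx 0 j.
      by rewrite opprD addrA addrAC scaleNr.
    by have := @smooth_increment R n k j M sk kM (y - x) (- u i); rewrite normrN.
  - move=> y _; apply: cvgM; first exact: cvg_cst.
    have Nu0 i : - u i != 0 by rewrite oppr_eq0; have [] := u01 i.
    have Nuc : - u i @[i --> \oo] --> (0 : R) by rewrite -oppr0; exact: cvgN.
    have := @smooth_quotient R n k j (y - x) (fun i => - u i) sk Nu0 Nuc.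
    move=> /cvgN; apply: cvg_trans; apply: near_eq_cvg; apply: nearW => i /=.
    rewrite -[LHS]/(- ((- u i)^-1 * (k ((y : T) - x + (- u i) *: delta_mx 0 j) - k ((y : T) - x)))).
    rewrite invrN mulNr opprK; congr (_ * (k _ - _)).
    by rewrite scaleNr opprD addrA addrAC.
by apply: DeriveDef; [apply/cvg_ex; eexists; exact: lim0|exact/cvg_lim].
Qed.

Lemma partial_conv z k j : lam.-integrable setT (EFin \o z) ->
  smooth k -> bounded_support k ->
  partial j (conv z k) = fun x => - conv z (partial j k) x.
Proof.
by move=> zi sk bk; apply/funext => x; have [_] := @conv_derive z k j x zi sk bk.
Qed.

Lemma smooth_conv z k : lam.-integrable setT (EFin \o z) ->
  smooth k -> bounded_support k -> smooth (conv z k).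
Proof.
move=> zi sk bk; pose G : set (T -> R) :=
  [set g | exists k', [/\ smooth k', bounded_support k' & g = conv z k']].
apply: (@smooth_gen_alg _ _ G); last by apply: gen_alg_gen; exists k.
move=> _ [k' [sk' bk' ->]]; split.
- by apply: conv_continuous => //; exact: smooth_continuous.
- by move=> j x; have [] := @conv_derive z k' j x zi sk' bk'.
- move=> j; rewrite partial_conv//.
  have -> : (fun x => - conv z (partial j k') x) = fun x => -1 * conv z (partial j k') x.
    by apply/funext => x; rewrite mulN1r.
  apply: gen_alg_mul; first exact: gen_alg_cst.
  apply: gen_alg_gen; exists (partial j k'); split; [exact: smooth_partial| |by []].
  exact: bounded_support_partial.
Qed.

Lemma conv_support z k (x : T) : conv z k x != 0 ->
  exists y : T, z y != 0 /\ k (y - x) != 0.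
Proof.
move=> c0; apply: contrapT => ny; move/eqP: c0; apply.
rewrite /conv (_ : (fun y : T => _) = fun=> 0); first by rewrite Rintegral_cst// mul0r.
apply/funext => y; apply/eqP; rewrite mulf_eq0; apply/negPn/negP.
by rewrite negb_or => /andP[zy ky]; apply: ny; exists y.
Qed.

End Convolution.

Lemma mul_le_sqrD {R : realType} (s t : R) : 0 <= s * t -> s * t <= s ^+ 2 + t ^+ 2.
Proof. by have := sqr_ge0 (s - t); nra. Qed.

(** * Kernel estimates in L^1 and L^2 *)

Section KernelEstimates.
Context {R : realType} {n : nat}.
Local Notation T := 'rV[R]_n.
Local Notation lam := (@lebesgue_rV R n).
Implicit Types (z w u k : T -> R).

(** A normalised bump: its integral is positive because it dominates the indicator of a cube of side
    r. The centre c is arbitrary so that shifted kernels are covered. *)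
Lemma kernel_exists (c : T) (r : R) : 0 < r -> exists k : T -> R,
  [/\ smooth k, forall x, 0 <= k x, \int[lam]_x k x = 1 &
      forall x i, k x != 0 -> `|x 0 i - c 0 i| < r].
Proof.
move=> r0; have r2 : 0 < r / 2 by rewrite divr_gt0.
have [b [sb b01 b1 bs]] := smooth_bump c r2.
have b0 x : 0 <= b x by have /andP[] := b01 x.
have bb : bounded_support b.
  apply: (@small_bounded_support R n b (r + `|c| + 1)) => x bx.
  have xc : `|x - c| <= r.
    rewrite [leLHS]/Num.Def.normr/= mx_normrE (bigmax_le _ (ltW r0))//= => -[i j] _.
    rewrite ord1 !mxE; have := bs x j bx; rewrite mulrCA mulfV// mulr1; exact: ltW.
  have : `|x| <= `|x - c| + `|c| by rewrite -{1}(subrK c x) ler_normD.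
  by lra.
have bi := bounded_support_integrable (smooth_continuous sb) bb.
pose A := @box R n (fun i => `[c 0 i - r / 2, c 0 i + r / 2]%classic).
have Ab x : \1_A x <= b x.
  have [Ax|nAx] := pselect (A x); last by rewrite indic_out.
  rewrite indic_in// b1// => i; have := Ax i; rewrite /= in_itv/= => /andP[h1 h2].
  by rewrite ler_norml; apply/andP; split; lra.
have mA : measurable A by exact: measurable_box.
have lA : lam A = (r ^+ n)%:E.
  rewrite /A lebesgue_box//.
  rewrite (eq_bigr (fun=> r%:E)); last first.
    move=> i _; rewrite lebesgue_measure_itv/= lte_fin ifT; last by lra.
    by rewrite -EFinB; congr EFin; lra.
  by rewrite prodEFin prodr_const card_ord.
have Ai : lam.-integrable setT (EFin \o (\1_A : T -> R)).
  by apply: rintg_indic => //; rewrite lA ltry.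
have bpos : 0 < \int[lam]_x b x.
  apply: (@lt_le_trans _ _ (\int[lam]_x (\1_A x))).
    by rewrite /Rintegral integral_indic// setIT lA exprn_gt0.
  exact: le_Rintegral.
exists (fun x => (\int[lam]_x b x)^-1 * b x); split.
- exact: smoothZ.
- by move=> x; rewrite mulr_ge0// invr_ge0 ltW.
- by rewrite RintegralZl// mulVf// gt_eqF.
- move=> x i; rewrite mulf_eq0 negb_or => /andP[_ /bs]; rewrite mulrCA mulfV// mulr1.
  exact.
Qed.

Lemma kernel_conv_bound z k (C : R) (x : T) : lam.-integrable setT (EFin \o z) ->
  continuous k -> bounded_support k -> (forall x, 0 <= k x) -> \int[lam]_x k x = 1 ->
  (forall y, k (y - x) != 0 -> `|z y| <= C) -> `|conv z k x| <= C.
Proof.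
move=> zi ck sk k0 k1 zC.
have ki := bounded_support_integrable ck sk.
have kxi : lam.-integrable setT (EFin \o (fun y : T => C * k (y - x))).
  by apply: rintgZ => //; exact: (rintg_shift (- x)).
apply: (le_trans (Rintegral_le_bound measurableT (conv_integrand x zi ck sk) kxi _)).
  move=> y _; rewrite normrM (ger0_norm (k0 _)).
  have [->|ky] := eqVneq (k ((y : T) - x)) 0; first by rewrite !mulr0.
  by rewrite ler_wpM2r// zC.
rewrite RintegralZl//; last exact: (rintg_shift (- x)).
by rewrite (Rintegral_shift (- x) ki) k1 mulr1.
Qed.

Section L1.
Variables (w k : T -> R).
Hypotheses (wi : lam.-integrable setT (EFin \o w)) (sk : smooth k)
  (bk : bounded_support k) (k0 : forall x, 0 <= k x) (k1 : \int[lam]_x k x = 1).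

Let ck : continuous k. Proof. exact: smooth_continuous. Qed.
Let ki : lam.-integrable setT (EFin \o k).
Proof. exact: bounded_support_integrable. Qed.
Let mw : measurable_fun setT w. Proof. exact: rintg_measurable wi. Qed.
Let mk : measurable_fun setT k. Proof. exact: continuous_measurable_mx. Qed.

Lemma conv_measurable : measurable_fun setT (conv w k).
Proof. by apply: continuous_measurable_mx; exact: conv_continuous. Qed.

Let wki x : lam.-integrable setT (EFin \o (fun s : T => w (s + x) * k s)).
Proof.
have [M kM] := bounded_support_bounded ck bk.
by apply: (@rintgM_bounded _ _ _ _ _ _ _ M) => //; exact: rintg_shift.
Qed.

Lemma conv_sub (x : T) : conv w k x - w x = \int[lam]_s ((w ((s : T) + x) - w x) * k s).
Proof.
rewrite (conv_shiftE x wi ck bk) -[X in _ - X]mulr1 -k1 -RintegralZl//.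
rewrite -RintegralB//; last exact: rintgZ.
by congr Rintegral; apply/funext => s; rewrite mulrBl.
Qed.

Let mF (g : R -> R -> R) : measurable_fun setT (fun p : R * R => g p.1 p.2) ->
  measurable_fun setT (fun p : T * T => g (w (p.2 + p.1)) (w p.1)).
Proof.
move=> mg; have mp : measurable_fun setT (fun p : T * T => (w (p.2 + p.1), w p.1)).
  apply: measurable_fun_pair; first exact: (measurableT_comp mw measurable_add).
  by apply: (measurableT_comp mw); exact: measurable_fst.
exact: (measurableT_comp mg mp).
Qed.

(** One Tonelli argument serves three estimates. If |h| lies below the kernel average of g(w(s + x),
    w x), its L^1 norm is at most any common bound C of the x-integrals over shifts s in the support
    of k. It is used with |a|, |a - b| and a^2. *)
Lemma conv_master (g : R -> R -> R) (h : T -> R) (C : R) :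
  measurable_fun setT (fun p : R * R => g p.1 p.2) -> (forall a b, 0 <= g a b) ->
  (forall s, k s != 0 -> (\int[lam]_x (g (w (s + x)%R) (w x))%:E <= C%:E)%E) ->
  measurable_fun setT h ->
  (forall x, (`|h x|%:E <= \int[lam]_s (g (w (s + x)%R) (w x) * k s)%:E)%E) ->
  lam.-integrable setT (EFin \o h) /\ \int[lam]_x `|h x| <= C.
Proof.
move=> mg g0 gC mh hg.
pose G (p : T * T) := (g (w (p.2 + p.1)) (w p.1) * k p.2)%:E.
have mG : measurable_fun setT G.
  apply/measurable_EFinP; apply: measurable_funM; first exact: mF.
  by apply: (measurableT_comp mk); exact: measurable_snd.
have G0 p : (0 <= G p)%E by rewrite lee_fin mulr_ge0.
have hC : (\int[lam]_x `|h x|%:E <= C%:E)%E.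
  apply: (@le_trans _ _ (\int[lam]_x \int[lam]_s G (x, s))%E).
    apply: ge0_le_integral => //.
    - by apply/measurable_EFinP; exact: measurableT_comp.
    - exact: (@measurable_fun_fubini_tonelli_F _ _ T T R (@lebesgue_sf R n) G mG G0).
  rewrite lebesgue_rV_tonelli//.
  apply: (@le_trans _ _ (\int[lam]_s (C * k s)%:E)%E).
    apply: ge0_le_integral => //.
    - by move=> s _; exact: integral_ge0.
    - exact: (@measurable_fun_fubini_tonelli_G _ _ T T R (@lebesgue_sf R n) G mG G0).
    - by apply/measurable_EFinP; apply: measurable_funM.
    - move=> s _; rewrite /G /=; have [->|ks] := eqVneq (k s) 0.
        by under eq_integral do rewrite mulr0; rewrite integral0 mulr0.
      under eq_integral do rewrite mulrC EFinM.
      rewrite ge0_integralZl//; last 3 first.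
      + apply/measurable_EFinP.
        exact: (measurableT_comp (mF mg) (measurable_fun_pair (@measurable_id _ _ _) (@measurable_cst _ _ _ _ _ s))).
      + by move=> x _; rewrite lee_fin.
      + by rewrite lee_fin.
      by rewrite (mulrC C) EFinM; apply: lee_wpmul2l; [rewrite lee_fin|exact: gC].
  by rewrite -EFin_Rintegral// ?RintegralZl// ?k1 ?mulr1//; exact: rintgZ.
have hi : lam.-integrable setT (EFin \o h).
  apply/integrableP; split; first exact/measurable_EFinP.
  exact: le_lt_trans hC (ltry _).
split => //; rewrite -lee_fin EFin_Rintegral//; exact: rintg_norm.
Qed.

Let shift_int (f : T -> R) s : measurable_fun setT f -> (forall x, 0 <= f x) ->
  (\int[lam]_x (f (s + x)%R)%:E = \int[lam]_x (f x)%:E)%E.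
Proof.
move=> mf f0; under eq_integral do rewrite addrC.
apply: (@integral_shift R n s (fun x => (f x)%:E)); first exact/measurable_EFinP.
by move=> x; rewrite lee_fin.
Qed.

Lemma conv_integrable : lam.-integrable setT (EFin \o conv w k).
Proof.
have [||||x|//] := @conv_master (fun a _ => `|a|) (conv w k) (\int[lam]_x `|w x|).
- by apply: measurableT_comp => //; exact: measurable_fst.
- by [].
- move=> s _; rewrite (shift_int s (f := fun x => `|w x|))//; last exact: measurableT_comp.
  by rewrite EFin_Rintegral//; exact: rintg_norm.
- exact: conv_measurable.
- have wnki : lam.-integrable setT (EFin \o (fun s : T => `|w (s + x)| * k s)).
    rewrite (_ : (fun s : T => _) = fun s : T => `|w (s + x) * k s|); first exact: rintg_norm.
    by apply/funext => s; rewrite normrM (ger0_norm (k0 s)).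
  rewrite -EFin_Rintegral// lee_fin (conv_shiftE x wi ck bk).
  by apply: Rintegral_le_bound => // s _; rewrite normrM (ger0_norm (k0 s)).
Qed.

Lemma conv_L1_sub (e : R) :
  (forall s, k s != 0 -> \int[lam]_x `|w (x + s) - w x| <= e) ->
  \int[lam]_x `|conv w k x - w x| <= e.
Proof.
move=> we; have [||||x|//] := @conv_master (fun a b => `|a - b|) (fun x => conv w k x - w x) e.
- apply: measurableT_comp => //.
  by apply: measurable_funB; [exact: measurable_fst|exact: measurable_snd].
- by [].
- move=> s ks; under eq_integral => x _ do rewrite (addrC s x).
  rewrite -EFin_Rintegral//; first by rewrite lee_fin; exact: we.
  by apply: rintg_norm => //; apply: rintgB => //; exact: rintg_shift.
- by apply: measurable_funB => //; exact: conv_measurable.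
- have wxki : lam.-integrable setT (EFin \o (fun s : T => (w (s + x) - w x) * k s)).
    rewrite (_ : (fun s : T => _) = fun s : T => w (s + x) * k s - w x * k s).
      by apply: rintgB => //; exact: rintgZ.
    by apply/funext => s; rewrite mulrBl.
  have wnki : lam.-integrable setT (EFin \o (fun s : T => `|w (s + x) - w x| * k s)).
    rewrite (_ : (fun s : T => _) = fun s : T => `|(w (s + x) - w x) * k s|).
      exact: rintg_norm.
    by apply/funext => s; rewrite normrM (ger0_norm (k0 s)).
  rewrite -EFin_Rintegral// lee_fin conv_sub.
  by apply: Rintegral_le_bound => // s _; rewrite normrM (ger0_norm (k0 s)).
Qed.

Lemma conv_L2 : lam.-integrable setT (EFin \o (fun x => w x ^+ 2)) ->
  lam.-integrable setT (EFin \o (fun x => conv w k x ^+ 2)) /\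
  \int[lam]_x (conv w k x ^+ 2) <= \int[lam]_x (w x ^+ 2).
Proof.
move=> w2i; have mw2 : measurable_fun setT (fun x => w x ^+ 2).
  exact: rintg_measurable w2i.
have [||||x|i2 c2] := @conv_master (fun a _ => a ^+ 2) (fun x => conv w k x ^+ 2)
    (\int[lam]_x (w x ^+ 2)).
- by apply: measurable_funX; exact: measurable_fst.
- by move=> a _; exact: sqr_ge0.
- move=> s _; rewrite (shift_int s (f := fun x => w x ^+ 2))//; last first.
    by move=> x; exact: sqr_ge0.
  by rewrite EFin_Rintegral.
- by apply: measurable_funX; exact: conv_measurable.
- have [M kM] := bounded_support_bounded ck bk.
  have w2ki : lam.-integrable setT (EFin \o (fun s : T => w (s + x) ^+ 2 * k s)).
    apply: (@rintgM_bounded _ _ _ _ _ _ _ M) => //.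
    exact: (rintg_shift x w2i).
  rewrite -EFin_Rintegral// lee_fin ger0_norm ?sqr_ge0//.
  set c := conv w k x.
  have cE : c = \int[lam]_s (w ((s : T) + x) * k s) by exact: conv_shiftE.
  (* Jensen's inequality for the square: c is the average of w against the probability density k,
     and the average of (w - c)^2 is nonnegative. *)
  have : 0 <= \int[lam]_s ((w ((s : T) + x) ^+ 2 * k s + - (2 * c) * (w (s + x) * k s)) + c ^+ 2 * k s).
    apply: Rintegral_ge0 => s _.
    have -> : (w ((s : T) + x) ^+ 2 * k s + - (2 * c) * (w (s + x) * k s)) + c ^+ 2 * k s =
      (w (s + x) - c) ^+ 2 * k s by ring.
    by rewrite mulr_ge0// sqr_ge0.
  rewrite RintegralD//; last exact: rintgZ.
    rewrite RintegralD//; last exact: rintgZ.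
    rewrite !RintegralZl// -cE k1 => h.
    by move: h; rewrite mulr1; lra.
  by apply: rintgD => //; exact: rintgZ.
split => //; apply: le_trans c2; apply: le_Rintegral => //; first exact: rintg_norm.
by move=> x _; exact: ler_norm.
Qed.

End L1.

(** Translation continuity is available in L^1, while u is merely square integrable. A bounded
    truncation of u meets the L^1 convergence of the mollification; the rest of u is small in L^2
    and meets the uniform bound of [conv_L2]. *)
Lemma conv_weak u w : lam.-integrable setT (EFin \o u) ->
  lam.-integrable setT (EFin \o (fun x => u x ^+ 2)) ->
  lam.-integrable setT (EFin \o w) ->
  lam.-integrable setT (EFin \o (fun x => w x ^+ 2)) ->
  forall e, 0 < e -> exists2 r, 0 < r & forall k, kernel r k ->
    `|\int[lam]_x (u x * conv w k x) - \int[lam]_x (u x * w x)| <= e.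
Proof.
move=> ui u2i wi w2i e e0.
have mu : measurable_fun setT u by exact: rintg_measurable ui.
have mw : measurable_fun setT w by exact: rintg_measurable wi.
set W := \int[lam]_x (w x ^+ 2).
have W0 : 0 <= W by apply: Rintegral_ge0 => x _; exact: sqr_ge0.
(* The weight in Young's inequality: the difference d below has squared L^2 norm at most 4 W, and
   its share (eta / 2) 4 W has to stay below e / 3. *)
have [eta eta0 etaW] : exists2 eta, 0 < eta & 2 * eta * W <= e / 3.
  have W1 : 0 < W + 1 by rewrite ltr_wpDl.
  exists (e / (6 * (W + 1))); first by rewrite divr_gt0// mulr_gt0.
  rewrite (_ : 2 * _ * W = (e / 3) * (W / (W + 1))); last by field; rewrite gt_eqF.
  by rewrite ler_piMr ?divr_ge0 ?(ltW e0)// ler_pdivrMr ?mul1r// lerDl.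
pose u_ (M : nat) x := if `|u x| <= M%:R then u x else 0.
have mu_ M : measurable_fun setT (u_ M).
  apply: measurable_fun_ifT => //; apply: measurable_fun_ler => //.
  exact: measurableT_comp.
have u_u M x : `|u_ M x| <= `|u x| by rewrite /u_; case: ifP; rewrite ?normr0.
have u_M M x : `|u_ M x| <= M%:R by rewrite /u_; case: ifP => //; rewrite normr0.
have du2 M x : (u x - u_ M x) ^+ 2 <= u x ^+ 2.
  by rewrite /u_; case: ifP => _; rewrite ?subr0 ?subrr ?expr0n ?sqr_ge0.
have mdu M : measurable_fun setT (fun x => (u x - u_ M x) ^+ 2).
  by apply: measurable_funX; exact: measurable_funB.
have dui M : lam.-integrable setT (EFin \o (fun x => (u x - u_ M x) ^+ 2)).
  apply: (rintg_le _ _ _ u2i) => // x _.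
  by rewrite ger0_norm ?sqr_ge0.
have : \int[lam]_x ((u x - u_ M x) ^+ 2) @[M --> \oo] --> (0 : R).
  have -> : (0 : R) = \int[lam]_(x in setT) (cst 0 x) by rewrite Rintegral_cst// mul0r.
  apply: (proj2 (@Rintegral_dct _ _ _ lam setT (fun M x => (u x - u_ M x) ^+ 2) (fun=> 0)
    (fun x => u x ^+ 2) measurableT _ _ _ _)) => //.
    by move=> M x _; rewrite ger0_norm ?sqr_ge0.
  move=> x _; apply: cvg_near_cst; near=> M.
  rewrite /u_ ifT ?subrr ?expr0n//; near: M; exact: nbhs_infty_ger.
have e2 : 0 < 2 * eta * e / 3 by rewrite divr_gt0// mulr_gt0// mulr_gt0.
move=> /cvgr_lt/(_ _ e2)[M _ /(_ M (leqnn M))/= uM].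
have [_ wc] := L1_cont_integrable wi.
have M1 : 0 < (M%:R + 1 : R) by rewrite ltr_wpDl.
have e3 : 0 < e / 3 / (M%:R + 1) by rewrite !divr_gt0.
have [r r0 rP] := wc _ e3.
exists r => // k [sk k0 k1 kr].
have bk := small_bounded_support kr.
have mc := conv_measurable wi sk bk.
have ci := conv_integrable wi sk bk k0 k1.
have [c2i c2] := conv_L2 wi sk bk k0 k1 w2i.
pose d x := conv w k x - w x.
have md : measurable_fun setT d by exact: measurable_funB.
have di : lam.-integrable setT (EFin \o d) by exact: rintgB.
have d1 : \int[lam]_x `|d x| <= e / 3 / (M%:R + 1).
  apply: (conv_L1_sub wi sk bk k0 k1) => s /kr; exact: rP.
have dsq x : d x ^+ 2 <= 2 * conv w k x ^+ 2 + 2 * w x ^+ 2.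
  rewrite -subr_ge0 (_ : _ - _ = (conv w k x + w x) ^+ 2); first exact: sqr_ge0.
  by rewrite /d; ring.
have c2wi : lam.-integrable setT (EFin \o (fun x => 2 * conv w k x ^+ 2 + 2 * w x ^+ 2)).
  by apply: rintgD => //; exact: rintgZ.
have d2i : lam.-integrable setT (EFin \o (fun x => d x ^+ 2)).
  apply: (rintg_le _ _ _ c2wi) => //; first exact: measurable_funX.
  by move=> x _; rewrite ger0_norm ?sqr_ge0.
have d2 : \int[lam]_x (d x ^+ 2) <= 4 * W.
  apply: (@le_trans _ _ (\int[lam]_x (2 * conv w k x ^+ 2 + 2 * w x ^+ 2))).
    exact: le_Rintegral.
  rewrite RintegralD//; [|exact: rintgZ..].
  rewrite !RintegralZl// (_ : 4 * W = 2 * W + 2 * W); last by ring.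
  by rewrite lerD2r ler_wpM2l.
have prodi (a b : T -> R) : measurable_fun setT a -> measurable_fun setT b ->
    lam.-integrable setT (EFin \o (fun x => a x ^+ 2)) ->
    lam.-integrable setT (EFin \o (fun x => b x ^+ 2)) ->
    lam.-integrable setT (EFin \o (fun x => a x * b x)).
  move=> ma mb a2 b2; apply: (@rintg_le _ _ _ _ _ _ (fun x => a x ^+ 2 + b x ^+ 2)) => //.
  - exact: measurable_funM.
  - move=> x _; rewrite normrM -(real_normK (num_real (a x))) -(real_normK (num_real (b x))).
    by apply: mul_le_sqrD; rewrite mulr_ge0.
  - exact: rintgD.
have dx : \int[lam]_x (u x * conv w k x) - \int[lam]_x (u x * w x) =
    \int[lam]_x (u x * d x).
  rewrite -RintegralB//; [|exact: prodi..].
  by congr Rintegral; apply/funext => x; rewrite mulrBr.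
pose B x := (2 * eta)^-1 * (u x - u_ M x) ^+ 2 + (eta / 2 * d x ^+ 2 + M%:R * `|d x|).
have ndi : lam.-integrable setT (EFin \o (fun x => `|d x|)) by exact: rintg_norm.
have Bi : lam.-integrable setT (EFin \o B).
  by apply: rintgD => //; [exact: rintgZ|apply: rintgD => //; exact: rintgZ].
rewrite dx; apply: (@le_trans _ _ (\int[lam]_x B x)).
  apply: Rintegral_le_bound => //; first exact: prodi.
  move=> x _; rewrite /B.
  have -> : u x * d x = (u x - u_ M x) * d x + u_ M x * d x by ring.
  apply: (le_trans (ler_normD _ _)); rewrite addrA lerD//; last first.
    by rewrite normrM ler_wpM2r.
  rewrite normrM -(real_normK (num_real (u x - u_ M x))) -(real_normK (num_real (d x))).
  set a := `|u x - u_ M x|; set b := `|d x|.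
  rewrite -subr_ge0 (_ : _ - _ = (2 * eta)^-1 * (a - eta * b) ^+ 2).
    by rewrite mulr_ge0// ?sqr_ge0// invr_ge0 mulr_ge0// ltW.
  by field; rewrite gt_eqF.
rewrite RintegralD//; [|exact: rintgZ|by apply: rintgD => //; exact: rintgZ].
rewrite RintegralD//; [|exact: rintgZ..].
rewrite !RintegralZl//.
have h1 : (2 * eta)^-1 * (\int[lam]_x ((u x - u_ M x) ^+ 2)) <= e / 3.
  rewrite mulrC ler_pdivrMr ?mulr_gt0//.
  by rewrite (_ : e / 3 * (2 * eta) = 2 * eta * e / 3) ?ltW//; field.
have h2 : eta / 2 * (\int[lam]_x (d x ^+ 2)) <= e / 3.
  apply: le_trans etaW; rewrite (_ : 2 * eta * W = eta / 2 * (4 * W)); last by field.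
  by rewrite ler_wpM2l// divr_ge0// ltW.
have h3 : M%:R * (\int[lam]_x `|d x|) <= e / 3.
  apply: (@le_trans _ _ ((M%:R + 1) * (\int[lam]_x `|d x|))).
    by rewrite ler_wpM2r ?lerDl// Rintegral_ge0.
  by rewrite mulrC -ler_pdivlMr.
by rewrite (_ : e = e / 3 + (e / 3 + e / 3)) ?lerD//; field.
Unshelve. all: by end_near. Qed.

End KernelEstimates.

(** * Test functions and partitions of unity *)

Section TestFunctions.
Context {R : realType} {n : nat}.
Local Notation T := 'rV[R]_n.
Implicit Types (U V K : set T) (f g : T -> R).

Lemma test_function_intro U K f : smooth f -> compact K ->
  (forall x, f x != 0 -> K x) -> K `<=` U -> test_function U f.
Proof.
move=> sf cK fK KU; have clK : closed K by apply: compact_closed => //; exact: norm_hausdorff.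
have sK : closure [set x | f x != 0] `<=` K.
  by have [/(_ clK) KE _] := closure_id K; rewrite [X in _ `<=` X]KE; apply: closure_subset.
split=> //; last exact: subset_trans KU.
by apply: subclosed_compact cK sK; exact: closed_closure.
Qed.

Lemma test_function_sub U V f : U `<=` V -> test_function U f -> test_function V f.
Proof. by move=> UV [sf cf fU]; split => //; exact: subset_trans UV. Qed.

Lemma test_function_smooth U f : test_function U f -> smooth f.
Proof. by case. Qed.

Lemma test_function_out U f x : test_function U f -> ~ U x -> f x = 0.
Proof.
move=> [_ _ fU] nUx; apply/eqP; apply: contrapT => /negP fx.
by apply: nUx; apply: fU; exact: subset_closure.
Qed.

Lemma test_function_bounded_support U f : test_function U f -> bounded_support f.
Proof.
move=> [_ /compact_bounded/bounded_sub_cube[k fk] _]; exists k => x fx.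
by apply: fk; exact: subset_closure.
Qed.

Lemma test_functionMI U V f g : test_function U f -> test_function V g ->
  test_function (U `&` V) (fun x => f x * g x).
Proof.
move=> [sf cf fU] [sg cg gV].
apply: (@test_function_intro _ (closure [set x | f x != 0] `&` closure [set x | g x != 0])).
- exact: smoothM.
- apply: (@subclosed_compact _ _ _ _ cf); last exact: subIsetl.
  by apply: closedI; exact: closed_closure.
- by move=> x; rewrite mulf_eq0 negb_or => /andP[fx gx]; split; exact: subset_closure.
- by move=> x [fx gx]; split; [exact: fU|exact: gV].
Qed.

Lemma test_functionMl U f g : smooth g -> test_function U f ->
  test_function U (fun x => g x * f x).
Proof.
move=> sg [sf cf fU]; apply: (@test_function_intro _ (closure [set x | f x != 0])).
- exact: smoothM.
- exact: cf.
- by move=> x; rewrite mulf_eq0 negb_or => /andP[_ fx]; exact: subset_closure.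
- exact: fU.
Qed.

Lemma test_functionZ U (c : R) f : test_function U f -> test_function U (fun x => c * f x).
Proof. by apply: test_functionMl; exact: smooth_cst. Qed.

Lemma test_functionD U f g : test_function U f -> test_function U g ->
  test_function U (fun x => f x + g x).
Proof.
move=> [sf cf fU] [sg cg gU].
apply: (@test_function_intro _ (closure [set x | f x != 0] `|` closure [set x | g x != 0])).
- exact: smoothD.
- exact: compactU.
- move=> x fgx; have [fx|fx] := eqVneq (f x) 0; last by left; exact: subset_closure.
  by right; apply: subset_closure; move: fgx; rewrite fx add0r.
- by move=> x [fx|gx]; [exact: fU|exact: gU].
Qed.

Lemma test_function0 U : test_function U (fun=> 0).
Proof.
apply: (@test_function_intro _ set0) => //; first exact: smooth_cst.
  exact: compact0.
by move=> x; rewrite eqxx.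
Qed.

Lemma test_function_sum U (I : Type) (s : seq I) (P : pred I) (F : I -> T -> R) :
  (forall i, P i -> test_function U (F i)) ->
  test_function U (fun x => \sum_(i <- s | P i) F i x).
Proof.
move=> UF; elim: s => [|i s IHs].
  rewrite (_ : (fun x => _) = fun=> 0); first exact: test_function0.
  by apply/funext => x; rewrite big_nil.
have [Pi|nPi] := boolP (P i).
  rewrite (_ : (fun x => _) = fun x => F i x + \sum_(j <- s | P j) F j x).
    by apply: test_functionD => //; exact: UF.
  by apply/funext => x; rewrite big_cons Pi.
rewrite (_ : (fun x => _) = fun x => \sum_(j <- s | P j) F j x) //.
by apply/funext => x; rewrite big_cons (negbTE nPi).
Qed.

Lemma test_function_partial U f j : test_function U f -> test_function U (partial j f).
Proof.
move=> [sf cf fU]; apply: (@test_function_intro _ (closure [set x | f x != 0])).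
- exact: smooth_partial.
- exact: cf.
- by move=> x; exact: partial_support.
- exact: fU.
Qed.

Lemma test_function_bounded U f : test_function U f -> exists M, forall x, `|f x| <= M.
Proof.
move=> tf; apply: bounded_support_bounded; last exact: test_function_bounded_support tf.
by apply: smooth_continuous; case: tf.
Qed.

Lemma local_bump U (x : T) : open U -> U x -> exists b r,
  [/\ 0 < r, test_function U b, forall y, 0 <= b y <= 1 &
      forall y, ball x r y -> b y = 1].
Proof.
move=> oU Ux; have /nbhs_ballP[e /= e0 eU] : nbhs x U by rewrite nbhsE; exists U.
have r0 : 0 < e / 4 by rewrite divr_gt0.
have [b [sb b01 b1 bs]] := smooth_bump x r0; exists b, (e / 4).
split => //; last first.
  by move=> y [_ xy]; apply: b1 => i; rewrite distrC ltW//; exact: xy.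
pose K : set T := box (fun i => `[x 0 i - e / 2, x 0 i + e / 2]%classic).
apply: (@test_function_intro _ K) => //.
- have := @rV_compact R n (fun i => `[x 0 i - e / 2, x 0 i + e / 2]%classic).
  by apply => i; exact: segment_compact.
- move=> y yb i; rewrite /= in_itv/= -ler_distl ltW//.
  by have := bs y i yb; rewrite (_ : 2 * (e / 4) = e / 2) //; field.
- move=> y yK; apply: eU; split => // i j; rewrite ord1.
  have := yK j; rewrite /= in_itv/= -ler_distl distrC => h.
  by rewrite /ball/= (le_lt_trans h)// ltr_pdivrMr// ltr_pMr// ltr1n.
Qed.

(** The summands are the pieces of a partition of unity: their sum is 1 wherever some [b a] with a <
    N equals 1. *)
Lemma telescope_prod (b : nat -> R) N :
  \sum_(a < N) (\prod_(a' < a) (1 - b a')) * b a = 1 - \prod_(a < N) (1 - b a).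
Proof.
elim: N => [|N IHN]; first by rewrite !big_ord0 subrr.
by rewrite big_ord_recr/= IHN big_ord_recr/=; ring.
Qed.

(** Finitely many bumps equal to 1 on balls covering K are combined by [telescope_prod]; each piece
    keeps its own bump as a factor, hence its support. *)
Lemma partition_of_unity (I : Type) (U : I -> set T) K : compact K ->
  (forall i, open (U i)) -> (forall x, K x -> exists i, U i x) ->
  exists N (theta : 'I_N -> T -> R) (idx : 'I_N -> I),
    [/\ forall a, test_function (U (idx a)) (theta a),
        forall a x, 0 <= theta a x,
        forall x, \sum_a theta a x <= 1 &
        forall x, K x -> \sum_a theta a x = 1].
Proof.
move=> cK oU KU.
have [[x0 Kx0]|nK] := pselect (K !=set0); last first.
  have idx0 : 'I_0 -> I by case.
  exists 0%N, (fun=> fun=> 0), idx0.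
  split=> [[]//|//|x|x Kx]; first by rewrite big_ord0.
  by exfalso; apply: nK; exists x.
have P (x : T) : exists ibr : I * (T -> R) * R, K x ->
    [/\ 0 < ibr.2, test_function (U ibr.1.1) ibr.1.2, forall y, 0 <= ibr.1.2 y <= 1 &
        forall y, ball x ibr.2 y -> ibr.1.2 y = 1].
  have [i0 _] := KU _ Kx0.
  have [Kx|nKx] := pselect (K x); last by exists (i0, fun=> 0, 0).
  have [i Uix] := KU x Kx; have [b [r brP]] := local_bump (oU i) Uix.
  by exists (i, b, r).
have [F FP] := choice P.
have cK' := cK; rewrite compact_cover in cK'.
have bO (x : T) : K x -> open (ball x (F x).2).
  by move=> Kx; apply: ball_open; have [] := FP x Kx.
have bK : K `<=` cover K (fun x => ball x (F x).2).
  by move=> x Kx; exists x => //; apply: ballxx; have [] := FP x Kx.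
have [s sK Ks] := cK' T K (fun x => ball x (F x).2) bO bK.
pose xs : seq T := enum_fset s; pose N := size xs.
have xsK (a : 'I_N) : K (nth x0 xs a).
  by have /sK/set_mem := mem_nth x0 (ltn_ord a).
(* Extended by 0 beyond N, since the telescoping identity runs over natural numbers. *)
pose b (a : nat) x := if (a < N)%N then (F (nth x0 xs a)).1.2 x else 0.
have b01 a x : 0 <= b a x <= 1.
  rewrite /b; case: ifPn => [aN|_]; last by rewrite lexx ler01.
  by have [_ _ + _] := FP _ (xsK (Ordinal aN)); exact.
have b1b a x : 0 <= 1 - b a x by rewrite subr_ge0; have /andP[] := b01 a x.
have bb0 a x : 0 <= b a x by have /andP[] := b01 a x.
have tb (a : 'I_N) : test_function (U (F (nth x0 xs a)).1.1) (b a).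
  by rewrite /b ltn_ord; have [] := FP _ (xsK a).
exists N, (fun a x => (\prod_(a' < a) (1 - b a' x)) * b a x), (fun a => (F (nth x0 xs a)).1.1).
have sE x : \sum_(a < N) (\prod_(a' < a) (1 - b a' x)) * b a x = 1 - \prod_(a < N) (1 - b a x).
  exact: (telescope_prod (fun a => b a x)).
split.
- move=> a; apply: test_functionMl => //; apply: smooth_prod => a'.
  have a'N : (a' < N)%N by rewrite (ltn_trans (ltn_ord a')).
  apply: smoothB; first exact: smooth_cst.
  exact: (test_function_smooth (tb (Ordinal a'N))).
- by move=> a x; rewrite mulr_ge0// prodr_ge0.
- by move=> x; rewrite sE lerBlDr lerDl prodr_ge0.
- move=> x Kx; rewrite sE; have [y /= ys xy] := Ks x Kx.
  have iy : (index y xs < N)%N by rewrite index_mem.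
  rewrite (bigD1 (Ordinal iy))//= {1}/b iy nth_index//.
  have [_ _ _ h] := FP y (set_mem (sK y ys)).
  by rewrite h// subrr mul0r subr0.
Qed.

(** Countably many rational balls exhaust U. The partial telescoping sums over the bumps attached to
    them reach 1 at each point of U after finitely many terms. *)
Lemma cutoffs U : open U -> exists phi : nat -> T -> R,
  [/\ forall k, test_function U (phi k), forall k x, 0 <= phi k x <= 1 &
      forall x, U x -> \forall k \near \oo, phi k x = 1].
Proof.
move=> oU; pose c (q : 'rV[rat]_n * nat) : T := map_mx ratr q.1.
(* A bump is chosen for every rational ball on which some test function in U with values in [0, 1]
   equals 1; the remaining balls receive 0. *)
have P (q : 'rV[rat]_n * nat) : exists b, [/\ test_function U b, forall x, 0 <= b x <= 1 &
    (exists2 b', [/\ test_function U b' & forall x, 0 <= b' x <= 1] &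
      forall x, ball (c q) (q.2.+1%:R^-1 : R) x -> b' x = 1) ->
    forall x, ball (c q) (q.2.+1%:R^-1 : R) x -> b x = 1].
  have [[b' [tb' b'01] b'1]|h] := pselect (exists2 b', [/\ test_function U b' & forall x, 0 <= b' x <= 1] &
      forall x, ball (c q) (q.2.+1%:R^-1 : R) x -> b' x = 1).
    by exists b'.
  exists (fun=> 0); split=> [|x|/h//]; first exact: test_function0.
  by rewrite lexx ler01.
have [F FP] := choice P.
pose b (k : nat) : T -> R := if @choice.unpickle ('rV[rat]_n * nat)%type k is Some q then F q else fun=> 0.
have tb k : test_function U (b k).
  by rewrite /b; case: choice.unpickle => [q|]; [have [] := FP q|exact: test_function0].
have b01 k x : 0 <= b k x <= 1.
  by rewrite /b; case: choice.unpickle => [q|]; [have [] := FP q|rewrite lexx ler01].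
have b1b a x : 0 <= 1 - b a x by rewrite subr_ge0; have /andP[] := b01 a x.
have bb0 a x : 0 <= b a x by have /andP[] := b01 a x.
exists (fun k x => \sum_(a < k) (\prod_(a' < a) (1 - b a' x)) * b a x); split.
- move=> k; apply: test_function_sum => a _; apply: test_functionMl => //.
  apply: smooth_prod => a'; apply: smoothB; first exact: smooth_cst.
  exact: test_function_smooth (tb a').
- move=> k x; rewrite sumr_ge0/=; last by move=> a _; rewrite mulr_ge0// prodr_ge0.
  by rewrite (telescope_prod (fun a => b a x)) lerBlDr lerDl prodr_ge0.
- move=> x Ux; have [b' [r [r0 tb' b'01 b'1]]] := local_bump oU Ux.
  have : ball x r x by exact: ballxx.
  have oB : open (ball x r) by exact: ball_open.
  rewrite (open_mx_rat oB) => -[q /= qr qx].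
  have bq : b (choice.pickle q) x = 1.
    rewrite /b choice.pickleK; have [_ _ h] := FP q; apply: h => //; exists b' => // y qy.
    by apply: b'1; exact: qr.
  near=> k; rewrite (telescope_prod (fun a => b a x)).
  have qk : (choice.pickle q < k)%N by near: k; exact: nbhs_infty_gt.
  by rewrite (bigD1 (Ordinal qk))//= bq subrr mul0r subr0.
Unshelve. all: by end_near. Qed.

End TestFunctions.

(** * Measures from functionals *)

Section BoundedFunctionals.
Context d (T : measurableType d) (R : realType).
Implicit Types (f g : T -> R^o) (I J : (T -> R^o) -> R).

Definition bounded_meas : set (T -> R^o) :=
  [set f | measurable_fun setT (f : T -> R) /\ exists M : R, forall x, `|f x| <= M].

(* Continuity along bounded pointwise limits; on bounded functions it is what
   distinguishes sigma-additive from finitely additive functionals. *)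
Definition dct_continuous I := forall (f_ : nat -> T -> R) (M : R),
  (forall k, measurable_fun setT (f_ k)) -> (forall k x, `|f_ k x| <= M) ->
  (forall x, f_ k x @[k --> \oo] --> (0 : R)) -> I (f_ k) @[k --> \oo] --> (0 : R).

Lemma bounded_meas_subspace : subspace bounded_meas.
Proof.
split=> [|a f g [mf [M fM]] [mg [N gN]]].
  by split; [exact: measurable_cst|exists 0 => x; rewrite normr0].
split; first by apply: measurable_funD => //; exact: measurable_funM.
exists (`|a| * M + N) => x; apply: (le_trans (ler_normD _ _)).
by rewrite normrM lerD// ler_wpM2l.
Qed.

Lemma bounded_meas_indic (A : set T) : measurable A -> bounded_meas \1_A.
Proof.
move=> mA; split; first exact: measurable_indic.
by exists 1 => x; rewrite ger0_norm ?indic_ge0// indicE lern1 leq_b1.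
Qed.

Lemma bounded_meas_simple f : simple_fun f -> bounded_meas f.
Proof.
move=> sf; split; first exact: simple_fun_measurable.
have [N [c [A [mA ->]]]] := sf; exists (\sum_(i < N) `|c i|) => x.
apply: (le_trans (ler_norm_sum _ _ _)); apply: ler_sum => i _.
by rewrite normrM ler_piMr// ger0_norm ?indic_ge0// indicE lern1 leq_b1.
Qed.

Lemma linear_on_simple I N (c : 'I_N -> R) (A : 'I_N -> set T) :
  linear_on bounded_meas I -> (forall i, measurable (A i)) ->
  I (fun x => \sum_(i < N) c i * \1_(A i) x) = \sum_(i < N) c i * I \1_(A i).
Proof.
move=> lI; elim: N c A => [|N IHN] c A mA.
  rewrite big_ord0 (_ : (fun x => _) = 0); last by apply/funext => x; rewrite big_ord0.
  exact: linear_on0 bounded_meas_subspace lI.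
rewrite big_ord_recl -IHN// -lI; last 2 first.
- exact: bounded_meas_indic.
- apply: bounded_meas_simple; exists N, (fun i => c (lift ord0 i)), (fun i => A (lift ord0 i)).
  by split.
by congr I; apply/funext => x; rewrite big_ord_recl.
Qed.

Lemma dct_continuous_lim I (f_ : nat -> T -> R) f M : linear_on bounded_meas I ->
  dct_continuous I -> (forall k, measurable_fun setT (f_ k)) ->
  measurable_fun setT (f : T -> R) -> (forall k x, `|f_ k x| <= M) ->
  (forall x, `|f x| <= M) ->
  (forall x, f_ k x @[k --> \oo] --> (f x : R)) -> I (f_ k) @[k --> \oo] --> I f.
Proof.
move=> lI dI mf_ mf f_M fM cf.
have h k : I (f_ k) = I (fun x => f_ k x - f x) + I f.
  rewrite -(linear_onD bounded_meas_subspace lI).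
  - by congr I; apply/funext => x; rewrite /GRing.add/= subrK.
  - split; first exact: measurable_funB.
    by exists (M + M) => x; rewrite (le_trans (ler_normB _ _))// lerD.
  - by split => //; exists M.
have c0 : I (fun x => f_ k x - f x) @[k --> \oo] --> (0 : R).
  apply: (dI _ (M + M)) => [k|k x|x].
  - exact: measurable_funB.
  - by rewrite (le_trans (ler_normB _ _))// lerD.
  - by rewrite -(subrr (f x)); apply: cvgB; [exact: cf|exact: cvg_cst].
have c1 : (fun k => I (fun x => f_ k x - f x) + I f) @ \oo --> (0 + I f).
  by apply: cvgD; [exact: c0|exact: cvg_cst].
rewrite add0r in c1.
rewrite (_ : (fun k => I (f_ k)) = (fun k => I (fun x => f_ k x - f x) + I f)); first exact: c1.
exact/funext.
Qed.

(** Agreement on indicators passes to simple functions by linearity and to bounded functions by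
    their uniformly bounded simple approximations. *)
Lemma dct_functional_ext I J : linear_on bounded_meas I -> linear_on bounded_meas J ->
  dct_continuous I -> dct_continuous J ->
  (forall A, measurable A -> I \1_A = J \1_A) ->
  forall f, bounded_meas f -> I f = J f.
Proof.
move=> lI lJ dI dJ IJ f [mf [M fM]].
have [f_ [sf ff cf]] := @simple_approx _ T R f mf.
have mf_ k : measurable_fun setT (f_ k) by exact: simple_fun_measurable.
have f_M k x : `|f_ k x| <= M by exact: le_trans (ff k x) (fM x).
have If := @dct_continuous_lim I f_ f M lI dI mf_ mf f_M fM cf.
have Jf := @dct_continuous_lim J f_ f M lJ dJ mf_ mf f_M fM cf.
have E : (fun k => I (f_ k)) = (fun k => J (f_ k)).
  apply/funext => k; have [N [c [A [mA ->]]]] := sf k.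
  by rewrite !linear_on_simple//; apply: eq_bigr => i _; rewrite IJ.
by rewrite -(cvg_lim _ If)// E; exact/cvg_lim.
Qed.

(** Additivity is linearity on indicators of disjoint sets; countable additivity is [dct_continuous]
    applied to the indicators of the finite unions. *)
Lemma charge_of_functional I : linear_on bounded_meas I -> dct_continuous I ->
  exists nu : {charge set T -> \bar R}, forall A, measurable A -> nu A = (I \1_A)%:E.
Proof.
move=> lI dI; pose nu0 (A : set T) : \bar R :=
  if `[< measurable A >] then (I \1_A)%:E else 0%E.
have nuE A : measurable A -> nu0 A = (I \1_A)%:E by move=> mA; rewrite /nu0 asboolT.
have h0 : nu0 set0 = 0%E.
  rewrite nuE// (_ : \1_set0 = 0); last by apply/funext => x; rewrite indic0.
  by rewrite (linear_on0 bounded_meas_subspace lI).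
have hfin A : measurable A -> nu0 A \is a fin_num by move=> mA; rewrite nuE.
have hadd : semi_sigma_additive nu0.
  move=> F mF tF mUF; rewrite nuE//.
  have sumE k : (\sum_(0 <= i < k) nu0 (F i))%E = (I \1_(\big[setU/set0]_(i < k) F i))%:E.
    elim: k => [|k IHk]; first by rewrite big_nil big_ord0 -nuE ?h0.
    rewrite big_nat_recr//= IHk nuE// -EFinD big_ord_recr/=; congr EFin.
    rewrite -(linear_onD bounded_meas_subspace lI); last 2 first.
    - by apply: bounded_meas_indic; exact: bigsetU_measurable.
    - exact: bounded_meas_indic.
    congr I; apply/funext => x; rewrite -[LHS]/(\1_(\big[setU/set0]_(i < k) F i) x + \1_(F k) x).
    set B := \big[setU/set0]_(i < k) F i.
    have BF : B x -> ~ F k x.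
      rewrite /B -bigcup_mkord => -[i /= ik Fi] Fk.
      by have := tF i k Logic.I Logic.I (ex_intro _ x (conj Fi Fk)) => h; rewrite h ltnn in ik.
    have [Bx|nBx] := pselect (B x).
      by rewrite (indic_in _ Bx) (indic_out _ (BF Bx)) addr0 indic_in//; left.
    have [Fx|nFx] := pselect (F k x).
      by rewrite (indic_out _ nBx) (indic_in _ Fx) add0r indic_in//; right.
    by rewrite (indic_out _ nBx) (indic_out _ nFx) add0r indic_out//; move=> [].
  under eq_fun do rewrite sumE.
  apply: cvg_EFin; first by apply: nearW.
  apply: (@dct_continuous_lim I (fun k => \1_(\big[setU/set0]_(i < k) F i)) (\1_(\bigcup_n F n)) 1) => //.
  - by move=> k; apply: measurable_indic; exact: bigsetU_measurable.
  - by move=> k x; rewrite ger0_norm ?indic_ge0// indicE lern1 leq_b1.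
  - by move=> x; rewrite ger0_norm ?indic_ge0// indicE lern1 leq_b1.
  - move=> x; apply: cvg_near_cst.
    have [[j _ Fj]|nF] := pselect ((\bigcup_n F n) x); last first.
      apply: nearW => k; rewrite !indic_out// -bigcup_mkord => -[i _ Fi].
      by apply: nF; exists i.
    near=> k; rewrite !indic_in//; first by exists j.
    by rewrite -bigcup_mkord; exists j => //=; near: k; exact: nbhs_infty_gt.
pose nu : {charge set T -> \bar R} :=
  HB.pack nu0 (isCharge.Build _ T R nu0 h0 hfin hadd).
by exists nu => A mA; exact: nuE.
Unshelve. all: by end_near. Qed.

(** The extension L is squeezed between -p(-f) and p(f), so it inherits from p the continuity along
    bounded pointwise limits. *)
Lemma charge_of_dominated (F : set (T -> R^o)) (l p : (T -> R^o) -> R) :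
  subspace F -> F `<=` bounded_meas -> linear_on F l ->
  convex_on bounded_meas p -> dct_continuous p ->
  (forall f, F f -> l f <= p f) ->
  exists L, [/\ linear_on bounded_meas L, dct_continuous L,
    forall f, bounded_meas f -> L f <= p f & forall f, F f -> L f = l f].
Proof.
move=> sF FB lF cp dp lp.
have [L [lL Lp LF]] := hahn_banach bounded_meas_subspace sF FB lF cp lp.
exists L; split => // f_ M mf fM f0.
have Bf k : bounded_meas (f_ k) by split => //; exists M.
have lo k : - p (fun x => - f_ k x) <= L (f_ k).
  have BN : bounded_meas (fun x => - f_ k x).
    by split; [exact: measurableT_comp|exists M => x; rewrite normrN].
  rewrite lerNl; apply: le_trans (Lp _ BN).
  have := linear_onZ (-1) bounded_meas_subspace lL (Bf k); rewrite mulN1r => <-.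
  suff -> : -1 *: f_ k = (fun x => - f_ k x) by [].
  by apply/funext => x; rewrite /GRing.scale/= scaleN1r.
have up k : L (f_ k) <= p (f_ k) by exact: Lp.
apply: (@squeeze_cvgr _ _ _ _ (fun k => - p (fun x => - f_ k x)) (fun k => p (f_ k))).
- by apply: nearW => k; rewrite lo up.
- rewrite -oppr0; apply: cvgN; apply: (dp _ M) => [k|k x|x].
  + exact: measurableT_comp.
  + by rewrite normrN.
  + by rewrite -oppr0; apply: cvgN.
- exact: dp.
Qed.

End BoundedFunctionals.

(** * Charges and functionals on bounded functions *)

Section ChargeIntegral.
Context {R : realType} {n : nat}.
Local Notation T := 'rV[R]_n.
Variable Omega : set T.
Hypothesis mO : measurable Omega.
Implicit Types (nu : {charge set T -> \bar R}) (f g : T -> R).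

(** Integral over Omega against the total variation of nu. *)
Definition var_integral nu f : R :=
  let h := projT2 (cid (projT2 (cid (Hahn_decomposition nu)))) in
  \int[jordan_pos h]_(x in Omega) f x + \int[jordan_neg h]_(x in Omega) f x.

Lemma fin_rintg (mu : {finite_measure set T -> \bar R}) f :
  bounded_meas f -> mu.-integrable Omega (EFin \o f).
Proof.
move=> [mf [M fM]]; apply: (@rintg_bounded _ _ _ _ _ _ M) => //.
- by rewrite -ge0_fin_numE// fin_num_measure.
- exact: measurable_funTS.
Qed.

Lemma fin_dct (mu : {finite_measure set T -> \bar R}) :
  @dct_continuous _ T R (fun f => \int[mu]_(x in Omega) f x).
Proof.
move=> f_ M mf fM f0.
have -> : (0 : R) = \int[mu]_(x in Omega) (cst 0 x) by rewrite Rintegral_cst// mul0r.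
apply: (proj2 (@Rintegral_dct _ _ _ mu Omega f_ (fun=> 0) (fun=> M) mO _ _ _ _)).
- by move=> k; exact: measurable_funTS.
- by apply: fin_rintg; split; [exact: measurable_cst|exists `|M|].
- by move=> k x _; exact: fM.
- by move=> x _; exact: f0.
Qed.

Lemma fin_linear (mu : {finite_measure set T -> \bar R}) :
  linear_on (@bounded_meas _ T R) (fun f => \int[mu]_(x in Omega) f x).
Proof.
move=> a f g Bf Bg; have fi := fin_rintg mu Bf; have gi := fin_rintg mu Bg.
by rewrite -RintegralZl// -RintegralD//; exact: rintgZ.
Qed.

Lemma charge_integral_linear nu : linear_on (@bounded_meas _ T R) (charge_integral Omega nu).
Proof.
move=> a f g Bf Bg; rewrite /charge_integral.
rewrite (fin_linear _ a Bf Bg) (fin_linear _ a Bf Bg).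
by do 4! move: (Rintegral _ _ _) => ?; ring.
Qed.

Lemma charge_integral_dct nu : @dct_continuous _ T R (charge_integral Omega nu).
Proof.
move=> f_ M mf fM f0; rewrite /charge_integral -(subrr 0).
by apply: cvgB; apply: fin_dct fM f0.
Qed.

Lemma charge_integral_indic nu A : measurable A ->
  (charge_integral Omega nu \1_A)%:E = nu (A `&` Omega).
Proof.
move=> mA; rewrite /charge_integral.
move: (projT2 (cid (projT2 (cid (Hahn_decomposition nu))))) => h.
rewrite /Rintegral !integral_indic//.
have mAO : measurable (A `&` Omega) by exact: measurableI.
rewrite EFinB !fineK ?fin_num_measure//.
by rewrite (jordan_decomp h mAO) /cadd /= cscaleN1.
Qed.

Lemma charge_integral_var nu f : bounded_meas f ->
  `|charge_integral Omega nu f| <= var_integral nu (fun x => `|f x|).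
Proof.
move=> Bf; rewrite /charge_integral /var_integral; set h := projT2 _.
apply: (le_trans (ler_normB _ _)); apply: lerD; apply: le_normr_Rintegral => //; exact: fin_rintg.
Qed.

Lemma var_integral_dct nu : @dct_continuous _ T R (var_integral nu).
Proof.
move=> f_ M mf fM f0; rewrite /var_integral -(addr0 0).
by apply: cvgD; apply: fin_dct fM f0.
Qed.

Lemma var_integral_le nu f g : bounded_meas f -> bounded_meas g ->
  (forall x, Omega x -> f x <= g x) -> var_integral nu f <= var_integral nu g.
Proof. by move=> Bf Bg fg; apply: lerD; apply: le_Rintegral => //; exact: fin_rintg. Qed.

Lemma var_integral_linear nu : linear_on (@bounded_meas _ T R) (var_integral nu).
Proof.
move=> a f g Bf Bg; rewrite /var_integral.
rewrite (fin_linear _ a Bf Bg) (fin_linear _ a Bf Bg).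
by do 4! move: (Rintegral _ _ _) => ?; ring.
Qed.

Lemma charge_integral_ext nu (I : (T -> R^o) -> R) :
  linear_on (@bounded_meas _ T R) I -> dct_continuous I ->
  (forall A, measurable A -> (I \1_A)%:E = nu (A `&` Omega)) ->
  forall f, bounded_meas f -> I f = charge_integral Omega nu f.
Proof.
move=> lI dI IA; apply: dct_functional_ext => //.
- exact: charge_integral_linear.
- exact: charge_integral_dct.
- by move=> A mA; apply: EFin_inj; rewrite IA// charge_integral_indic.
Qed.

(** The last hypothesis on p forces the extension to vanish on functions that are 0 on Omega. Hence
    the charge takes the same value on A and on its trace in Omega, as [charge_integral]
    requires. *)
Lemma riesz_dominated (F : set (T -> R^o)) (l p : (T -> R^o) -> R) :
  subspace F -> F `<=` (@bounded_meas _ T R) -> linear_on F l ->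
  convex_on (@bounded_meas _ T R) p -> dct_continuous p ->
  (forall f, F f -> l f <= p f) ->
  (forall f, bounded_meas f -> (forall x, Omega x -> f x = 0) -> p f <= 0) ->
  exists nu, forall f, F f -> l f = charge_integral Omega nu f.
Proof.
move=> sF FB lF cp dp lp p0.
have [L [lL dL Lp LF]] := charge_of_dominated sF FB lF cp dp lp.
have [nu nuE] := charge_of_functional lL dL.
have sB := @bounded_meas_subspace _ T R.
have L0 f : bounded_meas f -> (forall x, Omega x -> f x = 0) -> L f = 0.
  move=> Bf f0; apply/eqP; rewrite eq_le (le_trans (Lp _ Bf)) ?p0//=.
  rewrite -oppr_le0 -mulN1r -(linear_onZ (-1) sB lL Bf).
  have BNf : bounded_meas (-1 *: f) by exact: subspaceZ.
  rewrite (le_trans (Lp _ BNf)) ?p0// => x Ox.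
  by rewrite /GRing.scale/= f0// /GRing.scale/= mulr0.
exists nu => f Ff; rewrite -LF//; apply: charge_integral_ext => //; last exact: FB.
move=> A mA; have mAO : measurable (A `&` Omega) by exact: measurableI.
rewrite nuE//; congr EFin; apply/eqP; rewrite -subr_eq0.
have BA := @bounded_meas_indic _ T R _ mA; have BAO := @bounded_meas_indic _ T R _ mAO.
rewrite -(linear_onB sB lL BA BAO); apply/eqP/L0; first exact: subspaceB.
move=> x Ox; rewrite -[LHS]/(\1_A x - \1_(A `&` Omega) x : R).
have [Ax|nAx] := pselect (A x); first by rewrite !indic_in ?subrr.
by rewrite !indic_out ?subrr// => -[].
Qed.

(** A majorant I(|f|) with I linear and monotone is the form in which the later bounds arrive, from
    total variations or from absolute values of densities. *)
Lemma riesz_abs (F : set (T -> R^o)) (l I : (T -> R^o) -> R) :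
  subspace F -> F `<=` (@bounded_meas _ T R) -> linear_on F l ->
  linear_on (@bounded_meas _ T R) I -> dct_continuous I ->
  (forall f g, bounded_meas f -> bounded_meas g -> (forall x, Omega x -> f x <= g x) ->
    I f <= I g) ->
  (forall f, F f -> l f <= I (fun x => `|f x|)) ->
  exists nu, forall f, F f -> l f = charge_integral Omega nu f.
Proof.
move=> sF FB lF lI dI mI lp; have sB := @bounded_meas_subspace _ T R.
have Bn f : @bounded_meas _ T R f -> @bounded_meas _ T R (fun x => `|f x|).
  move=> [mf [M fM]]; split; first exact: measurableT_comp.
  by exists M => x; rewrite normr_id.
apply: (@riesz_dominated F l (fun f => I (fun x => `|f x|))) => //.
- move=> a f g /andP[a0 a1] Bf Bg; have BZ := subspaceZ (1 - a) sB (Bn _ Bg).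
  rewrite -(linear_onZ (1 - a) sB lI (Bn _ Bg)) -lI//; last exact: Bn.
  apply: mI => [||x _].
  + by apply: Bn; apply: subspaceD => //; exact: subspaceZ.
  + by apply: subspaceD => //; apply: subspaceZ => //; exact: Bn.
  rewrite (le_trans (ler_normD _ _))// lerD//=.
    by rewrite -[X in X <= _]/(`|a * f x|) normrM gtr0_norm.
  by rewrite -[X in X <= _]/(`|(1 - a) * g x|) normrM gtr0_norm// subr_gt0.
- move=> f_ M mf fM f0; apply: (dI _ M) => [k|k x|x].
  + exact: measurableT_comp.
  + by rewrite normr_id.
  + by rewrite -(@normr0 _ R); apply: cvg_norm.
- move=> f Bf f0; rewrite -[leRHS](linear_on0 sB lI); apply: mI.
  + exact: Bn.
  + by case: sB.
  + by move=> x Ox; rewrite f0// normr0.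
Qed.

End ChargeIntegral.

(** * Riesz representation of bounded functionals on test functions *)

Section Riesz.
Context {R : realType} {n : nat}.
Local Notation T := 'rV[R]_n.
Variables (Omega : set T) (t : (T -> R) -> R) (C : R).
Hypothesis oO : open Omega.
Hypothesis t_linear : forall c f g, test_function Omega f -> test_function Omega g ->
  t (fun x => c * f x + g x) = c * t f + t g.
Hypothesis t_bounded : forall f, test_function Omega f ->
  (forall x, `|f x| <= 1) -> `|t f| <= C.
Implicit Types (U V : set T) (f g : T -> R).

Let t0 : t (fun=> 0) = 0.
Proof.
have := t_linear 1 (@test_function0 _ _ Omega) (@test_function0 _ _ Omega).
rewrite (_ : (fun x : T => _) = fun=> 0); last by apply/funext => x; rewrite mulr0 addr0.
by move=> h; lra.
Qed.

Let tZ c f : test_function Omega f -> t (fun x => c * f x) = c * t f.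
Proof.
move=> tf; have := t_linear c tf (@test_function0 _ _ Omega); rewrite t0 addr0 => <-.
by congr t; apply/funext => x; rewrite addr0.
Qed.

Let t_sum N (F : 'I_N -> T -> R) : (forall i, test_function Omega (F i)) ->
  t (fun x => \sum_(i < N) F i x) = \sum_(i < N) t (F i).
Proof.
elim: N F => [|N IHN] F tF.
  by rewrite big_ord0 -[RHS]t0; congr t; apply/funext => x; rewrite big_ord0.
rewrite big_ord_recl -IHN// -[X in X + _]mul1r -t_linear//; last first.
  by apply: test_function_sum.
by congr t; apply/funext => x; rewrite big_ord_recl mul1r.
Qed.

(** A partition of unity may use one [U k] several times; pieces with the same index are added up,
    so that the k-th summand lives in [U k]. *)
Lemma test_function_split (U : nat -> set T) f : test_function Omega f ->
  (forall k, open (U k)) ->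
  (forall x, closure [set x | f x != 0] x -> exists k, U k x) ->
  exists N (chi : 'I_N -> T -> R), [/\ forall k : 'I_N, test_function (U k `&` Omega) (chi k),
    forall k x, `|chi k x| <= `|f x| & f = fun x => \sum_k chi k x].
Proof.
move=> tf oU fU; have [_ cf _] := tf.
have [N' [theta [idx [tt tt0 tt1 t1]]]] := partition_of_unity cf oU fU.
pose N := (\max_a idx a).+1; have aN a : (idx a < N)%N by rewrite ltnS; exact: leq_bigmax.
pose h a : 'I_N := Ordinal (aN a).
exists N, (fun k x => \sum_(a | h a == k) theta a x * f x); split.
- move=> k; apply: test_function_sum => a /eqP <-.
  exact: (test_functionMI (tt a) tf).
- move=> k x; rewrite -mulr_suml normrM ger0_norm ?sumr_ge0//.
  rewrite ler_piMl// (le_trans _ (tt1 x))// [leRHS](bigID (fun a => h a == k))/=.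
  by rewrite lerDl sumr_ge0.
- apply/funext => x.
  transitivity (\sum_a theta a x * f x); last by rewrite (partition_big h xpredT).
  rewrite -mulr_suml.
  have [->|fx] := eqVneq (f x) 0; first by rewrite mulr0.
  by rewrite t1 ?mul1r//; exact: subset_closure.
Qed.

(** Total variation of t on an open set; [variation_star] extends it to all sets by outer
    regularity. *)
Definition variation U : \bar R := ereal_sup [set (t f)%:E | f in
  [set f | test_function (U `&` Omega) f /\ forall x, `|f x| <= 1]].

Let tO U f : test_function (U `&` Omega) f -> test_function Omega f.
Proof. by apply: test_function_sub; exact: subIsetr. Qed.

Lemma variation_ge0 U : (0 <= variation U)%E.
Proof.
apply: ereal_sup_ubound; exists (fun=> 0); last by rewrite t0.
by split; [exact: test_function0|move=> x; rewrite normr0].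
Qed.

Lemma variation_le U : (variation U <= C%:E)%E.
Proof.
apply: ge_ereal_sup => _ [f [tf f1] <-]; rewrite lee_fin.
by apply: (le_trans (ler_norm _)); apply: t_bounded => //; exact: tO tf.
Qed.

Lemma variation_mono U V : U `<=` V -> (variation U <= variation V)%E.
Proof.
move=> UV; apply: le_ereal_sup => _ [f [tf f1] <-]; exists f => //; split => //.
by apply: test_function_sub tf; exact: setSI.
Qed.

Lemma variation0 : variation set0 = 0%E.
Proof.
apply/eqP; rewrite eq_le variation_ge0 andbT; apply: ge_ereal_sup => _ [f [tf f1] <-].
rewrite (_ : f = fun=> 0) ?t0//; apply/funext => x; apply: test_function_out tf _.
by rewrite set0I.
Qed.

Lemma variation_fin U : variation U \is a fin_num.
Proof.
rewrite ge0_fin_numE ?variation_ge0//.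
exact: le_lt_trans (variation_le U) (ltry _).
Qed.

Lemma t_le_variation U f (c : R) : 0 <= c -> test_function (U `&` Omega) f ->
  (forall x, `|f x| <= c) -> t f <= c * fine (variation U).
Proof.
move=> c0 tf fc; move: c0; rewrite le_eqVlt => /predU1P[c0|c0].
  rewrite -c0 mul0r (_ : f = fun=> 0) ?t0//; apply/funext => x.
  by apply/normr0_eq0/eqP; rewrite eq_le normr_ge0 andbT c0.
rewrite -ler_pdivrMl// -tZ; last exact: tO tf.
rewrite -lee_fin fineK ?variation_fin//; apply: ereal_sup_ubound.
exists (fun x => c^-1 * f x) => //; split; first exact: test_functionZ.
move=> x; rewrite normrM ger0_norm; last by rewrite invr_ge0 ltW.
by rewrite ler_pdivrMl// mulr1.
Qed.

Lemma variation_bigcup (U : nat -> set T) : (forall k, open (U k)) ->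
  (variation (\bigcup_k U k) <= \sum_(k <oo) variation (U k))%E.
Proof.
move=> oU; apply: ge_ereal_sup => _ [f [tf f1] <-].
have [_ _ fU] := tf.
have [|N [chi [tc cf fE]]] := @test_function_split U f (tO tf) oU.
  by move=> x fx; have [[k _ kx] _] := fU x fx; exists k.
apply: (@le_trans _ _ (\sum_(0 <= k < N) variation (U k))%E); last first.
  by apply: nneseries_lim_ge => k _ _; exact: variation_ge0.
rewrite fE t_sum; last by move=> k; exact: tO (tc k).
rewrite -sumEFin big_mkord; apply: lee_sum => k _.
apply: ereal_sup_ubound; exists (chi k) => //; split => // x.
exact: le_trans (cf k x) (f1 x).
Qed.

Definition variation_star (E : set T) : \bar R :=
  ereal_inf [set variation U | U in [set U | open U /\ E `<=` U]].

Lemma variation_star_open U : open U -> variation_star U = variation U.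
Proof.
move=> oU; apply/eqP; rewrite eq_le; apply/andP; split.
  by apply: ereal_inf_lbound; exists U; [split|].
by apply: le_ereal_inf_tmp => _ [V [_ UV] <-]; exact: variation_mono.
Qed.

Lemma variation_star_ge0 E : (0 <= variation_star E)%E.
Proof. by apply: le_ereal_inf_tmp => _ [V _ <-]; exact: variation_ge0. Qed.

Lemma variation_star0 : variation_star set0 = 0%E.
Proof. by rewrite variation_star_open ?variation0//; exact: open0. Qed.

Lemma variation_star_mono E E' : E `<=` E' -> (variation_star E <= variation_star E')%E.
Proof.
move=> EE; apply: le_ereal_inf => _ [V [oV EV] <-]; exists V => //; split => //.
exact: subset_trans EV.
Qed.

Lemma variation_star_lt E (e : R) : 0 < e -> exists U,
  [/\ open U, E `<=` U & (variation U <= variation_star E + e%:E)%E].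
Proof.
move=> e0; have Ef : variation_star E \is a fin_num.
  rewrite ge0_fin_numE ?variation_star_ge0//.
  apply: (@le_lt_trans _ _ (variation_star setT)); first exact: variation_star_mono.
  rewrite variation_star_open; last exact: openT.
  exact: le_lt_trans (variation_le _) (ltry _).
have [_ [U [oU EU] <-] /ltW UE] := lb_ereal_inf_adherent e0 Ef.
by exists U.
Qed.

Lemma variation_star_sub : sigma_subadditive variation_star.
Proof.
move=> F; apply/lee_addgt0Pr => e e0.
have e2 k : 0 < e / (2 ^ k.+1)%:R by rewrite divr_gt0// ltr0n expn_gt0.
have [U UP] := choice (fun k => variation_star_lt (F k) (e2 k)).
have oU k : open (U k) by have [] := UP k.
apply: (@le_trans _ _ (variation (\bigcup_k U k))).
  apply: ereal_inf_lbound; exists (\bigcup_k U k) => //; split; first exact: bigcup_open.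
  by apply: subset_bigcup => k _; have [] := UP k.
apply: (le_trans (variation_bigcup oU)).
apply: (le_trans _ (epsilon_trick xpredT _ (ltW e0))); last by move=> k; exact: variation_star_ge0.
apply: lee_nneseries => [*|k *]; first exact: variation_ge0.
by have [] := UP k.
Qed.

Definition variation_outer : {outer_measure set T -> \bar R} :=
  HB.pack variation_star (isOuterMeasure.Build R T variation_star variation_star0
    variation_star_ge0 variation_star_mono variation_star_sub).

(** A competitor f supported in V and U, and a competitor g supported in V off the support of f,
    never overlap. So f + g still has absolute value at most 1 and competes in V; taking suprema in
    f and g gives the splitting inequality. *)
Lemma open_caratheodory U : open U -> variation_outer.-caratheodory U.
Proof.
move=> oU; apply: le_caratheodory_measurable => E /=.
apply: le_ereal_inf_tmp => _ [V [oV EV] <-].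
apply: (@le_trans _ _ (variation (V `&` U) + variation_star (E `&` ~` U))%E).
  rewrite leeD2r// -variation_star_open; last exact: openI.
  by apply: variation_star_mono; exact: setSI.
rewrite -leeBrDr; last first.
  rewrite ge0_fin_numE ?variation_star_ge0//.
  apply: (@le_lt_trans _ _ (variation_star setT)); first exact: variation_star_mono.
  rewrite variation_star_open; last exact: openT.
  exact: le_lt_trans (variation_le _) (ltry _).
apply: ge_ereal_sup => _ [f [tf f1] <-].
have [_ cf fU] := tf.
pose K := closure [set x | f x != 0].
have oVK : open (V `&` ~` K) by apply: openI => //; apply: closed_openC; exact: closed_closure.
rewrite leeBrDr; last first.
  rewrite ge0_fin_numE ?variation_star_ge0//.
  apply: (@le_lt_trans _ _ (variation_star setT)); first exact: variation_star_mono.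
  rewrite variation_star_open; last exact: openT.
  exact: le_lt_trans (variation_le _) (ltry _).
apply: (@le_trans _ _ ((t f)%:E + variation (V `&` ~` K))%E).
  rewrite leeD2l// -(variation_star_open oVK); apply: variation_star_mono.
  by move=> x [Ex nUx]; split; [exact: EV|move=> /fU[[]]].
rewrite addeC -leeBrDr//; apply: ge_ereal_sup => _ [g [tg g1] <-].
rewrite leeBrDr// -EFinD.
have tfO := tO tf; have tgO := tO tg.
rewrite -[X in X + _]mul1r -t_linear//; apply: ereal_sup_ubound.
exists (fun x => 1 * g x + f x) => //; split.
  apply: test_functionD; first apply: test_functionZ.
    by apply: test_function_sub tg => x [[]].
  by apply: test_function_sub tf => x [[]].
move=> x; rewrite mul1r; have [fx|fx] := eqVneq (f x) 0; first by rewrite fx addr0.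
rewrite (test_function_out tg) ?add0r// => -[[_ nK] _].
by apply: nK; exact: subset_closure.
Qed.

Lemma measurable_caratheodory (E : set T) : measurable E ->
  variation_outer.-caratheodory E.
Proof.
apply: smallest_sub; last by move=> U; exact: open_caratheodory.
split.
- exact: caratheodory_measurable_set0.
- by move=> E' mE'; rewrite setTD; exact: caratheodory_measurable_setC.
- by move=> F mF; exact: caratheodory_measurable_bigcup.
Qed.

Let variation_star_additive : semi_sigma_additive variation_star.
Proof.
move=> F mF tF mUF.
exact: (@caratheodory_measure_sigma_additive R T variation_outer F
  (fun k => measurable_caratheodory (mF k)) tF (measurable_caratheodory mUF)).
Qed.

HB.instance Definition _ := isMeasure.Build _ T R variation_star
  variation_star0 variation_star_ge0 variation_star_additive.

Let variation_star_finite : fin_num_fun variation_star.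
Proof.
move=> E _; rewrite ge0_fin_numE ?variation_star_ge0//.
apply: (@le_lt_trans _ _ (variation_star setT)); first exact: variation_star_mono.
rewrite variation_star_open; last exact: openT.
exact: le_lt_trans (variation_le _) (ltry _).
Qed.

HB.instance Definition _ := @Measure_isFinite.Build _ T R variation_star
  variation_star_finite.

Let mu : {finite_measure set T -> \bar R} := variation_star.

Lemma sum_delta_le1 N m : \sum_(k < N) (val k == m)%:R <= 1 :> R.
Proof.
have [mN|mN] := ltnP m N.
  rewrite (bigD1 (Ordinal mN))//= eqxx big1 ?addr0// => k km.
  by rewrite (_ : (val k == m) = false)//; apply: contraNF km => /eqP km; exact/eqP/val_inj.
rewrite big1 ?ler01// => k _; rewrite (_ : (val k == m) = false)//.
by apply/eqP => km; have := ltn_ord k; rewrite -[nat_of_ord k]/(val k) km ltnNge mN.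
Qed.

Let mO : measurable Omega. Proof. exact: open_measurable_mx. Qed.

(** f is split along overlapping level layers of |f|; on the k-th layer t is at most (k+1) e times
    the variation, and (k+1) e is at most |f| + 2e there. Each point meets at most two layers,
    whence the factor 2, harmless because only a domination is wanted. *)
Lemma t_le_integral f (e : R) : 0 < e -> test_function Omega f ->
  t f <= \int[mu]_(x in Omega) (2 * (`|f x| + 2 * e)).
Proof.
move=> e0 tf; have cf : continuous f by apply: smooth_continuous; case: tf.
have caf : continuous (fun x : T => `|f x|).
  by move=> x; apply: continuous_comp; [exact: cf|exact: norm_continuous].
pose U (k : nat) : set T := [set x | (k%:R - 1) * e < `|f x| < k.+1%:R * e].
have oU k : open (U k).
  rewrite (_ : U k = (fun x => `|f x|) @^-1` [set y | (k%:R - 1) * e < y] `&`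
    (fun x => `|f x|) @^-1` [set y | y < k.+1%:R * e]); last first.
    apply/seteqP; split=> x /=; first by move=> /andP[].
    by move=> [h1 h2]; rewrite /U/= h1.
  by apply: openI; apply: open_comp => [x _|]; [exact: caf|exact: open_gt|exact: caf|exact: open_lt].
have [x fx|N [chi [tc cchi fE]]] := @test_function_split U f tf oU.
  exists (Num.truncn (`|f x| / e)); have /andP[h1 h2] : (Num.truncn (`|f x| / e))%:R <= `|f x| / e < (Num.truncn (`|f x| / e)).+1%:R.
    by apply: truncn_itv; rewrite divr_ge0// ltW.
  apply/andP; split; last by rewrite -ltr_pdivrMr.
  by rewrite -ltr_pdivlMr// (lt_le_trans _ h1)// ltrBlDr ltrDl.
have mU k : measurable (U k) by exact: open_measurable_mx.
have iI k : mu.-integrable Omega (EFin \o (fun x => k.+1%:R * e * \1_(U k) x)).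
  by apply: rintgZ => //; apply: (fin_rintg mO); exact: bounded_meas_indic.
have tchi (k : 'I_N) : t (chi k) <= \int[mu]_(x in Omega) (k.+1%:R * e * \1_(U k) x).
  have ke : 0 <= k.+1%:R * e by rewrite mulr_ge0// ltW.
  apply: (@le_trans _ _ (k.+1%:R * e * fine (variation (U k `&` Omega)))).
    apply: t_le_variation => //; first by rewrite -setIA setIid.
    move=> x; have [Ux|nUx] := pselect (U k x).
      by apply: (le_trans (cchi k x)); have /andP[_ /ltW] := Ux.
    by rewrite (test_function_out (tc k)) ?normr0// => -[].
  rewrite RintegralZl//; last by apply: (fin_rintg mO); exact: bounded_meas_indic.
  rewrite ler_wpM2l// /Rintegral integral_indic// -[leRHS]/(fine (variation_star (U k `&` Omega))).
  by rewrite variation_star_open//; exact: openI.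
have tE : t f = \sum_(k < N) t (chi k).
  by rewrite {1}fE t_sum// => k; exact: tO (tc k).
rewrite tE; apply: (@le_trans _ _ (\sum_(k < N) \int[mu]_(x in Omega) (k.+1%:R * e * \1_(U k) x))).
  exact: ler_sum.
rewrite -Rintegral_sum//; apply: le_Rintegral => //.
- by apply: rintg_sum.
- have [M fM] := test_function_bounded tf; apply: (fin_rintg mO); split.
    apply: (@measurable_funM _ _ _ setT (fun=> 2)); first exact: measurable_cst.
    apply: measurable_funD; last exact: measurable_cst.
    exact: continuous_measurable_mx caf.
  exists (2 * (M + 2 * e)) => x; rewrite ger0_norm; last first.
    by rewrite mulr_ge0// addr_ge0// mulr_ge0// ltW.
  by rewrite ler_wpM2l// lerD2r.
move=> x _; pose m := Num.truncn (`|f x| / e).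
have /andP[h1 h2] : m%:R <= `|f x| / e < m.+1%:R.
  by apply: truncn_itv; rewrite divr_ge0// ltW.
apply: (@le_trans _ _ (\sum_(k < N) ((val k == m)%:R + (val k == m.+1)%:R) * (`|f x| + 2 * e))).
  apply: ler_sum => k _; have [Ux|nUx] := pselect (U k x); last first.
    rewrite indic_out// mulr0 mulr_ge0// addr_ge0// mulr_ge0// ltW//.
  rewrite indic_in// mulr1; have /andP[u1 u2] := Ux.
  have km : ((val k == m) || (val k == m.+1))%N.
    rewrite -ltr_pdivlMr// in u1; rewrite -ltr_pdivrMr// in u2.
    have : (k%:R : R) < m.+2%:R by rewrite -[m.+2%:R]natr1 -ltrBlDr (lt_trans u1).
    have : (m%:R : R) < k.+1%:R by rewrite (le_lt_trans h1).
    rewrite !ltr_nat !ltnS => mk km; rewrite eqn_leq mk andbT.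
    by case: (leqP k m) => //= mk'; rewrite eqn_leq km mk'.
  apply: (@le_trans _ _ (1 * (`|f x| + 2 * e))).
    rewrite mul1r -lerBlDr (le_trans _ (ltW u1))// -natr1.
    by rewrite (_ : (k%:R + 1) * e - 2 * e = (k%:R - 1) * e)//; ring.
  rewrite ler_wpM2r//; first by rewrite addr_ge0// mulr_ge0// ltW.
  by case/orP: km => ->; rewrite ?lerDl ?lerDr.
rewrite -mulr_suml ler_wpM2r//; first by rewrite addr_ge0// mulr_ge0// ltW.
by rewrite big_split/= (_ : 2 = 1 + 1 :> R) ?lerD ?sum_delta_le1.
Qed.

(** Twice the variation measure dominates t, so [riesz_abs] turns this domination into a
    representation by a charge. *)
Lemma riesz_bounded : exists nu : {charge set T -> \bar R}, forall f,
  test_function Omega f -> t f = charge_integral Omega nu f.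
Proof.
have bt f : test_function Omega f -> @bounded_meas _ T R f.
  move=> tf; split; last exact: test_function_bounded tf.
  by apply: continuous_measurable_mx; apply: smooth_continuous; case: tf.
pose I (f : T -> R^o) := 2 * \int[mu]_(x in Omega) f x.
have Bn f : @bounded_meas _ T R f -> @bounded_meas _ T R (fun x => `|f x|).
  move=> [mf [M fM]]; split; first exact: measurableT_comp.
  by exists M => x; rewrite normr_id.
have tp f : test_function Omega f -> t f <= I (fun x => `|f x|).
  move=> tf; have fi := fin_rintg mO mu (Bn _ (bt _ tf)).
  have ci (c : R) : mu.-integrable Omega (EFin \o (fun=> c)).
    by apply: fin_rintg => //; split; [exact: measurable_cst|exists `|c|].
  (* M absorbs the factor 4 mu(Omega) that multiplies the error in [t_le_integral]. *)
  apply/ler_addgt0Pr => e e0; pose M := 4 * fine (mu Omega) + 1.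
  have M0 : 0 < M by rewrite ltr_wpDl// mulr_ge0// fine_ge0.
  have eM : 0 < e / M by rewrite divr_gt0.
  apply: (le_trans (t_le_integral eM tf)).
  rewrite RintegralZl//; last by apply: rintgD.
  rewrite RintegralD// mulrDr lerD2l Rintegral_cst//.
  rewrite (_ : 2 * (2 * (e / M) * fine (mu Omega)) = e * ((4 * fine (mu Omega)) / M)); last by ring.
  by rewrite ler_piMr ?(ltW e0)// ler_pdivrMr// mul1r lerDl.
have [|||||||nu nuP] := @riesz_abs R n Omega mO [set f | test_function Omega f] t I.
- split=> [|a f g tf tg]; first exact: test_function0.
  by apply: test_functionD => //; exact: test_functionZ.
- exact: bt.
- by move=> a f g tf tg; exact: t_linear.
- move=> a f g Bf Bg; rewrite /I (fin_linear mO mu a Bf Bg); ring.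
- move=> f_ M mf fM f0; rewrite /I -(mulr0 2); apply: cvgM; first exact: cvg_cst.
  exact: (@fin_dct R n Omega mO mu f_ M).
- by move=> f g Bf Bg fg; rewrite ler_wpM2l// le_Rintegral//; exact: fin_rintg.
- exact: tp.
- by exists nu.
Qed.

End Riesz.

(** * Integration by parts up to the boundary *)

Section Helpers.
Context {R : realType}.

Lemma Rintegral_zero_out d (T : measurableType d) (mu : {measure set T -> \bar R})
    (D : set T) (f : T -> R) : (forall x, ~ D x -> f x = 0) ->
  \int[mu]_(x in D) f x = \int[mu]_x f x.
Proof.
move=> f0; rewrite Rintegral_mkcond; congr Rintegral; apply/funext => x.
by rewrite patchE; have [Dx|nDx] := pselect (D x); [rewrite mem_set|rewrite memNset// f0].
Qed.

Lemma rintg_zero_out d (T : measurableType d) (mu : {measure set T -> \bar R})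
    (D : set T) (f : T -> R) : measurable D -> (forall x, ~ D x -> f x = 0) ->
  mu.-integrable D (EFin \o f) <-> mu.-integrable setT (EFin \o f).
Proof.
move=> mD f0; rewrite integrable_mkcond// (_ : (EFin \o f) \_ D = EFin \o f)//.
apply/funext => x; rewrite patchE /=; have [Dx|nDx] := pselect (D x); first by rewrite mem_set.
by rewrite memNset// f0.
Qed.

Lemma common_radius (I : eqType) (s : seq I) (F : I -> R) :
  (forall i, i \in s -> 0 < F i) -> exists2 e, 0 < e & forall i, i \in s -> e <= F i.
Proof.
elim: s => [|i s IHs] F0; first by exists 1.
have [j js|e e0 eF] := IHs; first by apply: F0; rewrite inE js orbT.
exists (Num.min (F i) e); first by rewrite lt_min e0 F0// mem_head.
move=> j; rewrite inE => /orP[/eqP->|/eF ej]; first by rewrite ge_min lexx.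
by rewrite ge_min ej orbT.
Qed.

(** Only x is confined to K: mollification compares points of K with points that may lie outside. *)
Lemma uniformly_continuous_on n (psi : 'rV[R]_n -> R) (K : set 'rV[R]_n) :
  compact K -> continuous psi -> forall eta, 0 < eta ->
  exists2 e, 0 < e & forall x y, K x -> `|x - y| < e -> `|psi x - psi y| < eta.
Proof.
move=> cK cpsi eta eta0; have eta2 : 0 < eta / 2 by rewrite divr_gt0.
have P (x : 'rV[R]_n) : exists d : R, 0 < d /\
    forall y, `|x - y| < d + d -> `|psi x - psi y| < eta / 2.
  have /cvgrPdist_lt/(_ _ eta2)/nbhs_normP[d /= d0 dP] := cpsi x.
  exists (d / 2); split; first by rewrite divr_gt0.
  by move=> y; rewrite -splitr => xy; exact: dP.
have [F FP] := choice P.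
have cK' := cK; rewrite compact_cover in cK'.
have [|x Kx|s sK Ks] := cK' 'rV[R]_n K (fun x => ball x (F x)).
- by move=> x _; apply: ball_open; have [] := FP x.
- by exists x => //; apply: ballxx; have [] := FP x.
have [x _|e e0 eF] := @common_radius _ (enum_fset s) F; first by have [] := FP x.
exists e => // x y Kx xy; have [z /= zs] := Ks x Kx.
rewrite -ball_normE /= => zx; have [_ Fz] := FP z.
have eFz := eF z zs.
rewrite (splitr eta) -(subrKA (psi z)) addrC (le_lt_trans (ler_normD _ _))//.
have zx2 : `|z - x| < F z + F z by rewrite (lt_le_trans zx)// lerDl; have [/ltW] := FP z.
have zy2 : `|z - y| < F z + F z.
  rewrite -(subrKA x) (le_lt_trans (ler_normD _ _))// ltrD//.
  exact: lt_le_trans xy eFz.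
by rewrite ltrD ?Fz// distrC Fz.
Qed.

End Helpers.

Section MatrixMap.
Context {R : realType} {m n : nat}.
Variable A : {linear 'M[R]_(m, n) -> 'M[R]_(m, n)}.

(** Entries of A in the basis of elementary matrices; symmetry of A for [frob] becomes symmetry of
    this array. *)
Definition mxc (i : 'I_m) (j : 'I_n) (k : 'I_m) (l : 'I_n) : R := A (delta_mx i j) k l.

Lemma mxc_apply (y : 'M[R]_(m, n)) k l :
  A y k l = \sum_(p : 'I_m * 'I_n) mxc p.1 p.2 k l * y p.1 p.2.
Proof.
rewrite {1}(matrix_sum_delta y) linear_sum summxE.
rewrite -(pair_bigA _ (fun i j => mxc i j k l * y i j))/=; apply: eq_bigr => i _.
by rewrite linear_sum summxE; apply: eq_bigr => j _; rewrite linearZ mxE mulrC.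
Qed.

Lemma frob_delta (y : 'M[R]_(m, n)) i j : frob (delta_mx i j) y = y i j.
Proof.
rewrite /frob (bigD1 i)//= [X in X + _](bigD1 j)//= mxE !eqxx mul1r.
rewrite !big1 ?addr0// => k ki.
  by rewrite big1// => l _; rewrite mxE (negbTE ki) mul0r.
by rewrite mxE (negbTE ki) andbF mul0r.
Qed.

Lemma frobC (y y' : 'M[R]_(m, n)) : frob y y' = frob y' y.
Proof. by apply: eq_bigr => i _; apply: eq_bigr => j _; rewrite mulrC. Qed.

Hypothesis A_sym : forall y y', frob (A y) y' = frob y (A y').

Lemma mxc_sym i j k l : mxc i j k l = mxc k l i j.
Proof. by rewrite /mxc -(frob_delta (A (delta_mx i j)) k l) -A_sym frobC frob_delta. Qed.

End MatrixMap.

Lemma partial_lincomb {R : realType} {n : nat} (I : Type) (s : seq I) (c : I -> R)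
    (F : I -> 'rV[R]_n -> R) l : (forall i, smooth (F i)) ->
  partial l (fun x => \sum_(i <- s) c i * F i x) =
  fun x => \sum_(i <- s) c i * partial l (F i) x.
Proof.
move=> sF; elim: s => [|i s IHs].
  rewrite (_ : (fun x => \sum_(i <- [::]) c i * F i x) = fun=> 0).
    by rewrite partial_cst; apply/funext => x; rewrite big_nil.
  by apply/funext => x; rewrite big_nil.
rewrite (_ : (fun x => \sum_(i <- i :: s) _) = fun x => c i * F i x + \sum_(i <- s) c i * F i x); last first.
  by apply/funext => x; rewrite big_cons.
have dZ (j : 'I_n) (x : 'rV[R]_n) : derivable (fun x => c i * F i x) x (delta_mx 0 j).
  by apply: smooth_derivable; exact: smoothZ.
have dS (j : 'I_n) (x : 'rV[R]_n) : derivable (fun x => \sum_(i <- s) c i * F i x) x (delta_mx 0 j).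
  by apply: smooth_derivable; apply: smooth_sum => i'; exact: smoothZ.
have dC (j : 'I_n) (x : 'rV[R]_n) : derivable (fun=> c i : R) x (delta_mx 0 j).
  by apply: smooth_derivable; exact: smooth_cst.
have dF (j : 'I_n) (x : 'rV[R]_n) : derivable (F i) x (delta_mx 0 j).
  exact: smooth_derivable.
rewrite (partialD l dZ dS) IHs (partialM l dC dF) partial_cst.
by apply/funext => x; rewrite big_cons mulr0 addr0.
Qed.

(** * Mollified fields tested against Au *)

Section Pairing.
Context {R : realType} {m n : nat}.
Local Notation T := 'rV[R]_n.
Local Notation lam := (@lebesgue_rV R n).
Variables (Omega : set T) (A : {linear 'M[R]_(m, n) -> 'M[R]_(m, n)}).
Hypothesis oO : open Omega.
Hypothesis A_sym : forall y y', frob (A y) y' = frob y (A y').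
Implicit Types (z Phi : T -> 'M[R]_(m, n)) (w u : T -> 'cV[R]_m) (k psi : T -> R).

Let mO : measurable Omega. Proof. exact: open_measurable_mx. Qed.

(* The divergence of a field extended by zero, tested against functions that
   need not vanish on the boundary: it encodes a zero normal trace. *)
Definition div0 z w := forall psi, smooth psi -> forall i,
  \int[lam]_x (w x i 0 * psi x) = - \int[lam]_x (\sum_j z x i j * partial j psi x).

(** The symmetric A is moved from the distributional gradient onto Phi, where it acts as the
    identity; what remains is the row-wise divergence of Phi. *)
Lemma dist_A_pair u Phi : (forall i, lam.-integrable Omega (EFin \o (fun x => u x i 0))) ->
  (forall i j, test_function Omega (fun x => Phi x i j)) ->
  (forall x, A (Phi x) = Phi x) ->
  \sum_i \sum_j dist_A Omega A u (fun x => Phi x i j) i j =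
  - \int[lam]_(x in Omega) (\sum_i u x i 0 * \sum_j partial j (fun x => Phi x i j) x).
Proof.
move=> ui tP AP.
have sP i j : smooth (fun x => Phi x i j) by case: (tP i j).
have iP i j (f : T -> R) : test_function Omega f ->
    lam.-integrable Omega (EFin \o (fun x => u x i 0 * partial j f x)).
  move=> tf; have tp := test_function_partial j tf; have [M fM] := test_function_bounded tp.
  apply: (@rintgM_bounded _ _ _ _ _ _ _ M) => //.
  apply: measurable_funTS; apply: continuous_measurable_mx; apply: smooth_continuous.
  by case: tp.
pose G (p : 'I_m * 'I_n) f := - \int[lam]_(x in Omega) (u x p.1 0 * partial p.2 f x).
have GE (p : 'I_m * 'I_n) :
    \sum_(q : 'I_m * 'I_n) mxc A p.1 p.2 q.1 q.2 * G p (fun x => Phi x q.1 q.2) =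
    G p (fun x => Phi x p.1 p.2).
  rewrite /G (_ : partial p.2 (fun x => Phi x p.1 p.2) = fun x =>
      \sum_(q : 'I_m * 'I_n) mxc A p.1 p.2 q.1 q.2 * partial p.2 (fun x => Phi x q.1 q.2) x); last first.
    rewrite -partial_lincomb; last by move=> q; exact: sP.
    congr partial; apply/funext => x; rewrite -{1}(AP x) mxc_apply.
    by apply: eq_bigr => q _; rewrite mxc_sym.
  rewrite (_ : (fun x => u x p.1 0 * _) = fun x => \sum_(q : 'I_m * 'I_n)
      mxc A p.1 p.2 q.1 q.2 * (u x p.1 0 * partial p.2 (fun x => Phi x q.1 q.2) x)); last first.
    by apply/funext => x; rewrite mulr_sumr; apply: eq_bigr => q _; rewrite mulrCA.
  rewrite Rintegral_sum//; last by move=> q; apply: rintgZ => //; exact: iP.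
  rewrite -sumrN; apply: eq_bigr => q _.
  by rewrite RintegralZl ?mulrN//; exact: iP.
rewrite pair_bigA/= (eq_bigr (fun q => \sum_(p : 'I_m * 'I_n)
    mxc A p.1 p.2 q.1 q.2 * G p (fun x => Phi x q.1 q.2))); last first.
  by move=> q _; rewrite /dist_A mxc_apply; apply: eq_bigr => p _; rewrite /dist_gradient mxE.
rewrite exchange_big/= (eq_bigr _ (fun p _ => GE p)) -(pair_bigA _ (fun i j => G (i, j) (fun x => Phi x i j)))/=.
rewrite Rintegral_sum//; last first.
  move=> i; rewrite (_ : (fun x => _) = fun x => \sum_j u x i 0 * partial j (fun x => Phi x i j) x).
    by apply: rintg_sum => // j; exact: iP.
  by apply/funext => x; rewrite mulr_sumr.
rewrite -sumrN; apply: eq_bigr => i _.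
rewrite (_ : (fun x => _) = fun x => \sum_j u x i 0 * partial j (fun x => Phi x i j) x); last first.
  by apply/funext => x; rewrite mulr_sumr.
by rewrite Rintegral_sum// ?sumrN// => j; exact: iP.
Qed.

Lemma conv_div0 z w k i x : (forall i j, lam.-integrable setT (EFin \o (fun x => z x i j))) ->
  div0 z w -> smooth k -> bounded_support k ->
  conv (fun x => w x i 0) k x = \sum_j partial j (conv (fun x => z x i j) k) x.
Proof.
move=> zi zw sk bk.
have E : conv (fun x => w x i 0) k x = - \sum_j conv (fun x => z x i j) (partial j k) x.
  apply: (etrans (zw _ (smooth_sub sk x) i)); congr (- _).
  have ci (j : 'I_n) : lam.-integrable setT
      (EFin \o (fun y : T => z y i j * partial j k (y - x))).
    apply: conv_integrand; first exact: zi.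
      by apply: smooth_continuous; exact: smooth_partial.
    exact: bounded_support_partial.
  apply: etrans (Rintegral_sum _ measurableT ci).
  apply: eq_Rintegral => y _; apply: eq_bigr => j _; congr (_ * _).
  by have := partial_shift j k (- x) => ->.
rewrite E -sumrN; apply: eq_bigr => j _.
by have := partial_conv j (zi i j) sk bk => ->.
Qed.

(** There are arbitrarily fine kernels whose mollification of z has compact support in Omega, which
    makes it a legitimate test field for Au. *)
Definition admissible z := forall e, 0 < e -> exists k S, [/\ kernel e k,
  compact S, S `<=` Omega & forall x y : T, z y != 0 -> k (y - x) != 0 -> S x].

Lemma A_conv z k x : (forall i j, lam.-integrable setT (EFin \o (fun x => z x i j))) ->
  continuous k -> bounded_support k -> (forall x, A (z x) = z x) ->
  A (\matrix_(i, j) conv (fun x => z x i j) k x) = \matrix_(i, j) conv (fun x => z x i j) k x.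
Proof.
move=> zi ck bk Az; apply/matrixP => i j; rewrite mxc_apply !mxE.
under eq_bigr do rewrite mxE.
rewrite /conv (_ : (fun y => _) = fun y => \sum_(p : 'I_m * 'I_n)
    mxc A p.1 p.2 i j * (z y p.1 p.2 * k (y - x))); last first.
  apply/funext => y; rewrite -{1}(Az y) mxc_apply mulr_suml.
  by apply: eq_bigr => p _; rewrite mulrA.
rewrite Rintegral_sum//; last by move=> p; apply: rintgZ => //; exact: conv_integrand.
by apply: eq_bigr => p _; rewrite RintegralZl//; exact: conv_integrand.
Qed.

(* Mollifying z along an admissible kernel gives a test field, on which the
   distribution Au acts by - int u . div. *)
Lemma dist_A_conv u z w k S : (forall i, lam.-integrable Omega (EFin \o (fun x => u x i 0))) ->
  (forall i j, lam.-integrable setT (EFin \o (fun x => z x i j))) ->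
  (forall x, A (z x) = z x) -> div0 z w -> smooth k -> bounded_support k ->
  compact S -> S `<=` Omega ->
  (forall x y : T, z y != 0 -> k (y - x) != 0 -> S x) ->
  (forall i j, test_function Omega (conv (fun x => z x i j) k)) /\
  \sum_i \sum_j dist_A Omega A u (conv (fun x => z x i j) k) i j =
  - \int[lam]_(x in Omega) (\sum_i u x i 0 * conv (fun x => w x i 0) k x).
Proof.
move=> ui zi Az zw sk bk cS SO zkS.
have tz i j : test_function Omega (conv (fun x => z x i j) k).
  apply: (@test_function_intro _ _ _ S) => [||x /conv_support[y [zy ky]]|].
  - exact: smooth_conv.
  - exact: cS.
  - by apply: zkS ky; apply: contraNneq zy => ->; rewrite mxE.
  - exact: SO.
split => //.
pose Phi x : 'M[R]_(m, n) := \matrix_(i, j) conv (fun x => z x i j) k x.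
have PE i j : (fun x => Phi x i j) = conv (fun x => z x i j) k by apply/funext => x; rewrite mxE.
have tP i j : test_function Omega (fun x => Phi x i j) by rewrite PE.
have AP x : A (Phi x) = Phi x by apply: A_conv => //; exact: smooth_continuous.
transitivity (\sum_i \sum_j dist_A Omega A u (fun x => Phi x i j) i j).
  by apply: eq_bigr => i _; apply: eq_bigr => j _; rewrite PE.
rewrite (dist_A_pair ui tP AP).
congr (- _); apply: eq_Rintegral => x _; apply: eq_bigr => i _; congr (_ * _).
by rewrite (conv_div0 _ _ zi zw sk bk); apply: eq_bigr => j _; rewrite PE.
Qed.

End Pairing.

Lemma le_eta {R : realType} (X Y K : R) : 0 <= K ->
  (forall eta, 0 < eta -> X <= Y + K * eta) -> X <= Y.
Proof.
move=> K0 h; apply/ler_addgt0Pr => e e0; have K1 : 0 < K + 1 by rewrite ltr_wpDl.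
apply: (le_trans (h (e / (K + 1)) _)); first by rewrite divr_gt0.
by rewrite lerD2l mulrA ler_pdivrMr// mulrDr mulr1 mulrC lerDl ltW.
Qed.

Lemma measurable_superlevel d (X : measurableType d) {R : realType} (f : X -> R) (M : R) :
  measurable_fun setT f -> measurable [set x | M < f x].
Proof.
move=> mf; rewrite (_ : [set x | M < f x] = setT `&` f @^-1` `]M, +oo[%classic).
  by apply: mf => //; exact: measurable_itv.
by rewrite setTI; apply/seteqP; split=> x; rewrite /= in_itv/= andbT.
Qed.

Section Convolve.
Context {R : realType} {n : nat}.
Local Notation T := 'rV[R]_n.
Local Notation lam := (@lebesgue_rV R n).

Lemma min_lel (a b : R) : Num.min a b <= a.
Proof. by rewrite ge_min lexx. Qed.

Lemma min_ler (a b : R) : Num.min a b <= b.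
Proof. by rewrite ge_min lexx orbT. Qed.

Lemma kernel_le (r e : R) (k : T -> R) : r <= e -> kernel r k -> kernel e k.
Proof. by move=> re [sk k0 k1 kr]; split => // x /kr xr; exact: lt_le_trans xr re. Qed.

Lemma tail_small (g : T -> R) : lam.-integrable setT (EFin \o g) -> forall eta, 0 < eta ->
  exists2 M, 0 <= M & \int[lam]_x (`|g x| * \1_[set x | M < `|g x|] x) <= eta.
Proof.
move=> gi eta eta0; have mg : measurable_fun setT g by exact: rintg_measurable gi.
have mag : measurable_fun setT (fun x => `|g x|) by exact: measurableT_comp.
pose f_ (N : nat) (x : T) : R := `|g x| * \1_[set x | N%:R < `|g x|] x.
have mD (N : nat) : measurable [set x | N%:R < `|g x|].
  exact: measurable_superlevel.
have [|||x _|fi fc] := @Rintegral_dct _ _ _ lam setT f_ (fun=> 0) (fun x => `|g x|) measurableT.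
- by move=> N; apply: measurable_funM => //; exact: measurable_indic.
- exact: rintg_norm.
- move=> N x _; rewrite normrM normr_id ler_piMr// ger0_norm ?indic_ge0// indicE lern1.
- apply: cvg_near_cst; near=> N; rewrite /f_ indic_out ?mulr0//= => /ltW.
  apply/negP; rewrite -ltNge; near: N; exact: nbhs_infty_gtr.
move: fc; rewrite Rintegral_cst// mul0r => /cvgrPdist_le/(_ _ eta0)[N _ /(_ N (leqnn N))].
rewrite /= sub0r normrN => h; exists N%:R => //.
exact: le_trans (ler_norm _) h.
Unshelve. all: by end_near. Qed.

(** Counterpart of [conv_weak] for g merely integrable and z bounded: the L^1 convergence of the
    mollification acts where |g| <= M, the bound 2 C on the difference where |g| > M. *)
Lemma conv_weak_bounded (g z : T -> R) (C : R) : lam.-integrable setT (EFin \o g) ->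
  lam.-integrable setT (EFin \o z) -> (forall x, `|z x| <= C) ->
  forall e, 0 < e -> exists2 r, 0 < r & forall k, kernel r k ->
  `|\int[lam]_x (g x * conv z k x) - \int[lam]_x (g x * z x)| <= e.
Proof.
move=> gi zi zC e e0; have C0 : 0 <= C by exact: le_trans (zC 0).
have C2 : 0 < 2 * C + 1 by rewrite ltr_wpDl// mulr_ge0.
have d0 : 0 < e / (2 * (2 * C + 1)) by rewrite divr_gt0// mulr_gt0.
have [M M0 gM] := tail_small gi d0.
have M1 : 0 < M + 1 by rewrite ltr_wpDl.
have d1 : 0 < e / (2 * (M + 1)) by rewrite divr_gt0// mulr_gt0.
have [_ /(_ _ d1)[r r0 zr]] := L1_cont_integrable zi.
exists r => // k [sk k0 k1 kr].
have bk : bounded_support k by exact: small_bounded_support kr.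
have ck : continuous k by exact: smooth_continuous.
have czi := conv_integrable zi sk bk k0 k1.
have mcz := rintg_measurable czi.
have czC x : `|conv z k x| <= C by apply: kernel_conv_bound.
have mg : measurable_fun setT g by exact: rintg_measurable gi.
have mz : measurable_fun setT z by exact: rintg_measurable zi.
have gci : lam.-integrable setT (EFin \o (fun x => g x * conv z k x)).
  by apply: (@rintgM_bounded _ _ _ _ _ _ _ C).
have gzi : lam.-integrable setT (EFin \o (fun x => g x * z x)).
  by apply: (@rintgM_bounded _ _ _ _ _ _ _ C).
have di : lam.-integrable setT (EFin \o (fun x => `|conv z k x - z x|)).
  by apply: rintg_norm => //; exact: rintgB.
have cz : \int[lam]_x `|conv z k x - z x| <= e / (2 * (M + 1)).
  by apply: conv_L1_sub => // s /kr; exact: zr.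
have mD : measurable [set x | M < `|g x|].
  by apply: measurable_superlevel; exact: measurableT_comp.
have ti : lam.-integrable setT (EFin \o (fun x => `|g x| * \1_[set x | M < `|g x|] x)).
  apply: (@rintgM_bounded _ _ _ _ _ _ _ 1) => //; first exact: rintg_norm.
  by move=> x _; rewrite ger0_norm ?indic_ge0// indicE lern1 leq_b1.
rewrite -RintegralB//.
apply: (@le_trans _ _ (\int[lam]_x (M * `|conv z k x - z x| +
    2 * C * (`|g x| * \1_[set x | M < `|g x|] x)))).
  apply: Rintegral_le_bound => //.
  - exact: rintgB.
  - by apply: rintgD => //; exact: rintgZ.
  move=> x _; rewrite -mulrBr normrM.
  have dC : `|conv z k x - z x| <= 2 * C.
    by rewrite (le_trans (ler_normB _ _))// mulr2n mulrDl mul1r lerD.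
  have [gxM|gxM] := ltP M `|g x|.
    rewrite indic_in// mulr1 ler_wpDl ?mulr_ge0//.
    by rewrite [leRHS]mulrC ler_wpM2l.
  rewrite indic_out ?mulr0 ?addr0; last by apply/negP; rewrite -leNgt.
  by rewrite ler_wpM2r.
rewrite RintegralD//; [|exact: rintgZ|exact: rintgZ].
rewrite !RintegralZl// (splitr e) lerD//.
  apply: (le_trans (ler_wpM2l M0 cz)).
  rewrite mulrA ler_pdivrMr ?mulr_gt0//.
  rewrite (_ : e / 2 * (2 * (M + 1)) = e * (M + 1)); last by field.
  by rewrite mulrC ler_wpM2l ?(ltW e0)// lerDl.
apply: (le_trans (ler_wpM2l _ gM)); first by rewrite mulr_ge0.
rewrite mulrA ler_pdivrMr ?mulr_gt0//.
rewrite (_ : e / 2 * (2 * (2 * C + 1)) = e * (2 * C + 1)); last by field.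
by rewrite mulrC ler_wpM2l ?(ltW e0)// lerDl.
Qed.

End Convolve.

(** * Integration by parts for fields with zero normal trace *)

Section Field.
Context {R : realType} {m n : nat}.
Local Notation T := 'rV[R]_n.
Local Notation lam := (@lebesgue_rV R n).
Variables (Omega : set T) (A : {linear 'M[R]_(m, n) -> 'M[R]_(m, n)}).
Hypothesis oO : open Omega.
Hypothesis bO : bounded_set Omega.
Hypothesis A_sym : forall y y', frob (A y) y' = frob y (A y').

Let mO : measurable Omega. Proof. exact: open_measurable_mx. Qed.

(* Bounded fields fixed by A, with square-integrable divergence and zero normal
   trace, everything extended by zero outside Omega. *)
Definition field (z : T -> 'M[R]_(m, n)) (w : T -> 'cV[R]_m) (C : R) : Prop :=
  [/\ forall i j, measurable_fun setT (fun x => z x i j),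
      forall i j x, `|z x i j| <= C, forall x, ~ Omega x -> z x = 0,
      forall x, A (z x) = z x &
      [/\ forall i, lam.-integrable setT (EFin \o (fun x => w x i 0)),
          forall i, lam.-integrable setT (EFin \o (fun x => w x i 0 ^+ 2)) & div0 z w]].

Definition L12 (u : T -> 'cV[R]_m) : Prop := forall i,
  lam.-integrable Omega (EFin \o (fun x => u x i 0)) /\
  lam.-integrable Omega (EFin \o (fun x => u x i 0 ^+ 2)).

Lemma field_integrable z w C i j : field z w C ->
  lam.-integrable setT (EFin \o (fun x => z x i j)).
Proof.
move=> [mz zC z0 _ _]; apply/(@rintg_zero_out _ _ _ _ Omega) => //.
  by move=> x nOx; rewrite z0// mxE.
apply: (@rintg_bounded _ _ _ _ _ _ C) => //; first exact: lebesgue_rV_lty.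
exact: measurable_funTS.
Qed.

Lemma L12_out u : L12 u -> forall i,
  [/\ lam.-integrable setT (EFin \o (fun x => u x i 0 * \1_Omega x)),
      lam.-integrable setT (EFin \o (fun x => (u x i 0 * \1_Omega x) ^+ 2)) &
      forall f : T -> R, \int[lam]_(x in Omega) (u x i 0 * f x) =
        \int[lam]_x (u x i 0 * \1_Omega x * f x)].
Proof.
move=> uL i; have [u1 u2] := uL i.
have h (p : T -> R) : lam.-integrable Omega (EFin \o p) ->
    lam.-integrable setT (EFin \o (fun x => p x * \1_Omega x)).
  move=> pi; apply/(@rintg_zero_out _ _ _ _ Omega) => //.
    by move=> x nO; rewrite indic_out ?mulr0.
  apply: (@rintgM_bounded _ _ _ _ _ _ _ 1) => //.
  by move=> x _; rewrite ger0_norm ?indic_ge0// indicE lern1 leq_b1.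
split; first exact: h.
  rewrite (_ : (fun x => _) = fun x => u x i 0 ^+ 2 * \1_Omega x); first exact: h.
  apply/funext => x; rewrite exprMn; congr (_ * _).
  by rewrite indicE; case: (_ \in _); rewrite ?expr1n ?expr0n.
move=> f; rewrite -(@Rintegral_zero_out _ _ _ _ Omega).
  by apply: eq_Rintegral => x /set_mem Ox; rewrite indic_in// mulr1.
by move=> x nO; rewrite indic_out// mulr0 mul0r.
Qed.

Lemma L12_mul u i (g : T -> R) : L12 u -> measurable_fun setT g ->
  lam.-integrable setT (EFin \o (fun x => g x ^+ 2)) ->
  lam.-integrable Omega (EFin \o (fun x => u x i 0 * g x)).
Proof.
move=> uL mg g2; have [u1 u2] := uL i.
apply: (@rintg_le _ _ _ _ _ _ (fun x => u x i 0 ^+ 2 + g x ^+ 2)) => //.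
- apply: measurable_funM; first exact: rintg_measurable u1.
  exact: measurable_funTS.
- move=> x _; rewrite ler_norml; nra.
- by apply: rintgD => //; apply: integrableS g2.
Qed.

Lemma common_kernel (I : finType) (P : I -> (T -> R) -> Prop) :
  (forall i, exists2 r, 0 < r & forall k, kernel r k -> P i k) ->
  exists2 r, 0 < r & forall k, kernel r k -> forall i, P i k.
Proof.
move=> h; have /choice[r rP] : forall i, exists r, 0 < r /\ forall k, kernel r k -> P i k.
  by move=> i; have [r r0 rk] := h i; exists r.
have [i _|e e0 er] := @common_radius R _ (enum I) r; first by have [] := rP i.
exists e => // k kk i; apply: (proj2 (rP i)); apply: kernel_le kk.
by apply: er; rewrite mem_enum.
Qed.

Lemma div_pair_limit u z w C : L12 u -> field z w C -> forall e, 0 < e ->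
  exists2 r, 0 < r & forall k, kernel r k ->
  `|\int[lam]_(x in Omega) (\sum_i u x i 0 * conv (fun x => w x i 0) k x) -
    \int[lam]_(x in Omega) (\sum_i u x i 0 * w x i 0)| <= e.
Proof.
move=> uL [_ _ _ _ [w1 w2 _]] e e0.
have M0 : 0 < m%:R + 1 :> R by rewrite ltr_wpDl.
have em : 0 < e / (m%:R + 1) by rewrite divr_gt0.
have [r r0 rk] : exists2 r, 0 < r & forall k, kernel r k -> forall i : 'I_m,
    `|\int[lam]_(x in Omega) (u x i 0 * conv (fun x => w x i 0) k x) -
      \int[lam]_(x in Omega) (u x i 0 * w x i 0)| <= e / (m%:R + 1).
  apply: common_kernel => i; have [v1 v2 vE] := L12_out uL i.
  have [r r0 rk] := conv_weak v1 v2 (w1 i) (w2 i) em.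
  by exists r => // k kk; rewrite !vE; exact: rk.
exists r => // k kk; have [sk k0 k1 kr] := kk.
have bk : bounded_support k by exact: small_bounded_support kr.
have i1 i : lam.-integrable Omega (EFin \o (fun x => u x i 0 * w x i 0)).
  by apply: L12_mul => //; exact: rintg_measurable (w1 i).
have i2 i : lam.-integrable Omega (EFin \o (fun x => u x i 0 * conv (fun x => w x i 0) k x)).
  apply: L12_mul => //; first exact: conv_measurable.
  by have [] := conv_L2 (w1 i) sk bk k0 k1 (w2 i).
rewrite !Rintegral_sum// -sumrB (le_trans (ler_norm_sum _ _ _))//.
apply: (@le_trans _ _ (\sum_(i < m) e / (m%:R + 1))).
  by apply: ler_sum => i _; exact: rk.
rewrite sumr_const card_ord -[leLHS]mulr_natl mulrA ler_pdivrMr//.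
by rewrite mulrC ler_wpM2l ?(ltW e0)// lerDl.
Qed.

Lemma dist_A_conv_field u z w C k S : L12 u -> field z w C -> smooth k ->
  bounded_support k -> compact S -> S `<=` Omega ->
  (forall x y : T, z y != 0 -> k (y - x) != 0 -> S x) ->
  (forall i j, test_function Omega (conv (fun x => z x i j) k)) /\
  \sum_i \sum_j dist_A Omega A u (conv (fun x => z x i j) k) i j =
  - \int[lam]_(x in Omega) (\sum_i u x i 0 * conv (fun x => w x i 0) k x).
Proof.
move=> uL zf; have [_ _ _ Az [_ _ zw]] := zf.
have u1 i : lam.-integrable Omega (EFin \o (fun x => u x i 0)) by have [] := uL i.
have zi i j := field_integrable i j zf.
move=> sk bk cS SO zkS; exact: (dist_A_conv oO A_sym u1 zi Az zw sk bk cS SO zkS).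
Qed.

(** Both sides are limits of the identity for mollified fields: on the left the density is
    integrable and z bounded, on the right u and w are square integrable. *)
Lemma W_pair u z w C (g : T -> 'M[R]_(m, n)) : L12 u -> field z w C -> admissible Omega z ->
  (forall i j, lam.-integrable Omega (EFin \o (fun x => g x i j))) ->
  is_density Omega (dist_A Omega A u) g ->
  \sum_i \sum_j \int[lam]_(x in Omega) (g x i j * z x i j) =
  - \int[lam]_(x in Omega) (\sum_i u x i 0 * w x i 0).
Proof.
move=> uL zf az gi dg; have [mz zC z0 Az [w1 w2 zw]] := zf.
pose g0 i j x := g x i j * \1_Omega x.
have g0i i j : lam.-integrable setT (EFin \o g0 i j).
  apply/(@rintg_zero_out _ _ _ _ Omega) => //.
    by move=> x nO; rewrite /g0 indic_out ?mulr0.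
  apply: (@rintgM_bounded _ _ _ _ _ _ _ 1) => //.
  by move=> x _; rewrite ger0_norm ?indic_ge0// indicE lern1 leq_b1.
have g0E i j (f : T -> R) : \int[lam]_(x in Omega) (g x i j * f x) = \int[lam]_x (g0 i j x * f x).
  rewrite -(@Rintegral_zero_out _ _ _ _ Omega).
    by apply: eq_Rintegral => x /set_mem Ox; rewrite /g0 indic_in// mulr1.
  by move=> x nO; rewrite /g0 indic_out// mulr0 mul0r.
apply/eqP; rewrite -subr_eq0 -normr_le0.
pose q : R := #|{: 'I_m * 'I_n}|%:R + 1.
apply: (@le_eta _ _ _ q) => [|eta eta0]; first by rewrite addr_ge0.
rewrite add0r.
have [r r0 rk] := div_pair_limit uL zf eta0.
have [r' r'0 r'k] : exists2 r, 0 < r & forall k, kernel r k -> forall p : 'I_m * 'I_n,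
    `|\int[lam]_x (g0 p.1 p.2 x * conv (fun x => z x p.1 p.2) k x) -
      \int[lam]_x (g0 p.1 p.2 x * z x p.1 p.2)| <= eta.
  apply: common_kernel => p.
  exact: (conv_weak_bounded (g0i p.1 p.2) (field_integrable p.1 p.2 zf) (zC p.1 p.2)).
have [k [S [kk cS SO zkS]]] : exists k S, [/\ kernel (Num.min r r') k,
  compact S, S `<=` Omega & forall x y : T, z y != 0 -> k (y - x) != 0 -> S x].
  by apply: az; rewrite lt_min r0.
have [sk _ _ kr] := kk.
have [tz zE] := dist_A_conv_field uL zf sk (small_bounded_support kr) cS SO zkS.
have rkk := rk k (kernel_le (min_lel r r') kk).
have r'kk := r'k k (kernel_le (min_ler r r') kk).
rewrite pair_bigA/=; move: zE; rewrite pair_bigA/= => zE.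
set B := \int[lam]_(x in Omega) (\sum_i u x i 0 * w x i 0) in rkk *.
set B' := \int[lam]_(x in Omega) _ in zE rkk.
rewrite opprK (_ : _ + B = (\sum_(p : 'I_m * 'I_n) (\int[lam]_(x in Omega) (g x p.1 p.2 * z x p.1 p.2) -
    dist_A Omega A u (conv (fun x => z x p.1 p.2) k) p.1 p.2)) - (B' - B)); last first.
  by rewrite sumrB zE; ring.
rewrite (le_trans (ler_normB _ _))// /q mulrDl mul1r lerD//.
rewrite (le_trans (ler_norm_sum _ _ _))// -[X in X * _]/(#|{: 'I_m * 'I_n}|%:R : R).
apply: (@le_trans _ _ (\sum_(p : 'I_m * 'I_n) eta)).
  apply: ler_sum => p _; rewrite (dg _ (tz p.1 p.2)) !g0E distrC; exact: r'kk.
by rewrite sumr_const mulr_natl.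
Qed.

(** Au is only a measure, so the mollified field cannot be replaced by its limit under the integral.
    It is bounded instead by c (psi + eta), through the uniform continuity of psi, and the total
    variation integrates this continuous bound. *)
Lemma BV_pair u z w C nu (psi : T -> R) c : L12 u -> field z w C -> admissible Omega z ->
  is_measure Omega (dist_A Omega A u) nu ->
  continuous psi -> (exists M, forall x, `|psi x| <= M) -> 0 <= c ->
  (forall i j x, `|z x i j| <= c * psi x) ->
  `|\int[lam]_(x in Omega) (\sum_i u x i 0 * w x i 0)| <=
  c * \sum_i \sum_j var_integral Omega (nu i j) psi.
Proof.
move=> uL zf az nuE cpsi [M psiM] c0 zpsi; have [mz zC z0 Az [w1 w2 zw]] := zf.
pose V (f : T -> R) := \sum_(p : 'I_m * 'I_n) var_integral Omega (nu p.1 p.2) f.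
have sB := @bounded_meas_subspace _ T R.
have mpsi : measurable_fun setT psi by exact: continuous_measurable_mx.
have Bpsi : @bounded_meas _ T R psi by split => //; exists M.
have B1 : @bounded_meas _ T R (fun=> 1).
  by split; [exact: measurable_cst|exists 1 => x; rewrite normr1].
have B0 : @bounded_meas _ T R (fun=> 0).
  by split; [exact: measurable_cst|exists 0 => x; rewrite normr0].
have V1 : 0 <= V (fun=> 1).
  apply: sumr_ge0 => p _; rewrite -(linear_on0 sB (var_integral_linear mO (nu p.1 p.2))).
  by apply: var_integral_le => // x _; exact: ler01.
rewrite pair_bigA/= -/(V psi).
apply: (@le_eta _ _ _ (1 + c * V (fun=> 1))) => [|eta eta0]; first by rewrite addr_ge0// mulr_ge0.
have [N ON] := bounded_sub_cube bO.
have [r1 r10 r1P] := uniformly_continuous_on (@cube_compact R n N) cpsi eta0.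
have [r r0 rk] := div_pair_limit uL zf eta0.
have [k [S [kk cS SO zkS]]] : exists k S, [/\ kernel (Num.min r r1) k,
  compact S, S `<=` Omega & forall x y : T, z y != 0 -> k (y - x) != 0 -> S x].
  by apply: az; rewrite lt_min r0.
have [sk k0 k1 kr] := kk.
have bk := small_bounded_support kr.
have [tz zE] := dist_A_conv_field uL zf sk bk cS SO zkS.
have rkk := rk k (kernel_le (min_lel r r1) kk).
have [_ _ _ kr1] := kernel_le (min_ler r r1) kk.
set B := \int[lam]_(x in Omega) (\sum_i u x i 0 * w x i 0) in rkk *.
set B' := \int[lam]_(x in Omega) _ in zE rkk.
have bconv i j x : Omega x -> `|conv (fun x => z x i j) k x| <= c * (psi x + eta).
  move=> Ox; apply: kernel_conv_bound => //; first exact: (field_integrable i j zf).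
    exact: smooth_continuous.
  move=> y /kr1 yx; apply: (le_trans (zpsi i j y)); rewrite ler_wpM2l//.
  have : `|psi x - psi y| < eta by apply: r1P; [exact: ON|rewrite distrC].
  by rewrite ltr_distlC => /andP[_ /ltW].
have Bce : @bounded_meas _ T R (fun x => c * (psi x + eta)).
  split; first by apply: measurable_funM => //; exact: measurable_funD.
  exists (c * (M + eta)) => x; rewrite normrM ger0_norm// ler_wpM2l//.
  by rewrite (le_trans (ler_normD _ _))// lerD// ger0_norm// ltW.
have B'V : `|B'| <= V (fun x => c * (psi x + eta)).
  rewrite -normrN -zE pair_bigA/= (le_trans (ler_norm_sum _ _ _))//.
  apply: ler_sum => p _; rewrite (nuE _ (tz p.1 p.2)).
  have Bc : @bounded_meas _ T R (conv (fun x => z x p.1 p.2) k).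
    split; last exact: test_function_bounded (tz p.1 p.2).
    by apply: continuous_measurable_mx; apply: smooth_continuous; case: (tz p.1 p.2).
  apply: (le_trans (charge_integral_var mO _ Bc)); apply: var_integral_le => //.
  - have [mc [Mc McP]] := Bc; split; first exact: measurableT_comp.
    by exists Mc => x; rewrite normr_id.
  - by move=> x Ox; exact: bconv.
have VE : V (fun x => c * (psi x + eta)) = c * (V psi + eta * V (fun=> 1)).
  rewrite /V mulr_sumr -big_split/= mulr_sumr; apply: eq_bigr => p _.
  have lV := var_integral_linear mO (nu p.1 p.2).
  rewrite (_ : (fun x => c * (psi x + eta)) = c *: (eta *: (fun=> 1) + psi : T -> R^o)).
    rewrite (linear_onZ c sB lV); last exact: sB.2.
    by rewrite lV// addrC.
  by apply/funext => x; rewrite -[RHS]/(c * (eta * 1 + psi x)); ring.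
rewrite (_ : B = B' - (B' - B)); last by ring.
rewrite (le_trans (ler_normB _ _))//.
apply: (le_trans (lerD B'V rkk)); rewrite VE; nra.
Qed.

End Field.

(** * Admissible kernels in the interior and at the boundary *)

Section Admissible.
Context {R : realType} {m n : nat}.
Local Notation T := 'rV[R]_n.
Local Notation lam := (@lebesgue_rV R n).
Variables (Omega : set T).
Hypothesis oO : open Omega.
Hypothesis bO : bounded_set Omega.
Implicit Type z : T -> 'M[R]_(m, n).

Lemma norm_le_coord p (x : 'rV[R]_p) (r : R) : 0 <= r -> (forall i, `|x 0 i| <= r) -> `|x| <= r.
Proof.
move=> r0 xr; rewrite [leLHS]/Num.Def.normr/= mx_normrE; apply/bigmax_leP; split => // ij _.
by rewrite (ord1 ij.1).
Qed.

Lemma kernel_near (c : T) (r : R) : 0 < r -> exists k : T -> R,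
  [/\ smooth k, forall x, 0 <= k x, \int[lam]_x k x = 1 &
      forall x : T, k x != 0 -> `|x - c| < r].
Proof.
move=> r0; have r2 : 0 < r / 2 by rewrite divr_gt0.
have [k [sk k0 k1 kr]] := kernel_exists c r2; exists k; split => // x kx.
apply: (@le_lt_trans _ _ (r / 2)); last by rewrite ltr_pdivrMr// ltr_pMr// ltr1n.
by apply: norm_le_coord (ltW r2) _ => i; rewrite !mxE ltW// kr.
Qed.

(** S is the support of a test function b equal to 1 on K; over the radius of the kernel b changes
    by less than 1/2, so the zeros of b stay out of reach. *)
Lemma compact_kernel (K : set T) : compact K -> K `<=` Omega -> forall e, 0 < e ->
  exists k S, [/\ kernel e k, compact S, S `<=` Omega &
    forall x y : T, K y -> k (y - x) != 0 -> S x].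
Proof.
move=> cK KO e e0.
have [|x Kx|N [theta [_ [tt _ _ t1]]]] := @partition_of_unity R n unit (fun=> Omega) K cK.
- by [].
- by exists tt; exact: KO.
pose b x := \sum_a theta a x.
have tb : test_function Omega b by apply: test_function_sum.
have half : 0 < 1 / 2 :> R by rewrite divr_gt0.
have [r r0 rb] := uniformly_continuous_on cK (smooth_continuous (test_function_smooth tb)) half.
have er : 0 < Num.min e r by rewrite lt_min e0.
have [k [sk k0 k1 kr]] := kernel_near 0 er.
have kr' x : k x != 0 -> `|x| < Num.min e r by move=> /kr; rewrite subr0.
have [_ cb bOm] := tb.
exists k, (closure [set x | b x != 0]); split => //.
  by split => // x /kr' xe; apply: lt_le_trans xe (min_lel e r).
move=> x y Ky /kr' yx; apply: subset_closure => /=.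
have := rb y x Ky (lt_le_trans yx (min_ler e r)); rewrite /b t1// => h.
by apply/eqP => bx; move: h; rewrite bx subr0 normr1 div1r ltNge invf_le1 ?ler1n.
Qed.

Lemma admissible_compact z (K : set T) : compact K -> K `<=` Omega ->
  (forall x, z x != 0 -> K x) -> admissible Omega z.
Proof.
move=> cK KO zK e e0; have [k [S [kk cS SO KS]]] := compact_kernel cK KO e0.
by exists k, S; split => // x y /zK; exact: KS.
Qed.

Lemma norm_mulmx_le (x : T) (Q : 'M[R]_n) j :
  `|(x *m Q) 0 j| <= `|x| * \sum_i \sum_j `|Q i j|.
Proof.
rewrite mxE (le_trans (ler_norm_sum _ _ _))// mulr_sumr ler_sum// => i _.
rewrite normrM ler_pM//; first exact: coord_norm_le.
by rewrite (bigD1 j)//= lerDl sumr_ge0.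
Qed.

Lemma continuous_of_lipschitz (F : T -> R) (L : R) :
  (forall x y, `|F x - F y| <= L * `|x - y|) -> continuous F.
Proof.
move=> FL x; have L1 : 0 < `|L| + 1 by rewrite ltr_wpDl.
apply: cvg_nbhs_seq => u ux; apply/cvgrPdist_le => e e0.
have h : 0 < e / (`|L| + 1) by rewrite divr_gt0.
move/cvgrPdist_le : ux => /(_ _ h); apply: filterS => k xu.
apply: (le_trans (FL x (u k))); apply: (@le_trans _ _ ((`|L| + 1) * `|x - u k|)).
  by rewrite ler_wpM2r// (le_trans (ler_norm _))// lerDl.
by rewrite mulrC -ler_pdivlMr.
Qed.

(* Near the boundary, shift into the epigraph before mollifying. *)
Lemma admissible_boundary (x0 : T) : lipschitz_boundary Omega ->
  (closure Omega `\` Omega°) x0 -> exists2 rho, 0 < rho &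
  forall z, (forall x, z x != 0 -> Omega x /\ `|x0 - x| < rho) -> admissible Omega z.
Proof.
move=> lO /lO[Q [k [g [QQ gL nO]]]].
have [L L0 gLip] : exists2 L, 0 <= L & forall y y', `|g y - g y'| <= L * `|y - y'|.
  have [M [_ MP]] := gL; exists (`|M| + 1) => [|y y']; first by rewrite addr_ge0.
  have ML : M < `|M| + 1 by rewrite (le_lt_trans (ler_norm _))// ltrDl.
  exact: (MP _ ML (y, y') (conj Logic.I Logic.I)).
have /nbhs_normP[d /= d0 dO] := nO.
have d4 : 0 < d / 4 by rewrite divr_gt0.
exists (d / 4) => // z zd e e0.
pose q := \sum_i \sum_j `|Q i j|; have q0 : 0 <= q by rewrite sumr_ge0// => i _; rewrite sumr_ge0.
(* Near [x0], Omega is the set where F is positive. *)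
pose F (x : T) : R := (x *m Q) 0 k - g (col' k (x *m Q)).
have FL (x h : T) : `|F (x + h) - F x - (h *m Q) 0 k| <= L * q * `|h|.
  rewrite /F mulmxDl (_ : _ - _ - _ = g (col' k (x *m Q)) - g (col' k (x *m Q + h *m Q))); last first.
    by move: (x *m Q) (h *m Q) => y y'; rewrite !mxE; ring.
  apply: (le_trans (gLip _ _)); rewrite -mulrA ler_wpM2l//.
  rewrite (_ : col' k (x *m Q) - _ = - col' k (h *m Q)); last first.
    by apply/rowP => j; rewrite !mxE; ring.
  rewrite normrN; apply: norm_le_coord; first by rewrite mulr_ge0.
  by move=> j; rewrite mxE mulrC; exact: norm_mulmx_le.
have FLip (x y : T) : `|F x - F y| <= (L * q + q) * `|x - y|.
  have := FL y (x - y); rewrite (_ : y + (x - y) = x) => [h|]; last by rewrite addrC subrK.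
  rewrite mulrDl -(subrK (((x - y) *m Q) 0 k) (F x - F y)).
  rewrite (le_trans (ler_normD _ _))// lerD// mulrC; exact: norm_mulmx_le.
have cF := continuous_of_lipschitz FLip.
(* In the rotated coordinates v is the k-th axis, so moving by [s *: v] raises F by exactly s. *)
pose v : T := delta_mx 0 k *m Q^T.
have vQ : v *m Q = delta_mx 0 k.
  by rewrite /v -mulmxA (mulmx1C QQ) mulmx1.
have Fv (x : T) s : F (x + s *: v) = F x + s.
  rewrite /F mulmxDl -scalemxAl vQ (_ : col' k _ = col' k (x *m Q)).
    by move: (x *m Q) => y; rewrite !mxE !eqxx /=; ring.
  apply/rowP => j; rewrite !mxE /= (_ : (lift k j == k) = false) ?andbF ?mulr0 ?addr0//.
  by apply/eqP => /esym/eqP; rewrite (negbTE (neq_lift _ _)).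
pose e' := Num.min e (d / 4).
have e'0 : 0 < e' by rewrite lt_min e0.
have v1 : 0 < `|v| + 1 by rewrite ltr_wpDl.
(* This makes the norm of the shift [s *: v] at most e' / 2. *)
pose s := e' / (2 * (`|v| + 1)).
have s0 : 0 < s by rewrite divr_gt0// mulr_gt0.
have c1 : 0 < 2 * (L * q + q + 1) by rewrite mulr_gt0// ltr_wpDl// addr_ge0// mulr_ge0.
(* The kernel lives within t of [- (s *: v)]. Since F has Lipschitz constant [L * q + q], it loses
   at most s / 2 over this radius, so at least s / 2 of the gain s survives. *)
pose t := Num.min (e' / 2) (s / (2 * (L * q + q + 1))).
have t0 : 0 < t by rewrite lt_min !divr_gt0.
have [ker [sk k0 k1 kr]] := kernel_near (- (s *: v)) t0.
have hnorm (h : T) : `|h + s *: v| < t -> `|h| < e'.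
  move=> ht; rewrite -(addrK (s *: v) h) (le_lt_trans (ler_normB _ _))//.
  rewrite (splitr e') ltr_leD//; first exact: lt_le_trans ht (min_lel _ _).
  rewrite normrZ gtr0_norm// /s mulrAC ler_pdivrMr ?mulr_gt0// mulrA divfK//.
  by rewrite ler_wpM2l ?(ltW e'0)// lerDl.
have kr' (x : T) : ker x != 0 -> `|x + s *: v| < t by move=> /kr; rewrite opprK.
pose S : set T := (fun x => `|x0 - x|) @^-1` [set y | y <= d / 2] `&` F @^-1` [set y | s / 2 <= y].
have clS : closed S.
  apply: closedI; apply: preimage_closed.
  - move=> x _; apply: (@continuous_of_lipschitz _ 1) => y y'; rewrite mul1r.
    rewrite (le_trans (ler_dist_dist _ _))//.
    have -> : x0 - y - (x0 - y') = - (y - y').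
      by rewrite [LHS]addrC !opprB addrA subrK.
    by rewrite normrN.
  - exact: closed_le.
  - by move=> x _; exact: cF.
  - exact: closed_ge.
exists ker, S; split.
- split => // x /kr' /hnorm xe; exact: lt_le_trans xe (min_lel _ _).
- have bS : bounded_set S.
    exists (`|x0| + d); split; first exact: num_real.
    move=> M Md x [xd _]; apply: (le_trans _ (ltW Md)).
    rewrite -(subKr x0 x) (le_trans (ler_normB _ _))// lerD2l (le_trans xd)//.
    by rewrite ler_pdivrMr// ler_pMr// ler1n.
  have [N SN] := bounded_sub_cube bS.
  exact: (subclosed_compact clS (@cube_compact R n N) SN).
- move=> x [xd Fx]; apply/dO => /=.
    by rewrite (le_lt_trans xd)// ltr_pdivrMr// ltr_pMr// ltr1n.
  by rewrite -subr_gt0 (lt_le_trans _ Fx)// divr_gt0.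
- move=> x y zy /kr' hx; have [Oy yd] := zd y zy.
  have hn := hnorm _ hx.
  have Fy : 0 < F y.
    rewrite subr_gt0; apply/(dO y) => //=.
    by rewrite (lt_le_trans yd)// ler_pdivrMr// ler_pMr ?ler1n.
  split => /=.
    rewrite -(subrKA y) (le_trans (ler_normD _ _))//.
    rewrite (_ : d / 2 = d / 4 + d / 4); last by field.
    by rewrite lerD// ltW// (lt_le_trans hn)// min_ler.
  have := FLip x (y + s *: v); rewrite Fv.
  rewrite (_ : x - (y + s *: v) = - (y - x + s *: v)); last by rewrite !opprD opprK addrA [- y + x]addrC.
  rewrite normrN => Fx.
  have : (L * q + q) * `|y - x + s *: v| <= s / 2.
    apply: (@le_trans _ _ ((L * q + q + 1) * (s / (2 * (L * q + q + 1))))).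
      rewrite ler_pM// ?addr_ge0 ?mulr_ge0//; first by rewrite lerDl.
      by rewrite ltW// (lt_le_trans hx)// min_ler.
    rewrite le_eqVlt; apply/orP; left; apply/eqP; field.
    by rewrite gt_eqF// ltr_wpDl// addr_ge0// mulr_ge0.
  move=> h; move: Fx; rewrite ler_norml => /andP[Fx _].
  lra.
Qed.

Lemma good_partition : lipschitz_boundary Omega ->
  exists N (theta : 'I_N -> T -> R), [/\ forall a, test_function setT (theta a),
    forall a x, 0 <= theta a x, forall a x, theta a x <= 1,
    forall x, closure Omega x -> \sum_a theta a x = 1 &
    forall a z, (forall x, ~ Omega x -> z x = 0) ->
      admissible Omega (fun x => theta a x *: z x)].
Proof.
(* A set is good if cutting by a function supported in it gives admissible fields. Omega is good,
   and so are small balls at boundary points; together they cover the compact closure. *)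
move=> lO; pose good (U : set T) := open U /\ forall theta z, test_function U theta ->
  (forall x, ~ Omega x -> z x = 0) -> admissible Omega (fun x => theta x *: z x).
have nz (theta : T -> R) z x : theta x *: z x != 0 -> theta x != 0 /\ z x != 0.
  by rewrite scaler_eq0 negb_or => /andP.
have gO : good Omega.
  split => // theta z [_ ct tO] z0; apply: (admissible_compact ct tO) => x /nz[tx _].
  exact: subset_closure.
have cov (x : T) : closure Omega x -> exists i : {U : set T | good U}, sval i x.
  move=> cx; have [Ox|nOx] := pselect (Omega x); first by exists (exist _ Omega gO).
  have bx : (closure Omega `\` Omega°) x by split => // /interior_subset.
  have [rho rho0 rhoP] := admissible_boundary lO bx.
  have gB : good (ball x rho).
    split; first exact: ball_open.
    move=> theta z tt z0; apply: rhoP => y /nz[ty zy]; split.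
      by apply: contrapT => nOy; rewrite z0// eqxx in zy.
    have : ball x rho y by apply: contrapT => nb; rewrite (test_function_out tt nb) eqxx in ty.
    by rewrite -ball_normE.
  by exists (exist _ (ball x rho) gB); exact: ballxx.
have [k Ok] := bounded_sub_cube bO.
have cO : compact (closure Omega).
  apply: (subclosed_compact _ (@cube_compact R n k)); first exact: closed_closure.
  have [/(_ (@cube_closed R n k)) -> _] := closure_id (@cube R n k).
  exact: closure_subset.
have oU (i : {U : set T | good U}) : open (sval i) by case: i => U [].
have [N [theta [idx [tt tt0 tt1 t1]]]] := partition_of_unity cO oU cov.
exists N, theta; split => //.
- by move=> a; apply: test_function_sub (tt a).
- move=> a x; rewrite (le_trans _ (tt1 x))// (bigD1 a)//= lerDl sumr_ge0//.
- by move=> a z z0; case: (idx a) (tt a) => U [_ gU] /= ta; exact: gU.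
Qed.

End Admissible.

(** * Localisation by a partition of unity *)

Section Global.
Context {R : realType} {m n : nat}.
Local Notation T := 'rV[R]_n.
Local Notation lam := (@lebesgue_rV R n).
Variables (Omega : set T) (A : {linear 'M[R]_(m, n) -> 'M[R]_(m, n)}).
Hypothesis oO : open Omega.
Hypothesis bO : bounded_set Omega.
Hypothesis A_sym : forall y y', frob (A y) y' = frob y (A y').

Let mO : measurable Omega. Proof. exact: open_measurable_mx. Qed.

(** The divergence of theta z, by the product rule. *)
Definition cut_div (theta : T -> R) (z : T -> 'M[R]_(m, n)) (w : T -> 'cV[R]_m) x : 'cV[R]_m :=
  \col_i (theta x * w x i 0 + \sum_j z x i j * partial j theta x).

(** The divergence of z is tested against theta psi only. This covers fields with zero normal trace
    and compactly supported theta, as well as fields without boundary condition when the support of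
    theta lies in Omega. *)
Lemma field_cut (z : T -> 'M[R]_(m, n)) (w : T -> 'cV[R]_m) (C M0 : R) (theta : T -> R) : test_function setT theta -> (forall x, `|theta x| <= M0) ->
  (forall i j, measurable_fun setT (fun x => z x i j)) ->
  (forall i j x, `|z x i j| <= C) -> (forall x, ~ Omega x -> z x = 0) ->
  (forall x, A (z x) = z x) ->
  (forall i, lam.-integrable setT (EFin \o (fun x => w x i 0))) ->
  (forall i, lam.-integrable setT (EFin \o (fun x => w x i 0 ^+ 2))) ->
  (forall psi, smooth psi -> forall i,
    \int[lam]_x (w x i 0 * (theta x * psi x)) =
    - \int[lam]_x (\sum_j z x i j * partial j (fun x => theta x * psi x) x)) ->
  field Omega A (fun x => theta x *: z x) (cut_div theta z w) (M0 * C).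
Proof.
move=> tt t1 mz zC z0 Az w1 w2 zw.
have st : smooth theta by case: tt.
have mt : measurable_fun setT theta by apply: continuous_measurable_mx; exact: smooth_continuous.
have tp j : test_function setT (partial j theta) by exact: test_function_partial.
have mtp j : measurable_fun setT (partial j theta).
  by apply: continuous_measurable_mx; apply: smooth_continuous; case: (tp j).
have zi i j : lam.-integrable setT (EFin \o (fun x => z x i j)).
  apply/(@rintg_zero_out _ _ _ _ Omega) => //; first by move=> x nO; rewrite z0// mxE.
  apply: (@rintg_bounded _ _ _ _ _ _ C) => //; first exact: lebesgue_rV_lty.
  exact: measurable_funTS.
have zti i j : lam.-integrable setT (EFin \o (fun x => z x i j * partial j theta x)).
  have [M tM] := test_function_bounded (tp j).
  by apply: (@rintgM_bounded _ _ _ _ _ _ _ M).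
pose v i x := \sum_j z x i j * partial j theta x.
have vi i : lam.-integrable setT (EFin \o v i) by exact: rintg_sum.
have v2i i : lam.-integrable setT (EFin \o (fun x => v i x ^+ 2)).
  have /choice[M tM] j := test_function_bounded (tp j).
  apply: (@rintgM_bounded _ _ _ _ _ _ _ (\sum_j C * M j)) => //; first exact: rintg_measurable (vi i).
  move=> x _; rewrite (le_trans (ler_norm_sum _ _ _))// ler_sum// => j _.
  by rewrite normrM ler_pM.
have twi i : lam.-integrable setT (EFin \o (fun x => theta x * w x i 0)).
  rewrite (_ : (fun x => _) = fun x => w x i 0 * theta x); last by apply/funext => x; rewrite mulrC.
  by apply: (@rintgM_bounded _ _ _ _ _ _ _ M0).
have mw i : measurable_fun setT (fun x => w x i 0) by exact: rintg_measurable (w1 i).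
split.
- by move=> i j; under eq_fun do rewrite mxE; exact: measurable_funM.
- by move=> i j x; rewrite mxE normrM ler_pM.
- by move=> x nO; rewrite z0// scaler0.
- by move=> x; rewrite linearZ Az.
split.
- move=> i; under eq_fun do rewrite mxE.
  exact: (rintgD measurableT (twi i) (vi i)).
- move=> i; under eq_fun do rewrite mxE.
  apply: (@rintg_le _ _ _ _ _ _ (fun x => 2 * (M0 ^+ 2 * w x i 0 ^+ 2) + 2 * v i x ^+ 2)) => //.
  + apply: measurable_funX; apply: measurable_funD; first exact: measurable_funM.
    exact: rintg_measurable (vi i).
  + move=> x _; rewrite -/(v i x) ger0_norm ?sqr_ge0//.
    have tw : (theta x * w x i 0) ^+ 2 <= M0 ^+ 2 * w x i 0 ^+ 2.
      rewrite exprMn ler_wpM2r ?sqr_ge0// -[X in X <= _]real_normK ?num_real//.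
      by rewrite ler_pXn2r ?nnegrE// (le_trans _ (t1 x)).
    by have := sqr_ge0 (theta x * w x i 0 - v i x); nra.
  + by apply: rintgD => //; apply: rintgZ => //; exact: rintgZ.
- move=> psi sp i.
  have ttp : test_function setT (fun x => theta x * psi x).
    rewrite (_ : (fun x => _) = fun x => psi x * theta x); first exact: test_functionMl.
    by apply/funext => x; rewrite mulrC.
  have testI (f g : T -> R) : lam.-integrable setT (EFin \o f) -> test_function setT g ->
      lam.-integrable setT (EFin \o (fun x => f x * g x)).
    move=> fi tg; have [M gM] := test_function_bounded tg.
    apply: (@rintgM_bounded _ _ _ _ _ _ _ M) => //.
    by apply: continuous_measurable_mx; apply: smooth_continuous; case: tg.
  have i1 : lam.-integrable setT (EFin \o (fun x => w x i 0 * (theta x * psi x))) by exact: testI.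
  have i2 j : lam.-integrable setT (EFin \o (fun x => z x i j * (psi x * partial j theta x))).
    by apply: testI; [exact: zi|exact: test_functionMl].
  have i3 j : lam.-integrable setT (EFin \o (fun x => z x i j * (theta x * partial j psi x))).
    apply: testI; first exact: zi.
    rewrite (_ : (fun x => _) = fun x => partial j psi x * theta x).
      by apply: test_functionMl; [exact: smooth_partial|exact: tt].
    by apply/funext => x; rewrite mulrC.
  have pE j : partial j (fun x => theta x * psi x) = fun x => theta x * partial j psi x + psi x * partial j theta x.
    by apply: partialM => l x; exact: smooth_derivable.
  transitivity (\int[lam]_x (w x i 0 * (theta x * psi x) + \sum_j z x i j * (psi x * partial j theta x))).
    apply: eq_Rintegral => x _; rewrite mxE mulrDl mulr_suml; congr (_ + _); first by ring.
    by apply: eq_bigr => j _; ring.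
  rewrite RintegralD//; last exact: rintg_sum.
  rewrite zw// (_ : (fun x => \sum_j z x i j * partial j _ x) = fun x =>
      \sum_j z x i j * (theta x * partial j psi x) + \sum_j z x i j * (psi x * partial j theta x)); last first.
    by apply/funext => x; rewrite -big_split/=; apply: eq_bigr => j _; rewrite pE mulrDr.
  rewrite RintegralD//; [|exact: rintg_sum|exact: rintg_sum].
  rewrite opprD addrNK; congr (- _); apply: eq_Rintegral => x _; apply: eq_bigr => j _.
  by rewrite mxE; ring.
Qed.

(* Localising with a partition of unity whose pieces are admissible; the
   gradient terms cancel because the pieces sum to 1. *)
Lemma BV_pair_global : lipschitz_boundary Omega -> exists2 K, 0 <= K &
  forall u z w C nu (psi : T -> R) c, L12 Omega u -> field Omega A z w C ->
  is_measure Omega (dist_A Omega A u) nu ->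
  continuous psi -> (exists M, forall x, `|psi x| <= M) -> 0 <= c ->
  (forall i j x, `|z x i j| <= c * psi x) ->
  `|\int[lam]_(x in Omega) (\sum_i u x i 0 * w x i 0)| <=
  K * (c * \sum_i \sum_j var_integral Omega (nu i j) psi).
Proof.
move=> lO; have [N [theta [tt tt0 tt1 t1 ta]]] := @good_partition R m n Omega oO bO lO.
(* N counts the pieces; each contributes the same bound because 0 <= theta <= 1. *)
exists N%:R => // u z w C nu psi c uL zf nuE cpsi bpsi c0 zpsi.
have [mz zC z0 Az [w1 w2 zw]] := zf.
have ta1 a x : `|theta a x| <= 1 by rewrite ger0_norm.
have fa a : field Omega A (fun x => theta a x *: z x) (cut_div (theta a) z w) (1 * C).
  apply: (field_cut (tt a) (ta1 a) mz zC z0 Az w1 w2) => psi' sp i; apply: zw.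
  by have [sa _ _] := tt a; exact: (smoothM sa sp).
have pa a := BV_pair oO bO A_sym uL (fa a) (ta a z z0) nuE cpsi bpsi c0.
have sumE x : Omega x -> \sum_i u x i 0 * w x i 0 =
    \sum_a \sum_i u x i 0 * cut_div (theta a) z w x i 0.
  move=> Ox; rewrite exchange_big/=; apply: eq_bigr => i _; rewrite -mulr_sumr; congr (_ * _).
  rewrite (eq_bigr (fun a => theta a x * w x i 0 + \sum_j z x i j * partial j (theta a) x)); last first.
    by move=> a _; rewrite mxE.
  rewrite big_split/= -mulr_suml t1 ?mul1r; last exact: subset_closure.
  rewrite exchange_big/= big1 ?addr0// => j _; rewrite -mulr_sumr.
  suff -> : \sum_a partial j (theta a) x = 0 by rewrite mulr0.
  have -> : \sum_a partial j (theta a) x = partial j (fun x => \sum_a theta a x) x.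
    rewrite (_ : (fun x => \sum_a theta a x) = fun x => \sum_a 1 * theta a x); last first.
      by apply/funext => y; apply: eq_bigr => a _; rewrite mul1r.
    rewrite partial_lincomb; last by move=> a; case: (tt a).
    by apply: eq_bigr => a _; rewrite mul1r.
  (* The pieces sum to 1 on the open set Omega, so the sum is constant near x and its partials
     vanish there. *)
  have h : \forall y \near x, 1 = \sum_a theta a y.
    have : nbhs x Omega by exact: open_nbhs_nbhs.
    by apply: filterS => y Oy; rewrite t1//; exact: subset_closure.
  pose one : T -> R := fun=> 1.
  have [_ d0] := @near_eq_is_derive _ _ _ one (fun y => \sum_a theta a y) x (delta_mx 0 j) 0 h
    (is_derive_cst _ _ _).
  by rewrite /partial d0.
have uwi a i : lam.-integrable Omega (EFin \o (fun x => u x i 0 * cut_div (theta a) z w x i 0)).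
  have [_ _ _ _ [wa1 wa2 _]] := fa a.
  by apply: L12_mul => //; exact: rintg_measurable (wa1 i).
have -> : \int[lam]_(x in Omega) (\sum_i u x i 0 * w x i 0) =
    \int[lam]_(x in Omega) (\sum_a \sum_i u x i 0 * cut_div (theta a) z w x i 0).
  by apply: eq_Rintegral => x /set_mem; exact: sumE.
rewrite Rintegral_sum//; last by move=> a; exact: rintg_sum.
rewrite (le_trans (ler_norm_sum _ _ _))//.
apply: (@le_trans _ _ (\sum_(a < N) c * \sum_i \sum_j var_integral Omega (nu i j) psi)).
  apply: ler_sum => a _; apply: pa => i j x; rewrite mxE normrM.
  by rewrite (le_trans _ (zpsi i j x))// ler_piMl.
by rewrite sumr_const card_ord mulr_natl.
Qed.

End Global.

(** * Lebesgue spaces *)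

Section FrobNorm.
Context {R : realType} {a b : nat}.
Implicit Type y : 'M[R]_(a, b).

Lemma frob_ge0 y : 0 <= frob y y.
Proof. by apply: sumr_ge0 => i _; apply: sumr_ge0 => j _; rewrite -expr2 sqr_ge0. Qed.

Lemma frob_norm_ge0 y : 0 <= frob_norm y.
Proof. exact: sqrtr_ge0. Qed.

Lemma frob_norm_sqr y : frob_norm y ^+ 2 = frob y y.
Proof. by rewrite sqr_sqrtr// frob_ge0. Qed.

Lemma entry_sqr_le_frob y i j : y i j ^+ 2 <= frob y y.
Proof.
rewrite /frob (bigD1 i)//= (bigD1 j)//= -expr2 -addrA lerDl addr_ge0//.
  by apply: sumr_ge0 => l _; rewrite -expr2 sqr_ge0.
by apply: sumr_ge0 => k _; apply: sumr_ge0 => l _; rewrite -expr2 sqr_ge0.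
Qed.

Lemma entry_le_frob_norm y i j : `|y i j| <= frob_norm y.
Proof.
rewrite -(@ler_pXn2r _ 2)// ?nnegrE ?frob_norm_ge0//.
by rewrite frob_norm_sqr real_normK ?num_real// entry_sqr_le_frob.
Qed.

Definition sum_norm y := \sum_i \sum_j `|y i j|.

Lemma sum_norm_ge0 y : 0 <= sum_norm y.
Proof. by apply: sumr_ge0 => i _; apply: sumr_ge0. Qed.

Lemma sum_sqr_le (I : finType) (F : I -> R) : (forall i, 0 <= F i) ->
  \sum_i F i ^+ 2 <= (\sum_i F i) ^+ 2.
Proof.
move=> F0; rewrite expr2 mulr_suml; apply: ler_sum => i _.
by rewrite expr2 ler_wpM2l// (bigD1 i)//= lerDl sumr_ge0.
Qed.

Lemma frob_norm_le_sum y : frob_norm y <= sum_norm y.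
Proof.
rewrite -(@ler_pXn2r _ 2)// ?nnegrE ?frob_norm_ge0 ?sum_norm_ge0//.
rewrite frob_norm_sqr /frob /sum_norm !pair_bigA/=.
rewrite (eq_bigr (fun p => `|y p.1 p.2| ^+ 2)); first exact: sum_sqr_le.
by move=> p _; rewrite real_normK ?num_real.
Qed.

End FrobNorm.

Section LpSpaces.
Context {R : realType} {n : nat}.
Local Notation T := 'rV[R]_n.
Local Notation lam := (@lebesgue_rV R n).
Variable Omega : set T.
Hypothesis oO : open Omega.
Context {a b : nat}.
Implicit Type g : T -> 'M[R]_(a, b).

Let mO : measurable Omega. Proof. exact: open_measurable_mx. Qed.

Lemma measurable_fun_frob g : measurable_fun Omega g ->
  measurable_fun Omega (fun x => frob (g x) (g x)).
Proof.
move=> mg; apply: measurable_sum => i; apply: measurable_sum => j.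
by apply: measurable_funM; exact: measurable_fun_coord.
Qed.

Lemma measurable_fun_frob_norm g : measurable_fun Omega g ->
  measurable_fun Omega (fun x => frob_norm (g x)).
Proof.
move=> mg; apply: (measurableT_comp (f := @Num.sqrt R)); last exact: measurable_fun_frob.
by apply: continuous_measurable_fun; exact: sqrt_continuous.
Qed.

Lemma Lnorm_finE (r : R) g : r != 0 ->
  (LpNorm Omega r%:E g `^ r = \int[lam]_(x in Omega) ((frob_norm (g x) `^ r)%R)%:E)%E.
Proof.
move=> r0; rewrite /LpNorm (poweR_Lnorm _ _ r0) [in RHS]integral_mkcond.
apply: eq_integral => x _; rewrite /= !patchE; case: ifPn => xO /=.
  by rewrite ger0_norm ?frob_norm_ge0.
by rewrite normr0 powR0.
Qed.

Lemma LpNorm_lty (r : R) g : 0 < r ->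
  (LpNorm Omega r%:E g < +oo)%E <->
  (\int[lam]_(x in Omega) ((frob_norm (g x) `^ r)%R)%:E < +oo)%E.
Proof.
move=> r0; rewrite -Lnorm_finE ?gt_eqF//; split; first exact: poweR_lty.
by move=> h; rewrite ltey; apply/eqP => e; move: h; rewrite e poweRyr// gt_eqF.
Qed.

Lemma rintg_ge0_lty (f : T -> R) : measurable_fun Omega f ->
  (forall x, 0 <= f x) -> (\int[lam]_(x in Omega) (f x)%:E < +oo)%E ->
  lam.-integrable Omega (EFin \o f).
Proof.
move=> mf f0 foo; apply/integrableP; split; first exact/measurable_EFinP.
by under eq_integral do rewrite /= ger0_norm//.
Qed.

Lemma rintg_lty (f : T -> R) : (forall x, 0 <= f x) ->
  lam.-integrable Omega (EFin \o f) -> (\int[lam]_(x in Omega) (f x)%:E < +oo)%E.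
Proof.
by move=> f0 /integrableP[_]; under eq_integral do rewrite /= ger0_norm//.
Qed.

Lemma Lp1P g : Lp Omega 1%:E g <-> measurable_fun Omega g /\
  forall i j, lam.-integrable Omega (EFin \o (fun x => g x i j)).
Proof.
split=> -[mg h]; split => //.
  move=> i j; apply: (@rintg_le _ _ _ _ _ _ (fun x => frob_norm (g x))) => //.
  - exact: measurable_fun_coord.
  - by move=> x _; exact: entry_le_frob_norm.
  apply: rintg_ge0_lty; first exact: measurable_fun_frob_norm.
    by move=> x; exact: frob_norm_ge0.
  move/LpNorm_lty : h => /(_ ltr01); congr (_ < _)%E; apply: eq_integral => x _.
  by rewrite powRr1// frob_norm_ge0.
apply/LpNorm_lty => //.
have -> : (\int[lam]_(x in Omega) ((frob_norm (g x) `^ 1)%R)%:E =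
    \int[lam]_(x in Omega) (frob_norm (g x))%:E)%E.
  by apply: eq_integral => x _; rewrite powRr1// frob_norm_ge0.
apply: rintg_lty; first by move=> x; exact: frob_norm_ge0.
apply: (@rintg_le _ _ _ _ _ _ (fun x => sum_norm (g x))) => //.
- exact: measurable_fun_frob_norm.
- by move=> x _; rewrite ger0_norm ?frob_norm_ge0// frob_norm_le_sum.
- by apply: rintg_sum => // i; apply: rintg_sum => // j; exact: rintg_norm.
Qed.

Lemma Lp2P g : Lp Omega 2%:E g <-> measurable_fun Omega g /\
  lam.-integrable Omega (EFin \o (fun x => frob (g x) (g x))).
Proof.
have E : (\int[lam]_(x in Omega) ((frob_norm (g x) `^ 2)%R)%:E =
    \int[lam]_(x in Omega) (frob (g x) (g x))%:E)%E.
  by apply: eq_integral => x _; rewrite powR_mulrn ?frob_norm_ge0// frob_norm_sqr.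
split=> -[mg h]; split => //.
  apply: rintg_ge0_lty; first exact: measurable_fun_frob.
    by move=> x; exact: frob_ge0.
  by rewrite -E; apply/LpNorm_lty.
by apply/LpNorm_lty => //; rewrite E; apply: rintg_lty => // x; exact: frob_ge0.
Qed.

Lemma LpNorm2E g : Lp Omega 2%:E g ->
  LpNorm Omega 2%:E g = (Num.sqrt (\int[lam]_(x in Omega) frob (g x) (g x)))%:E.
Proof.
move=> gL; have [mg h] := (Lp2P g).1 gL.
have E : (LpNorm Omega 2%:E g `^ 2 = (\int[lam]_(x in Omega) frob (g x) (g x))%:E)%E.
  rewrite Lnorm_finE// EFin_Rintegral//; apply: eq_integral => x _.
  by rewrite powR_mulrn ?frob_norm_ge0// frob_norm_sqr.
have := Lnorm_ge0 lam 2%:E (EFin \o ((fun x => frob_norm (g x)) \_ Omega)).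
rewrite -/(LpNorm Omega 2%:E g); case: gL => _.
case: (LpNorm Omega 2%:E g) E => [r|//|//]; rewrite poweR_EFin lee_fin => -[<-] _ r0.
by rewrite powR_mulrn// sqrtr_sqr ger0_norm.
Qed.

Hypothesis bO : bounded_set Omega.

Lemma Lp_bounded (r C : R) g : 0 < r -> measurable_fun Omega g ->
  (forall x i j, Omega x -> `|g x i j| <= C) -> Lp Omega r%:E g.
Proof.
move=> r0 mg gC; split => //; apply/LpNorm_lty => //.
apply: rintg_lty; first by move=> x; exact: powR_ge0.
apply: (@rintg_bounded _ _ _ _ _ _ ((\sum_(i < a) \sum_(j < b) C) `^ r)) => //.
- exact: lebesgue_rV_lty.
- apply: (measurableT_comp (measurable_powR r)); exact: measurable_fun_frob_norm.
move=> x Ox; rewrite ger0_norm ?powR_ge0//.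
apply: ge0_ler_powR; rewrite ?nnegrE; [exact: ltW|exact: frob_norm_ge0| |].
  by apply: (le_trans (sum_norm_ge0 (g x))); apply: ler_sum => i _; apply: ler_sum => j _; exact: gC.
by rewrite (le_trans (frob_norm_le_sum _))//; apply: ler_sum => i _; apply: ler_sum => j _; exact: gC.
Qed.

Lemma Lpoo_bounded (C : R) g : measurable_fun Omega g ->
  (forall x i j, Omega x -> `|g x i j| <= C) -> Lp Omega +oo%E g.
Proof.
move=> mg gC; split => //; rewrite /LpNorm unlock; case: ifPn => // _.
pose C' := Num.max 0 (\sum_(i < a) \sum_(j < b) C).
apply: (@le_lt_trans _ _ C'%:E); last exact: ltry.
apply/ess_sup_inf.ess_supP; apply: nearW => x /=; rewrite patchE lee_fin; case: ifPn => [/set_mem Ox|_].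
  rewrite ger0_norm ?frob_norm_ge0// le_max; apply/orP; right.
  by rewrite (le_trans (frob_norm_le_sum _))//; apply: ler_sum => i _; apply: ler_sum => j _; exact: gC.
by rewrite normr0 le_max lexx.
Qed.

Lemma Lpoo_ae g : Lp Omega +oo%E g -> exists2 C, 0 <= C &
  \forall x \ae lam, Omega x -> forall i j, `|g x i j| <= C.
Proof.
(* By convention the L^infinity norm is 0 if the whole space is null; in that case every property
   holds almost everywhere. *)
move=> [mg]; rewrite /LpNorm unlock; case: ifPn => [mu0|mu0 _]; last first.
  have lam0 : lam setT = 0%E by apply/eqP; rewrite eq_le measure_ge0 andbT leNgt.
  exists 0 => //; exists setT; split => //.
move=> soo; pose s := ess_sup_inf.ess_sup lam (abse \o (EFin \o ((fun x => frob_norm (g x)) \_ Omega))).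
have s0 : (0 <= s)%E by apply: ess_sup_inf.ess_sup_gee => //; apply: nearW => x; exact: abse_ge0.
have sf : s \is a fin_num by rewrite ge0_fin_numE.
exists (fine s); first exact: fine_ge0.
have := ess_sup_inf.ess_sup_ge lam (abse \o (EFin \o ((fun x => frob_norm (g x)) \_ Omega))).
apply: filterS => x /=; rewrite -/s -(fineK sf) lee_fin patchE => + Ox.
rewrite mem_set// ger0_norm ?frob_norm_ge0// => xs i j.
exact: le_trans (entry_le_frob_norm _ _ _) xs.
Qed.

End LpSpaces.

Section L2Convergence.
Context {R : realType} {n : nat}.
Local Notation T := 'rV[R]_n.
Local Notation lam := (@lebesgue_rV R n).
Variable Omega : set T.
Hypothesis oO : open Omega.
Context {a b : nat}.
Implicit Type g : T -> 'M[R]_(a, b).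

Let mO : measurable Omega. Proof. exact: open_measurable_mx. Qed.

Lemma Lp2B g h : Lp Omega 2%:E g -> Lp Omega 2%:E h ->
  Lp Omega 2%:E (fun x => g x - h x).
Proof.
move=> /(Lp2P oO)[mg g2] /(Lp2P oO)[mh h2]; apply/(Lp2P oO).
have mgh : measurable_fun Omega (fun x => g x - h x).
  apply: measurable_fun_mx => // i j.
  rewrite (_ : (fun x => _) = fun x => g x i j - h x i j); last by apply/funext => x; rewrite !mxE.
  by apply: measurable_funB; exact: measurable_fun_coord.
split => //; apply: (@rintg_le _ _ _ _ _ _ (fun x => 2 * frob (g x) (g x) + 2 * frob (h x) (h x))) => //.
- exact: measurable_fun_frob.
- move=> x _; rewrite ger0_norm ?frob_ge0// /frob !mulr_sumr -big_split/=.
  apply: ler_sum => i _; rewrite !mulr_sumr -big_split/=; apply: ler_sum => j _; rewrite !mxE.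
  by have := sqr_ge0 (g x i j + h x i j); nra.
- by apply: rintgD => //; exact: rintgZ.
Qed.

Lemma L2_cvgP (u_ : nat -> T -> 'M[R]_(a, b)) (u : T -> 'M[R]_(a, b)) :
  Lp Omega 2%:E u -> L2_cvg Omega u_ u <-> (forall l, Lp Omega 2%:E (u_ l)) /\
  \int[lam]_(x in Omega) frob (u_ l x - u x) (u_ l x - u x) @[l --> \oo] --> (0 : R).
Proof.
move=> uL; split=> -[uL_ uc]; split => //.
  have uBL l := Lp2B (uL_ l) uL.
  have E l := LpNorm2E oO (uBL l).
  have Ef := funext E; rewrite Ef in uc.
  have sc : Num.sqrt (\int[lam]_(x in Omega) frob (u_ l x - u x) (u_ l x - u x)) @[l --> \oo] --> (0 : R).
    exact: (fine_cvg uc).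
  rewrite (_ : (fun l => _) = fun l => Num.sqrt (\int[lam]_(x in Omega) frob (u_ l x - u x) (u_ l x - u x)) *
      Num.sqrt (\int[lam]_(x in Omega) frob (u_ l x - u x) (u_ l x - u x))).
    by rewrite -(mulr0 0); apply: cvgM; exact: sc.
  apply/funext => l; rewrite -expr2 sqr_sqrtr//; apply: Rintegral_ge0 => x _; exact: frob_ge0.
have uBL l := Lp2B (uL_ l) uL.
have E l := LpNorm2E oO (uBL l).
rewrite (funext E).
apply: cvg_EFin; first by apply: nearW.
rewrite -(@sqrtr0 R).
apply: (cvg_comp _ _ uc); exact: sqrt_continuous.
Qed.

End L2Convergence.

(** * Fundamental lemma and uniqueness of densities and divergences *)

Section Fundamental.
Context {R : realType} {n : nat}.
Local Notation T := 'rV[R]_n.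
Local Notation lam := (@lebesgue_rV R n).
Variable Omega : set T.
Hypothesis oO : open Omega.

Let mO : measurable Omega. Proof. exact: open_measurable_mx. Qed.

Lemma measurable_test_function (U : set T) (phi : T -> R) : test_function U phi ->
  measurable_fun setT phi.
Proof. by move=> [sp _ _]; apply: continuous_measurable_mx; exact: smooth_continuous. Qed.

Lemma rintg_test (D : set T) (f phi : T -> R) : measurable D ->
  lam.-integrable D (EFin \o f) -> test_function Omega phi ->
  lam.-integrable D (EFin \o (fun x => f x * phi x)).
Proof.
move=> mD fi tp; have [M pM] := test_function_bounded tp.
apply: (@rintgM_bounded _ _ _ _ _ _ _ M) => //.
by apply: measurable_funTS; exact: measurable_test_function tp.
Qed.

Lemma rintg_indic_out (f : T -> R) : lam.-integrable Omega (EFin \o f) ->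
  lam.-integrable setT (EFin \o (fun x => f x * \1_Omega x)).
Proof.
move=> fi; apply/(@rintg_zero_out _ _ _ _ Omega) => //.
  by move=> x nO; rewrite indic_out ?mulr0.
apply: (@rintgM_bounded _ _ _ _ _ _ _ 1) => //.
by move=> x _; rewrite ger0_norm ?indic_ge0// indicE lern1 leq_b1.
Qed.

Lemma Rintegral_indic_out (f g : T -> R) :
  \int[lam]_(x in Omega) (f x * g x) = \int[lam]_x (f x * \1_Omega x * g x).
Proof.
rewrite -(@Rintegral_zero_out _ _ _ _ Omega).
  by apply: eq_Rintegral => x /set_mem Ox; rewrite indic_in// mulr1.
by move=> x nO; rewrite indic_out// mulr0 mul0r.
Qed.

(* Test against mollifications of the sign of h, cut off inside Omega. *)
Lemma fundamental_lemma (h : T -> R) : lam.-integrable Omega (EFin \o h) ->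
  (forall phi, test_function Omega phi -> \int[lam]_(x in Omega) (h x * phi x) = 0) ->
  \forall x \ae lam, Omega x -> h x = 0.
Proof.
move=> hi h0; pose h1 x := h x * \1_Omega x.
have h1i : lam.-integrable setT (EFin \o h1) by exact: rintg_indic_out.
have mh1 : measurable_fun setT h1 by exact: rintg_measurable h1i.
have [phi [tphi phi01 phi1]] := cutoffs oO.
pose sg x : R := if 0 <= h1 x then 1 else -1.
have msg : measurable_fun setT sg.
  by apply: measurable_fun_ifT => //; apply: measurable_fun_ler.
have sg1 x : `|sg x| <= 1 by rewrite /sg; case: ifP; rewrite ?normrN normr1.
have h1sg x : h1 x * sg x = `|h1 x|.
  rewrite /sg; case: ifPn => [hx|]; first by rewrite mulr1 ger0_norm.
  by rewrite -ltNge => hx; rewrite mulrN1 ltr0_norm.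
have step k : \int[lam]_x (`|h1 x| * phi k x) = 0.
  have [sp cp pO] := tphi k.
  have pk x : `|phi k x| <= 1 by have /andP[p0 p1] := phi01 k x; rewrite ger0_norm.
  have vi : lam.-integrable setT (EFin \o (fun x => phi k x * sg x)).
    apply: (@rintgM_bounded _ _ _ _ _ _ _ 1) => //.
    apply: bounded_support_integrable; first exact: smooth_continuous.
    exact: test_function_bounded_support (tphi k).
  have v1 x : `|phi k x * sg x| <= 1 by rewrite normrM mulr_ile1.
  rewrite (_ : (fun x => _) = fun x => h1 x * (phi k x * sg x)); last first.
    by apply/funext => x; rewrite -h1sg; ring.
  apply/eqP; rewrite -normr_le0; apply/ler_addgt0Pr => e e0; rewrite add0r.
  have [r r0 rP] := conv_weak_bounded h1i vi v1 e0.
  have [ker [S [kk cS SO KS]]] := @compact_kernel R n Omega oO _ cp pO r r0.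
  have := rP _ kk; rewrite -Rintegral_indic_out h0; first by rewrite sub0r normrN.
  have [sk _ _ kr] := kk.
  apply: (@test_function_intro _ _ _ S) => [||x /conv_support[y [vy ky]]|].
  - by apply: smooth_conv => //; exact: small_bounded_support kr.
  - exact: cS.
  - apply: KS ky; apply: subset_closure => /=.
    by apply: contraNneq vy => ->; rewrite mul0r.
  - exact: SO.
have [|||x _|_ c0] := @Rintegral_dct _ _ _ lam setT (fun k x => `|h1 x| * phi k x) (fun x => `|h1 x|)
  (fun x => `|h1 x|) measurableT.
- move=> k; apply: measurable_funM; first exact: measurableT_comp.
  exact: measurable_test_function (tphi k).
- exact: rintg_norm.
- move=> k x _; rewrite normrM normr_id ler_piMr//.
  by have /andP[p0 p1] := phi01 k x; rewrite ger0_norm.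
- apply: cvg_near_cst; have [Ox|nOx] := pselect (Omega x).
    by apply: filterS (phi1 x Ox) => k ->; rewrite mulr1.
  by apply: nearW => k; rewrite /h1 indic_out// mulr0 normr0 mul0r.
have I0 : \int[lam]_x `|h1 x| = 0.
  by rewrite -(cvg_lim _ c0)// (funext step) lim_cst.
have mEh : measurable_fun setT (EFin \o h1) by exact/measurable_EFinP.
have : ae_eq lam setT (EFin \o h1) (cst 0%E).
  apply/(ae_eq_integral_abs lam measurableT mEh).
  under eq_integral do rewrite /= .
  by rewrite -(EFin_Rintegral measurableT (rintg_norm measurableT h1i)) I0.
apply: filterS => x /(_ Logic.I) /= [hx] Ox.
by rewrite -hx /h1 indic_in// mulr1.
Qed.

Lemma ae_forall_fin (I : finType) (P : I -> T -> Prop) :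
  (forall i, \forall x \ae lam, P i x) -> \forall x \ae lam, forall i, P i x.
Proof. by move=> h; exact: filter_forall. Qed.

Lemma density_unique m (t : (T -> R) -> 'M[R]_(m, n)) (g g' : T -> 'M[R]_(m, n)) :
  Lp Omega 1%:E g -> Lp Omega 1%:E g' -> is_density Omega t g -> is_density Omega t g' ->
  \forall x \ae lam, Omega x -> g x = g' x.
Proof.
move=> /(Lp1P oO)[_ gi] /(Lp1P oO)[_ g'i] dg dg'.
have h (p : 'I_m * 'I_n) : \forall x \ae lam, Omega x -> g x p.1 p.2 - g' x p.1 p.2 = 0.
  apply: fundamental_lemma; first exact: rintgB.
  move=> phi tp; rewrite (_ : (fun x => _) = fun x => g x p.1 p.2 * phi x - g' x p.1 p.2 * phi x).
    by rewrite RintegralB ?(rintg_test _ _ tp)// -dg// -dg'// subrr.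
  by apply/funext => x; rewrite mulrBl.
apply: filterS (ae_forall_fin h) => x hx Ox; apply/matrixP => i j.
by apply/eqP; rewrite -subr_eq0; apply/eqP; exact: (hx (i, j)).
Qed.

Lemma div_unique m (z : T -> 'M[R]_(m, n)) (d d' : T -> 'cV[R]_m) :
  (forall i, lam.-integrable Omega (EFin \o (fun x => d x i 0))) ->
  (forall i, lam.-integrable Omega (EFin \o (fun x => d' x i 0))) ->
  is_div Omega z d -> is_div Omega z d' ->
  \forall x \ae lam, Omega x -> d x = d' x.
Proof.
move=> di d'i zd zd'.
have h (i : 'I_m) : \forall x \ae lam, Omega x -> d x i 0 - d' x i 0 = 0.
  apply: fundamental_lemma; first exact: rintgB.
  move=> phi tp; rewrite (_ : (fun x => _) = fun x => d x i 0 * phi x - d' x i 0 * phi x).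
    by rewrite RintegralB ?(rintg_test _ _ tp)// zd// zd'// subrr.
  by apply/funext => x; rewrite mulrBl.
apply: filterS (ae_forall_fin h) => x hx Ox; apply/colP => i.
by apply/eqP; rewrite -subr_eq0; apply/eqP; exact: hx.
Qed.

End Fundamental.

(** * Functions smooth on the whole space *)

Section SmoothFields.
Context {R : realType} {m n : nat}.
Local Notation T := 'rV[R]_n.
Local Notation lam := (@lebesgue_rV R n).
Variables (Omega : set T) (A : {linear 'M[R]_(m, n) -> 'M[R]_(m, n)}).
Hypothesis oO : open Omega.
Hypothesis bO : bounded_set Omega.

Let mO : measurable Omega. Proof. exact: open_measurable_mx. Qed.

(** Each entry is dominated by the integral of |r| |phi| with r the density, so [riesz_abs] supplies
    the charge. *)
Lemma density_BV (u : T -> 'cV[R]_m) (g : T -> 'M[R]_(m, n)) : Lp Omega 1%:E u ->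
  (forall i j, lam.-integrable Omega (EFin \o (fun x => g x i j))) ->
  is_density Omega (dist_A Omega A u) g -> BV Omega A u.
Proof.
move=> uL gi dg; split => //.
have h (p : 'I_m * 'I_n) : exists nu : {charge set T -> \bar R}, forall phi,
    test_function Omega phi -> dist_A Omega A u phi p.1 p.2 = charge_integral Omega nu phi.
  pose r x := g x p.1 p.2.
  have ri : lam.-integrable Omega (EFin \o r) by exact: gi.
  have rB f : @bounded_meas _ T R f -> lam.-integrable Omega (EFin \o (fun x => r x * f x)).
    by move=> [mf [M fM]]; apply: (@rintgM_bounded _ _ _ _ _ _ _ M) => //; exact: measurable_funTS.
  have arB f : @bounded_meas _ T R f -> lam.-integrable Omega (EFin \o (fun x => `|r x| * f x)).
    move=> [mf [M fM]]; apply: (@rintgM_bounded _ _ _ _ _ _ _ M) => //; last exact: measurable_funTS.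
    exact: rintg_norm.
  have tB f : test_function Omega f -> @bounded_meas _ T R f.
    by move=> tf; split; [exact: measurable_test_function tf|exact: test_function_bounded tf].
  have Bn (f : T -> R^o) : @bounded_meas _ T R f -> @bounded_meas _ T R (fun x => `|f x|).
    move=> [mf [M fM]]; split; first exact: measurableT_comp.
    by exists M => x; rewrite normr_id.
  have [|||||||nu nuP] := @riesz_abs R n Omega mO [set f | test_function Omega f]
    (fun f => \int[lam]_(x in Omega) (r x * f x)) (fun f => \int[lam]_(x in Omega) (`|r x| * f x)).
  - split=> [|c f f' tf tf']; first exact: test_function0.
    by apply: test_functionD => //; exact: test_functionZ.
  - exact: tB.
  - move=> c f f' tf tf'; have fi := rB _ (tB _ tf); have f'i := rB _ (tB _ tf').
    rewrite -RintegralZl// -RintegralD//; last exact: rintgZ.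
    by apply: eq_Rintegral => x _; rewrite -[(_ *: _ + _) x]/(c * f x + f' x); ring.
  - move=> c f f' Bf Bf'; have fi := arB _ Bf; have f'i := arB _ Bf'.
    rewrite -RintegralZl// -RintegralD//; last exact: rintgZ.
    by apply: eq_Rintegral => x _; rewrite -[(_ *: _ + _) x]/(c * f x + f' x); ring.
  - move=> f_ M mf fM f0.
    have [|||x _|_] := @Rintegral_dct _ _ _ lam Omega (fun k x => `|r x| * f_ k x) (fun=> 0)
      (fun x => `|r x| * M) mO.
    + move=> k; apply: measurable_funM; last exact: measurable_funTS.
      by apply: measurableT_comp => //; exact: rintg_measurable ri.
    + by apply: arB; split; [exact: measurable_cst|exists `|M|].
    + by move=> k x _; rewrite normrM normr_id ler_wpM2l.
    + by rewrite -(mulr0 `|r x|); apply: cvgM; [exact: cvg_cst|exact: f0].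
    by rewrite Rintegral_cst// mul0r.
  - move=> f f' Bf Bf' ff; apply: le_Rintegral => //; [exact: arB|exact: arB|].
    by move=> x Ox; rewrite ler_wpM2l// ff.
  - move=> f tf; apply: le_Rintegral => //; first exact: rB (tB _ tf).
      by apply: arB; apply: Bn; exact: tB.
    by move=> x _; rewrite -normrM ler_norm.
  by exists nu => phi tp; rewrite dg// nuP.
have /choice[nu nuP] := h.
by exists (fun i j => nu (i, j)) => phi tp i j; exact: (nuP (i, j)).
Qed.

Definition smooth_vec (v : T -> 'cV[R]_m) := forall i, smooth (fun x => v x i 0).

Definition grad (v : T -> 'cV[R]_m) (x : T) : 'M[R]_(m, n) :=
  \matrix_(i, j) partial j (fun y => v y i 0) x.

Lemma smooth_bounded_on (f : T -> R) : smooth f -> exists M, forall x, Omega x -> `|f x| <= M.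
Proof.
move=> sf; have [N ON] := bounded_sub_cube bO.
have [M fM] := continuous_bounded_compact (@cube_compact R n N) (smooth_continuous sf).
by exists M => x /ON; exact: fM.
Qed.

Lemma smooth_integrable (f : T -> R) : smooth f -> lam.-integrable Omega (EFin \o f).
Proof.
move=> sf; have [M fM] := smooth_bounded_on sf.
apply: (@rintg_bounded _ _ _ _ _ _ M) => //; first exact: lebesgue_rV_lty.
by apply: measurable_funTS; apply: continuous_measurable_mx; exact: smooth_continuous.
Qed.

Lemma grad_smooth v i j : smooth_vec v -> smooth (fun x => grad v x i j).
Proof.
move=> sv; rewrite (_ : (fun x => _) = partial j (fun y => v y i 0)); last first.
  by apply/funext => x; rewrite mxE.
exact: smooth_partial.
Qed.

Lemma A_grad_smooth v i j : smooth_vec v -> smooth (fun x => A (grad v x) i j).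
Proof.
move=> sv; rewrite (_ : (fun x => _) = fun x => \sum_(p : 'I_m * 'I_n) mxc A p.1 p.2 i j * grad v x p.1 p.2).
  by apply: smooth_sum => p; apply: smoothZ; exact: grad_smooth.
by apply/funext => x; rewrite mxc_apply.
Qed.

(** The product v phi has compact support in Omega, so its partials integrate to 0 although v need
    not vanish at the boundary. *)
Lemma smooth_is_density v : smooth_vec v ->
  is_density Omega (dist_A Omega A v) (fun x => A (grad v x)).
Proof.
move=> sv phi tp i j.
have gE (p : 'I_m * 'I_n) : dist_gradient Omega v phi p.1 p.2 =
    \int[lam]_(x in Omega) (grad v x p.1 p.2 * phi x).
  have [sp _ _] := tp.
  have tvp : test_function Omega (fun x => v x p.1 0 * phi x).
    exact: (test_functionMl (sv p.1) tp).
  have E : partial p.2 (fun x => v x p.1 0 * phi x) =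
      fun x => v x p.1 0 * partial p.2 phi x + phi x * partial p.2 (fun x => v x p.1 0) x.
    by apply: partialM => l x; [exact: smooth_derivable (sv _)|exact: smooth_derivable sp].
  have I0 : \int[lam]_(x in Omega) partial p.2 (fun x => v x p.1 0 * phi x) x = 0.
    rewrite Rintegral_zero_out; last first.
      by move=> x; exact: (test_function_out (test_function_partial p.2 tvp)).
    apply: Rintegral_partial; first by case: tvp.
    exact: test_function_bounded_support tvp.
  have i1 : lam.-integrable Omega (EFin \o (fun x => v x p.1 0 * partial p.2 phi x)).
    exact: (smooth_integrable (smoothM (sv p.1) (smooth_partial p.2 sp))).
  have i2 : lam.-integrable Omega (EFin \o (fun x => phi x * partial p.2 (fun x => v x p.1 0) x)).
    exact: (smooth_integrable (smoothM sp (smooth_partial p.2 (sv p.1)))).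
  move: I0; rewrite E RintegralD// => /eqP; rewrite addr_eq0 => /eqP I0.
  rewrite mxE I0 opprK; apply: eq_Rintegral => x _; by rewrite mxE mulrC.
rewrite /dist_A mxc_apply.
rewrite (_ : (fun x => _) = fun x => \sum_(p : 'I_m * 'I_n) mxc A p.1 p.2 i j * (grad v x p.1 p.2 * phi x)).
  have [sp _ _] := tp.
  have gi (p : 'I_m * 'I_n) : lam.-integrable Omega (EFin \o (fun x => grad v x p.1 p.2 * phi x)).
    exact: (smooth_integrable (smoothM (grad_smooth p.1 p.2 sv) sp)).
  rewrite Rintegral_sum//; last by move=> p; exact: rintgZ.
  by apply: eq_bigr => p _; rewrite gE RintegralZl.
by apply/funext => x; rewrite mxc_apply mulr_suml; apply: eq_bigr => p _; rewrite mulrA.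
Qed.

Lemma smooth_bounded_mx a b (g : T -> 'M[R]_(a, b)) : (forall i j, smooth (fun x => g x i j)) ->
  measurable_fun Omega g /\ exists C, forall x i j, Omega x -> `|g x i j| <= C.
Proof.
move=> sg; split.
  apply: measurable_fun_mx => // i j; apply: measurable_funTS.
  by apply: continuous_measurable_mx; exact: smooth_continuous.
have /choice[M MP] (p : 'I_a * 'I_b) := smooth_bounded_on (sg p.1 p.2).
exists (\sum_p `|M p|) => x i j Ox; rewrite (bigD1 (i, j))//=.
rewrite (le_trans (MP (i, j) x Ox))// (le_trans (ler_norm _))// lerDl sumr_ge0//.
Qed.

(** On a bounded set smooth functions and their gradients are bounded, hence in L^r for every r >
    0. *)
Lemma smooth_W (r : R) v : 0 < r -> smooth_vec v -> W Omega A r%:E v /\ Lp Omega 2%:E v.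
Proof.
move=> r0 sv; have sv' (i : 'I_m) (j : 'I_1) : smooth (fun x => v x i j) by rewrite ord1.
have [mv [C vC]] := smooth_bounded_mx sv'.
have [mg [D gD]] := smooth_bounded_mx (fun i j => A_grad_smooth i j sv).
split; last exact: Lp_bounded vC.
split; last by exists (fun x => A (grad v x)); [exact: Lp_bounded gD|exact: smooth_is_density].
apply: (@density_BV v (fun x => A (grad v x))).
- exact: Lp_bounded vC.
- by move=> i j; apply: smooth_integrable; exact: A_grad_smooth.
- exact: smooth_is_density.
Qed.

(** [density_A] is an arbitrary choice among the integrable densities; uniqueness identifies it
    almost everywhere only. *)
Lemma density_A_smooth v : smooth_vec v ->
  \forall x \ae lam, Omega x -> density_A Omega A v x = A (grad v x).
Proof.
move=> sv; have dg := smooth_is_density sv.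
have [mg [D gD]] := smooth_bounded_mx (fun i j => A_grad_smooth i j sv).
have gL : Lp Omega 1%:E (fun x => A (grad v x)) by exact: Lp_bounded gD.
have [dL dd] : Lp Omega 1%:E (density_A Omega A v) /\ is_density Omega (dist_A Omega A v) (density_A Omega A v).
  by rewrite /density_A; case: xgetP => [g _ []//|/(_ (fun x => A (grad v x)))]; case.
exact: (density_unique oO dL gL dd dg).
Qed.

End SmoothFields.

(** * The pairing *)

Lemma cvgr_sum {R : realType} (I : Type) (s : seq I) (f : I -> nat -> R) (l : I -> R) :
  (forall i, f i k @[k --> \oo] --> l i) ->
  \sum_(i <- s) f i k @[k --> \oo] --> \sum_(i <- s) l i.
Proof.
move=> fl; elim: s => [|i s IHs].
  rewrite big_nil (_ : (fun k => _) = fun=> 0); first exact: cvg_cst.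
  by apply/funext => k; rewrite big_nil.
rewrite big_cons (_ : (fun k => _) = fun k => f i k + \sum_(j <- s) f j k).
  by apply: cvgD; [exact: fl|exact: IHs].
by apply/funext => k; rewrite big_cons.
Qed.

Section Pairing.
Context {R : realType} {m n : nat}.
Local Notation T := 'rV[R]_n.
Local Notation lam := (@lebesgue_rV R n).
Variables (Omega : set T) (A : {linear 'M[R]_(m, n) -> 'M[R]_(m, n)}).
Hypothesis oO : open Omega.
Hypothesis bO : bounded_set Omega.
Hypothesis A_sym : forall y y', frob (A y) y' = frob y (A y').
Hypothesis A_proj : forall y, A (A y) = A y.
Implicit Types (u : T -> 'cV[R]_m) (z : T -> 'M[R]_(m, n)) (phi : T -> R).

Let mO : measurable Omega. Proof. exact: open_measurable_mx. Qed.

Lemma rintg_of_sqr (f : T -> R) : measurable_fun Omega f ->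
  lam.-integrable Omega (EFin \o (fun x => f x ^+ 2)) -> lam.-integrable Omega (EFin \o f).
Proof.
move=> mf f2; apply: (@rintg_le _ _ _ _ _ _ (fun x => 1 + f x ^+ 2)) => //.
- by move=> x _; rewrite ler_norml; have := sqr_ge0 (f x - 1); have := sqr_ge0 (f x + 1); nra.
- apply: rintgD => //; apply: (@rintg_bounded _ _ _ _ _ _ 1) => //.
    exact: lebesgue_rV_lty.
  by move=> x _; rewrite normr1.
Qed.

Lemma Lp2_L12 u : Lp Omega 2%:E u -> L12 Omega u.
Proof.
move=> /(Lp2P oO)[mu u2] i; have mui : measurable_fun Omega (fun x => u x i 0).
  exact: measurable_fun_coord.
have ui2 : lam.-integrable Omega (EFin \o (fun x => u x i 0 ^+ 2)).
  apply: (@rintg_le _ _ _ _ _ _ (fun x => frob (u x) (u x))) => //; first exact: measurable_funX.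
  by move=> x _; rewrite ger0_norm ?sqr_ge0// entry_sqr_le_frob.
by split => //; exact: rintg_of_sqr.
Qed.

Lemma L12_Lp1 u : Lp Omega 2%:E u -> Lp Omega 1%:E u.
Proof.
move=> uL; apply/(Lp1P oO); split; first by case: uL.
by move=> i j; rewrite ord1; have [] := Lp2_L12 uL i.
Qed.

(* Same as [field], but tested inside Omega only: no condition on the normal
   trace. *)
Definition tfield z (d : T -> 'cV[R]_m) (C : R) : Prop :=
  [/\ forall i j, measurable_fun setT (fun x => z x i j),
      forall i j x, `|z x i j| <= C, forall x, ~ Omega x -> z x = 0,
      forall x, A (z x) = z x &
      [/\ forall i, lam.-integrable setT (EFin \o (fun x => d x i 0)),
          forall i, lam.-integrable setT (EFin \o (fun x => d x i 0 ^+ 2)) &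
          forall phi, test_function Omega phi -> forall i,
            \int[lam]_x (d x i 0 * phi x) = - \int[lam]_x (\sum_j z x i j * partial j phi x)]].

(** A cutoff inside Omega removes the boundary: phi z has compact support in Omega, hence zero
    normal trace, and is admissible. *)
Lemma tfield_cut z d C M phi : tfield z d C -> test_function Omega phi ->
  (forall x, `|phi x| <= M) ->
  field Omega A (fun x => phi x *: z x) (cut_div phi z d) (M * C) /\
  admissible Omega (fun x => phi x *: z x).
Proof.
move=> [mz zC z0 Az [d1 d2 zd]] tp pM; split.
  have tpT : test_function setT phi by apply: test_function_sub tp.
  apply: (field_cut oO bO tpT pM mz zC z0 Az d1 d2) => psi sp i; apply: zd.
  rewrite (_ : (fun x => _) = fun x => psi x * phi x); last by apply/funext => x; rewrite mulrC.
  exact: (test_functionMl sp tp).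
have [_ cp pO] := tp.
apply: (@admissible_compact _ _ _ _ oO _ _ cp pO) => x.
by rewrite scaler_eq0 negb_or => /andP[px _]; exact: subset_closure.
Qed.

(** The pairing written as minus the integral of u against the divergence of phi z. *)
Definition pair z d u phi := - \int[lam]_(x in Omega) (\sum_i u x i 0 * cut_div phi z d x i 0).

Lemma pair_integrable z d C u phi i : tfield z d C -> L12 Omega u -> test_function Omega phi ->
  lam.-integrable Omega (EFin \o (fun x => u x i 0 * cut_div phi z d x i 0)).
Proof.
move=> zd uL tp; have [M pM] := test_function_bounded tp.
have [[_ _ _ _ [w1 w2 _]] _] := tfield_cut zd tp pM.
by apply: L12_mul => //; exact: rintg_measurable (w1 i).
Qed.

Lemma pair_linear z d C u : tfield z d C -> L12 Omega u -> forall c f g,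
  test_function Omega f -> test_function Omega g ->
  pair z d u (fun x => c * f x + g x) = c * pair z d u f + pair z d u g.
Proof.
move=> zd uL c f g tf tg; rewrite /pair.
have fi : lam.-integrable Omega (EFin \o (fun x => \sum_i u x i 0 * cut_div f z d x i 0)).
  by apply: rintg_sum => // i; exact: pair_integrable zd uL tf.
have gi : lam.-integrable Omega (EFin \o (fun x => \sum_i u x i 0 * cut_div g z d x i 0)).
  by apply: rintg_sum => // i; exact: pair_integrable zd uL tg.
rewrite mulrN -opprD -(RintegralZl _ mO fi) -(RintegralD mO (rintgZ c mO fi) gi).
congr (- _); apply: eq_Rintegral => x _; rewrite mulr_sumr -big_split/=.
apply: eq_bigr => i _; rewrite !mxE.
have sf : smooth f by case: tf. have sg : smooth g by case: tg.
have E j : partial j (fun x => c * f x + g x) x = c * partial j f x + partial j g x.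
  have dcf (l : 'I_n) (y : T) : derivable (fun x => c * f x) y (delta_mx 0 l).
    by apply: smooth_derivable; exact: smoothZ.
  have dg (l : 'I_n) (y : T) : derivable g y (delta_mx 0 l) by exact: smooth_derivable.
  have df (l : 'I_n) (y : T) : derivable f y (delta_mx 0 l) by exact: smooth_derivable.
  have dc (l : 'I_n) (y : T) : derivable (fun=> c : R) y (delta_mx 0 l).
    by apply: smooth_derivable; exact: smooth_cst.
  by rewrite (partialD j dcf dg) (partialM j dc df) partial_cst mulr0 addr0.
under eq_bigr do rewrite E mulrDr.
rewrite big_split/= (eq_bigr (fun j => c * (z x i j * partial j f x))); last by move=> j _; ring.
by rewrite -mulr_sumr; ring.
Qed.

(** [BV_pair] with psi = |phi| bounds the pairing by a multiple of the total variation of Au applied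
    to |phi|; this is why (z, Au) is itself a bounded measure. *)
Lemma pair_charge z d C u : tfield z d C -> Lp Omega 2%:E u -> BV Omega A u ->
  exists nu : {charge set T -> \bar R}, forall phi, test_function Omega phi ->
    pair z d u phi = charge_integral Omega nu phi.
Proof.
move=> zd uL2 [_ [nu nuE]]; have uL := Lp2_L12 uL2.
have [_ zC _ _ _] := zd.
have tB f : test_function Omega f -> @bounded_meas _ T R f.
  by move=> tf; split; [exact: measurable_test_function tf|exact: test_function_bounded tf].
have [C0 C00 zC0] : exists2 C0, 0 <= C0 & forall i j x, `|z x i j| <= C0.
  by exists `|C| => // i j x; rewrite (le_trans (zC i j x))// ler_norm.
pose V (f : T -> R^o) := C0 * \sum_i \sum_j var_integral Omega (nu i j) f.
have [|||||||nu' nu'P] := @riesz_abs R n Omega mO [set f | test_function Omega f] (pair z d u) V.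
- split=> [|c f f' tf tf']; first exact: test_function0.
  by apply: test_functionD => //; exact: test_functionZ.
- exact: tB.
- by move=> c f f' tf tf'; exact: (pair_linear zd uL).
- move=> c f f' Bf Bf'; rewrite /V mulrCA -mulrDr; congr (_ * _).
  rewrite mulr_sumr -big_split/=; apply: eq_bigr => i _.
  rewrite mulr_sumr -big_split/=; apply: eq_bigr => j _.
  exact: (var_integral_linear mO).
- move=> f_ M mf fM f0; have e0 : C0 * (\sum_(i < m) \sum_(j < n) 0) = 0.
    by rewrite big1 ?mulr0// => i _; rewrite big1.
  rewrite -[X in _ --> X]e0; apply: cvgM; first exact: cvg_cst.
  apply: cvgr_sum => i; apply: cvgr_sum => j.
  exact: (var_integral_dct mO _ mf fM f0).
- move=> f f' Bf Bf' ff; rewrite /V ler_wpM2l//; apply: ler_sum => i _; apply: ler_sum => j _.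
  exact: var_integral_le.
- move=> phi tp; have [M pM] := test_function_bounded tp.
  have [fz az] := tfield_cut zd tp pM.
  rewrite (le_trans (ler_norm _))// normrN.
  apply: (BV_pair oO bO A_sym uL fz az nuE) => //.
  + have cp : continuous phi by apply: smooth_continuous; case: tp.
    by move=> x; apply: continuous_comp; [exact: cp|exact: norm_continuous].
  + by exists M => x; rewrite normr_id.
  + by move=> i j x; rewrite mxE normrM mulrC ler_wpM2r.
by exists nu'.
Qed.

Lemma charge_cutoffs (nu : {charge set T -> \bar R}) (phi : nat -> T -> R) :
  (forall k, test_function Omega (phi k)) -> (forall k x, 0 <= phi k x <= 1) ->
  (forall x, Omega x -> \forall k \near \oo, phi k x = 1) ->
  charge_integral Omega nu (phi k) @[k --> \oo] --> fine (nu Omega).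
Proof.
move=> tphi phi01 phi1.
have -> : fine (nu Omega) = charge_integral Omega nu \1_Omega.
  by apply: EFin_inj; rewrite (charge_integral_indic mO nu mO) setIid fineK ?fin_num_measure.
apply: (dct_continuous_lim (M := 1) (charge_integral_linear mO nu) (charge_integral_dct mO nu)).
- by move=> k; exact: measurable_test_function (tphi k).
- exact: measurable_indic.
- by move=> k x; have /andP[p0 p1] := phi01 k x; rewrite ger0_norm.
- by move=> x; rewrite ger0_norm ?indic_ge0// indicE lern1 leq_b1.
- move=> x; apply: cvg_near_cst; have [Ox|nOx] := pselect (Omega x).
    by apply: filterS (phi1 x Ox) => k ->; rewrite indic_in.
  by apply: nearW => k; rewrite indic_out// (test_function_out (tphi k)).
Qed.

Definition clip (C t : R) : R := Num.max (- C) (Num.min t C).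

Lemma clip_le C t : 0 <= C -> `|clip C t| <= C.
Proof. by move=> C0; rewrite ler_norml /clip le_max lexx/= ge_max ge_min lexx orbT andbT; lra. Qed.

Lemma clip_id C t : `|t| <= C -> clip C t = t.
Proof.
rewrite ler_norml => /andP[h1 h2].
by rewrite /clip /Num.min; case: ltP => h3; rewrite /Num.max; case: ltP => h4; lra.
Qed.

Lemma measurable_clip (C : R) (f : T -> R) : measurable_fun setT f ->
  measurable_fun setT (fun x => clip C (f x)).
Proof.
by move=> mf; apply: measurable_maxr; [exact: measurable_cst|apply: measurable_minr].
Qed.

(** Provides a representative whose properties hold at every point. Clipping the entries may destroy
    the invariance under A, so A is applied afterwards; almost everywhere on Omega nothing
    changes. *)
Lemma X2_tfield z : X2 Omega A z -> exists z' d' C, [/\ tfield z' d' C,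
  \forall x \ae lam, Omega x -> z x = z' x &
  forall u phi, L12 Omega u -> test_function Omega phi -> pairing Omega z u phi = pair z' d' u phi].
Proof.
move=> [zoo Az [d dL zd]].
have [C C0 zC] := Lpoo_ae zoo; have [mz _] := zoo.
pose z' x : 'M[R]_(m, n) := A (\matrix_(i, j) clip C (z x i j * \1_Omega x)).
have [dvL dvz] : Lp Omega 2%:E (div Omega z) /\ is_div Omega z (div Omega z).
  by rewrite /div; case: xgetP => [g _ []//|/(_ d)]; case.
pose d' x : 'cV[R]_m := \col_i (div Omega z x i 0 * \1_Omega x).
have mz1 i j : measurable_fun setT (fun x => z x i j * \1_Omega x).
  have mzi : measurable_fun Omega (fun x => z x i j) by exact: measurable_fun_coord.
  have := (measurable_restrictT (fun x => z x i j) mO).1 mzi.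
  congr measurable_fun; apply/funext => x; rewrite patchE.
  have [Ox|nOx] := pselect (Omega x); first by rewrite mem_set// indic_in// mulr1.
  by rewrite memNset// indic_out// mulr0.
have z'E i j x : z' x i j = \sum_(p : 'I_m * 'I_n) mxc A p.1 p.2 i j * clip C (z x p.1 p.2 * \1_Omega x).
  by rewrite /z' mxc_apply; apply: eq_bigr => p _; rewrite mxE.
have mz' i j : measurable_fun setT (fun x => z' x i j).
  under eq_fun do rewrite z'E.
  by apply: measurable_sum => p; apply: measurable_funM => //; exact: measurable_clip.
have zz' : \forall x \ae lam, Omega x -> z x = z' x.
  apply: filterS2 Az zC => x Azx zCx Ox; rewrite -Azx//; congr (A _); apply/matrixP => i j.
  by rewrite mxE indic_in// mulr1 clip_id// zCx.
have d1 i : lam.-integrable setT (EFin \o (fun x => d' x i 0)).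
  under eq_fun do rewrite mxE; apply: rintg_indic_out => //.
  by have [] := Lp2_L12 dvL i.
have d2 i : lam.-integrable setT (EFin \o (fun x => d' x i 0 ^+ 2)).
  have [_ h] := Lp2_L12 dvL i; have := rintg_indic_out oO h.
  congr (lam.-integrable _ _); apply/funext => x /=; congr EFin; rewrite mxE exprMn; congr (_ * _).
  by rewrite indicE; case: (_ \in _); rewrite ?expr1n ?expr0n.
pose C' := \sum_(p : 'I_m * 'I_n) \sum_(q : 'I_m * 'I_n) `|mxc A q.1 q.2 p.1 p.2| * C.
have z'C i j x : `|z' x i j| <= C'.
  rewrite z'E (le_trans (ler_norm_sum _ _ _))//.
  apply: (@le_trans _ _ (\sum_(q : 'I_m * 'I_n) `|mxc A q.1 q.2 i j| * C)).
    by apply: ler_sum => q _; rewrite normrM ler_wpM2l// clip_le.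
  rewrite /C' [leRHS](bigD1 (i, j))//= lerDl.
  by apply: sumr_ge0 => p _; apply: sumr_ge0 => q _; rewrite mulr_ge0.
have zpO (phi : T -> R) i : test_function Omega phi ->
    lam.-integrable Omega (EFin \o (fun x => \sum_j z' x i j * partial j phi x)).
  move=> tp; apply: rintg_sum => // j; apply: (rintg_test mO _ (test_function_partial j tp)).
  apply: (@rintg_bounded _ _ _ _ _ _ C') => //; first exact: lebesgue_rV_lty.
    exact: measurable_funTS.
have zd' : tfield z' d' C'.
  split => //.
  - move=> x nOx; rewrite /z' (_ : \matrix_(i, j) _ = 0) ?linear0//.
    by apply/matrixP => i j; rewrite !mxE indic_out// mulr0 clip_id// normr0.
  - by move=> x; rewrite A_proj.
  split => // phi tp i.
  transitivity (\int[lam]_(x in Omega) (div Omega z x i 0 * phi x)).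
    by rewrite [RHS]Rintegral_indic_out; apply: eq_Rintegral => x _; rewrite mxE.
  rewrite dvz//; congr (- _).
  have -> : \int[lam]_x (\sum_j z' x i j * partial j phi x) =
      \int[lam]_(x in Omega) (\sum_j z' x i j * partial j phi x).
    rewrite [RHS]Rintegral_zero_out// => x nOx; rewrite big1// => j _.
    by rewrite (test_function_out (test_function_partial j tp) nOx) mulr0.
  apply/esym; apply: (proj2 (Rintegral_ae_eq mO (zpO phi i tp) _ _)).
    apply: measurable_sum => j; apply: measurable_funM; first exact: measurable_fun_coord.
    by apply: measurable_funTS; exact: measurable_test_function (test_function_partial j tp).
  by apply: filterS zz' => x zx Ox; rewrite zx.
exists z', d', C'; split => // u phi uL tp; congr (- _); apply/esym.
have ui := fun i => pair_integrable i zd' uL tp.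
apply: (proj2 (Rintegral_ae_eq mO (rintg_sum _ mO ui) _ _)).
  apply: measurable_sum => i; apply: measurable_funD.
    apply: measurable_funM; last by have [/rintg_measurable] := uL i.
    apply: measurable_funM; first by apply: measurable_funTS; exact: measurable_test_function tp.
    by have [/rintg_measurable] := Lp2_L12 dvL i.
  apply: measurable_sum => j; apply: measurable_funM; last by have [/rintg_measurable] := uL i.
  apply: measurable_funM; last exact: measurable_fun_coord.
  by apply: measurable_funTS; exact: measurable_test_function (test_function_partial j tp).
apply: filterS zz' => x zx Ox; apply: eq_bigr => i _; rewrite !mxE indic_in// mulr1.
rewrite mulrDr mulr_sumr; congr (_ + _); first by ring.
by apply: eq_bigr => j _; rewrite zx//; ring.
Qed.

(** Cutoffs recover the mass of Omega from values on test functions, so [pairing_mass] does not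
    depend on the charge that [xget] selects. *)
Lemma pairing_mass_lim z u (phi : nat -> T -> R) : X2 Omega A z -> Lp Omega 2%:E u ->
  BV Omega A u ->
  (forall k, test_function Omega (phi k)) -> (forall k x, 0 <= phi k x <= 1) ->
  (forall x, Omega x -> \forall k \near \oo, phi k x = 1) ->
  exists2 e : R, pairing_mass Omega z u = e%:E &
    pairing Omega z u (phi k) @[k --> \oo] --> e.
Proof.
move=> zX uL uBV tphi phi01 phi1.
have [z' [d' [C [zd zz' zE]]]] := X2_tfield zX.
have [nu nuE] := pair_charge zd uL uBV.
have nuE' psi : test_function Omega psi -> pairing Omega z u psi = charge_integral Omega nu psi.
  by move=> tp; rewrite zE ?nuE//; exact: Lp2_L12.
rewrite /pairing_mass; case: xgetP => [e _ [nu' [nu'E ->]]|]; last first.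
  by move/(_ (nu Omega)); case; exists nu.
exists (fine (nu' Omega)); first by rewrite fineK ?fin_num_measure.
under eq_fun do rewrite nu'E//.
exact: charge_cutoffs.
Qed.

End Pairing.

(** * Total mass of the pairing for zero normal trace *)

Section FieldMass.
Context {R : realType} {m n : nat}.
Local Notation T := 'rV[R]_n.
Local Notation lam := (@lebesgue_rV R n).
Variables (Omega : set T) (A : {linear 'M[R]_(m, n) -> 'M[R]_(m, n)}).
Hypothesis oO : open Omega.
Hypothesis bO : bounded_set Omega.
Hypothesis A_sym : forall y y', frob (A y) y' = frob y (A y').
Hypothesis A_proj : forall y, A (A y) = A y.
Hypothesis lO : lipschitz_boundary Omega.
Implicit Types (u : T -> 'cV[R]_m) (z : T -> 'M[R]_(m, n)) (phi : T -> R).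

Let mO : measurable Omega. Proof. exact: open_measurable_mx. Qed.

Lemma partial_near_cst (f : T -> R) (c : R) j x : (\forall y \near x, f y = c) ->
  partial j f x = 0.
Proof.
move=> fc; pose g : T -> R := fun=> c.
have h : \forall y \near x, g y = f y by apply: filterS fc => y ->.
have [_ d0] := @near_eq_is_derive _ _ _ g f x (delta_mx 0 j) 0 h (is_derive_cst _ _ _).
by rewrite /partial d0.
Qed.

(** Stands in for the constant 1, which lacks compact support when n > 0, in differences with
    cutoffs. *)
Lemma plateau : exists chi : T -> R, [/\ test_function setT chi, forall x, 0 <= chi x <= 1 &
  forall x, Omega x -> chi x = 1].
Proof.
have [k Ok] := bounded_sub_cube bO.
have [|x Kx|N [theta [_ [tt tt0 tt1 t1]]]] :=
  @partition_of_unity R n unit (fun=> setT) (cube k) (@cube_compact R n k).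
- by move=> _; exact: openT.
- by exists tt.
exists (fun x => \sum_a theta a x); split.
- by apply: test_function_sum => a _; exact: tt.
- by move=> x; rewrite tt1 sumr_ge0.
- by move=> x /Ok; exact: t1.
Qed.

Lemma field_tfield z w C : field Omega A z w C -> tfield Omega A z w C.
Proof.
by move=> [? ? ? ? [? ? zw]]; split => //; split => // phi [sp _ _] i; exact: zw.
Qed.

Lemma field_is_div z w C : field Omega A z w C -> is_div Omega z w.
Proof.
move=> [mz zC z0 Az [w1 w2 zw]] phi tp i.
have sp := test_function_smooth tp.
rewrite Rintegral_zero_out; last by move=> x nO; rewrite (test_function_out tp)// mulr0.
rewrite zw//; congr (- _); apply/esym; apply: Rintegral_zero_out => x nO.
by rewrite big1// => j _; rewrite z0// mxE mul0r.
Qed.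

Lemma field_Lp2 z w C : field Omega A z w C -> Lp Omega 2%:E w.
Proof.
move=> [mz zC z0 Az [w1 w2 zw]]; apply/(Lp2P oO); split.
  apply: measurable_fun_mx => // i j; rewrite ord1; apply: measurable_funTS.
  exact: rintg_measurable (w1 i).
rewrite /frob; apply: rintg_sum => // i; apply: rintg_sum => // j; rewrite ord1.
by apply: (@integrableS _ _ _ lam setT) => //; exact: (w2 i).
Qed.

Lemma field_X2 z w C : field Omega A z w C -> X2 Omega A z.
Proof.
move=> zf; have [mz zC z0 Az _] := zf; split.
- apply: (@Lpoo_bounded _ _ _ _ _ C) => //.
  by apply: measurable_fun_mx => // i j; exact: measurable_funTS.
- by apply: nearW => x _; exact: Az.
- by exists w; [exact: field_Lp2 zf|exact: field_is_div zf].
Qed.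

Lemma field_pairing z w C u phi : field Omega A z w C -> L12 Omega u ->
  test_function Omega phi -> pairing Omega z u phi = pair Omega z w u phi.
Proof.
move=> zf uL tp.
have [dvL dvz] : Lp Omega 2%:E (div Omega z) /\ is_div Omega z (div Omega z).
  rewrite /div; case: xgetP => [g _ []//|/(_ w)]; case; split.
    exact: field_Lp2 zf.
  exact: field_is_div zf.
have [mz zC z0 Az [w1 w2 zw]] := zf.
have dw : \forall x \ae lam, Omega x -> div Omega z x = w x.
  apply: (div_unique oO _ _ dvz (field_is_div zf)).
    by move=> i; have [] := Lp2_L12 oO bO dvL i.
  by move=> i; apply: (@integrableS _ _ _ lam setT).
have ui i := pair_integrable oO bO i (field_tfield zf) uL tp.
congr (- _); apply/esym; apply: (proj2 (Rintegral_ae_eq mO (rintg_sum _ mO ui) _ _)).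
  apply: measurable_sum => i; apply: measurable_funD.
    apply: measurable_funM; last by have [/rintg_measurable] := uL i.
    apply: measurable_funM; first by apply: measurable_funTS; exact: measurable_test_function tp.
    by have [/rintg_measurable] := Lp2_L12 oO bO dvL i.
  apply: measurable_sum => j; apply: measurable_funM; last by have [/rintg_measurable] := uL i.
  apply: measurable_funM; last exact: measurable_funTS.
  by apply: measurable_funTS; exact: measurable_test_function (test_function_partial j tp).
apply: filterS dw => x dwx Ox; apply: eq_bigr => i _; rewrite !mxE dwx//.
rewrite mulrDr mulr_sumr; congr (_ + _); first by ring.
by apply: eq_bigr => j _; ring.
Qed.

(* The remaining mass (1 - phi_k) z sees only the variation of Au near the
   boundary, which vanishes in the limit. *)
Lemma field_pairing_mass z w C u : field Omega A z w C -> Lp Omega 2%:E u -> BV Omega A u ->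
  pairing_mass Omega z u = (- \int[lam]_(x in Omega) (\sum_i u x i 0 * w x i 0))%:E.
Proof.
move=> zf uL2 uBV; have uL := Lp2_L12 oO bO uL2.
have [mz zC z0 Az [w1 w2 zw]] := zf.
have [phi [tphi phi01 phi1]] := cutoffs oO.
have [e -> pe] := pairing_mass_lim oO bO A_sym A_proj (field_X2 zf) uL2 uBV tphi phi01 phi1.
have [chi [tchi chi01 chi1]] := plateau.
have [K K0 KP] := BV_pair_global oO bO A_sym lO.
have [_ [nu nuE]] := uBV.
(* On Omega this is 1 - phi_k. It does not vanish towards the boundary, so cutting z by it relies on
   the zero normal trace of z. *)
pose theta k x := chi x - phi k x.
have tth k : test_function setT (theta k).
  rewrite (_ : theta k = fun x => -1 * phi k x + chi x); last by apply/funext => x; rewrite /theta; ring.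
  apply: test_functionD; last exact: tchi.
  by apply: test_functionZ; apply: test_function_sub (tphi k).
have th0 k x : 0 <= theta k x.
  rewrite subr_ge0; have [Ox|nOx] := pselect (Omega x).
    by rewrite chi1//; have /andP[] := phi01 k x.
  by rewrite (test_function_out (tphi k) nOx); have /andP[] := chi01 x.
have th1 k x : `|theta k x| <= 1.
  rewrite ger0_norm// lerBlDr (le_trans (proj2 (andP (chi01 x))))// lerDl.
  by have /andP[] := phi01 k x.
have fth k : field Omega A (fun x => theta k x *: z x) (cut_div (theta k) z w) (1 * C).
  apply: (field_cut oO bO (tth k) (th1 k) mz zC z0 Az w1 w2) => psi sp i; apply: zw.
  by have [sk _ _] := tth k; exact: (smoothM sk sp).
have thE k x i : Omega x -> cut_div (theta k) z w x i 0 = w x i 0 - cut_div (phi k) z w x i 0.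
  move=> Ox; rewrite !mxE opprD addrA; congr (_ + _); first by rewrite /theta chi1//; ring.
  rewrite -sumrN; apply: eq_bigr => j _; rewrite -mulrN; congr (_ * _).
  have dchi (l : 'I_n) (y : T) : derivable chi y (delta_mx 0 l).
    by apply: smooth_derivable; case: tchi.
  have dphi (l : 'I_n) (y : T) : derivable (fun x => -1 * phi k x) y (delta_mx 0 l).
    by apply: smooth_derivable; apply: smoothZ; case: (tphi k).
  have E : partial j (theta k) = fun x => partial j chi x + partial j (fun x => -1 * phi k x) x.
    rewrite -(partialD j dchi dphi); congr partial; apply/funext => y; rewrite /theta; ring.
  rewrite E (@partial_near_cst chi 1) ?add0r; last first.
    have : nbhs x Omega by exact: open_nbhs_nbhs.
    by apply: filterS => y; exact: chi1.
  have dp (l : 'I_n) (y : T) : derivable (phi k) y (delta_mx 0 l).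
    by apply: smooth_derivable; case: (tphi k).
  have dc (l : 'I_n) (y : T) : derivable (fun=> -1 : R) y (delta_mx 0 l).
    by apply: smooth_derivable; exact: smooth_cst.
  by rewrite (partialM j dc dp) partial_cst; ring.
pose S := \int[lam]_(x in Omega) (\sum_i u x i 0 * w x i 0).
have uwi i : lam.-integrable Omega (EFin \o (fun x => u x i 0 * w x i 0)).
  by apply: L12_mul => //; exact: rintg_measurable (w1 i).
have ui k i := pair_integrable oO bO i (field_tfield zf) uL (tphi k).
have diffE k : pairing Omega z u (phi k) + S =
    \int[lam]_(x in Omega) (\sum_i u x i 0 * cut_div (theta k) z w x i 0).
  rewrite (field_pairing zf)// /pair addrC -RintegralB//; [|exact: rintg_sum|exact: rintg_sum].
  apply: eq_Rintegral => x /set_mem Ox; rewrite -sumrB; apply: eq_bigr => i _.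
  by rewrite thE// mulrBr.
(* The indicator does not affect integrals over Omega, and it makes the convergence to 0 pointwise
   on the whole space, as [dct_continuous] asks. *)
pose V k := K * (`|C| * \sum_i \sum_j var_integral Omega (nu i j) (fun x => \1_Omega x * theta k x)).
have bd k : `|pairing Omega z u (phi k) + S| <= V k.
  rewrite diffE; apply: (le_trans (KP _ _ _ _ _ (theta k) `|C| uL (fth k) nuE _ _ _ _)) => //.
  - by apply: smooth_continuous; case: (tth k).
  - by exists 1.
  - move=> i j x; rewrite mxE normrM mulrC (ger0_norm (th0 k x)) ler_wpM2r//.
    by rewrite (le_trans (zC i j x))// ler_norm.
  rewrite ler_wpM2l// ler_wpM2l//; apply: ler_sum => i _; apply: ler_sum => j _.
  have Bth : @bounded_meas _ T R (theta k).
    by split; [exact: measurable_test_function (tth k)|exists 1].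
  apply: var_integral_le => //.
    split; first by apply: measurable_funM; [exact: measurable_indic|case: Bth].
    by exists 1 => x; rewrite normrM mulr_ile1// ger0_norm ?indic_ge0// indicE lern1 leq_b1.
  by move=> x Ox; rewrite indic_in// mul1r.
have Vc : V k @[k --> \oo] --> (0 : R).
  have e0 : K * (`|C| * (\sum_(i < m) \sum_(j < n) 0)) = 0.
    by rewrite big1 ?mulr0// => i _; rewrite big1.
  rewrite -[X in _ --> X]e0; apply: cvgM; first exact: cvg_cst.
  apply: cvgM; first exact: cvg_cst.
  apply: cvgr_sum => i; apply: cvgr_sum => j.
  apply: (var_integral_dct mO (nu i j) (M := 1)).
  - by move=> k; apply: measurable_funM; [exact: measurable_indic|exact: measurable_test_function (tth k)].
  - by move=> k x; rewrite normrM mulr_ile1// ger0_norm ?indic_ge0// indicE lern1 leq_b1.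
  - move=> x; apply: cvg_near_cst; have [Ox|nOx] := pselect (Omega x); last first.
      by apply: nearW => k; rewrite indic_out// mul0r.
    by apply: filterS (phi1 x Ox) => k pk; rewrite /theta chi1// pk subrr mulr0.
have c0 : pairing Omega z u (phi k) + S @[k --> \oo] --> (0 : R).
  apply/norm_cvg0P; apply: (@squeeze_cvgr _ _ _ _ (fun=> 0) V) => //.
  - by apply: nearW => k; rewrite normr_ge0 bd.
  - exact: cvg_cst.
have c1 : pairing Omega z u (phi k) + S @[k --> \oo] --> e + S.
  by apply: cvgD; [exact: pe|exact: cvg_cst].
have : e + S = 0 by rewrite -(cvg_lim _ c1)// (cvg_lim _ c0).
by move/eqP; rewrite addr_eq0 => /eqP ->.
Qed.

End FieldMass.

(** * The dual energy bounds the relaxed energy from below *)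

Lemma limn_einf_ge {R : realType} (u : nat -> \bar R) (a : R) :
  (forall e : R, 0 < e -> \forall l \near \oo, ((a - e)%:E <= u l)%E) ->
  (a%:E <= limn_einf u)%E.
Proof.
move=> h; rewrite limn_einf_lim; have -> : limn (einfs u) = ereal_sup (range (einfs u)).
  by apply/cvg_lim => //; exact: cvg_einfs_sup.
apply/lee_subgt0Pr => e e0; have [N _ NP] := h e e0.
apply: (@le_trans _ _ (einfs u N)); last by apply: ereal_sup_ubound; exists N.
rewrite -EFinB; apply: le_ereal_inf_tmp => _ [k /= Nk <-]; exact: NP.
Qed.

Lemma limn_einf_le {R : realType} (u : nat -> \bar R) (a : R) :
  (forall e : R, 0 < e -> \forall l \near \oo, (u l <= (a + e)%:E)%E) ->
  (limn_einf u <= a%:E)%E.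
Proof.
move=> h; rewrite limn_einf_lim; have -> : limn (einfs u) = ereal_sup (range (einfs u)).
  by apply/cvg_lim => //; exact: cvg_einfs_sup.
apply: ge_ereal_sup => _ [N _ <-]; apply/lee_addgt0Pr => e e0.
have [N' _ NP] := h e e0; apply: (@le_trans _ _ (u (maxn N N'))).
  by apply: ereal_inf_lbound; exists (maxn N N') => //=; rewrite leq_maxl.
by rewrite -EFinD; apply: NP; rewrite /= leq_maxr.
Qed.

Lemma limn_einf_lty {R : realType} (u : nat -> \bar R) : (limn_einf u < +oo)%E ->
  exists B : R, forall N, exists2 l, (N <= l)%N & (u l <= B%:E)%E.
Proof.
rewrite limn_einf_lim; have -> : limn (einfs u) = ereal_sup (range (einfs u)).
  by apply/cvg_lim => //; exact: cvg_einfs_sup.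
move=> soo; have [B sB] : exists B : R, (ereal_sup (range (einfs u)) < B%:E)%E.
  case: (ereal_sup _) soo => [r _|//|_]; last by exists 0; exact: ltNyr.
  by exists (r + 1); rewrite lte_fin ltrDl.
exists B => N; have iB : (einfs u N < B%:E)%E.
  by apply: le_lt_trans sB; apply: ereal_sup_ubound; exists N.
have [_ [l /= Nl <-] lB] : exists2 y, [set u k | k in [set k | (N <= k)%N]] y & (y < B%:E)%E.
  by apply/ereal_inf_lt.
by exists l => //; exact: ltW.
Qed.

Lemma real_lim_le {R : realType} (a : nat -> R) (l : R) (X : \bar R) :
  a k @[k --> \oo] --> l -> (forall k, ((a k)%:E <= X)%E) -> (l%:E <= X)%E.
Proof.
move=> al; case: X => [r||] h; last by have := h 0%N.
  rewrite lee_fin -(cvg_lim _ al)//; apply: limr_le; first by apply/cvg_ex; exists l.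
  by apply: nearW => k; have := h k; rewrite lee_fin.
by rewrite leey.
Qed.

Section LowerBound.
Context {R : realType} {m n : nat}.
Local Notation T := 'rV[R]_n.
Local Notation lam := (@lebesgue_rV R n).
Variables (Omega : set T) (A : {linear 'M[R]_(m, n) -> 'M[R]_(m, n)}).
Hypothesis oO : open Omega.
Hypothesis bO : bounded_set Omega.
Hypothesis A_sym : forall y y', frob (A y) y' = frob y (A y').
Hypothesis A_proj : forall y, A (A y) = A y.
Variable f : T -> 'M[R]_(m, n) -> R.
Hypothesis f_ge0 : forall x y, closure Omega x -> 0 <= f x y.
Hypothesis f_borel : measurable_fun (closure Omega `*` [set: 'M[R]_(m, n)])
                 (fun xy => f xy.1 xy.2).
Variables (c0 C0 : R).
Hypothesis c0_gt0 : 0 < c0.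
Hypothesis C0_gt0 : 0 < C0.
Hypothesis f_growth : forall x y, closure Omega x ->
       c0 * frob_norm (A y) <= f x y /\ f x y <= C0 * (1 + frob_norm (A y)).
Implicit Types (u : T -> 'cV[R]_m) (z g : T -> 'M[R]_(m, n)) (phi : T -> R).

Let mO : measurable Omega. Proof. exact: open_measurable_mx. Qed.

(** Measurability of f is known on a product set only; extending g by 0 first makes x |-> (x, g x) a
    measurable map into the product space. *)
Lemma measurable_fun_f g : measurable_fun Omega g -> measurable_fun Omega (fun x => f x (g x)).
Proof.
move=> mg.
have mE : measurable (closure Omega `*` [set: 'M[R]_(m, n)]).
  apply: measurableX => //; rewrite -[closure _]setCK; apply: measurableC.
  by apply: open_measurable_mx; apply: closed_openC; exact: closed_closure.
pose g0 x : 'M[R]_(m, n) := \matrix_(i, j) ((fun x => g x i j) \_ Omega) x.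
have g0E x : Omega x -> g0 x = g x.
  by move=> Ox; apply/matrixP => i j; rewrite mxE patchE mem_set.
have mg0 : measurable_fun setT g0.
  apply: measurable_fun_mx => // i j; under eq_fun do rewrite mxE.
  by apply/(measurable_restrictT _ mO); exact: measurable_fun_coord.
have mh : measurable_fun Omega (fun x => f x (g0 x)).
  apply: (measurable_comp mE _ f_borel (g := fun x => (x, g0 x))).
  - by move=> _ [x Ox <-]; split => //; exact: subset_closure.
  - apply: measurable_funTS; apply/measurable_fun_pairP; split; first exact: measurable_id.
    exact: mg0.
by apply: eq_measurable_fun mh => x /set_mem Ox; rewrite g0E.
Qed.

Lemma A_integrable g i j : (forall i j, lam.-integrable Omega (EFin \o (fun x => g x i j))) ->
  lam.-integrable Omega (EFin \o (fun x => A (g x) i j)).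
Proof.
move=> gi; rewrite (_ : (fun x => _) = fun x => \sum_(p : 'I_m * 'I_n) mxc A p.1 p.2 i j * g x p.1 p.2).
  by apply: rintg_sum => // p; exact: rintgZ.
by apply/funext => x; rewrite mxc_apply.
Qed.

Lemma f_integrable g : Lp Omega 1%:E g -> lam.-integrable Omega (EFin \o (fun x => f x (g x))).
Proof.
move=> /(Lp1P oO)[mg gi].
apply: (@rintg_le _ _ _ _ _ _ (fun x => C0 * (1 + sum_norm (A (g x))))) => //.
- exact: measurable_fun_f.
- move=> x Ox; have cx := subset_closure Ox; rewrite ger0_norm ?f_ge0//.
  rewrite (le_trans (proj2 (f_growth (g x) cx)))// ler_wpM2l ?(ltW C0_gt0)//.
  by rewrite lerD2l frob_norm_le_sum.
apply: rintgZ => //; apply: rintgD => //.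
  apply: (@rintg_bounded _ _ _ _ _ _ 1) => //; first exact: lebesgue_rV_lty.
  by move=> x _; rewrite normr1.
apply: rintg_sum => // i; apply: rintg_sum => // j; apply: rintg_norm => //.
exact: A_integrable.
Qed.

Lemma energyE u : W Omega A 1%:E u -> [/\ Lp Omega 1%:E (density_A Omega A u),
  is_density Omega (dist_A Omega A u) (density_A Omega A u) &
  energy Omega A f u = (\int[lam]_(x in Omega) f x (density_A Omega A u x))%:E].
Proof.
move=> [_ [g gL dg]].
have [dL dd] : Lp Omega 1%:E (density_A Omega A u) /\ is_density Omega (dist_A Omega A u) (density_A Omega A u).
  by rewrite /density_A; case: xgetP => [h _ []//|/(_ g)]; case.
by split => //; rewrite EFin_Rintegral//; exact: f_integrable.
Qed.

Lemma L2_weak_cvg (u_ : nat -> T -> 'cV[R]_m) u (w : T -> 'cV[R]_m) :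
  L2_cvg Omega u_ u -> Lp Omega 2%:E u ->
  (forall i, lam.-integrable setT (EFin \o (fun x => w x i 0))) ->
  (forall i, lam.-integrable setT (EFin \o (fun x => w x i 0 ^+ 2))) ->
  \int[lam]_(x in Omega) (\sum_i u_ l x i 0 * w x i 0) @[l --> \oo] -->
  \int[lam]_(x in Omega) (\sum_i u x i 0 * w x i 0).
Proof.
move=> /(L2_cvgP oO) uc uL w1 w2; have [uL_ {}uc] := uc uL.
have mw i : measurable_fun setT (fun x => w x i 0) by exact: rintg_measurable (w1 i).
have ui l i : lam.-integrable Omega (EFin \o (fun x => u_ l x i 0 * w x i 0)).
  by apply: L12_mul => //; exact: Lp2_L12.
have ui' i : lam.-integrable Omega (EFin \o (fun x => u x i 0 * w x i 0)).
  by apply: L12_mul => //; exact: Lp2_L12.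
have wi : lam.-integrable Omega (EFin \o (fun x => \sum_i w x i 0 ^+ 2)).
  by apply: rintg_sum => // i; apply: (@integrableS _ _ _ lam setT) => //; exact: w2.
set Wn := \int[lam]_(x in Omega) (\sum_i w x i 0 ^+ 2).
have W0 : 0 <= Wn by apply: Rintegral_ge0 => x _; apply: sumr_ge0 => i _; exact: sqr_ge0.
pose D l := \int[lam]_(x in Omega) frob (u_ l x - u x) (u_ l x - u x).
(* Young's inequality with a free weight t plays the part of Cauchy-Schwarz; t is taken proportional
   to e below. *)
have bd l (t : R) : 0 < t ->
    `|\int[lam]_(x in Omega) (\sum_i u x i 0 * w x i 0) -
      \int[lam]_(x in Omega) (\sum_i u_ l x i 0 * w x i 0)| <= t * Wn + t^-1 * D l.
  move=> t0; rewrite -RintegralB//; [|exact: rintg_sum|exact: rintg_sum].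
  have Di : lam.-integrable Omega (EFin \o (fun x => frob (u_ l x - u x) (u_ l x - u x))).
    by have [] := (Lp2P oO _).1 (Lp2B oO (uL_ l) uL).
  rewrite /Wn /D -!RintegralZl// -RintegralD//; [|exact: rintgZ|exact: rintgZ].
  apply: Rintegral_le_bound => //.
  - by apply: rintgB => //; exact: rintg_sum.
  - by apply: rintgD => //; exact: rintgZ.
  move=> x _; rewrite -sumrB (le_trans (ler_norm_sum _ _ _))//.
  rewrite /frob !mulr_sumr -big_split/=; apply: ler_sum => i _; rewrite big_ord1 !mxE.
  rewrite -mulrBl normrM -[in leRHS](real_normK (num_real (w x i 0))).
  rewrite -[X in _ + _ * X]expr2 -[in leRHS](real_normK (num_real (_ - u x i 0))) distrC.
  set p := `|_ - u x i 0|; set q := `|w x i 0|.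
  have : 0 <= t^-1 * (p - t * q) ^+ 2 + t^-1 * p ^+ 2 + t * q ^+ 2.
    by rewrite !addr_ge0// mulr_ge0 ?sqr_ge0 ?invr_ge0 ?ltW.
  have -> : t^-1 * (p - t * q) ^+ 2 + t^-1 * p ^+ 2 + t * q ^+ 2 =
     2 * (t * q ^+ 2 + t^-1 * p ^+ 2 - p * q) by field; rewrite gt_eqF.
  by rewrite pmulr_rge0// subr_ge0.
apply/cvgrPdist_le => e e0.
have t0 : 0 < e / (2 * (Wn + 1)) by rewrite divr_gt0// mulr_gt0// ltr_wpDl.
set t := e / (2 * (Wn + 1)) in t0.
have te : 0 < t * (e / 2) by rewrite mulr_gt0// divr_gt0.
move/cvgrPdist_le : uc => /(_ _ te); apply: filterS => l; rewrite sub0r normrN => Dl.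
apply: (le_trans (bd l t t0)); rewrite (splitr e) lerD//.
  rewrite /t -mulrA ler_pM2l// ler_pdivrMl ?mulr_gt0 ?ltr_wpDl//.
  by rewrite mulrAC divff ?mul1r ?lerDl// gt_eqF.
by rewrite ler_pdivrMl// (le_trans (ler_norm _)).
Qed.

(** z may have a nonzero normal trace, so the inequality is localised by a cutoff phi' with values
    in [0, 1]; since f is nonnegative, phi' f <= f. For fixed phi' the pairing is continuous along
    [u_], and afterwards phi' tends to 1. *)
Lemma lower_bound z u (u_ : nat -> T -> 'cV[R]_m) : calZ Omega A f z ->
  BV Omega A u -> Lp Omega 2%:E u -> (forall l, W Omega A 1%:E (u_ l)) -> L2_cvg Omega u_ u ->
  (\int[lam]_(x in Omega) (- legendre f x (z x)) + pairing_mass Omega z u <=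
   limn_einf (fun l => energy Omega A f (u_ l)))%E.
Proof.
move=> [zX Li] uBV uL2 uW uc.
have [z' [d' [C [zd zz' zE]]]] := X2_tfield oO bO A_proj zX.
have [phi [tphi phi01 phi1]] := cutoffs oO.
have [e -> pe] := pairing_mass_lim oO bO A_sym A_proj zX uL2 uBV tphi phi01 phi1.
(* A real-valued representative of the transform, whose integrability gives finiteness almost
   everywhere only. *)
pose L x := fine (legendre f x (z x)).
have Lfin : \forall x \ae lam, Omega x -> legendre f x (z x) \is a fin_num.
  exact: (integrable_ae mO Li).
have mLe : measurable_fun Omega (fun x => legendre f x (z x)) by case/integrableP : Li.
have mL : measurable_fun Omega L by apply: (measurableT_comp (f := @fine R)).
have LE : ae_eq lam Omega (fun x => legendre f x (z x)) (EFin \o L).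
  by apply: filterS Lfin => x h Ox; rewrite /= fineK// h.
have LiR : lam.-integrable Omega (EFin \o L).
  apply: (le_integrable mO _ _ Li); first exact/measurable_EFinP.
  by move=> x _; rewrite /= /L; case: (legendre f x (z x)) => [r||] /=; rewrite ?normr0 ?leey.
have -> : (\int[lam]_(x in Omega) (- legendre f x (z x)) = (- \int[lam]_(x in Omega) L x)%:E)%E.
  rewrite EFinN EFin_Rintegral// -integralN; last first.
    by apply: fin_num_adde_defr; rewrite ?integrable_neg_fin_num ?integrable_pos_fin_num.
  apply: ae_eq_integral => //.
  - exact: measurableT_comp.
  - by apply: measurableT_comp => //; exact/measurable_EFinP.
  - by apply: filterS LE => x h Ox; rewrite h.
have uL := Lp2_L12 oO bO uL2.
have key phi' : test_function Omega phi' -> (forall x, 0 <= phi' x <= 1) ->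
    ((pair Omega z' d' u phi' - \int[lam]_(x in Omega) (phi' x * L x))%:E <=
      limn_einf (fun l => energy Omega A f (u_ l)))%E.
  move=> tp p01; have p1 x : `|phi' x| <= 1.
    by have /andP[p0 ?] := p01 x; rewrite ger0_norm.
  have [fz az] := tfield_cut oO bO zd tp p1.
  have [_ _ _ _ [w1 w2 _]] := fz.
  have [uL_ _] := uc.
  have Pc : pair Omega z' d' (u_ l) phi' @[l --> \oo] --> pair Omega z' d' u phi'.
    by apply: cvgN; exact: L2_weak_cvg.
  have pL : lam.-integrable Omega (EFin \o (fun x => phi' x * L x)).
    rewrite (_ : (fun x => _) = fun x => L x * phi' x); last by apply/funext => x; rewrite mulrC.
    exact: rintg_test tp.
  apply: limn_einf_ge => eps eps0.
  move/cvgrPdist_le : Pc => /(_ _ eps0); apply: filterS => l Pl.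
  have [gL gd ->] := energyE (uW l).
  have [mg gi] := (Lp1P oO _).1 gL.
  rewrite lee_fin; apply: (@le_trans _ _ (pair Omega z' d' (u_ l) phi' - \int[lam]_(x in Omega) (phi' x * L x))).
    by move: Pl; rewrite ler_norml => /andP[_]; lra.
  rewrite /pair -(W_pair oO bO A_sym (Lp2_L12 oO bO (uL_ l)) fz az gi gd).
  set g := density_A Omega A (u_ l).
  have gzi (p : 'I_m * 'I_n) : lam.-integrable Omega (EFin \o (fun x => g x p.1 p.2 * (phi' x *: z' x) p.1 p.2)).
    have [mfz fzC _ _ _] := fz.
    apply: (@rintgM_bounded _ _ _ _ _ _ _ (1 * C)) => //.
    by apply: measurable_funTS; exact: mfz.
  rewrite pair_bigA/= -(Rintegral_sum _ mO gzi) -RintegralB//; last exact: rintg_sum.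
  have Fi : lam.-integrable Omega (EFin \o (fun x => \sum_(p : 'I_m * 'I_n) g x p.1 p.2 * (phi' x *: z' x) p.1 p.2 - phi' x * L x)).
    by apply: rintgB => //; exact: rintg_sum.
  have mf := measurable_fun_f mg.
  (* The minimum makes the comparison with f hold at every point, while it changes the integrand
     only on a null set. *)
  pose F' x := Num.min (\sum_(p : 'I_m * 'I_n) g x p.1 p.2 * (phi' x *: z' x) p.1 p.2 - phi' x * L x) (f x (g x)).
  have [F'i ->] : lam.-integrable Omega (EFin \o F') /\
      \int[lam]_(x in Omega) (\sum_(p : 'I_m * 'I_n) g x p.1 p.2 * (phi' x *: z' x) p.1 p.2 - phi' x * L x) =
      \int[lam]_(x in Omega) F' x.
    apply: Rintegral_ae_eq => //.
      by apply: measurable_minr => //; exact: rintg_measurable Fi.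
    apply: filterS2 zz' Lfin => x zx Lx Ox; rewrite /F'; apply/esym/min_idPl.
    have cx := subset_closure Ox.
    have fL : frob (z x) (g x) - f x (g x) <= L x.
      rewrite -lee_fin fineK ?Lx//; apply: ereal_sup_ubound; by exists (g x).
    have -> : \sum_(p : 'I_m * 'I_n) g x p.1 p.2 * (phi' x *: z' x) p.1 p.2 = phi' x * frob (z x) (g x).
      rewrite /frob pair_bigA/= mulr_sumr; apply: eq_bigr => p _; rewrite mxE zx//; ring.
    rewrite -mulrBr (@le_trans _ _ (phi' x * f x (g x)))//.
      by rewrite ler_wpM2l//; [have /andP[] := p01 x|lra].
    by rewrite ler_piMl ?f_ge0//; have /andP[] := p01 x.
  apply: le_Rintegral => //; first exact: f_integrable.
  by move=> x _; rewrite /F' ge_min lexx orbT.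
have Ic : \int[lam]_(x in Omega) (phi k x * L x) @[k --> \oo] --> \int[lam]_(x in Omega) L x.
  have [|||x Ox|//] := @Rintegral_dct _ _ _ lam Omega (fun k x => phi k x * L x) L (fun x => `|L x|) mO.
  - move=> k; apply: measurable_funM => //; apply: measurable_funTS.
    exact: measurable_test_function (tphi k).
  - exact: rintg_norm.
  - move=> k x _; rewrite normrM ler_piMl//.
    by have /andP[p0 ?] := phi01 k x; rewrite ger0_norm.
  - by apply: cvg_near_cst; apply: filterS (phi1 x Ox) => k ->; rewrite mul1r.
have ac : (pair Omega z' d' u (phi k) - \int[lam]_(x in Omega) (phi k x * L x)) @[k --> \oo] -->
    e - \int[lam]_(x in Omega) L x.
  apply: cvgB; last exact: Ic.
  by rewrite (_ : (fun k => pair Omega z' d' u (phi k)) = fun k => pairing Omega z u (phi k))//;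
    apply/funext => k; rewrite zE.
rewrite addeC -EFinD.
apply: (real_lim_le ac) => k; exact: (key _ (tphi k) (phi01 k)).
Qed.

Lemma dist_gradient_cvg u (u_ : nat -> T -> 'cV[R]_m) phi i j : Lp Omega 2%:E u ->
  L2_cvg Omega u_ u -> test_function Omega phi ->
  dist_A Omega A (u_ l) phi i j @[l --> \oo] --> dist_A Omega A u phi i j.
Proof.
move=> uL2 uc tp; rewrite /dist_A.
rewrite (_ : (fun l => _) = fun l => \sum_(p : 'I_m * 'I_n)
  mxc A p.1 p.2 i j * dist_gradient Omega (u_ l) phi p.1 p.2); last by apply/funext => l; exact: mxc_apply.
rewrite mxc_apply; apply: cvgr_sum => p; apply: cvgM; first exact: cvg_cst.
pose w x : 'cV[R]_m := \col_i ((i == p.1)%:R * partial p.2 phi x).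
have wE v : dist_gradient Omega v phi p.1 p.2 = - \int[lam]_(x in Omega) (\sum_i v x i 0 * w x i 0).
  rewrite mxE; congr (- _); apply: eq_Rintegral => x _.
  rewrite (bigD1 p.1)//= big1 ?addr0; last by move=> k kp; rewrite mxE (negbTE kp) mul0r mulr0.
  by rewrite mxE eqxx mul1r.
rewrite wE (_ : (fun l => _) = fun l => - \int[lam]_(x in Omega) (\sum_i u_ l x i 0 * w x i 0)).
  have tpp := test_function_partial p.2 tp.
  have pi : lam.-integrable setT (EFin \o partial p.2 phi).
    apply: bounded_support_integrable; last exact: test_function_bounded_support tpp.
    by apply: smooth_continuous; case: tpp.
  have [M pM] := test_function_bounded tpp.
  apply: cvgN; apply: L2_weak_cvg => // k.
    by under eq_fun do rewrite mxE; apply: rintgZ.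
  under eq_fun do rewrite mxE exprMn; apply: rintgZ => //.
  rewrite (_ : (fun x => _) = fun x => partial p.2 phi x * partial p.2 phi x); last first.
    by apply/funext => x; rewrite expr2.
  apply: (@rintgM_bounded _ _ _ _ _ _ _ M) => //.
  exact: measurable_test_function tpp.
by apply/funext => l; rewrite wE.
Qed.

Lemma dist_A_linear u i j : L12 Omega u -> forall (c : R) (g h : T -> R), test_function Omega g ->
  test_function Omega h ->
  dist_A Omega A u (fun x => c * g x + h x) i j = c * dist_A Omega A u g i j + dist_A Omega A u h i j.
Proof.
move=> uL c g h tg th.
have E0 psi : dist_A Omega A u psi i j =
    \sum_(p : 'I_m * 'I_n) mxc A p.1 p.2 i j * dist_gradient Omega u psi p.1 p.2.
  exact: mxc_apply.
pose G (psi : T -> R) := \sum_(p : 'I_m * 'I_n) mxc A p.1 p.2 i j * dist_gradient Omega u psi p.1 p.2.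
transitivity (c * G g + G h); last by congr (_ * _ + _); apply/esym; exact: E0.
apply: (etrans (E0 _)); rewrite /G mulr_sumr -big_split/=.
apply: eq_bigr => p _.
pose H psi := - \int[lam]_(x in Omega) (u x p.1 0 * partial p.2 psi x).
have HE psi : dist_gradient Omega u psi p.1 p.2 = H psi by exact: mxE.
transitivity (mxc A p.1 p.2 i j * (c * H g + H h)); last first.
  transitivity (c * (mxc A p.1 p.2 i j * H g) + mxc A p.1 p.2 i j * H h); first by rewrite mulrDr [_ * (c * _)]mulrCA.
  by congr (_ * (_ * _) + _ * _); apply/esym; exact: HE.
congr (_ * _); apply: (etrans (HE _)); rewrite /H.
have gi : lam.-integrable Omega (EFin \o (fun x => u x p.1 0 * partial p.2 g x)).
  by apply: (rintg_test mO _ (test_function_partial p.2 tg)); have [] := uL p.1.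
have hi : lam.-integrable Omega (EFin \o (fun x => u x p.1 0 * partial p.2 h x)).
  by apply: (rintg_test mO _ (test_function_partial p.2 th)); have [] := uL p.1.
have E x : partial p.2 (fun x => c * g x + h x) x = c * partial p.2 g x + partial p.2 h x.
  have sg := test_function_smooth tg. have sh := test_function_smooth th.
  have dcg (l : 'I_n) (y : T) : derivable (fun x => c * g x) y (delta_mx 0 l).
    by apply: smooth_derivable; exact: smoothZ.
  have dg (l : 'I_n) (y : T) : derivable g y (delta_mx 0 l) by exact: smooth_derivable.
  have dh (l : 'I_n) (y : T) : derivable h y (delta_mx 0 l) by exact: smooth_derivable.
  have dc (l : 'I_n) (y : T) : derivable (fun=> c : R) y (delta_mx 0 l).
    by apply: smooth_derivable; exact: smooth_cst.
  by rewrite (partialD p.2 dcg dh) (partialM p.2 dc dg) partial_cst mulr0 addr0.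
have -> : \int[lam]_(x in Omega) (u x p.1 0 * partial p.2 (fun x => c * g x + h x) x) =
    c * \int[lam]_(x in Omega) (u x p.1 0 * partial p.2 g x) +
    \int[lam]_(x in Omega) (u x p.1 0 * partial p.2 h x).
  rewrite -RintegralZl// -RintegralD//; last exact: rintgZ.
  by apply: eq_Rintegral => x _; rewrite E mulrDr mulrCA.
by rewrite opprD mulrN.
Qed.

(** Energies stay below B for infinitely many l, and coercivity then bounds [dist_A] of [u_ l]
    uniformly on test functions of size 1. The bound passes to the limit, and [riesz_bounded] yields
    the measure. *)
Lemma BV_of_bounded_energy u (u_ : nat -> T -> 'cV[R]_m) : Lp Omega 2%:E u ->
  (forall l, W Omega A 1%:E (u_ l)) -> L2_cvg Omega u_ u ->
  (limn_einf (fun l => energy Omega A f (u_ l)) < +oo)%E -> BV Omega A u.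
Proof.
move=> uL2 uW uc /limn_einf_lty[B BP].
split; first exact: L12_Lp1.
have bd phi i j : test_function Omega phi -> (forall x, `|phi x| <= 1) ->
    `|dist_A Omega A u phi i j| <= c0^-1 * B.
  move=> tp p1; apply/ler_addgt0Pr => e e0.
  have Tc : dist_A Omega A (u_ l) phi i j @[l --> \oo] --> dist_A Omega A u phi i j.
    exact: dist_gradient_cvg.
  move/cvgrPdist_le : Tc => /(_ _ e0)[N _ NP].
  have [l Nl lB] := BP N; have := NP l Nl => /= dl.
  have [gL gd gE] := energyE (uW l); move: lB; rewrite gE lee_fin => lB.
  have [mg gi] := (Lp1P oO _).1 gL.
  set g := density_A Omega A (u_ l) in gL gd lB mg gi.
  have Agi := fun i j => A_integrable i j gi.
  (* By A A = A the density g may be replaced by A g, the part that coercivity controls. *)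
  have E : dist_A Omega A (u_ l) phi i j = \int[lam]_(x in Omega) (A (g x) i j * phi x).
    transitivity (A (dist_A Omega A (u_ l) phi) i j); first by rewrite /dist_A A_proj.
    rewrite mxc_apply; have gpi (p : 'I_m * 'I_n) : lam.-integrable Omega (EFin \o (fun x => g x p.1 p.2 * phi x)).
      exact: (rintg_test mO (gi p.1 p.2) tp).
    transitivity (\int[lam]_(x in Omega) \sum_(p : 'I_m * 'I_n) mxc A p.1 p.2 i j * (g x p.1 p.2 * phi x)).
      rewrite Rintegral_sum//; last by move=> p; exact: rintgZ.
      by apply: eq_bigr => p _; rewrite gd// RintegralZl.
    by apply: eq_Rintegral => x _; rewrite mxc_apply mulr_suml; apply: eq_bigr => p _; rewrite mulrA.
  have E1 : `|dist_A Omega A (u_ l) phi i j| <= c0^-1 * B.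
    rewrite E; apply: (@le_trans _ _ (\int[lam]_(x in Omega) (c0^-1 * f x (g x)))).
      apply: Rintegral_le_bound => //.
      - exact: (rintg_test mO (Agi i j) tp).
      - by apply: rintgZ => //; exact: f_integrable.
      move=> x Ox; have [h _] := f_growth (g x) (subset_closure Ox).
      rewrite ler_pdivlMl// (le_trans _ h)// ler_pM2l// normrM.
      by rewrite (le_trans _ (entry_le_frob_norm _ i j))// ler_piMr.
    by rewrite RintegralZl ?ler_pM2l ?invr_gt0//; exact: f_integrable.
  rewrite -(subrK (dist_A Omega A (u_ l) phi i j) (dist_A Omega A u phi i j)).
  by rewrite addrC (le_trans (ler_normD _ _))// lerD.
have h (p : 'I_m * 'I_n) : exists nu : {charge set T -> \bar R}, forall phi,
    test_function Omega phi -> dist_A Omega A u phi p.1 p.2 = charge_integral Omega nu phi.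
  apply: (@riesz_bounded R n Omega (fun phi => dist_A Omega A u phi p.1 p.2) (c0^-1 * B) oO).
    by move=> c g h tg th; apply: dist_A_linear => //; exact: Lp2_L12.
  by move=> phi tp p1; exact: bd.
have /choice[nu nuP] := h.
by exists (fun i j => nu (i, j)) => phi tp i j; exact: (nuP (i, j)).
Qed.

End LowerBound.

(** * Duality for the penalised problem *)

Lemma monotone_limit_le d (T : measurableType d) {R : realType}
    (mu : {measure set T -> \bar R}) (D : set T) (g : nat -> T -> R) (G : T -> \bar R) (B : R) :
  measurable D -> (forall k, measurable_fun D (g k)) ->
  (forall k x, D x -> 0 <= g k x) ->
  (forall x, D x -> {homo (fun k => g k x) : i j / (i <= j)%N >-> i <= j}) ->
  (forall x, D x -> ((g k x)%:E @[k --> \oo] --> G x)%E) ->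
  (forall k, (\int[mu]_(x in D) (g k x)%:E <= B%:E)%E) ->
  measurable_fun D G /\ (\int[mu]_(x in D) G x <= B%:E)%E.
Proof.
move=> mD mg g0 gnd gG gB.
have mEg k : measurable_fun D (fun x => (g k x)%:E) by exact/measurable_EFinP.
split; first exact: (emeasurable_fun_cvg (fun k x => (g k x)%:E)).
have -> : (\int[mu]_(x in D) G x = \int[mu]_(x in D) limn (fun k => (g k x)%:E))%E.
  by apply: eq_integral => x /set_mem Dx; apply/esym/cvg_lim => //; exact: gG.
rewrite monotone_convergence//.
apply: lime_le; last by apply: nearW.
apply: ereal_nondecreasing_is_cvgn => i j ij; apply: ge0_le_integral => // x Dx; rewrite ?lee_fin ?g0//.
exact: gnd.
Qed.

(** * Functionals represented by densities *)

Section Densities.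
Context {R : realType} {n : nat}.
Local Notation T := 'rV[R]_n.
Local Notation lam := (@lebesgue_rV R n).
Variable Omega : set T.
Hypothesis oO : open Omega.
Hypothesis bO : bounded_set Omega.

Let mO : measurable Omega. Proof. exact: open_measurable_mx. Qed.

Local Notation bm := (@bounded_meas _ T R).

Lemma bounded_measN (f : T -> R) : bm f -> bm (fun x => - f x).
Proof. by move=> [mf [M fM]]; split; [exact: measurableT_comp|exists M => x; rewrite normrN]. Qed.

Lemma bounded_measM (f g : T -> R) : bm f -> bm g -> bm (fun x => f x * g x).
Proof.
move=> [mf [M fM]] [mg [N gN]]; split; first exact: measurable_funM.
by exists (M * N) => x; rewrite normrM ler_pM.
Qed.

Lemma bounded_measZ (c : R) (f : T -> R) : bm f -> bm (fun x => c * f x).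
Proof. by move=> Bf; have := subspaceZ c (@bounded_meas_subspace _ T R) Bf; exact. Qed.

Lemma bounded_meas_integrable (f g : T -> R) : lam.-integrable setT (EFin \o f) -> bm g ->
  lam.-integrable setT (EFin \o (fun x => f x * g x)).
Proof. by move=> fi [mg [M gM]]; apply: (@rintgM_bounded _ _ _ _ _ _ _ M). Qed.

Lemma bounded_meas_integrable_on (g : T -> R) : bm g -> lam.-integrable Omega (EFin \o g).
Proof.
move=> [mg [M gM]]; apply: (@rintg_bounded _ _ _ _ _ _ M) => //; first exact: lebesgue_rV_lty.
exact: measurable_funTS.
Qed.

Lemma density_linear (rho : T -> R) : lam.-integrable setT (EFin \o rho) ->
  linear_on bm (fun h => \int[lam]_x (rho x * h x)).
Proof.
move=> ri c f g Bf Bg; have fi := bounded_meas_integrable ri Bf.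
have gi := bounded_meas_integrable ri Bg.
rewrite -RintegralZl// -RintegralD//; last exact: rintgZ.
by apply: eq_Rintegral => x _; rewrite -[(_ *: _ + _) x]/(c * f x + g x); ring.
Qed.

Lemma density_dct (rho : T -> R) : lam.-integrable setT (EFin \o rho) ->
  @dct_continuous _ T R (fun h => \int[lam]_x (rho x * h x)).
Proof.
move=> ri f_ M mf fM f0.
have [|||x _|_] := @Rintegral_dct _ _ _ lam setT (fun k x => rho x * f_ k x) (fun=> 0)
  (fun x => `|rho x| * M) measurableT.
- by move=> k; apply: measurable_funM => //; exact: rintg_measurable ri.
- apply: bounded_meas_integrable; first exact: rintg_norm.
  by split; [exact: measurable_cst|exists `|M|].
- by move=> k x _; rewrite normrM ler_wpM2l.
- by rewrite -(mulr0 (rho x)); apply: cvgM; [exact: cvg_cst|exact: f0].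
by rewrite Rintegral_cst// mul0r.
Qed.

(** The functional defines a charge that vanishes on null sets; its Radon-Nikodym derivative, made
    real valued and cut to Omega, represents the functional on indicators and hence everywhere. *)
Lemma density_of_functional (I : (T -> R^o) -> R) : linear_on bm I -> dct_continuous I ->
  (forall E, measurable E -> lam (E `&` Omega) = 0%E -> I \1_E = 0) ->
  exists rho : T -> R, [/\ lam.-integrable setT (EFin \o rho), forall x, ~ Omega x -> rho x = 0 &
    forall h, bm h -> I h = \int[lam]_x (rho x * h x)].
Proof.
move=> lI dI I0; have sB := @bounded_meas_subspace _ T R.
have [nu nuE] := charge_of_functional lI dI.
have dom : nu `<< (@lebesgue_sf R n).
  move=> E; rewrite /null_set => E0 B mB BE; rewrite nuE// I0//.
  by apply: E0; [exact: measurableI|move=> x [/BE]].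
pose f := Radon_Nikodym nu (@lebesgue_sf R n).
have ffin x : f x \is a fin_num by exact: Radon_Nikodym_fin_num.
have fi : lam.-integrable setT f.
  have /integrableP[mf foo] := Radon_Nikodym_integrable dom.
  by apply/integrableP; split; [exact: mf|exact: foo].
have fE E : measurable E -> nu E = (\int[lam]_(x in E) f x)%E.
  by move=> mE; exact: Radon_Nikodym_integral.
pose r x := fine (f x).
have rE : EFin \o r = f by apply/funext => x; rewrite /= /r fineK.
have ri : lam.-integrable setT (EFin \o r) by rewrite rE.
pose rho x := r x * \1_Omega x.
have rhoi : lam.-integrable setT (EFin \o rho).
  by apply: bounded_meas_integrable => //; exact: bounded_meas_indic.
exists rho; split => //; first by move=> x nO; rewrite /rho indic_out// mulr0.
apply: dct_functional_ext => //; [exact: density_linear|exact: density_dct|].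
move=> E mE; have mEO : measurable (E `&` Omega) by exact: measurableI.
transitivity (I \1_(E `&` Omega)).
  have mED : measurable (E `\` Omega) by exact: measurableD.
  have -> : \1_E = (\1_(E `&` Omega) + \1_(E `\` Omega) : T -> R^o).
    apply/funext => x; rewrite -[RHS]/(\1_(E `&` Omega) x + \1_(E `\` Omega) x).
    have [Ex|nEx] := pselect (E x); last by rewrite !indic_out ?addr0// => -[].
    have [Ox|nOx] := pselect (Omega x).
      by rewrite (indic_in _ Ex) indic_in// indic_out ?addr0// => -[].
    by rewrite (indic_in _ Ex) indic_out ?indic_in ?add0r// => -[].
  rewrite (linear_onD sB lI); [|exact: bounded_meas_indic|exact: bounded_meas_indic].
  rewrite (I0 _ mED) ?addr0// (_ : (E `\` Omega) `&` Omega = set0) ?measure0//.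
  by rewrite setDE -setIA setICl setI0.
apply: EFin_inj; rewrite -nuE// fE//.
have -> : (fun x => rho x * \1_E x) = (fun x => r x * \1_(E `&` Omega) x).
  apply/funext => x; rewrite /rho -mulrA; congr (_ * _).
  by rewrite indicI mulrC.
rewrite EFin_Rintegral//; last by apply: bounded_meas_integrable => //; exact: bounded_meas_indic.
rewrite -rE [LHS]integral_mkcond; apply: eq_integral => x _; rewrite patchE /=.
have [Ex|nEx] := pselect ((E `&` Omega) x).
  by rewrite mem_set// indic_in// mulr1.
by rewrite memNset// indic_out// mulr0.
Qed.

(** Testing with the sign of rho on the set where |rho| > C shows that the integral of |rho| - C
    over this set is nonpositive. *)
Lemma bounded_density (rho : T -> R) (C : R) : 0 <= C ->
  lam.-integrable setT (EFin \o rho) -> (forall x, ~ Omega x -> rho x = 0) ->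
  (forall h, bm h -> \int[lam]_x (rho x * h x) <= C * \int[lam]_(x in Omega) `|h x|) ->
  \forall x \ae lam, `|rho x| <= C.
Proof.
move=> C0 ri rO rC; have mr := rintg_measurable ri.
have mar : measurable_fun setT (fun x => `|rho x|) by exact: measurableT_comp.
pose E := [set x | C < `|rho x|].
have mE : measurable E by exact: measurable_superlevel.
have EO : E `<=` Omega.
  by move=> x Ex; apply: contrapT => /rO rx; move: Ex; rewrite /E/= rx normr0 ltNge C0.
pose sg x : R := if 0 <= rho x then 1 else -1.
have msg : measurable_fun setT sg.
  by apply: measurable_fun_ifT => //; apply: measurable_fun_ler.
have Bsg : bm sg.
  by split => //; exists 1 => x; rewrite /sg; case: ifP; rewrite ?normrN normr1.
have BE : bm \1_E by exact: bounded_meas_indic.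
have rsg x : rho x * sg x = `|rho x|.
  rewrite /sg; case: ifPn => [hx|]; first by rewrite mulr1 ger0_norm.
  by rewrite -ltNge => hx; rewrite mulrN1 ltr0_norm.
have i1 : lam.-integrable setT (EFin \o (fun x => `|rho x| * \1_E x)).
  by apply: bounded_meas_integrable => //; exact: rintg_norm.
have i2 : lam.-integrable setT (EFin \o (\1_E : T -> R)).
  apply/(@rintg_zero_out _ _ _ _ Omega) => //.
    by move=> x nO; rewrite indic_out// => /EO.
  exact: bounded_meas_integrable_on.
have h := rC _ (bounded_measM Bsg BE).
have le0 : \int[lam]_x (`|rho x| * \1_E x - C * \1_E x) <= 0.
  rewrite RintegralB//; last exact: rintgZ.
  rewrite subr_le0 RintegralZl//.
  move: h; rewrite (_ : (fun x => rho x * (sg x * \1_E x)) = fun x => `|rho x| * \1_E x); last first.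
    by apply/funext => x; rewrite mulrA rsg.
  move=> /le_trans; apply; rewrite ler_wpM2l// Rintegral_zero_out; last first.
    by move=> x nO; rewrite indic_out ?mulr0 ?normr0// => /EO.
  rewrite le_eqVlt; apply/orP; left; apply/eqP; apply: eq_Rintegral => x _.
  have [Ex|nEx] := pselect (E x); last by rewrite indic_out// mulr0 normr0.
  by rewrite indic_in// mulr1 /sg; case: ifP; rewrite ?normrN normr1.
have k0 x : 0 <= `|rho x| * \1_E x - C * \1_E x.
  have [Ex|nEx] := pselect (E x); last by rewrite indic_out// !mulr0 subrr.
  by rewrite indic_in// !mulr1 subr_ge0 ltW.
have ki : lam.-integrable setT (EFin \o (fun x => `|rho x| * \1_E x - C * \1_E x)).
  by apply: rintgB => //; exact: rintgZ.
have I0 : \int[lam]_x (`|rho x| * \1_E x - C * \1_E x) = 0.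
  by apply/eqP; rewrite eq_le le0 Rintegral_ge0.
have mk : measurable_fun setT (EFin \o (fun x => `|rho x| * \1_E x - C * \1_E x)).
  by case/integrableP : ki.
have : ae_eq lam setT (EFin \o (fun x => `|rho x| * \1_E x - C * \1_E x)) (cst 0%E).
  apply/(ae_eq_integral_abs lam measurableT mk).
  transitivity (\int[lam]_x (`|rho x| * \1_E x - C * \1_E x)%:E)%E.
    by apply: eq_integral => x _; rewrite /= ger0_norm.
  by rewrite -EFin_Rintegral// I0.
apply: filterS => x /(_ Logic.I) /= [hx]; rewrite leNgt; apply/negP => Ex.
by move: hx; rewrite indic_in// !mulr1 => /eqP; rewrite subr_eq0 => /eqP e; rewrite e ltxx in Ex.
Qed.

End Densities.

Section SumNorm.
Context {R : realType} {m n : nat}.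
Implicit Types y : 'M[R]_(m, n).

Lemma sum_normD y y' : sum_norm (y + y') <= sum_norm y + sum_norm y'.
Proof.
rewrite /sum_norm -big_split/=; apply: ler_sum => i _; rewrite -big_split/=.
by apply: ler_sum => j _; rewrite mxE ler_normD.
Qed.

Lemma sum_normZ (c : R) y : sum_norm (c *: y) = `|c| * sum_norm y.
Proof.
rewrite /sum_norm mulr_sumr; apply: eq_bigr => i _; rewrite mulr_sumr.
by apply: eq_bigr => j _; rewrite mxE normrM.
Qed.

Lemma sum_norm0 : sum_norm (0 : 'M[R]_(m, n)) = 0.
Proof. by rewrite /sum_norm big1// => i _; rewrite big1// => j _; rewrite mxE normr0. Qed.

End SumNorm.

(** * Convexity and growth of the integrand *)

Section Integrand.
Context {R : realType} {m n : nat}.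
Local Notation T := 'rV[R]_n.
Local Notation lam := (@lebesgue_rV R n).
Variables (Omega : set T) (A : {linear 'M[R]_(m, n) -> 'M[R]_(m, n)}).
Variable f : T -> 'M[R]_(m, n) -> R.
Hypothesis f_ge0 : forall x y, closure Omega x -> 0 <= f x y.
Hypothesis f_convex : forall x, closure Omega x -> convex_function setT (f x).
Variables (c0 C0 : R).
Hypothesis C0_gt0 : 0 < C0.
Hypothesis f_growth : forall x y, closure Omega x ->
       c0 * frob_norm (A y) <= f x y /\ f x y <= C0 * (1 + frob_norm (A y)).

Lemma f_conv x (t : R) y y' : closure Omega x -> 0 <= t -> t <= 1 ->
  f x (t *: y + (1 - t) *: y') <= t * f x y + (1 - t) * f x y'.
Proof.
move=> cx t0 t1.
exact: (f_convex cx (Itv01 t0 t1) (mem_set (Logic.I : setT y)) (mem_set (Logic.I : setT y'))).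
Qed.

(* Compare with the far point y + q / t, where only the growth bound matters, and
   let t tend to 0. *)
Lemma f_lipschitz x y q : closure Omega x -> f x (y + q) <= f x y + C0 * sum_norm (A q).
Proof.
move=> cx; have K0 : 0 <= C0 * (1 + sum_norm (A y)).
  by rewrite mulr_ge0 ?(ltW C0_gt0)// addr_ge0// sum_norm_ge0.
apply: (@le_eta _ _ _ _ K0) => eta eta0.
pose t := Num.min eta 1; have t0 : 0 < t by rewrite lt_min eta0 ltr01.
have t1 : t <= 1 by rewrite ge_min lexx orbT.
have E : y + q = t *: (y + t^-1 *: q) + (1 - t) *: y.
  rewrite scalerDr scalerA divff ?gt_eqF// scale1r scalerBl scale1r.
  by rewrite [RHS]addrC addrA subrK.
have := @f_conv x t (y + t^-1 *: q) y cx (ltW t0) t1; rewrite -E => h.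
have [_ g] := f_growth (y + t^-1 *: q) cx.
have g' : f x (y + t^-1 *: q) <= C0 * (1 + sum_norm (A y) + t^-1 * sum_norm (A q)).
  apply: (le_trans g); rewrite ler_wpM2l ?(ltW C0_gt0)// -addrA lerD2l.
  rewrite (le_trans (frob_norm_le_sum _))// linearD linearZ (le_trans (sum_normD _ _))//.
  by rewrite sum_normZ gtr0_norm ?invr_gt0.
apply: (le_trans h).
have fy := f_ge0 y cx.
apply: (@le_trans _ _ (t * (C0 * (1 + sum_norm (A y) + t^-1 * sum_norm (A q))) + f x y)).
  rewrite lerD//; first by rewrite ler_pM2l.
  by rewrite mulrBl mul1r lerBlDr lerDl mulr_ge0// ltW.
set a := sum_norm (A y) in K0 *; set b := sum_norm (A q).
have -> : t * (C0 * (1 + a + t^-1 * b)) = C0 * (1 + a) * t + C0 * b by field; rewrite gt_eqF.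
have : C0 * (1 + a) * t <= C0 * (1 + a) * eta by rewrite ler_wpM2l// ge_min lexx.
lra.
Qed.

End Integrand.

(** * The perturbed value function and its subgradient *)

Section ValueFunction.
Context {R : realType} {m n : nat}.
Local Notation T := 'rV[R]_n.
Local Notation lam := (@lebesgue_rV R n).
Variables (Omega : set T) (A : {linear 'M[R]_(m, n) -> 'M[R]_(m, n)}).
Hypothesis oO : open Omega.
Hypothesis bO : bounded_set Omega.
Variable f : T -> 'M[R]_(m, n) -> R.
Hypothesis f_ge0 : forall x y, closure Omega x -> 0 <= f x y.
Hypothesis f_borel : measurable_fun (closure Omega `*` [set: 'M[R]_(m, n)])
                 (fun xy => f xy.1 xy.2).
Hypothesis f_convex : forall x, closure Omega x -> convex_function setT (f x).
Variables (c0 C0 : R).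
Hypothesis C0_gt0 : 0 < C0.
Hypothesis f_growth : forall x y, closure Omega x ->
       c0 * frob_norm (A y) <= f x y /\ f x y <= C0 * (1 + frob_norm (A y)).
Variables (u : T -> 'cV[R]_m) (K : R).
Hypothesis uL2 : Lp Omega 2%:E u.
Hypothesis K0 : 0 < K.

Let mO : measurable Omega. Proof. exact: open_measurable_mx. Qed.
Let uL : L12 Omega u. Proof. exact: Lp2_L12. Qed.

Local Notation bm := (@bounded_meas _ T R).
Local Notation X := ((T -> 'M[R]_(m, n)) * (T -> 'cV[R]_m))%type.

(** The first component perturbs the gradient, the second the fidelity. Boundedness keeps every
    perturbed energy finite and leads to functionals that define charges. *)
Definition bounded_pair : set X := fun x =>
  (forall (i : 'I_m) (j : 'I_n), bm (fun y : T => (x.1 y : 'M[R]_(m, n)) i j)) /\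
  (forall i : 'I_m, bm (fun y : T => (x.2 y : 'cV[R]_m) i 0)).

Lemma bounded_pair_subspace : subspace bounded_pair.
Proof.
have sB := @bounded_meas_subspace _ T R.
split=> [|c x y [x1 x2] [y1 y2]].
  split=> [i j|i].
    by rewrite (_ : (fun y => _) = 0); [case: sB|apply/funext => y; rewrite mxE].
  by rewrite (_ : (fun y => _) = 0); [case: sB|apply/funext => y; rewrite mxE].
split=> [i j|i].
  rewrite (_ : (fun _ => _) = c *: (fun y => x.1 y i j) + (fun t => y.1 t i j)).
    exact: sB.2.
  by apply/funext => t; rewrite !mxE.
rewrite (_ : (fun _ => _) = c *: (fun y => x.2 y i 0) + (fun t => y.2 t i 0)).
  exact: sB.2.
by apply/funext => t; rewrite !mxE.
Qed.

Definition stored_energy (v : T -> 'cV[R]_m) (x : X) :=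
  \int[lam]_(y in Omega) f y (A (grad v y) + x.1 y).

Definition fidelity (v : T -> 'cV[R]_m) (x : X) :=
  \int[lam]_(y in Omega) (\sum_i (v y i 0 - u y i 0 + x.2 y i 0) ^+ 2).

Definition perturbed_energy (v : T -> 'cV[R]_m) (x : X) := stored_energy v x + K * fidelity v x.

Lemma field_Lp1 (v : T -> 'cV[R]_m) (x : X) : smooth_vec v -> bounded_pair x ->
  Lp Omega 1%:E (fun y => A (grad v y) + x.1 y).
Proof.
move=> sv [x1 x2]; have vi i j : lam.-integrable Omega (EFin \o (fun y => A (grad v y) i j + x.1 y i j)).
  apply: rintgD => //; last exact: bounded_meas_integrable_on.
  by apply: smooth_integrable => //; exact: A_grad_smooth.
apply/(Lp1P oO); split=> [|i j]; last by under eq_fun do rewrite mxE; exact: vi.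
apply: measurable_fun_mx => // i j; under eq_fun do rewrite mxE.
exact: rintg_measurable (vi i j).
Qed.

Lemma stored_integrable v x : smooth_vec v -> bounded_pair x ->
  lam.-integrable Omega (EFin \o (fun y => f y (A (grad v y) + x.1 y))).
Proof. by move=> sv Bx; apply: (f_integrable oO bO f_ge0 f_borel C0_gt0 f_growth); exact: field_Lp1. Qed.

Lemma sqrD_integrable (g h : T -> R) : measurable_fun Omega g -> measurable_fun Omega h ->
  lam.-integrable Omega (EFin \o (fun y => g y ^+ 2)) ->
  lam.-integrable Omega (EFin \o (fun y => h y ^+ 2)) ->
  lam.-integrable Omega (EFin \o (fun y => (g y + h y) ^+ 2)).
Proof.
move=> mg mh g2 h2; apply: (@rintg_le _ _ _ _ _ _ (fun y => 2 * g y ^+ 2 + 2 * h y ^+ 2)) => //.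
- by apply: measurable_funX; exact: measurable_funD.
- by move=> y _; rewrite ger0_norm ?sqr_ge0//; have := sqr_ge0 (g y - h y); nra.
- by apply: rintgD => //; exact: rintgZ.
Qed.

Lemma vu_sqr_integrable v i : smooth_vec v ->
  measurable_fun Omega (fun y => v y i 0 - u y i 0) /\
  lam.-integrable Omega (EFin \o (fun y => (v y i 0 - u y i 0) ^+ 2)).
Proof.
move=> sv; have [u1 u2] := uL i; have mu := rintg_measurable u1.
have mv : measurable_fun Omega (fun y => v y i 0).
  by apply: rintg_measurable; apply: smooth_integrable (sv i).
split; first exact: measurable_funB.
apply: (@sqrD_integrable (fun y => v y i 0) (fun y => - u y i 0)) => //.
  exact: measurableT_comp.
  rewrite (_ : (fun y => _) = fun y => v y i 0 * v y i 0); last by apply/funext => y; rewrite expr2.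
  exact: (smooth_integrable oO bO (smoothM (sv i) (sv i))).
by rewrite (_ : (fun y => _) = fun y => u y i 0 ^+ 2)//; apply/funext => y; rewrite sqrrN.
Qed.

Lemma penalty_integrable1 v x i : smooth_vec v -> bounded_pair x ->
  lam.-integrable Omega (EFin \o (fun y => (v y i 0 - u y i 0 + x.2 y i 0) ^+ 2)).
Proof.
move=> sv [x1 x2]; have [mvu vu2] := vu_sqr_integrable i sv.
apply: sqrD_integrable => //; first by apply: measurable_funTS; case: (x2 i).
rewrite (_ : (fun y => _) = fun y => x.2 y i 0 * x.2 y i 0); last by apply/funext => y; rewrite expr2.
by apply: bounded_meas_integrable_on => //; exact: bounded_measM.
Qed.

Lemma penalty_integrable v x : smooth_vec v -> bounded_pair x ->
  lam.-integrable Omega (EFin \o (fun y => \sum_i (v y i 0 - u y i 0 + x.2 y i 0) ^+ 2)).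
Proof. by move=> sv Bx; apply: rintg_sum => // i; exact: penalty_integrable1. Qed.

Lemma stored_ge0 v x : 0 <= stored_energy v x.
Proof. by apply: Rintegral_ge0 => y Oy; apply: f_ge0; exact: subset_closure. Qed.

Lemma penalty_ge0 v x : 0 <= fidelity v x.
Proof. by apply: Rintegral_ge0 => y Oy; apply: sumr_ge0 => i _; exact: sqr_ge0. Qed.

Lemma value_of_ge0 v x : 0 <= perturbed_energy v x.
Proof. by rewrite addr_ge0 ?stored_ge0// mulr_ge0 ?penalty_ge0// ltW. Qed.

Definition value_function (x : X) := inf [set perturbed_energy v x | v in smooth_vec].

Lemma smooth_vec0 : smooth_vec (fun=> 0 : 'cV[R]_m) (n := n).
Proof.
move=> i; rewrite (_ : (fun x => _) = fun=> 0); first exact: smooth_cst.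
by apply/funext => x; rewrite mxE.
Qed.

Lemma value_has_inf x : has_inf [set perturbed_energy v x | v in smooth_vec].
Proof.
split; first by exists (perturbed_energy (fun=> 0) x); exists (fun=> 0) => //; exact: smooth_vec0.
by exists 0 => _ [v _ <-]; exact: value_of_ge0.
Qed.

Lemma value_le v x : smooth_vec v -> value_function x <= perturbed_energy v x.
Proof. by move=> sv; apply: ge_inf; [by case: (value_has_inf x)|exists v]. Qed.

Lemma value_near x (e : R) : 0 < e -> exists2 v, smooth_vec v & perturbed_energy v x < value_function x + e.
Proof.
by move=> e0; have [_ [v sv <-] vx] := inf_adherent e0 (value_has_inf x); exists v.
Qed.

Lemma smooth_vec_comb (c d : R) (v v' : T -> 'cV[R]_m) : smooth_vec v -> smooth_vec v' ->
  smooth_vec (fun y => c *: v y + d *: v' y).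
Proof.
move=> sv sv' i; rewrite (_ : (fun x => _) = fun x => c * v x i 0 + d * v' x i 0).
  by apply: smoothD; apply: smoothZ.
by apply/funext => x; rewrite !mxE.
Qed.

Lemma grad_comb (c d : R) (v v' : T -> 'cV[R]_m) y : smooth_vec v -> smooth_vec v' ->
  grad (fun y => c *: v y + d *: v' y) y = c *: grad v y + d *: grad v' y.
Proof.
move=> sv sv'; apply/matrixP => i j; rewrite !mxE.
pose F (b : bool) x := if b then v x i 0 else v' x i 0.
have sF b : smooth (F b) by case: b; [exact: sv|exact: sv'].
have := partial_lincomb [:: true; false] (fun b : bool => if b then c else d) j sF.
rewrite (_ : (fun x => _) = fun x => (c *: v x + d *: v' x) i 0); last first.
  by apply/funext => x; rewrite !big_cons big_nil addr0 !mxE.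
by move=> ->; rewrite !big_cons big_nil addr0.
Qed.

(** The energy is jointly convex in (v, x), because v and the perturbations enter affinely; the
    infimum over v remains convex, with near-minimisers in place of minimisers. *)
Lemma value_convex : convex_on bounded_pair value_function.
Proof.
move=> t x x' /andP[t0 t1] Bx Bx'; have t0' := ltW t0. have t1' := ltW t1.
have s0 : 0 < 1 - t by rewrite subr_gt0. have s0' := ltW s0.
apply/ler_addgt0Pr => e e0.
have [v sv vx] := value_near x e0; have [v' sv' vx'] := value_near x' e0.
have sw := smooth_vec_comb t (1 - t) sv sv'.
have Bw : bounded_pair (t *: x + (1 - t) *: x').
  have [_ h] := bounded_pair_subspace; apply: h => //.
  exact: (subspaceZ (1 - t) bounded_pair_subspace).
apply: (le_trans (value_le _ sw)).
apply: (@le_trans _ _ (t * perturbed_energy v x + (1 - t) * perturbed_energy v' x')); last first.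
  apply: (@le_trans _ _ (t * (value_function x + e) + (1 - t) * (value_function x' + e))).
    by apply: lerD; [exact: (ler_wpM2l t0' (ltW vx))|exact: (ler_wpM2l s0' (ltW vx'))].
  by rewrite le_eqVlt; apply/orP; left; apply/eqP; ring.
have st : stored_energy (fun y => t *: v y + (1 - t) *: v' y) (t *: x + (1 - t) *: x') <=
    t * stored_energy v x + (1 - t) * stored_energy v' x'.
  rewrite /stored_energy -!RintegralZl//; try exact: stored_integrable.
  rewrite -RintegralD//; try (apply: rintgZ => //; exact: stored_integrable).
  apply: le_Rintegral => //; first exact: stored_integrable.
    by apply: rintgD => //; apply: rintgZ => //; exact: stored_integrable.
  move=> y Oy; have cy := subset_closure Oy.
  have := @f_conv _ _ _ Omega f f_convex y t (A (grad v y) + x.1 y) (A (grad v' y) + x'.1 y) cy t0' t1'.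
  have AE (a b : 'M[R]_(m, n)) : A (t *: a + (1 - t) *: b) = t *: A a + (1 - t) *: A b.
    by rewrite linearD !linearZ.
  have gE := grad_comb t (1 - t) y sv sv'.
  have -> : A (grad (fun y => t *: v y + (1 - t) *: v' y) y) + (t *: x + (1 - t) *: x').1 y =
      t *: (A (grad v y) + x.1 y) + (1 - t) *: (A (grad v' y) + x'.1 y).
    rewrite gE AE -[(t *: x + (1 - t) *: x').1 y]/(t *: x.1 y + (1 - t) *: x'.1 y).
    by rewrite !scalerDr addrACA.
  exact.
have pt : fidelity (fun y => t *: v y + (1 - t) *: v' y) (t *: x + (1 - t) *: x') <=
    t * fidelity v x + (1 - t) * fidelity v' x'.
  rewrite /fidelity -!RintegralZl//; try exact: penalty_integrable.
  rewrite -RintegralD//; try (apply: rintgZ => //; exact: penalty_integrable).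
  apply: le_Rintegral => //; first exact: penalty_integrable.
    by apply: rintgD => //; apply: rintgZ => //; exact: penalty_integrable.
  move=> y Oy; rewrite !mulr_sumr -big_split/=; apply: ler_sum => i _.
  rewrite !mxE; set a := v y i 0 - u y i 0 + x.2 y i 0; set b := v' y i 0 - u y i 0 + x'.2 y i 0.
  have -> : t * v y i 0 + (1 - t) * v' y i 0 - u y i 0 + (t * x.2 y i 0 + (1 - t) * x'.2 y i 0) =
    t * a + (1 - t) * b by rewrite /a /b; ring.
  have := mulr_ge0 (mulr_ge0 t0' s0') (sqr_ge0 (a - b)).
  have -> : t * (1 - t) * (a - b) ^+ 2 = t * a ^+ 2 + (1 - t) * b ^+ 2 - (t * a + (1 - t) * b) ^+ 2.
    by ring.
  by rewrite subr_ge0.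
rewrite /perturbed_energy mulrDr [(1 - t) * (_ + _)]mulrDr addrACA lerD//.
rewrite [t * (K * _)]mulrCA [(1 - t) * (K * _)]mulrCA -mulrDr ler_pM2l//.
Qed.

(** Hahn-Banach is started from the zero subspace with majorant h - h(0). It is convex but need not
    be positively homogeneous, hence the form of [hahn_banach]. *)
Lemma subgradient : exists L : X -> R, linear_on bounded_pair L /\
  forall v x, smooth_vec v -> bounded_pair x -> L x <= perturbed_energy v x - value_function 0.
Proof.
have sB := bounded_pair_subspace.
pose F : set X := [set 0].
have sF : subspace F by split => // c x y -> ->; rewrite scaler0 addr0.
have [|||x ->|L [lL Lp _]] := @hahn_banach R X bounded_pair F (fun=> 0) (fun x => value_function x - value_function 0) sB sF.
- by move=> x ->; case: sB.
- by move=> c x y _ _; rewrite mulr0 addr0.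
- move=> t x y t01 Bx By; have := value_convex t01 Bx By; move/andP: t01 => [t0 t1].
  move: (value_function x) (value_function y) (value_function 0) (value_function (t *: x + (1 - t) *: y)) => a b c e abe.
  by rewrite (_ : t * (a - c) + (1 - t) * (b - c) = t * a + (1 - t) * b - c) ?lerD2r//; ring.
- by rewrite subrr.
exists L; split => // v x sv Bx; apply: (le_trans (Lp x Bx)).
by rewrite lerB// value_le.
Qed.

End ValueFunction.

Lemma linear_on_sum {R : realType} {V : lmodType R} (D : set V) (L : V -> R) (I : Type)
    (s : seq I) (x : I -> V) : subspace D -> linear_on D L -> (forall i, D (x i)) ->
  D (\sum_(i <- s) x i) /\ L (\sum_(i <- s) x i) = \sum_(i <- s) L (x i).
Proof.
move=> sD lL Dx; elim: s => [|i s [IH1 IH2]].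
  by rewrite !big_nil (linear_on0 sD lL); split => //; case: sD.
rewrite !big_cons; split; first exact: subspaceD.
by rewrite (linear_onD sD lL)// IH2.
Qed.

Lemma eq0_of_scaled_le {R : realType} (a M : R) : (forall c, c * a <= M) -> a = 0.
Proof.
move=> h; apply/eqP; apply: contrapT => /negP a0.
have := h ((M + 1) / a); rewrite divfK//.
by rewrite gerDl ler10.
Qed.

(** * Representation under L^1 and L^2 bounds *)

Section Functionals.
Context {R : realType} {n : nat}.
Local Notation T := 'rV[R]_n.
Local Notation lam := (@lebesgue_rV R n).
Variable Omega : set T.
Hypothesis oO : open Omega.
Hypothesis bO : bounded_set Omega.

Let mO : measurable Omega. Proof. exact: open_measurable_mx. Qed.

Local Notation bm := (@bounded_meas _ T R).

Lemma linear_on_opp (I : (T -> R^o) -> R) (h : T -> R) : linear_on bm I -> bm h ->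
  I (fun x => - h x) = - I h.
Proof.
move=> lI Bh; have := linear_onZ (-1) (@bounded_meas_subspace _ T R) lI Bh.
rewrite mulN1r => <-; congr I; apply/funext => x.
by rewrite -[RHS]/(-1 * h x) mulN1r.
Qed.

Lemma indic_null (E : set T) : measurable E -> lam (E `&` Omega) = 0%E ->
  \int[lam]_(x in Omega) \1_E x = 0.
Proof. by move=> mE E0; rewrite /Rintegral integral_indic// E0. Qed.

Lemma indic_norm (E : set T) (x : T) : `|\1_E x| = \1_E x :> R.
Proof. by rewrite ger0_norm. Qed.

Lemma finite_dct (h_ : nat -> T -> R) (M : R) : (forall k, measurable_fun setT (h_ k)) ->
  (forall k x, `|h_ k x| <= M) -> (forall x, h_ k x @[k --> \oo] --> (0 : R)) ->
  \int[lam]_(x in Omega) h_ k x @[k --> \oo] --> (0 : R).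
Proof.
move=> mh hM h0; have [|||x _|_] := @Rintegral_dct _ _ _ lam Omega h_ (fun=> 0) (fun=> M) mO.
- by move=> k; exact: measurable_funTS.
- by apply: bounded_meas_integrable_on => //; split; [exact: measurable_cst|exists `|M|].
- by move=> k x _; exact: hM.
- exact: h0.
by rewrite Rintegral_cst// mul0r.
Qed.

(** The bound gives both continuity along bounded limits and vanishing on null sets. The density is
    then at most C almost everywhere, and clipping makes this hold at every point. *)
Lemma L1_functional (I : (T -> R^o) -> R) (C : R) : 0 <= C -> linear_on bm I ->
  (forall h : T -> R, bm h -> I h <= C * \int[lam]_(x in Omega) `|h x|) ->
  exists rho : T -> R, [/\ measurable_fun setT rho, forall x, `|rho x| <= C,
    forall x, ~ Omega x -> rho x = 0 &
    forall h : T -> R, bm h -> I h = \int[lam]_(x in Omega) (rho x * h x)].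
Proof.
move=> C0 lI IC.
have IC' (h : T -> R) : bm h -> `|I h| <= C * \int[lam]_(x in Omega) `|h x|.
  move=> Bh; rewrite ler_norml IC// andbT lerNl -linear_on_opp//.
  apply: (le_trans (IC _ (bounded_measN Bh))).
  by rewrite le_eqVlt; apply/orP; left; apply/eqP; congr (_ * _); apply: eq_Rintegral => x _; rewrite normrN.
have dI : dct_continuous I.
  move=> f_ M mf fM f0; apply/norm_cvg0P.
  apply: (@squeeze_cvgr _ _ _ _ (fun=> 0) (fun k => C * \int[lam]_(x in Omega) `|f_ k x|)).
  - by apply: nearW => k; rewrite normr_ge0 IC'//; split => //; exists M.
  - exact: cvg_cst.
  - rewrite -(mulr0 C); apply: cvgM; first exact: cvg_cst.
    apply: (@finite_dct (fun k x => `|f_ k x|) M) => [k|k x|x].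
    + exact: measurableT_comp.
    + by rewrite normr_id.
    + by rewrite -(@normr0 _ R); apply: cvg_norm; exact: f0.
have [|rho [ri rO rE]] := density_of_functional oO lI dI.
  move=> E mE E0; apply/eqP; rewrite -normr_le0 (le_trans (IC' _ (bounded_meas_indic _ mE)))//.
  rewrite (_ : \int[lam]_(x in Omega) _ = 0) ?mulr0//.
  by rewrite -[RHS](indic_null mE E0); apply: eq_Rintegral => x _; rewrite indic_norm.
have rC : \forall x \ae lam, `|rho x| <= C.
  by apply: (bounded_density oO bO C0 ri rO) => h Bh; rewrite -rE//; exact: IC.
have mr := rintg_measurable ri.
exists (fun x => clip C (rho x)); split.
- exact: measurable_clip.
- by move=> x; exact: clip_le.
- by move=> x nO; rewrite rO// clip_id// normr0.
- move=> h Bh; rewrite rE// -(@Rintegral_zero_out _ _ _ _ Omega); last first.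
    by move=> x nO; rewrite rO// mul0r.
  apply: (proj2 (Rintegral_ae_eq mO _ _ _)).
  + by apply: (@integrableS _ _ _ lam setT) => //; exact: bounded_meas_integrable.
  + apply: measurable_funTS; apply: measurable_funM; first exact: measurable_clip.
    by case: Bh.
  + by apply: filterS rC => x rx _; rewrite clip_id.
Qed.

(** The bound is not homogeneous, as it comes from a quadratic penalty. Small t gives continuity; t
    = 1, tested on a small multiple of the truncated density, gives an L^2 bound independent of the
    truncation. *)
Lemma L2_functional (I : (T -> R^o) -> R) (a b : R) : 0 <= a -> 0 <= b -> linear_on bm I ->
  (forall (t : R) (h : T -> R), 0 < t -> bm h ->
     I h <= a * t + b * (1 + t^-1) * \int[lam]_(x in Omega) (h x ^+ 2)) ->
  exists rho : T -> R, [/\ lam.-integrable setT (EFin \o rho),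
    lam.-integrable setT (EFin \o (fun x => rho x ^+ 2)),
    forall x, ~ Omega x -> rho x = 0 &
    forall h : T -> R, bm h -> I h = \int[lam]_(x in Omega) (rho x * h x)].
Proof.
move=> a0 b0 lI Iab.
have Iab' (t : R) (h : T -> R) : 0 < t -> bm h ->
    `|I h| <= a * t + b * (1 + t^-1) * \int[lam]_(x in Omega) (h x ^+ 2).
  move=> t0 Bh; rewrite ler_norml Iab// andbT lerNl -linear_on_opp//.
  apply: (le_trans (Iab _ _ t0 (bounded_measN Bh))).
  by rewrite le_eqVlt; apply/orP; left; apply/eqP; congr (_ + _ * _); apply: eq_Rintegral => x _; rewrite sqrrN.
have dI : dct_continuous I.
  move=> f_ M mf fM f0; apply/cvgrPdist_le => e e0.
  have a1 : 0 < 2 * (a + 1) by rewrite mulr_gt0// ltr_wpDl.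
  have [t t0 ate] : exists2 t, 0 < t & a * t <= e / 2.
    exists (e / (2 * (a + 1))); first by rewrite divr_gt0.
    rewrite mulrA ler_pdivrMr// (_ : e / 2 * (2 * (a + 1)) = a * e + e); last by field.
    by rewrite lerDl ltW.
  have c : b * (1 + t^-1) * \int[lam]_(x in Omega) (f_ k x ^+ 2) @[k --> \oo] --> (0 : R).
    rewrite -(mulr0 (b * (1 + t^-1))); apply: cvgM; first exact: cvg_cst.
    apply: (@finite_dct (fun k x => f_ k x ^+ 2) (M ^+ 2)) => [k|k x|x].
    - exact: measurable_funX.
    - by rewrite normrX ler_pXn2r ?nnegrE// (le_trans _ (fM k x)).
    - rewrite (_ : (fun k => _) = fun k => f_ k x * f_ k x); last by apply/funext => k; rewrite expr2.
      by rewrite -(mulr0 0); apply: cvgM; exact: f0.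
  have e2 : 0 < e / 2 by rewrite divr_gt0.
  move/cvgrPdist_le : c => /(_ _ e2); apply: filterS => k.
  rewrite !sub0r !normrN => ck.
  have Bf : bm (f_ k) by split => //; exists M.
  apply: (le_trans (Iab' t _ t0 Bf)); rewrite (splitr e) lerD//.
  exact: le_trans (ler_norm _) ck.
have [|rho [ri rO rE]] := density_of_functional oO lI dI.
  move=> E mE E0; apply/eqP; rewrite -normr_le0; apply: (le_eta a0) => t t0.
  rewrite add0r (le_trans (Iab' t _ t0 (bounded_meas_indic _ mE)))//.
  rewrite (_ : \int[lam]_(x in Omega) _ = 0) ?mulr0 ?addr0//.
  rewrite -[RHS](indic_null mE E0); apply: eq_Rintegral => x _.
  by rewrite indicE; case: (_ \in _); rewrite ?expr1n ?expr0n.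
have mr := rintg_measurable ri.
have mar : measurable_fun setT (fun x => `|rho x|) by exact: measurableT_comp.
pose r_ (N : nat) x := if `|rho x| <= N%:R then rho x else 0.
have mr_ N : measurable_fun setT (r_ N).
  by apply: measurable_fun_ifT => //; apply: measurable_fun_ler.
have Br_ N : bm (r_ N).
  by split => //; exists N%:R => x; rewrite /r_; case: ifP => //; rewrite normr0.
have rr_ N x : rho x * r_ N x = r_ N x ^+ 2.
  by rewrite /r_; case: ifP => _; [rewrite expr2|rewrite mulr0 expr2 mulr0].
have XN N : \int[lam]_(x in Omega) (r_ N x ^+ 2) <= 8 * a * (b + 1).
  set X := \int[lam]_(x in Omega) (r_ N x ^+ 2).
  have b1 : 0 < b + 1 by rewrite ltr_wpDl.
  (* With t = 1 the bound at tau r_N reads tau X <= a + 2 b tau^2 X; for this tau the last term is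
     at most half of the left side, whence X <= 2 a / tau. *)
  pose tau := (4 * (b + 1))^-1; have tau0 : 0 < tau by rewrite invr_gt0 mulr_gt0.
  have BZ : bm (fun x => tau * r_ N x) by exact: bounded_measZ.
  have := Iab 1 _ ltr01 BZ; rewrite mulr1 invr1.
  have -> : I (fun x => tau * r_ N x) = tau * X.
    rewrite rE//; rewrite -(@Rintegral_zero_out _ _ _ _ Omega); last by move=> x nO; rewrite rO// mul0r.
    have -> : (fun x => rho x * (tau * r_ N x)) = (fun x => tau * r_ N x ^+ 2).
      by apply/funext => x; rewrite mulrCA rr_.
    rewrite RintegralZl//; apply: bounded_meas_integrable_on => //.
    by rewrite (_ : (fun x => r_ N x ^+ 2) = fun x => r_ N x * r_ N x)//; exact: bounded_measM.
  have -> : \int[lam]_(x in Omega) ((tau * r_ N x) ^+ 2) = tau ^+ 2 * X.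
    rewrite -RintegralZl//; first by apply: eq_Rintegral => x _; rewrite exprMn.
    apply: bounded_meas_integrable_on => //.
    by rewrite (_ : (fun x => r_ N x ^+ 2) = fun x => r_ N x * r_ N x)//; exact: bounded_measM.
  have X0 : 0 <= X by apply: Rintegral_ge0 => x _; exact: sqr_ge0.
  move=> h; have h2 : b * (1 + 1) * (tau ^+ 2 * X) <= tau * X / 2.
    rewrite (_ : b * (1 + 1) * (tau ^+ 2 * X) = (4 * b * tau) * (tau * X / 2)); last by field.
    rewrite ler_piMl ?divr_ge0 ?mulr_ge0 ?(ltW tau0)//.
    rewrite /tau ler_pdivrMr ?mulr_gt0// mul1r ler_wpM2l//.
    by rewrite lerDl.
  have h3 : tau * X <= 2 * a by lra.
  rewrite -(ler_pM2l tau0) (le_trans h3)// le_eqVlt; apply/orP; left; apply/eqP.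
  by rewrite /tau; field; rewrite gt_eqF.
have [|||x Ox|N|_ r2] := @monotone_limit_le _ _ _ lam Omega (fun N x => r_ N x ^+ 2)
  (fun x => (rho x ^+ 2)%:E) (8 * a * (b + 1)) mO.
- by move=> N; apply: measurable_funTS; exact: measurable_funX.
- by move=> N x _; exact: sqr_ge0.
- move=> x Ox i j ij; rewrite /r_; case: ifPn => hi.
    by rewrite (le_trans hi)// ler_nat.
  by rewrite expr0n sqr_ge0.
- apply: cvg_near_cst; near=> N; rewrite /r_ ifT//; near: N.
  exists (Num.truncn `|rho x|).+1 => // N /= rN.
  by rewrite ltW// (lt_le_trans (truncnS_gt _))// ler_nat.
- rewrite -EFin_Rintegral ?lee_fin//.
  apply: bounded_meas_integrable_on => //.
  by rewrite (_ : (fun x => r_ N x ^+ 2) = fun x => r_ N x * r_ N x)//; exact: bounded_measM.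
exists rho; split => //; last first.
  move=> h Bh; rewrite rE// -(@Rintegral_zero_out _ _ _ _ Omega)// => x nO.
  by rewrite rO// mul0r.
apply/(@rintg_zero_out _ _ _ _ Omega) => //; first by move=> x nO; rewrite rO// expr0n.
apply: rintg_ge0_lty => //; [by apply: measurable_funTS; exact: measurable_funX|by move=> x; exact: sqr_ge0|].
exact: le_lt_trans r2 (ltry _).
Unshelve. all: by end_near. Qed.

End Functionals.

(** * The dual field *)

Section DualField.
Context {R : realType} {m n : nat}.
Local Notation T := 'rV[R]_n.
Local Notation lam := (@lebesgue_rV R n).
Variables (Omega : set T) (A : {linear 'M[R]_(m, n) -> 'M[R]_(m, n)}).
Hypothesis oO : open Omega.
Hypothesis bO : bounded_set Omega.
Hypothesis A_sym : forall y y', frob (A y) y' = frob y (A y').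
Hypothesis A_proj : forall y, A (A y) = A y.
Variable f : T -> 'M[R]_(m, n) -> R.
Hypothesis f_ge0 : forall x y, closure Omega x -> 0 <= f x y.
Hypothesis f_borel : measurable_fun (closure Omega `*` [set: 'M[R]_(m, n)])
                 (fun xy => f xy.1 xy.2).
Hypothesis f_convex : forall x, closure Omega x -> convex_function setT (f x).
Variables (c0 C0 : R).
Hypothesis C0_gt0 : 0 < C0.
Hypothesis f_growth : forall x y, closure Omega x ->
       c0 * frob_norm (A y) <= f x y /\ f x y <= C0 * (1 + frob_norm (A y)).
Variables (u : T -> 'cV[R]_m) (K : R).
Hypothesis uL2 : Lp Omega 2%:E u.
Hypothesis K0 : 0 < K.

Let mO : measurable Omega. Proof. exact: open_measurable_mx. Qed.

Local Notation bm := (@bounded_meas _ T R).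
Local Notation X := ((T -> 'M[R]_(m, n)) * (T -> 'cV[R]_m))%type.
Local Notation bp := (@bounded_pair R m n).
Local Notation value_of := (perturbed_energy Omega A f u K).
Local Notation value := (value_function Omega A f u K).
Local Notation stored := (stored_energy Omega A f).
Local Notation penalty := (fidelity Omega u).

Let sI v x (sv : smooth_vec v) (Bx : bp x) :=
  stored_integrable oO bO f_ge0 f_borel C0_gt0 f_growth sv Bx.
Let pI v x (sv : smooth_vec v) (Bx : bp x) :=
  penalty_integrable oO bO uL2 sv Bx.
Let sbp := @bounded_pair_subspace R m n.

Lemma bounded_pair_fst (x : X) : bp x -> bp (x.1, 0).
Proof. by move=> [x1 _]; split => //; case: sbp => -[]. Qed.

Lemma bounded_pair_snd (x : X) : bp x -> bp (0, x.2).
Proof. by move=> [_ x2]; split => //; case: sbp => -[]. Qed.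

Lemma bounded_sum_norm (q : T -> 'M[R]_(m, n)) : bp (q, 0) -> bm (fun y => sum_norm (A (q y))).
Proof.
move=> [q1 _]; have sB := @bounded_meas_subspace _ T R.
rewrite /sum_norm; under eq_fun do rewrite pair_bigA/=.
have Bp (p : 'I_m * 'I_n) : bm (fun y => `|A (q y) p.1 p.2|).
  have [ma [M aM]] : bm (fun y => A (q y) p.1 p.2).
    rewrite (_ : (fun y => _) = \sum_(r : 'I_m * 'I_n) (mxc A r.1 r.2 p.1 p.2 *: (fun y => q y r.1 r.2) : T -> R^o)).
      apply: (big_ind bm) => [|g h|r _]; [by case: sB|exact: subspaceD|].
      by apply: (subspaceZ _ sB); exact: q1.
    by apply/funext => y; rewrite fct_sumE mxc_apply.
  by split; [exact: measurableT_comp|exists M => y; rewrite normr_id].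
rewrite (_ : (fun y => _) = \sum_(p : 'I_m * 'I_n) ((fun y => `|A (q y) p.1 p.2|) : T -> R^o)).
  by apply: (big_ind bm) => [|g h|r _]; [case: sB|exact: subspaceD|exact: Bp].
by apply/funext => y; rewrite fct_sumE.
Qed.

Lemma value_of_fst v q : smooth_vec v -> bp (q, 0) ->
  value_of v (q, 0) <= value_of v 0 + C0 * \int[lam]_(y in Omega) sum_norm (A (q y)).
Proof.
move=> sv Bq; have B0 : bp 0 by case: sbp.
rewrite /perturbed_energy addrAC lerD2r.
have ni : lam.-integrable Omega (EFin \o (fun y => C0 * sum_norm (A (q y)))).
  by apply: bounded_meas_integrable_on => //; apply: bounded_measZ; exact: bounded_sum_norm.
rewrite -RintegralZl//; last by apply: bounded_meas_integrable_on => //; exact: bounded_sum_norm.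
rewrite -RintegralD//; last exact: sI.
apply: le_Rintegral => //; [exact: sI|by apply: rintgD => //; exact: sI|].
move=> y Oy; have cy := subset_closure Oy.
rewrite addr0; exact: (f_lipschitz f_ge0 f_convex C0_gt0 f_growth).
Qed.

(** Young's inequality with weight t is applied to the cross term of the square. The factor t
    multiplies the unperturbed energy, which near-minimisers bring close to [value 0]. *)
Lemma value_of_snd v s (t : R) : smooth_vec v -> bp (0, s) -> 0 < t ->
  value_of v (0, s) <= value_of v 0 + t * value_of v 0 +
    K * (1 + t^-1) * \int[lam]_(y in Omega) (\sum_i s y i 0 ^+ 2).
Proof.
move=> sv Bs t0; have B0 : bp 0 by case: sbp.
have s0 := @stored_ge0 _ _ _ Omega A f f_ge0 v 0.
have si : lam.-integrable Omega (EFin \o (fun y => \sum_i s y i 0 ^+ 2)).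
  apply: rintg_sum => // i; rewrite (_ : (fun y => _) = fun y => s y i 0 * s y i 0).
    by apply: bounded_meas_integrable_on => //; apply: bounded_measM; exact: Bs.2.
  by apply/funext => y; rewrite expr2.
have : penalty v (0, s) <= (1 + t) * penalty v 0 + (1 + t^-1) * \int[lam]_(y in Omega) (\sum_i s y i 0 ^+ 2).
  rewrite /fidelity -!RintegralZl//; try exact: pI.
  rewrite -RintegralD//; try (apply: rintgZ => //; exact: pI).
  apply: le_Rintegral => //; [exact: pI|by apply: rintgD => //; apply: rintgZ => //; exact: pI|].
  move=> y Oy; rewrite !mulr_sumr -big_split/=; apply: ler_sum => i _.
  rewrite [(0 : X).2 y i 0]mxE addr0; set a := v y i 0 - u y i 0; set b := s y i 0.
  have ti : 0 < t^-1 by rewrite invr_gt0.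
  have h : 2 * a * b <= t * a ^+ 2 + t^-1 * b ^+ 2.
    have := mulr_ge0 (ltW ti) (sqr_ge0 (t * a - b)).
    have -> : t^-1 * (t * a - b) ^+ 2 = t * a ^+ 2 + t^-1 * b ^+ 2 - 2 * a * b.
      by field; rewrite gt_eqF.
    by rewrite subr_ge0.
  have -> : (a + b) ^+ 2 = a ^+ 2 + b ^+ 2 + 2 * a * b by ring.
  have -> : (1 + t) * a ^+ 2 = a ^+ 2 + t * a ^+ 2 by ring.
  have -> : (1 + t^-1) * b ^+ 2 = b ^+ 2 + t^-1 * b ^+ 2 by ring.
  lra.
rewrite -(ler_pM2l K0) /perturbed_energy.
have -> : stored v (0, s) = stored v 0 by [].
set P := penalty v 0; set Q := penalty v (0, s); set S := stored v 0 in s0 *.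
set J := \int[lam]_(y in Omega) _ => h.
have := mulr_ge0 (ltW t0) s0; set V := t * S => V0.
have -> : S + K * P + t * (S + K * P) + K * (1 + t^-1) * J = S + (V + K * ((1 + t) * P + (1 + t^-1) * J)).
  by rewrite /V; ring.
by rewrite lerD2l (le_trans h)// lerDr.
Qed.

Variable L : X -> R.
Hypothesis lL : linear_on bp L.
Hypothesis Lle : forall v x, smooth_vec v -> bp x -> L x <= value_of v x - value 0.

Lemma subgradient_fst q : bp (q, 0) -> L (q, 0) <= C0 * \int[lam]_(y in Omega) sum_norm (A (q y)).
Proof.
move=> Bq; apply/ler_addgt0Pr => e e0.
have [v sv vx] : exists2 v, smooth_vec v & value_of v 0 < value 0 + e by exact: value_near.
have := Lle sv Bq; have := value_of_fst sv Bq; lra.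
Qed.

Lemma subgradient_snd s (t : R) : bp (0, s) -> 0 < t -> L (0, s) <= value 0 * t +
  K * (1 + t^-1) * \int[lam]_(y in Omega) (\sum_i s y i 0 ^+ 2).
Proof.
move=> Bs t0; have K1 : 0 <= 1 + t by rewrite addr_ge0// ltW.
apply: (le_eta K1) => e e0.
have [v sv vx] : exists2 v, smooth_vec v & value_of v 0 < value 0 + e by exact: value_near.
have := Lle sv Bs; have := value_of_snd sv Bs t0.
have : t * value_of v 0 <= t * (value 0 + e) by rewrite ler_pM2l// ltW.
rewrite mulrDr [value 0 * t]mulrC mulrDl mul1r; lra.
Qed.

Lemma subgradient_split (x : X) : bp x -> L x = L (x.1, 0) + L (0, x.2).
Proof.
move=> Bx; rewrite -(linear_onD sbp lL); [|exact: bounded_pair_fst|exact: bounded_pair_snd].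
congr L; case: x {Bx} => a b.
by transitivity ((a + 0, 0 + b) : X); [rewrite addr0 add0r|].
Qed.

Lemma subgradient_fst_linear : linear_on [set q | bp (q, 0)] (fun q => L (q, 0)).
Proof.
move=> c q q' Bq Bq'; rewrite -lL//; congr L.
by transitivity ((c *: q + q', c *: 0 + 0) : X); [rewrite scaler0 addr0|].
Qed.

Lemma subgradient_snd_linear : linear_on [set s | bp (0, s)] (fun s => L (0, s)).
Proof.
move=> c q q' Bq Bq'; rewrite -lL//; congr L.
by transitivity ((c *: 0 + 0, c *: q + q') : X); [rewrite scaler0 addr0|].
Qed.

Lemma annihilated_pair v : smooth_vec v ->
  bp (fun y => - (\1_Omega y *: A (grad v y)), fun y => - (\1_Omega y *: v y)).
Proof.
move=> sv.
have sB := @bounded_meas_subspace _ T R.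
have Bi (g : T -> R) : smooth g -> bm (fun y => - (\1_Omega y * g y)).
  move=> sg; have [M gM] := smooth_bounded_on bO sg; split.
    apply: measurableT_comp => //; apply: measurable_funM; first exact: measurable_indic.
    by apply: continuous_measurable_mx; exact: smooth_continuous.
  exists `|M| => y; rewrite normrN; have [Oy|nOy] := pselect (Omega y).
    by rewrite indic_in// mul1r (le_trans (gM y Oy))// ler_norm.
  by rewrite indic_out// mul0r normr0.
split=> [i j|i].
  rewrite (_ : (fun y => _) = fun y => - (\1_Omega y * A (grad v y) i j)).
    by apply: Bi; exact: A_grad_smooth.
  by apply/funext => y; rewrite /= 2!mxE.
rewrite (_ : (fun y => _) = fun y => - (\1_Omega y * v y i 0)); first by apply: Bi; exact: sv.
by apply/funext => y; rewrite /= 2!mxE.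
Qed.

(** Passing from 0 to c v cancels c times this perturbation on Omega, so the perturbed energy does
    not depend on c. L is thus bounded above along a whole line and vanishes on it. *)
Lemma subgradient_annihilates v : smooth_vec v ->
  L (fun y => - (\1_Omega y *: A (grad v y)), fun y => - (\1_Omega y *: v y)) = 0.
Proof.
move=> sv; have Bx := annihilated_pair sv; move: Bx; set x : X := (_, _) => Bx.
apply: (@eq0_of_scaled_le _ _ (value_of (fun=> 0) 0 - value 0)) => c.
rewrite -(linear_onZ c sbp lL Bx).
have sz := @smooth_vec0 R m n.
have scv : smooth_vec (fun y => c *: v y + 0 *: (0 : 'cV[R]_m)) by exact: (smooth_vec_comb c 0 sv sz).
apply: (le_trans (Lle scv (subspaceZ c sbp Bx))); rewrite lerD2r.
rewrite le_eqVlt; apply/orP; left; apply/eqP; congr (_ + _ * _).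
  apply: eq_Rintegral => y /set_mem Oy; congr (f y _).
  have gE := grad_comb c 0 y sv sz; rewrite gE linearD linearZ scale0r linear0 addr0.
  rewrite -[(c *: x).1 y]/(c *: - (\1_Omega y *: A (grad v y))) indic_in// scale1r scalerN subrr.
  rewrite addr0 (_ : grad _ y = 0) ?linear0//.
  have g0 := grad_comb 0 0 y sz sz.
  have E : (fun y : T => (0 : R) *: (0 : 'cV[R]_m) + 0 *: 0) = fun=> 0 by apply/funext => t; rewrite !scaler0 addr0.
  by rewrite E in g0; rewrite g0 !scale0r addr0.
apply: eq_Rintegral => y /set_mem Oy; apply: eq_bigr => i _.
rewrite -[(c *: x).2 y]/(c *: - (\1_Omega y *: v y)) indic_in// scale1r; congr (_ ^+ 2).
by rewrite !mxE; ring.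
Qed.


Lemma bounded_scaled_delta (h : T -> R) (p : 'I_m * 'I_n) : bm h ->
  bp (fun y => h y *: delta_mx p.1 p.2, 0).
Proof.
move=> Bh; apply: (@bounded_pair_fst (_, 0)); split => [i j|i] /=.
  rewrite (_ : (fun y => _) = fun y => (delta_mx p.1 p.2 : 'M[R]_(m, n)) i j * h y).
    exact: bounded_measZ.
  by apply/funext => y; rewrite mxE mulrC.
by case: sbp => -[_ b0] _; exact: (b0 i).
Qed.

Lemma bounded_scaled_unit (h : T -> R) (i : 'I_m) : bm h ->
  bp (0, fun y => h y *: delta_mx i 0).
Proof.
move=> Bh; apply: (@bounded_pair_snd (0, _)); split => [k j|k] /=.
  by case: sbp => -[b0 _] _; exact: (b0 k j).
rewrite (_ : (fun y => _) = fun y => (delta_mx i 0 : 'cV[R]_m) k 0 * h y).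
  exact: bounded_measZ.
by apply/funext => y; rewrite mxE mulrC.
Qed.

(** Entry by entry: on multiples of an elementary matrix, L obeys an L^1 bound whose constant is
    [C0] times the norm of the image of that matrix under A. *)
Lemma subgradient_fst_density : exists rho : T -> 'M[R]_(m, n),
  [/\ forall i j, bm (fun y => rho y i j),
    forall i j y, `|rho y i j| <= C0 * sum_norm (A (delta_mx i j)),
    forall x, ~ Omega x -> rho x = 0 &
    forall q, bp (q, 0) -> L (q, 0) = \int[lam]_(y in Omega) frob (rho y) (q y)].
Proof.
have /choice[r rP] (p : 'I_m * 'I_n) : exists rho : T -> R, [/\ bm rho,
    forall x, `|rho x| <= C0 * sum_norm (A (delta_mx p.1 p.2)), forall x, ~ Omega x -> rho x = 0 &
    forall h : T -> R, bm h -> L (fun y => h y *: delta_mx p.1 p.2, 0) = \int[lam]_(x in Omega) (rho x * h x)].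
  have C1 : 0 <= C0 * sum_norm (A (delta_mx p.1 p.2)) by rewrite mulr_ge0 ?sum_norm_ge0// ltW.
  have [||rho [mr rC rO rE]] := @L1_functional _ _ Omega oO bO
    (fun h => L (fun y => h y *: delta_mx p.1 p.2, 0)) _ C1.
  - move=> c g h Bg Bh; rewrite -(subgradient_fst_linear c (bounded_scaled_delta p Bg) (bounded_scaled_delta p Bh)).
    congr (L (_, _)); apply/funext => y; rewrite -[RHS]/(c *: (g y *: _) + h y *: _).
    by rewrite scalerA -scalerDl.
  - move=> h Bh; apply: (le_trans (subgradient_fst (bounded_scaled_delta p Bh))).
    rewrite le_eqVlt; apply/orP; left; apply/eqP; rewrite -mulrA; congr (_ * _).
    rewrite -RintegralZl//; last first.
      apply: bounded_meas_integrable_on => //; case: Bh => [mh [M hM]].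
      by split; [exact: measurableT_comp|exists M => x; rewrite normr_id].
    by apply: eq_Rintegral => y _; rewrite linearZ sum_normZ mulrC.
  exists rho; split => //; split => //.
  by exists (C0 * sum_norm (A (delta_mx p.1 p.2))).
pose rho y : 'M[R]_(m, n) := \matrix_(i, j) r (i, j) y.
exists rho; split.
- move=> i j; rewrite (_ : (fun y => _) = r (i, j)); first by case: (rP (i, j)).
  by apply/funext => y; rewrite mxE.
- by move=> i j y; rewrite mxE; case: (rP (i, j)).
- move=> x nO; apply/matrixP => i j; rewrite !mxE.
  by have [_ _ rO _] := rP (i, j); exact: rO.
move=> q Bq; pose xq p : T -> 'M[R]_(m, n) := fun y => q y p.1 p.2 *: delta_mx p.1 p.2.
have sD : subspace [set q | bp (q, 0)].
  split; first by case: sbp.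
  move=> c a b Ba Bb; have := sbp.2 c _ _ Ba Bb.
  by rewrite -[c *: _ + _]/(c *: a + b, c *: 0 + 0) scaler0 addr0.
have [|_ E] := @linear_on_sum _ _ _ _ _ (index_enum _) xq sD subgradient_fst_linear.
  by move=> p; apply: bounded_scaled_delta; exact: Bq.1.
have -> : q = \sum_p xq p.
  apply/funext => y; rewrite fct_sumE [LHS]matrix_sum_delta pair_bigA/=.
  by apply: eq_bigr.
rewrite E (eq_bigr (fun p => \int[lam]_(y in Omega) (r p y * q y p.1 p.2))); last first.
  by move=> p _; have [_ _ _ ->] := rP p => //; exact: Bq.1.
rewrite -Rintegral_sum//; last first.
  move=> p; apply: bounded_meas_integrable_on => //; apply: bounded_measM; last exact: Bq.1.
  by case: (rP p).
apply: eq_Rintegral => y _; rewrite /frob pair_bigA/=; apply: eq_bigr => p _.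
rewrite mxE -surjective_pairing; congr (_ * _).
rewrite fct_sumE [in LHS](matrix_sum_delta (q y)) pair_bigA/=.
by congr (fun_of_matrix _ _ _); apply: eq_bigr.
Qed.

(** Row by row, [L2_functional] applies with a = [value 0] and b = K. *)
Lemma subgradient_snd_density : exists w : T -> 'cV[R]_m,
  [/\ forall i, lam.-integrable setT (EFin \o (fun x => w x i 0)),
    forall i, lam.-integrable setT (EFin \o (fun x => w x i 0 ^+ 2)),
    forall x, ~ Omega x -> w x = 0 &
    forall s, bp (0, s) -> L (0, s) = \int[lam]_(y in Omega) (\sum_i w y i 0 * s y i 0)].
Proof.
have /choice[r rP] (i : 'I_m) : exists rho : T -> R, [/\ lam.-integrable setT (EFin \o rho),
    lam.-integrable setT (EFin \o (fun x => rho x ^+ 2)),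
    forall x, ~ Omega x -> rho x = 0 &
    forall h : T -> R, bm h -> L (0, fun y => h y *: delta_mx i 0) = \int[lam]_(x in Omega) (rho x * h x)].
  have a0 : 0 <= value 0.
    apply: lb_le_inf; first by case: (value_has_inf A f_ge0 u K0 0).
    by move=> _ [v _ <-]; exact: value_of_ge0.
  apply: (@L2_functional _ _ Omega oO bO
    (fun h => L (0, fun y => h y *: delta_mx i 0)) _ _ a0 (ltW K0)).
  - move=> c g h Bg Bh; rewrite -(subgradient_snd_linear c (bounded_scaled_unit i Bg) (bounded_scaled_unit i Bh)).
    congr (L (_, _)); apply/funext => y; rewrite -[RHS]/(c *: (g y *: _) + h y *: _).
    by rewrite scalerA -scalerDl.
  - move=> t h t0 Bh; apply: (le_trans (subgradient_snd (bounded_scaled_unit i Bh) t0)).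
    rewrite le_eqVlt; apply/orP; left; apply/eqP; congr (_ + _ * _).
    apply: eq_Rintegral => y _; rewrite (bigD1 i)//= big1 ?addr0.
      by rewrite !mxE !eqxx mulr1.
    by move=> k ki; rewrite !mxE (negbTE ki) mulr0 expr0n.
pose w y : 'cV[R]_m := \col_i r i y.
have wE i : (fun y => w y i 0) = r i by apply/funext => y; rewrite mxE.
exists w; split.
- by move=> i; rewrite wE; case: (rP i).
- move=> i; rewrite (_ : (fun y => _) = fun y => r i y ^+ 2); first by case: (rP i).
  by apply/funext => y; rewrite mxE.
- move=> x nO; apply/matrixP => i j; rewrite !mxE.
  by have [_ _ rO _] := rP i; exact: rO.
move=> s Bs; pose xs i : T -> 'cV[R]_m := fun y => s y i 0 *: delta_mx i 0.
have sD : subspace [set s | bp (0, s)].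
  split; first by case: sbp.
  move=> c a b Ba Bb; have := sbp.2 c _ _ Ba Bb.
  by rewrite -[c *: _ + _]/(c *: 0 + 0, c *: a + b) scaler0 addr0.
have [|_ E] := @linear_on_sum _ _ _ _ _ (index_enum _) xs sD subgradient_snd_linear.
  by move=> i; apply: bounded_scaled_unit; exact: Bs.2.
have {1}-> : s = \sum_i xs i.
  apply/funext => y; rewrite fct_sumE [LHS]matrix_sum_delta.
  by apply: eq_bigr => i _; rewrite big_ord1.
rewrite E (eq_bigr (fun i => \int[lam]_(y in Omega) (r i y * s y i 0))); last first.
  by move=> i _; have [_ _ _ ->] := rP i => //; exact: Bs.2.
rewrite -Rintegral_sum//; last first.
  move=> i; have [ri _ _ _] := rP i; apply: (@integrableS _ _ _ lam setT) => //.
  by apply: bounded_meas_integrable => //; exact: Bs.2.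
by apply: eq_Rintegral => y _; apply: eq_bigr => i _; rewrite mxE.
Qed.

Lemma bounded_pair_A q : bp (q, 0) -> bp (fun y => A (q y), 0).
Proof.
move=> [q1 q2]; have sB := @bounded_meas_subspace _ T R; split => // i j.
rewrite (_ : (fun y => _) = \sum_(r : 'I_m * 'I_n) (mxc A r.1 r.2 i j *: (fun y => q y r.1 r.2) : T -> R^o)).
  apply: (big_ind bm) => [|g h|r _]; [by case: sB|exact: subspaceD|].
  by apply: (subspaceZ _ sB); exact: q1.
by apply/funext => y; rewrite fct_sumE mxc_apply.
Qed.

(** The bound of [subgradient_fst] sees q only through A q, so it is 0 on all multiples of q. *)
Lemma subgradient_fst_ker q : bp (q, 0) -> (forall y, A (q y) = 0) -> L (q, 0) = 0.
Proof.
move=> Bq Aq; apply: (@eq0_of_scaled_le _ _ 0) => c.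
rewrite -(linear_onZ c sbp lL Bq) -[c *: _]/(c *: q, c *: 0) scaler0.
have Bc : bp (c *: q, 0) by have := subspaceZ c sbp Bq; rewrite -[c *: (q, 0)]/(c *: q, c *: 0) scaler0.
apply: (le_trans (subgradient_fst Bc)).
rewrite (_ : \int[lam]_(y in Omega) _ = \int[lam]_(y in Omega) 0); last first.
  apply: eq_Rintegral => y _; have -> : A ((c *: q) y) = c *: A (q y) by exact: linearZ.
  by rewrite Aq scaler0 sum_norm0.
by rewrite Rintegral_cst// mul0r mulr0.
Qed.

(** A crude bound for every entry of A rho, given the bounds on the entries of rho. It involves only
    A and [C0], hence neither u nor K. *)
Definition dual_bound : R := \sum_(p : 'I_m * 'I_n) \sum_(q : 'I_m * 'I_n)
  `|mxc A q.1 q.2 p.1 p.2| * (C0 * sum_norm (A (delta_mx q.1 q.2))).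

(* Stationarity in v turns the densities of the subgradient into a field with
   divergence w and vanishing normal trace. *)
Lemma subgradient_field : exists z w, [/\ field Omega A z w dual_bound, forall x, ~ Omega x -> w x = 0,
    forall q, bp (q, 0) -> L (q, 0) = \int[lam]_(y in Omega) frob (z y) (q y) &
    forall s, bp (0, s) -> L (0, s) = \int[lam]_(y in Omega) (\sum_i w y i 0 * s y i 0)].
Proof.
have [rho [Br rC rO rE]] := subgradient_fst_density.
have [w [w1 w2 wO wE]] := subgradient_snd_density.
(* The density rho need not be fixed by A; A rho represents the same functional because L vanishes
   on q - A q. *)
pose z y := A (rho y).
have Brp : bp (rho, 0) by split => // i; case: sbp => -[_]; exact.
have [Bz _] := bounded_pair_A Brp.
have Lz q : bp (q, 0) -> L (q, 0) = \int[lam]_(y in Omega) frob (z y) (q y).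
  move=> Bq; have BA := bounded_pair_A Bq.
  have BB : bp (q - (fun y => A (q y)), 0).
    by have := subspaceB sbp Bq BA; rewrite -[(q, 0) - _]/(q - (fun y => A (q y)), 0 - 0) subr0.
  have : L (q - (fun y => A (q y)), 0) = 0.
    apply: subgradient_fst_ker => // y.
    by rewrite -[(q - _) y]/(q y - A (q y)) linearB A_proj subrr.
  have -> : (q - (fun y => A (q y)), 0) = (q, 0) - (fun y => A (q y), 0) :> X.
    by transitivity ((q - (fun y => A (q y)), 0 - 0) : X); [rewrite subr0|].
  rewrite (linear_onB sbp lL Bq BA) => /eqP; rewrite subr_eq0 => /eqP ->.
  by rewrite rE//; apply: eq_Rintegral => y _; rewrite /z A_sym.
exists z, w; split => //; split => //.
- by move=> i j; case: (Bz i j).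
- move=> i j y; rewrite /z mxc_apply (le_trans (ler_norm_sum _ _ _))//.
  apply: (@le_trans _ _ (\sum_(q : 'I_m * 'I_n) `|mxc A q.1 q.2 i j| * (C0 * sum_norm (A (delta_mx q.1 q.2))))).
    by apply: ler_sum => q _; rewrite normrM ler_wpM2l.
  rewrite /dual_bound [leRHS](bigD1 (i, j))//= lerDl.
  apply: sumr_ge0 => p _; apply: sumr_ge0 => q _; rewrite mulr_ge0// mulr_ge0 ?sum_norm_ge0//.
  exact: ltW.
- by move=> x nO; rewrite /z rO// linear0.
- by move=> x; rewrite /z A_proj.
split => // psi sp i0.
(* Placing psi in the row [i0] and 0 elsewhere isolates one row of the divergence. *)
pose v y : 'cV[R]_m := psi y *: delta_mx i0 0.
have vE i : (fun y => v y i 0) = fun y => (delta_mx i0 0 : 'cV[R]_m) i 0 * psi y.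
  by apply/funext => y; rewrite mxE mulrC.
have sv : smooth_vec v by move=> i; rewrite vE; exact: smoothZ.
have gv y i j : grad v y i j = (i == i0)%:R * partial j psi y.
  rewrite mxE vE; have [->|ii] := eqVneq i i0.
    by rewrite mxE !eqxx mul1r; congr (partial j _ y); apply/funext => t; rewrite mul1r.
  rewrite mxE (negbTE ii) /= mul0r (_ : (fun y => _) = fun=> 0); last by apply/funext => t; rewrite mul0r.
  by rewrite partial_cst.
have L0 := subgradient_annihilates sv; have Bx := annihilated_pair sv.
rewrite (subgradient_split Bx) Lz in L0; last exact: (bounded_pair_fst Bx).
rewrite wE in L0; last exact: (bounded_pair_snd Bx).
have -> : \int[lam]_x (w x i0 0 * psi x) = - \int[lam]_(y in Omega) (\sum_i w y i 0 * (- (\1_Omega y *: v y)) i 0).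
  rewrite -(@Rintegral_zero_out _ _ _ _ Omega); last by move=> x nO; rewrite wO// mxE mul0r.
  have wi : lam.-integrable Omega (EFin \o (fun x => w x i0 0 * psi x)).
    have [M' pM] := smooth_bounded_on bO sp; apply: (@rintgM_bounded _ _ _ _ _ _ _ M') => //.
      by apply: (@integrableS _ _ _ lam setT) => //; exact: w1.
    by apply: measurable_funTS; apply: continuous_measurable_mx; exact: smooth_continuous.
  have -> : \int[lam]_(y in Omega) (\sum_i w y i 0 * (- (\1_Omega y *: v y)) i 0) =
      \int[lam]_(x in Omega) (-1 * (w x i0 0 * psi x)).
    apply: eq_Rintegral => y /set_mem Oy; rewrite indic_in// scale1r (bigD1 i0)//= big1 ?addr0.
      by rewrite !mxE !eqxx mulr1; ring.
    by move=> i ii; rewrite !mxE (negbTE ii) mulr0 oppr0 mulr0.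
  by rewrite RintegralZl// mulN1r opprK.
have -> : \int[lam]_x (\sum_j z x i0 j * partial j psi x) =
    - \int[lam]_(y in Omega) frob (z y) (- (\1_Omega y *: A (grad v y))).
  rewrite -(@Rintegral_zero_out _ _ _ _ Omega); last first.
    by move=> x nO; rewrite big1// => j _; rewrite /z rO// linear0 mxE mul0r.
  have zi : lam.-integrable Omega (EFin \o (fun x => \sum_j z x i0 j * partial j psi x)).
    apply: rintg_sum => // j; have sj := smooth_partial j sp.
    have [M' pM] := smooth_bounded_on bO sj; apply: (@rintgM_bounded _ _ _ _ _ _ _ M') => //.
      exact: bounded_meas_integrable_on.
    by apply: measurable_funTS; apply: continuous_measurable_mx; exact: smooth_continuous.
  have -> : \int[lam]_(y in Omega) frob (z y) (- (\1_Omega y *: A (grad v y))) =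
      \int[lam]_(x in Omega) (-1 * (\sum_j z x i0 j * partial j psi x)).
    apply: eq_Rintegral => y /set_mem Oy; rewrite indic_in// scale1r -linearN -A_sym /z A_proj.
    rewrite /frob (bigD1 i0)//= [X in _ + X]big1 ?addr0; last first.
      by move=> i ii; rewrite big1// => j _; rewrite mxE gv (negbTE ii) mul0r oppr0 mulr0.
    rewrite mulr_sumr; apply: eq_bigr => j _; rewrite mxE gv eqxx mul1r.
    by rewrite mulrN mulN1r.
  by rewrite RintegralZl// mulN1r opprK.
by apply/eqP; rewrite eqr_opp -subr_eq0 opprK addrC; apply/eqP.
Qed.

End DualField.

Lemma clip_norm_le {R : realType} (C t : R) : 0 <= C -> `|clip C t| <= `|t|.
Proof.
move=> C0; have [tC|Ct] := lerP `|t| C; first by rewrite clip_id.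
by rewrite (le_trans (clip_le t C0))// ltW.
Qed.

Lemma clip_cvg {R : realType} (t : R) : clip N%:R t @[N --> \oo] --> t.
Proof.
apply: cvg_near_cst; near=> N; apply: clip_id; near: N.
exists (Num.truncn `|t|).+1 => // N /= rN.
by rewrite ltW// (lt_le_trans (truncnS_gt _))// ler_nat.
Unshelve. all: by end_near. Qed.

(** * From the subgradient inequality to the dual problem *)

Section Duality.
Context {R : realType} {m n : nat}.
Local Notation T := 'rV[R]_n.
Local Notation lam := (@lebesgue_rV R n).
Variables (Omega : set T) (A : {linear 'M[R]_(m, n) -> 'M[R]_(m, n)}).
Hypothesis oO : open Omega.
Hypothesis bO : bounded_set Omega.
Hypothesis A_sym : forall y y', frob (A y) y' = frob y (A y').
Hypothesis A_proj : forall y, A (A y) = A y.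
Variable f : T -> 'M[R]_(m, n) -> R.
Hypothesis f_ge0 : forall x y, closure Omega x -> 0 <= f x y.
Hypothesis f_borel : measurable_fun (closure Omega `*` [set: 'M[R]_(m, n)])
                 (fun xy => f xy.1 xy.2).
Hypothesis f_convex : forall x, closure Omega x -> convex_function setT (f x).
Variables (c0 C0 : R).
Hypothesis C0_gt0 : 0 < C0.
Hypothesis f_growth : forall x y, closure Omega x ->
       c0 * frob_norm (A y) <= f x y /\ f x y <= C0 * (1 + frob_norm (A y)).
Variables (u : T -> 'cV[R]_m) (K : R).
Hypothesis uL2 : Lp Omega 2%:E u.
Hypothesis K0 : 0 < K.

Let mO : measurable Omega. Proof. exact: open_measurable_mx. Qed.

Local Notation bm := (@bounded_meas _ T R).
Local Notation X := ((T -> 'M[R]_(m, n)) * (T -> 'cV[R]_m))%type.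
Local Notation bp := (@bounded_pair R m n).
Local Notation value_of := (perturbed_energy Omega A f u K).
Local Notation value := (value_function Omega A f u K).
Local Notation stored := (stored_energy Omega A f).
Local Notation penalty := (fidelity Omega u).


(** The subgradient inequality is taken at v = 0 with s a truncation of u: the fidelity tends to 0
    and the integral of w . s to that of w . u, so K disappears from the inequality apart from
    [value 0]. *)
Lemma dual_field : exists z w, field Omega A z w (dual_bound A C0) /\
  forall y : T -> 'M[R]_(m, n), (forall i j, bm (fun x => y x i j)) ->
    value 0 + \int[lam]_(x in Omega) frob (z x) (y x) +
      \int[lam]_(x in Omega) (\sum_i u x i 0 * w x i 0) <= \int[lam]_(x in Omega) f x (y x).
Proof.
have [L [lL Lle]] := subgradient oO bO f_ge0 f_borel f_convex C0_gt0 f_growth uL2 K0.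
have [z [w [zf wO zE wE]]] := subgradient_field oO bO A_sym A_proj f_ge0 f_borel f_convex
  C0_gt0 f_growth uL2 K0 lL Lle.
have uL := Lp2_L12 oO bO uL2; have [_ _ _ _ [w1 w2 _]] := zf.
have sbp := @bounded_pair_subspace R m n.
exists z, w; split => // y By.
have By0 : bp (y, 0) by split => // i; case: sbp => -[_ b0] _; exact: (b0 i).
pose ub i x := u x i 0 * \1_Omega x.
have mub i : measurable_fun setT (ub i).
  have [/rintg_measurable mu _] := uL i.
  have := (measurable_restrictT (fun x => u x i 0) mO).1 mu.
  congr measurable_fun; apply/funext => x; rewrite patchE /ub.
  have [Ox|nOx] := pselect (Omega x); first by rewrite mem_set// indic_in// mulr1.
  by rewrite memNset// indic_out// mulr0.
(* Truncations, because u may be unbounded and thus fail to be an allowed perturbation. *)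
pose s (N : nat) x : 'cV[R]_m := \col_i clip N%:R (ub i x).
have Bs N : bp (0, s N).
  split=> [i j|i]; first by case: sbp => -[b0 _] _; exact: (b0 i j).
  split; first by under eq_fun do rewrite mxE; exact: measurable_clip.
  by exists N%:R => x; rewrite mxE clip_le.
have ubE i x : Omega x -> ub i x = u x i 0 by move=> Ox; rewrite /ub indic_in// mulr1.
have sle N x i : Omega x -> `|s N x i 0| <= `|u x i 0|.
  by move=> Ox; rewrite mxE -(ubE i x Ox) clip_norm_le.
have sz := @smooth_vec0 R m n.
have main N : value 0 + \int[lam]_(x in Omega) frob (z x) (y x) +
    \int[lam]_(x in Omega) (\sum_i w x i 0 * s N x i 0) -
    K * \int[lam]_(x in Omega) (\sum_i (s N x i 0 - u x i 0) ^+ 2) <= \int[lam]_(x in Omega) f x (y x).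
  have Bx : bp (y, s N) by split; [exact: By|case: (Bs N)].
  have := Lle _ _ sz Bx; rewrite (subgradient_split lL Bx) zE// wE; last exact: Bs.
  rewrite /perturbed_energy.
  have -> : stored (fun=> 0) (y, s N) = \int[lam]_(x in Omega) f x (y x).
    apply: eq_Rintegral => x _; congr (f x _) => /=.
    have g0 := grad_comb 0 0 x sz sz.
    have E : (fun t : T => (0 : R) *: (0 : 'cV[R]_m) + 0 *: 0) = fun=> 0 by apply/funext => t; rewrite !scaler0 addr0.
    by rewrite E in g0; rewrite g0 !scale0r addr0 linear0 add0r.
  have -> : penalty (fun=> 0) (y, s N) = \int[lam]_(x in Omega) (\sum_i (s N x i 0 - u x i 0) ^+ 2).
    apply: eq_Rintegral => x _; apply: eq_bigr => i _; rewrite [(0 : 'cV[R]_m) i 0]mxE sub0r.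
    by rewrite addrC.
  move=> /=; lra.
have c1 : \int[lam]_(x in Omega) (\sum_i w x i 0 * s N x i 0) @[N --> \oo] -->
    \int[lam]_(x in Omega) (\sum_i u x i 0 * w x i 0).
  have iuw i : lam.-integrable Omega (EFin \o (fun x => `|u x i 0 * w x i 0|)).
    by apply: rintg_norm => //; apply: L12_mul => //; exact: rintg_measurable (w1 i).
  have [|||x Ox|_ //] := @Rintegral_dct _ _ _ lam Omega (fun N x => \sum_i w x i 0 * s N x i 0)
    (fun x => \sum_i u x i 0 * w x i 0) (fun x => \sum_i `|u x i 0 * w x i 0|) mO.
  - move=> N; apply: measurable_sum => i; apply: measurable_funTS; apply: measurable_funM.
      exact: rintg_measurable (w1 i).
    by have [_ /(_ i)[]] := Bs N.
  - exact: rintg_sum.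
  - move=> N x Ox; rewrite (le_trans (ler_norm_sum _ _ _))//; apply: ler_sum => i _.
    by rewrite !normrM mulrC ler_wpM2r// sle.
  - apply: cvgr_sum => i; rewrite [u x i 0 * _]mulrC; apply: cvgM; first exact: cvg_cst.
    by under eq_fun do rewrite mxE (ubE i x Ox); exact: clip_cvg.
have c2 : \int[lam]_(x in Omega) (\sum_i (s N x i 0 - u x i 0) ^+ 2) @[N --> \oo] --> (0 : R).
  have iu i : lam.-integrable Omega (EFin \o (fun x => 4 * u x i 0 ^+ 2)).
    by apply: rintgZ => //; case: (uL i).
  have [|||x Ox|_] := @Rintegral_dct _ _ _ lam Omega (fun N x => \sum_i (s N x i 0 - u x i 0) ^+ 2)
    (fun=> 0) (fun x => \sum_i 4 * u x i 0 ^+ 2) mO.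
  - move=> N; apply: measurable_sum => i; apply: measurable_funX; apply: measurable_funB.
      by apply: measurable_funTS; have [_ /(_ i)[]] := Bs N.
    by have [/rintg_measurable] := uL i.
  - exact: rintg_sum.
  - move=> N x Ox; rewrite (le_trans (ler_norm_sum _ _ _))//; apply: ler_sum => i _.
    have -> : 4 * u x i 0 ^+ 2 = (2 * `|u x i 0|) ^+ 2 by rewrite exprMn real_normK ?num_real//; ring.
    rewrite normrX ler_pXn2r ?nnegrE ?mulr_ge0// (le_trans (ler_normB _ _))//.
    by rewrite mulr_natl mulr2n lerD2r sle.
  - rewrite [X in _ --> X](_ : _ = \sum_(i < m) (0 : R)); last by rewrite big1.
    apply: (@cvgr_sum _ _ _ (fun i N => (s N x i 0 - u x i 0) ^+ 2)) => i.
    have c : s N x i 0 - u x i 0 @[N --> \oo] --> (0 : R).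
      rewrite -(subrr (u x i 0)); apply: cvgB; last exact: cvg_cst.
      by under eq_fun do rewrite mxE (ubE i x Ox); exact: clip_cvg.
    rewrite (_ : (fun N => _) = fun N => (s N x i 0 - u x i 0) * (s N x i 0 - u x i 0)); last first.
      by apply/funext => N; rewrite expr2.
    by rewrite -(mulr0 0); apply: cvgM; exact: c.
  by rewrite Rintegral_cst// mul0r.
pose a := value 0 + \int[lam]_(x in Omega) frob (z x) (y x).
pose F N := \int[lam]_(x in Omega) (\sum_i w x i 0 * s N x i 0).
pose G N := \int[lam]_(x in Omega) (\sum_i (s N x i 0 - u x i 0) ^+ 2).
have cl : a + F N - K * G N @[N --> \oo] --> a + \int[lam]_(x in Omega) (\sum_i u x i 0 * w x i 0).
  rewrite -[X in _ --> X]subr0 -{2}(mulr0 K); apply: cvgB.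
    by apply: cvgD; [exact: cvg_cst|exact: c1].
  by apply: cvgM; [exact: cvg_cst|exact: c2].
by rewrite -lee_fin; apply: (real_lim_le cl) => N; rewrite lee_fin; exact: main.
Qed.


Let gap (z : T -> 'M[R]_(m, n)) (x : T) (y : 'M[R]_(m, n)) : R := frob (z x) y - f x y.

Definition rat_mx (k : nat) : 'M[R]_(m, n) :=
  if (choice.unpickle k : option 'M[rat]_(m, n)) is Some q then map_mx ratr q else 0.

Lemma rat_mx_dense (y : 'M[R]_(m, n)) (d : R) : 0 < d ->
  exists k, forall i j, `|rat_mx k i j - y i j| <= d.
Proof.
move=> d0; have /choice[q qP] (p : 'I_m * 'I_n) : exists q : rat, `|ratr q - y p.1 p.2| <= d.
  have : y p.1 p.2 - d < y p.1 p.2 + d by rewrite ltrBlDr -addrA ltrDl addr_gt0.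
  move=> /rat_in_itvoo[q]; rewrite in_itv/= => /andP[q1 q2]; exists q.
  by rewrite ltW// ltr_distl q1.
exists (choice.pickle (\matrix_(i, j) q (i, j))) => i j.
by rewrite /rat_mx choice.pickleK !mxE; exact: (qP (i, j)).
Qed.

(** A maximiser of the gap among 0 and the first k rational matrices. Being built from successive
    comparisons it is a measurable selection; the indicator keeps these comparisons measurable on
    the whole space. *)
Fixpoint best z (k : nat) (x : T) : 'M[R]_(m, n) :=
  if k is k'.+1 then
    if \1_Omega x * gap z x (best z k' x) < \1_Omega x * gap z x (rat_mx k') then rat_mx k'
    else best z k' x
  else 0.

Lemma measurable_gap (z y : T -> 'M[R]_(m, n)) : (forall i j, bm (fun x => z x i j)) ->
  (forall i j, bm (fun x => y x i j)) -> measurable_fun Omega (fun x => gap z x (y x)).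
Proof.
move=> Bz By; apply: measurable_funB.
  rewrite /frob; apply: measurable_sum => i; apply: measurable_sum => j.
  by apply: measurable_funTS; apply: measurable_funM; [case: (Bz i j)|case: (By i j)].
apply: (measurable_fun_f oO f_borel); apply: measurable_fun_mx => // i j.
by apply: measurable_funTS; case: (By i j).
Qed.

Lemma bounded_best (z : T -> 'M[R]_(m, n)) k i j : (forall i j, bm (fun x => z x i j)) -> bm (fun x => best z k x i j).
Proof.
move=> Bz; elim: k i j => [|k IH] i j.
  split; first by under eq_fun do rewrite mxE; exact: measurable_cst.
  by exists 0 => x; rewrite mxE normr0.
pose b x := \1_Omega x * gap z x (best z k x) < \1_Omega x * gap z x (rat_mx k).
have mr (y : T -> 'M[R]_(m, n)) : (forall i j, bm (fun x => y x i j)) ->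
    measurable_fun setT (fun x => \1_Omega x * gap z x (y x)).
  move=> By; have := (measurable_restrictT (fun x => gap z x (y x)) mO).1 (measurable_gap Bz By).
  congr measurable_fun; apply/funext => x; rewrite patchE.
  have [Ox|nOx] := pselect (Omega x); first by rewrite mem_set// indic_in// mul1r.
  by rewrite memNset// indic_out// mul0r.
have bE : (fun x => best z k.+1 x i j) = fun x => if b x then rat_mx k i j else best z k x i j.
  by apply/funext => x /=; rewrite -/(b x); case: ifP.
have [mb [M bM]] := IH i j; rewrite bE; split.
  apply: measurable_fun_ifT => //; apply: measurable_fun_ltr; apply: mr => // i' j'.
  by split; [exact: measurable_cst|exists `|rat_mx k i' j'|].
exists (`|rat_mx k i j| + M) => x; case: ifP => _.
  by rewrite lerDl (le_trans _ (bM x)).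
by rewrite (le_trans (bM x))// lerDr.
Qed.

Lemma gap_best z k x : Omega x -> gap z x (best z k.+1 x) =
  Num.max (gap z x (best z k x)) (gap z x (rat_mx k)).
Proof. by move=> Ox /=; rewrite indic_in// !mul1r; case: ltP. Qed.

Lemma gap_best_nd z x : Omega x -> {homo (fun k => gap z x (best z k x)) : i j / (i <= j)%N >-> i <= j}.
Proof.
move=> Ox; apply: homo_leq => [t|b a c|k] //; first exact: le_trans.
by rewrite gap_best// le_max lexx.
Qed.

(** The gap is Lipschitz in y by [f_lipschitz], so the supremum over rational matrices is already
    the Legendre transform. *)
Lemma gap_best_cvg z x : Omega x -> ((gap z x (best z k x))%:E @[k --> \oo] --> legendre f x (z x))%E.
Proof.
move=> Ox; have cx := subset_closure Ox.
have -> : legendre f x (z x) = ereal_sup (range (fun k => (gap z x (best z k x))%:E)).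
  apply/eqP; rewrite eq_le; apply/andP; split; last first.
    by apply: le_ereal_sup => _ [k _ <-]; exists (best z k x).
  apply: ge_ereal_sup => _ [y _ <-].
  pose S : R := \sum_(p : 'I_m * 'I_n) \sum_(q : 'I_m * 'I_n) `|mxc A q.1 q.2 p.1 p.2|.
  have S0 : 0 <= S by apply: sumr_ge0 => p _; exact: sumr_ge0.
  have c0' : 0 <= sum_norm (z x) + C0 * S by rewrite addr_ge0 ?sum_norm_ge0// mulr_ge0// ltW.
  case E : (ereal_sup _) => [r||]; [|by rewrite leey|]; last first.
    have : ((gap z x (best z 0 x))%:E <= -oo)%E by rewrite -E; apply: ereal_sup_ubound; exists 0%N.
    by rewrite leeNy_eq.
  rewrite lee_fin; apply: (le_eta c0') => d d0.
  have [k kd] := rat_mx_dense y d0.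
  have gr : gap z x (rat_mx k) <= r.
    rewrite -lee_fin -E; apply: (@le_trans _ _ (gap z x (best z k.+1 x))%:E).
      by rewrite lee_fin gap_best// le_max lexx orbT.
    by apply: ereal_sup_ubound; exists k.+1.
  have h := f_lipschitz f_ge0 f_convex C0_gt0 f_growth y (rat_mx k - y) cx.
  rewrite addrC subrK in h.
  have hA : sum_norm (A (rat_mx k - y)) <= S * d.
    rewrite /sum_norm pair_bigA/= /S mulr_suml; apply: ler_sum => p _.
    rewrite mxc_apply (le_trans (ler_norm_sum _ _ _))// mulr_suml; apply: ler_sum => q _.
    by rewrite normrM ler_wpM2l// !mxE.
  have hz : frob (z x) y <= frob (z x) (rat_mx k) + sum_norm (z x) * d.
    rewrite /frob /sum_norm mulr_suml -big_split/=; apply: ler_sum => i _.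
    rewrite mulr_suml -big_split/=; apply: ler_sum => j _.
    rewrite -lerBlDl -mulrBr (le_trans (ler_norm _))// normrM ler_wpM2l// distrC; exact: kd.
  have : C0 * sum_norm (A (rat_mx k - y)) <= C0 * (S * d) by rewrite ler_wpM2l// ltW.
  move: gr; rewrite /gap; lra.
apply: ereal_nondecreasing_cvgn => i j ij; rewrite lee_fin; exact: gap_best_nd.
Qed.


Hypothesis lO : lipschitz_boundary Omega.
Hypothesis uBV : BV Omega A u.

(** The initial candidate 0 gives the gap -f(x, 0) >= -C0, and later candidates only improve it;
    this floor makes monotone convergence applicable. *)
Lemma gap_best_ge z k x : Omega x -> - C0 <= gap z x (best z k x).
Proof.
move=> Ox; have cx := subset_closure Ox.
apply: le_trans (gap_best_nd z Ox (leq0n k)).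
rewrite /gap /= /frob big1; last by move=> i _; rewrite big1// => j _; rewrite mxE mulr0.
rewrite sub0r lerN2; have [_ h] := f_growth 0 cx.
apply: (le_trans h); rewrite linear0 /frob_norm /frob big1; last first.
  by move=> i _; rewrite big1// => j _; rewrite mxE mulr0.
by rewrite sqrtr0 addr0 mulr1.
Qed.

(** Taking y = [best z k] in the hypothesis bounds the integrals of the increasing gaps. Monotone
    convergence, after adding [C0], bounds the integral of the Legendre transform, which puts z in
    [calZ] and gives the inequality at once. *)
Lemma value_le_dual z w C : field Omega A z w C ->
  (forall y : T -> 'M[R]_(m, n), (forall i j, bm (fun x => y x i j)) ->
    value 0 + \int[lam]_(x in Omega) frob (z x) (y x) +
      \int[lam]_(x in Omega) (\sum_i u x i 0 * w x i 0) <= \int[lam]_(x in Omega) f x (y x)) ->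
  calZ Omega A f z /\
  ((value 0)%:E <= \int[lam]_(x in Omega) (- legendre f x (z x)) + pairing_mass Omega z u)%E.
Proof.
move=> zf h; have [mz zC _ _ _] := zf.
have Bz i j : bm (fun x => z x i j) by split => //; exists C.
set W := \int[lam]_(x in Omega) (\sum_i u x i 0 * w x i 0) in h *.
have By k i j : bm (fun x => best z k x i j) by exact: bounded_best.
have zyi k : lam.-integrable Omega (EFin \o (fun x => frob (z x) (best z k x))).
  rewrite /frob; apply: rintg_sum => // i; apply: rintg_sum => // j.
  by apply: bounded_meas_integrable_on => //; exact: bounded_measM.
have fyi k : lam.-integrable Omega (EFin \o (fun x => f x (best z k x))).
  apply: (f_integrable oO bO f_ge0 f_borel C0_gt0 f_growth); apply/(Lp1P oO); split.
    by apply: measurable_fun_mx => // i j; apply: measurable_funTS; case: (By k i j).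
  by move=> i j; exact: bounded_meas_integrable_on.
have gi k : lam.-integrable Omega (EFin \o (fun x => gap z x (best z k x))) by exact: rintgB.
have ci (c : R) : lam.-integrable Omega (EFin \o (fun=> c)).
  by apply: bounded_meas_integrable_on => //; split; [exact: measurable_cst|exists `|c|].
pose V := \int[lam]_(x in Omega) C0.
have ub0 k x : Omega x -> 0 <= gap z x (best z k x) + C0.
  by move=> Ox; rewrite -lerBlDr sub0r gap_best_ge.
have [|||x Ox|k|mG iG] := @monotone_limit_le _ _ _ lam Omega (fun k x => gap z x (best z k x) + C0)
    (fun x => legendre f x (z x) + C0%:E)%E (- value 0 - W + V) mO.
- by move=> k; apply: measurable_funD; [exact: measurable_gap|exact: measurable_cst].
- by move=> k x; exact: ub0.
- by move=> x Ox i j ij; rewrite lerD2r; exact: gap_best_nd.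
- under eq_fun do rewrite EFinD.
  by apply: cvgeD; [rewrite fin_num_adde_defl|exact: gap_best_cvg|exact: cvg_cst].
- have cg : lam.-integrable Omega (EFin \o (fun x => gap z x (best z k x) + C0)) by exact: rintgD.
  rewrite -EFin_Rintegral// lee_fin RintegralD// -/V lerD2r RintegralB//.
  by have := h _ (By k); lra.
have Lge x : Omega x -> (0 <= legendre f x (z x) + C0%:E)%E.
  move=> Ox; rewrite -(leeD2rE _ _ (_ : (- C0)%:E \is a fin_num))// add0e -addeA -EFinD subrr adde0.
  apply: (@le_trans _ _ (gap z x (best z 0 x))%:E); first by rewrite lee_fin gap_best_ge.
  by apply: ereal_sup_ubound; exists (best z 0 x).
have Gi : lam.-integrable Omega (fun x => legendre f x (z x) + C0%:E)%E.
  apply/integrableP; split => //; apply: le_lt_trans (ltry (- value 0 - W + V)).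
  apply: le_trans iG; rewrite le_eqVlt; apply/orP; left; apply/eqP.
  by apply: eq_integral => x /set_mem Ox; rewrite gee0_abs// Lge.
have LE x : legendre f x (z x) = (legendre f x (z x) + C0%:E - C0%:E)%E.
  by rewrite -addeA -EFinN -EFinD subrr adde0.
have Li : lam.-integrable Omega (fun x => legendre f x (z x)).
  by rewrite (funext LE); apply: integrableB => //; exact: (ci C0).
split; first by split => //; exact: field_X2 zf.
(* Here the zero normal trace enters: minus the integral of u . w is the total mass of the
   pairing. *)
rewrite (field_pairing_mass oO bO A_sym A_proj lO zf uL2 uBV) -/W.
have -> : (\int[lam]_(x in Omega) (- legendre f x (z x)))%E =
    (V%:E - \int[lam]_(x in Omega) (legendre f x (z x) + C0%:E))%E.
  rewrite EFin_Rintegral; [|by []|exact: ci].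
  rewrite -integralB//; last exact: (ci C0).
  apply: eq_integral => x _; rewrite {1}LE fin_num_oppeB// addeC; congr (_ + _)%E.
move: iG (integrable_fin_num mO Gi); case: (\int[lam]_(x in Omega) _)%E => [r||]// iG _.
by move: iG; rewrite -EFinN -!EFinD !lee_fin; lra.
Qed.

End Duality.

(** * Recovery sequences and the two inequalities *)

Section Relaxation.
Context {R : realType} {m n : nat}.
Local Notation T := 'rV[R]_n.
Local Notation lam := (@lebesgue_rV R n).
Variables (Omega : set T) (A : {linear 'M[R]_(m, n) -> 'M[R]_(m, n)}).
Hypothesis oO : open Omega.
Hypothesis bO : bounded_set Omega.
Hypothesis A_sym : forall y y', frob (A y) y' = frob y (A y').
Hypothesis A_proj : forall y, A (A y) = A y.
Variable f : T -> 'M[R]_(m, n) -> R.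
Hypothesis f_ge0 : forall x y, closure Omega x -> 0 <= f x y.
Hypothesis f_borel : measurable_fun (closure Omega `*` [set: 'M[R]_(m, n)])
                 (fun xy => f xy.1 xy.2).
Hypothesis f_convex : forall x, closure Omega x -> convex_function setT (f x).
Variables (c0 C0 : R).
Hypothesis C0_gt0 : 0 < C0.
Hypothesis f_growth : forall x y, closure Omega x ->
       c0 * frob_norm (A y) <= f x y /\ f x y <= C0 * (1 + frob_norm (A y)).
Variables (u : T -> 'cV[R]_m).
Hypothesis uL2 : Lp Omega 2%:E u.

Let mO : measurable Omega. Proof. exact: open_measurable_mx. Qed.
Hypothesis lO : lipschitz_boundary Omega.

Local Notation bm := (@bounded_meas _ T R).
Local Notation bp := (@bounded_pair R m n).

(** The inequality of [dual_field] at y = 0 bounds m_K by the integral of f(x, 0) minus that of u .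
    w. The boundary estimate with psi = 1 controls the last term through [dual_bound], which does
    not depend on K. *)
Lemma value_bounded : BV Omega A u ->
  exists B, forall K, 0 < K -> value_function Omega A f u K 0 <= B.
Proof.
move=> [_ [nu nuE]]; have uL := Lp2_L12 oO bO uL2.
have [M M0 MP] := BV_pair_global oO bO A_sym lO.
have D0 : 0 <= dual_bound A C0.
  apply: sumr_ge0 => p _; apply: sumr_ge0 => q _; rewrite mulr_ge0// mulr_ge0 ?sum_norm_ge0//.
  exact: ltW.
exists (\int[lam]_(x in Omega) f x 0 +
  M * (dual_bound A C0 * \sum_i \sum_j var_integral Omega (nu i j) (fun=> 1))) => K K0.
have [z [w [zf zwP]]] := dual_field oO bO A_sym A_proj f_ge0 f_borel f_convex C0_gt0 f_growth uL2 K0.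
have B0 (i : 'I_m) (j : 'I_n) : bm (fun x : T => (0 : 'M[R]_(m, n)) i j).
  by split; [exact: measurable_cst|exists `|(0 : 'M[R]_(m, n)) i j|].
have := zwP (fun=> 0) B0.
have -> : \int[lam]_(x in Omega) frob (z x) 0 = 0.
  transitivity (\int[lam]_(x in Omega) (0 : R)); last by rewrite Rintegral_cst// mul0r.
  apply: eq_Rintegral => x _; rewrite /frob big1// => i _; rewrite big1// => j _.
  by rewrite mxE mulr0.
have zC i j x : `|z x i j| <= dual_bound A C0 * (fun=> 1) x by rewrite mulr1; have [_ h _ _ _] := zf.
have b1 : exists M : R, forall x : T, `|(fun=> 1 : R) x| <= M by exists 1 => x; rewrite normr1.
have c1 : continuous (fun _ : T => 1 : R) by exact: smooth_continuous (smooth_cst 1).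
have := MP u z w _ nu (fun=> 1) (dual_bound A C0) uL zf nuE c1 b1 D0 zC.
rewrite ler_norml => /andP[]; lra.
Qed.

Lemma energy_smooth v : smooth_vec v -> energy Omega A f v = (stored_energy Omega A f v 0)%:E.
Proof.
move=> sv; have [vW _] := smooth_W A oO bO ltr01 sv.
have [dL _ ->] := energyE oO bO f_ge0 f_borel C0_gt0 f_growth vW; congr EFin.
have B0 : bp 0 by case: (@bounded_pair_subspace R m n).
have si := stored_integrable oO bO f_ge0 f_borel C0_gt0 f_growth sv B0.
apply: (proj2 (Rintegral_ae_eq mO _ _ _)).
- exact: (f_integrable oO bO f_ge0 f_borel C0_gt0 f_growth).
- exact: rintg_measurable si.
- by apply: filterS (density_A_smooth A oO bO sv) => x dE Ox; rewrite dE// addr0.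
Qed.

Lemma value_le_F_dual K : 0 < K -> BV Omega A u ->
  ((value_function Omega A f u K 0)%:E <= F_dual Omega A f u)%E.
Proof.
move=> K0 uBV.
have [z [w [zf zwP]]] := dual_field oO bO A_sym A_proj f_ge0 f_borel f_convex C0_gt0 f_growth uL2 K0.
have [zZ le] := value_le_dual oO bO A_sym A_proj f_ge0 f_borel f_convex C0_gt0 f_growth uL2 lO uBV zf zwP.
rewrite /F_dual asboolT//; apply: (le_trans le); apply: ereal_sup_ubound.
by exists z.
Qed.

(** The near-minimisers are taken with error 1/(l+1): their stored energies are at most m_K +
    1/(l+1), and m_K is at most the dual value. *)
Lemma recovery_sequence : BV Omega A u -> exists u_ : nat -> T -> 'cV[R]_m,
  [/\ forall l, smooth_vec (u_ l), L2_cvg Omega u_ u &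
    (limn_einf (fun l => energy Omega A f (u_ l)) <= F_dual Omega A f u)%E].
Proof.
move=> uBV; have [B BP] := value_bounded uBV.
have K0 l : 0 < l.+1%:R :> R by rewrite ltr0n.
have e0 l : 0 < l.+1%:R^-1 :> R by rewrite invr_gt0.
have /choice[u_ uP] l : exists v, smooth_vec v /\
    perturbed_energy Omega A f u l.+1%:R v 0 < value_function Omega A f u l.+1%:R 0 + l.+1%:R^-1.
  by have [v sv vx] := value_near A f_ge0 u (K0 l) 0 (e0 l); exists v.
have su l : smooth_vec (u_ l) by case: (uP l).
have s0 l := @stored_ge0 _ _ _ Omega A f f_ge0 (u_ l) 0.
have p0 l : 0 <= l.+1%:R * fidelity Omega u (u_ l) 0 by rewrite mulr_ge0// penalty_ge0.
have sle l : stored_energy Omega A f (u_ l) 0 <= value_function Omega A f u l.+1%:R 0 + l.+1%:R^-1.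
  by have [_ /ltW] := uP l; apply: le_trans; rewrite /perturbed_energy lerDl.
exists u_; split => //.
  apply/(L2_cvgP oO _ uL2); split.
    by move=> l; have [_] := smooth_W A oO bO ltr01 (su l).
  have pE l : \int[lam]_(x in Omega) frob (u_ l x - u x) (u_ l x - u x) = fidelity Omega u (u_ l) 0.
    apply: eq_Rintegral => x _; rewrite /frob; apply: eq_bigr => i _.
    by rewrite big_ord1 !mxE addr0 expr2.
  rewrite (funext pE).
  (* As the stored energy is nonnegative, (l+1) times the fidelity is at most m_K + 1, hence at most
     B + 1. *)
  apply: (@squeeze_cvgr _ _ _ _ (fun=> 0) (fun l => (B + 1) * harmonic l)).
  - apply: nearW => l; rewrite penalty_ge0/= /harmonic ler_pdivlMr// mulrC.
    have [_ /ltW] := uP l; rewrite /perturbed_energy => h.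
    have := BP _ (K0 l); have := s0 l.
    have : l.+1%:R^-1 <= 1 :> R by rewrite invf_le1// ler1n.
    move: h; set p := _ * fidelity _ _ _ _; set i := _^-1; lra.
  - exact: cvg_cst.
  - by rewrite -(mulr0 (B + 1)); apply: cvgM; [exact: cvg_cst|exact: cvg_harmonic].
have := fun l => value_le_F_dual (K0 l) uBV.
case: (F_dual _ _ _ _) => [r||] h; last 2 first.
- by rewrite leey.
- by have := h 0%N; rewrite leeNy_eq.
apply: limn_einf_le => e e0'.
have /cvgrPdist_le/(_ _ e0') := @cvg_harmonic R; apply: filterS => l.
rewrite sub0r normrN ger0_norm ?invr_ge0// => le.
rewrite energy_smooth// lee_fin (le_trans (sle l))// lerD//.
by have := h l; rewrite lee_fin.
Qed.

Hypothesis c0_gt0 : 0 < c0.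

(** When u is not in BV the dual value is infinite; a competing sequence with finite lower limit
    would force u into BV by [BV_of_bounded_energy]. *)
Lemma F_dual_le_F_relaxed : (F_dual Omega A f u <= F_relaxed Omega A f u)%E.
Proof.
apply: le_ereal_inf_tmp => _ [u_ [uW uc] <-].
have [uBV|nBV] := pselect (BV Omega A u); last first.
  rewrite leNgt; apply/negP => lt; apply: nBV.
  refine (BV_of_bounded_energy oO bO A_proj f_ge0 f_borel c0_gt0 C0_gt0 f_growth uL2 uW uc _).
  by apply: lt_le_trans lt _; rewrite leey.
rewrite /F_dual asboolT//; apply: ge_ereal_sup => _ [z zZ <-].
exact: (lower_bound oO bO A_sym A_proj f_ge0 f_borel C0_gt0 f_growth zZ uBV uL2 uW uc).
Qed.

Lemma F_relaxed_le (u_ : nat -> T -> 'cV[R]_m) : (forall l, smooth_vec (u_ l)) -> L2_cvg Omega u_ u ->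
  (F_relaxed Omega A f u <= limn_einf (fun l => energy Omega A f (u_ l)))%E.
Proof.
move=> su uc; apply: ereal_inf_lbound; exists u_ => //; split => // l.
by have [] := smooth_W A oO bO ltr01 (su l).
Qed.

End Relaxation.

Theorem theorem4p5 (R : realType) (m n : nat) (m_gt0 : (0 < m)%N)
    (n_gt0 : (0 < n)%N)
    (Omega : set 'rV[R]_n) (Omega_open : open Omega)
    (Omega_bounded : bounded_set Omega)
    (Omega_lipschitz : lipschitz_boundary Omega)
    (A : {linear 'M[R]_(m, n) -> 'M[R]_(m, n)})
    (A_sym : forall y y', frob (A y) y' = frob y (A y'))
    (A_proj : forall y, A (A y) = A y)
    (f : 'rV[R]_n -> 'M[R]_(m, n) -> R)
    (f_ge0 : forall x y, closure Omega x -> 0 <= f x y)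
    (f_borel : measurable_fun (closure Omega `*` [set: 'M[R]_(m, n)])
                 (fun xy => f xy.1 xy.2))
    (f_convex : forall x, closure Omega x -> convex_function setT (f x))
    (c0 C0 : R) (c0_gt0 : 0 < c0) (C0_gt0 : 0 < C0)
    (f_growth : forall x y, closure Omega x ->
       c0 * frob_norm (A y) <= f x y /\ f x y <= C0 * (1 + frob_norm (A y))) :
  (forall u : 'rV[R]_n -> 'cV[R]_m, Lp Omega 2%:E u ->
     F_relaxed Omega A f u = F_dual Omega A f u) /\
  (forall u : 'rV[R]_n -> 'cV[R]_m, BV Omega A u -> Lp Omega 2%:E u ->
     exists u_ : nat -> 'rV[R]_n -> 'cV[R]_m,
       [/\ forall l, W Omega A (1 + l.+1%:R^-1)%:E (u_ l) /\
                     Lp Omega 2%:E (u_ l),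
           L2_cvg Omega u_ u &
           limn_einf (fun l => energy Omega A f (u_ l)) =
             F_relaxed Omega A f u]).
Proof.
have le1 u (uL2 : Lp Omega 2%:E u) := F_dual_le_F_relaxed Omega_open Omega_bounded A_sym A_proj
  f_ge0 f_borel C0_gt0 f_growth uL2 c0_gt0.
have rec u uL2 uBV := recovery_sequence Omega_open Omega_bounded A_sym A_proj f_ge0 f_borel
  f_convex C0_gt0 f_growth (u := u) uL2 Omega_lipschitz uBV.
have eqF u : Lp Omega 2%:E u -> F_relaxed Omega A f u = F_dual Omega A f u.
  move=> uL2; apply/eqP; rewrite eq_le le1// andbT.
  have [uBV|nBV] := pselect (BV Omega A u); last by rewrite /F_dual asboolF// leey.
  have [u_ [su uc le2]] := rec u uL2 uBV.
  by apply: le_trans le2; exact: F_relaxed_le.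
split => // u uBV uL2; have [u_ [su uc le2]] := rec u uL2 uBV.
exists u_; split => // [l|].
  (* Every positive exponent is allowed for smooth functions; indices start at l = 0, hence the
     exponent 1 + 1/(l+1). *)
  by apply: smooth_W => //; rewrite ltr_pwDl.
apply/eqP; rewrite eq_le F_relaxed_le// andbT eqF//.
Qed.
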